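(* Let $d\ge 2$ be standard, and for a countable ordinal $\alpha$ put $$f_\alpha(x)=\sqrt[F_\alpha^{-1}(x)]{\log^{(d-2)}(x)}.$$ 1. For each $\alpha<\omega_{d-1}$, $\mathsf{RCA}_0^{\ast}+\mathsf{I}\Sigma^0_{d-1}$ proves $\mathrm{WPH}^{d,f_\alpha}$. 2. $\mathsf{RCA}_0^{\ast}+\mathsf{I}\Sigma^0_{d-1}$ does not prove $\mathrm{WPH}^{d,f_{\omega_{d-1}}}$.
   Context: $\mathsf{RCA}_0^{\ast}$ is the subsystem of second order arithmetic, in the usual language augmented by a binary function symbol $\exp$ (written $m^n$), whose axioms are: the basic axioms of second order arithmetic (the usual quantifier-free axioms for $0,1,+,\cdot,<$); the exponentiation axioms $m^0=1$, $m^{n+1}=m\cdot m^n$; the induction scheme for all $\Sigma^0_0$ formulas (possibly containing $\exp$); and the comprehension scheme for all $\Delta^0_1$ formulas (possibly containing $\exp$). $\mathsf{I}\Sigma^0_k$ is the induction scheme for $\Sigma^0_k$ formulas. $\mathbb{N}$ is the set of nonnegative integers, and $c\in\mathbb{N}$ is identified with $\{0,\dots,c-1\}$. $[a,R]=\{n\in\mathbb{N}:a\le n\le R\}$ and $[a,R]^d=\{(x_0,\dots,x_{d-1})\in\mathbb{N}^d:a\le x_0<\cdots<x_{d-1}\le R\}$. For a coloring $C\colon[a,R]^d\to c$, a set $H=\{h_0<h_1<\cdots\}\subseteq[a,R]$ is $C$-weakly homogeneous if $C(h_i,\dots,h_{i+d-1})=C(h_{i+1},\dots,h_{i+d})$ for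 all $h_i,h_{i+1},\dots,h_{i+d}$ in $H$. For $f\colon\mathbb{N}\to\mathbb{N}$, $\mathrm{WPH}^{d,f}$ states: for all $c$ and $a$ there exists $R$ such that for every $C\colon[a,R]^d\to c$ there exists a (nonempty) $C$-weakly homogeneous $H\subseteq[a,R]$ such that $|H|>f(\min H)$. $\omega_x$ is the tower $\omega^{\cdot^{\cdot^{\omega}}}$ of $x$ $\omega$'s ($\omega_1=\omega$, $\omega_{x+1}=\omega^{\omega_x}$). $F_\alpha$ is the $\alpha$-th fast growing function: $F_0(x)=x+1$, $F_{\alpha+1}(x)=F_\alpha^{(x+1)}(x)$ (the $(x+1)$-fold iterate), $F_\lambda(x)=F_{\lambda[x]}(x)$ for limit $\lambda$, with standard fundamental sequences: for Cantor normal forms, $(\delta+\omega^{\beta+1})[x]=\delta+\omega^\beta\cdot x$ and $(\delta+\omega^{\beta})[x]=\delta+\omega^{\beta[x]}$ for limit $\beta$. Inside the theories, the graph of $F_\alpha$ is expressed by the standard arithmetization (a $\Delta^0_1$ formula, as in Hájek–Pudlák), ordinals being coded by Cantor normal forms. $F_\alpha^{-1}(x)$ is the inverse of $F_\alpha$, i.e. the largest $y$ with $F_\alpha(y)$ defined and $F_\alpha(y)\le x$ ($0$ if there is none), which is total even where $F_\alpha$ is not provably total. $\log^{(k)}$ is the $k$-fold iterate of the base $2$ logarithm ($\log^{(0)}(x)=x$); logarithms and roots are taken as functions $\mathbb{N}\to\mathbb{N}$ by rounding down (with $\log 0=0$), and $\sqrt[0]{x}=x$ by convention. Standard means an actual natural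 number of the metatheory. *)

(* Defs.v *)
From Stdlib Require Import List Arith.
Import ListNotations.

(** * Second order arithmetic with exponentiation: syntax

    Number variables and set variables are two separate families of de Bruijn
    indices.  Classical logic: the other connectives and the existential
    quantifiers are abbreviations. *)

Inductive term : Type :=
| Var (n : nat)
| Zero
| One
| Add (t u : term)
| Mul (t u : term)
| Exp (t u : term).

Inductive form : Type :=
| Eq (t u : term)
| Lt (t u : term)
| Mem (t : term) (X : nat)
| Bot
| Imp (A B : form)
| All (A : form)      (* number quantifier *)
| All2 (A : form).    (* set quantifier *)

Definition Not A := Imp A Bot.
Definition Or A B := Imp (Not A) B.
Definition And A B := Not (Imp A (Not B)).
Definition Iff A B := And (Imp A B) (Imp B A).
Definition Ex A := Not (All (Not A)).
Definition Ex2 A := Not (All2 (Not A)).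

Definition scons {X : Type} (x : X) (f : nat -> X) (n : nat) : X :=
  match n with O => x | S m => f m end.

Fixpoint tsub (s : nat -> term) (t : term) : term :=
  match t with
  | Var n => s n
  | Zero => Zero
  | One => One
  | Add t u => Add (tsub s t) (tsub s u)
  | Mul t u => Mul (tsub s t) (tsub s u)
  | Exp t u => Exp (tsub s t) (tsub s u)
  end.

Definition shift (n : nat) : term := Var (S n).
Definition tlift : term -> term := tsub shift.

(* simultaneous substitution: [s] for number variables, [r] for set variables *)
Fixpoint fsub (s : nat -> term) (r : nat -> nat) (A : form) : form :=
  match A with
  | Eq t u => Eq (tsub s t) (tsub s u)
  | Lt t u => Lt (tsub s t) (tsub s u)
  | Mem t X => Mem (tsub s t) (r X)
  | Bot => Bot
  | Imp A B => Imp (fsub s r A) (fsub s r B)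
  | All A => All (fsub (scons (Var 0) (fun n => tlift (s n))) r A)
  | All2 A => All2 (fsub s (scons 0 (fun X => S (r X))) A)
  end.

Definition lift : form -> form := fsub shift id.
Definition lift2 : form -> form := fsub Var S.
Definition inst (t : term) : form -> form := fsub (scons t Var) id.
Definition inst2 (X : nat) : form -> form := fsub Var (scons X id).

(** * Natural deduction for two-sorted classical logic with equality on numbers

    The free variables of an axiom in [T] are read universally: [d_ax] applies
    under any hypotheses, so by [d_allI] and [d_all2I] the universal closure of
    an axiom is derivable. *)

Inductive derives (T : form -> Prop) : list form -> form -> Prop :=
| d_hyp G A : In A G -> derives T G A
| d_ax G A : T A -> derives T G A
| d_impI G A B : derives T (A :: G) B -> derives T G (Imp A B)
| d_impE G A B : derives T G (Imp A B) -> derives T G A -> derives T G B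
| d_raa G A : derives T (Not A :: G) Bot -> derives T G A
| d_allI G A : derives T (map lift G) A -> derives T G (All A)
| d_allE G A t : derives T G (All A) -> derives T G (inst t A)
| d_all2I G A : derives T (map lift2 G) A -> derives T G (All2 A)
| d_all2E G A X : derives T G (All2 A) -> derives T G (inst2 X A)
| d_refl G t : derives T G (Eq t t)
| d_subst G A t u :
    derives T G (Eq t u) -> derives T G (inst t A) -> derives T G (inst u A).

Definition proves (T : form -> Prop) (A : form) : Prop := derives T [] A.

(** * Named-variable notation for formulas

    A [cterm] (resp. [cform]) gives a term (resp. formula) for each number [n]
    of enclosing number quantifiers.  The variable bound by the quantifier at
    depth [n] is the de Bruijn index [m - (n + 1)] at depth [m].  A closed
    [cform] denotes the sentence obtained at depth [0]. *)

Definition cterm := nat -> term.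
Definition cform := nat -> form.

Definition call (P : cterm -> cform) : cform :=
  fun n => All (P (fun m => Var (m - S n)) (S n)).
Definition cnot (P : cform) : cform := fun n => Not (P n).
Definition cor (P Q : cform) : cform := fun n => Or (P n) (Q n).
Definition cand (P Q : cform) : cform := fun n => And (P n) (Q n).
Definition cimp (P Q : cform) : cform := fun n => Imp (P n) (Q n).
Definition ciff (P Q : cform) : cform := fun n => Iff (P n) (Q n).
Definition cex (P : cterm -> cform) : cform := cnot (call (fun x => cnot (P x))).
Definition ceq (t u : cterm) : cform := fun n => Eq (t n) (u n).
Definition clt (t u : cterm) : cform := fun n => Lt (t n) (u n).
Definition czero : cterm := fun _ => Zero.
Definition cone : cterm := fun _ => One.
Definition cadd (t u : cterm) : cterm := fun n => Add (t n) (u n).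
Definition cmul (t u : cterm) : cterm := fun n => Mul (t n) (u n).
Definition cexp (t u : cterm) : cterm := fun n => Exp (t n) (u n).
Definition ctrue : cform := fun _ => Imp Bot Bot.
Definition cball (t : cterm) (P : cterm -> cform) : cform :=
  call (fun x => cimp (clt x t) (P x)).
Definition cbex (t : cterm) (P : cterm -> cform) : cform :=
  cnot (cball t (fun x => cnot (P x))).

Definition sentence (P : cform) : form := P 0.

Declare Scope fm_scope.
Delimit Scope fm_scope with fm.
Notation "0" := czero : fm_scope.
Notation "1" := cone : fm_scope.
Notation "2" := (cadd cone cone) : fm_scope.
Notation "t + u" := (cadd t u) : fm_scope.
Notation "t * u" := (cmul t u) : fm_scope.
Notation "t ^ u" := (cexp t u) : fm_scope.
Notation "t = u" := (ceq t u) : fm_scope.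
Notation "t < u" := (clt t u) : fm_scope.
Notation "t <= u" := (clt t (cadd u cone)) : fm_scope.
Notation "~ P" := (cnot P) : fm_scope.
Notation "P /\ Q" := (cand P Q) : fm_scope.
Notation "P \/ Q" := (cor P Q) : fm_scope.
Notation "P ==> Q" := (cimp P Q) (at level 90, right associativity) : fm_scope.
Notation "P <-> Q" := (ciff P Q) : fm_scope.
Notation "∀ x .. y , P" := (call (fun x => .. (call (fun y => P)) ..))
  (at level 200, x binder, y binder, right associativity) : fm_scope.
Notation "∃ x .. y , P" := (cex (fun x => .. (cex (fun y => P)) ..))
  (at level 200, x binder, y binder, right associativity) : fm_scope.
Notation "∀ x .. y '<' t , P" := (cball t (fun x => .. (cball t (fun y => P)) ..))
  (at level 200, x binder, y binder, t at level 69, right associativity) : fm_scope.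
Notation "∃ x .. y '<' t , P" := (cbex t (fun x => .. (cbex t (fun y => P)) ..))
  (at level 200, x binder, y binder, t at level 69, right associativity) : fm_scope.

(** * Formula classes *)

Inductive sigma00 : form -> Prop :=
| s_eq t u : sigma00 (Eq t u)
| s_lt t u : sigma00 (Lt t u)
| s_mem t X : sigma00 (Mem t X)
| s_bot : sigma00 Bot
| s_imp A B : sigma00 A -> sigma00 B -> sigma00 (Imp A B)
| s_ball t A : sigma00 A -> sigma00 (All (Imp (Lt (Var 0) (tlift t)) A)).

Inductive sigma0 : nat -> form -> Prop :=
| sigma0_O A : sigma00 A -> sigma0 0 A
| sigma0_S k A : pi0 k A -> sigma0 (S k) (Ex A)
with pi0 : nat -> form -> Prop :=
| pi0_O A : sigma00 A -> pi0 0 A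
| pi0_S k A : sigma0 k A -> pi0 (S k) (All A).

(** * The theories *)

Definition basic_axioms : list cform :=
  [ (∀ m, ~ m + 1 = 0);
    (∀ m n, m + 1 = n + 1 ==> m = n);
    (∀ m, m + 0 = m);
    (∀ m n, m + (n + 1) = (m + n) + 1);
    (∀ m, m * 0 = 0);
    (∀ m n, m * (n + 1) = m * n + m);
    (∀ m, ~ m < 0);
    (∀ m n, m < n + 1 <-> m < n \/ m = n);
    (∀ m, m ^ 0 = 1);
    (∀ m n, m ^ (n + 1) = m * m ^ n) ]%fm.

(* In the schemes the distinguished variable is index 0 of [A]; all other
   variables are parameters. *)

Definition induction (A : form) : form :=
  Imp (inst Zero A)
    (Imp (All (Imp A (fsub (scons (Add (Var 0) One) shift) id A)))
      (All A)).

Definition comprehension (A B : form) : form :=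
  Imp (All (Iff A B)) (Ex2 (All (Iff (Mem (Var 0) 0) (lift2 A)))).

Inductive RCA0star : form -> Prop :=
| ax_basic P : In P basic_axioms -> RCA0star (sentence P)
| ax_ind A : sigma00 A -> RCA0star (induction A)
| ax_comp A B : sigma0 1 A -> pi0 1 B -> RCA0star (comprehension A B).

Inductive ISigma (k : nat) : form -> Prop :=
| ax_isigma A : sigma0 k A -> ISigma k (induction A).

Definition RCA0star_ISigma (k : nat) (A : form) : Prop := RCA0star A \/ ISigma k A.

(** * Ordinals below epsilon_0 in Cantor normal form *)

(* [OCons b n g] is omega^b * (n + 1) + g *)
Inductive ord : Type :=
| OZero
| OCons (b : ord) (n : nat) (g : ord).

Fixpoint ocmp (a a' : ord) : comparison :=
  match a, a' with
  | OZero, OZero => Datatypes.Eq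
  | OZero, OCons _ _ _ => Datatypes.Lt
  | OCons _ _ _, OZero => Datatypes.Gt
  | OCons b n g, OCons b' n' g' =>
      match ocmp b b' with
      | Datatypes.Eq =>
          match Nat.compare n n' with
          | Datatypes.Eq => ocmp g g'
          | c => c
          end
      | c => c
      end
  end.

Definition olt (a a' : ord) : Prop := ocmp a a' = Datatypes.Lt.

Fixpoint cnf (a : ord) : Prop :=
  match a with
  | OZero => True
  | OCons b n g => cnf b /\ cnf g /\ olt g (OCons b 0 OZero)
  end.

(* [omega_tower x] is omega_x, with omega_0 = 1 *)
Fixpoint omega_tower (x : nat) : ord :=
  match x with
  | O => OCons OZero 0 OZero
  | S y => OCons (omega_tower y) 0 OZero
  end.

(** * Arithmetization *)

Local Open Scope fm_scope.

(* an injective pairing *)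
Definition pair (x y : cterm) : cterm := (x + y) * (x + y) + x.

(* A pair of numbers [b], [s] codes a finite sequence of numbers below [b]:
   the [i]-th entry is the [i]-th digit of [s] in base [b]. *)
Definition entry (b s i v : cterm) : cform :=
  v < b /\ ∃ q < s + 1, ∃ r < b ^ i, s = (q * b + v) * b ^ i + r.

(* [v] is derivable from the rules [rule]: it is the last entry of a sequence
   (over the base [b]) all of whose entries [j] satisfy [rule b E j], where [E]
   holds of the strictly earlier entries. *)
Definition derivable (rule : cterm -> (cterm -> cform) -> cterm -> cform)
    (v : cterm) : cform :=
  ∃ b s n,
    (∀ i < n + 1, ∀ j < b,
       entry b s i j ==> rule b (fun w => ∃ k < i, entry b s k w) j) /\
    entry b s n v.

(** Ordinal codes: [0] codes zero and [osnoc d b n] codes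
    delta + omega^beta * (n + 1), this being the last term of the Cantor normal
    form. *)
Definition osnoc (d b n : cterm) : cterm := pair d (pair b n) + 1.

(* [r] codes delta + omega^beta * m *)
Definition plus_pow_mul (d b m r : cterm) : cform :=
  (m = 0 /\ r = d) \/ ∃ p < m, m = p + 1 /\ r = osnoc d b p.

(* In the next definitions [c] bounds all codes involved. *)

Definition osucc (c a a' : cterm) : cform :=
  ∃ d n < c, a = osnoc d 0 n /\ plus_pow_mul d 0 n a'.

Definition olimit (c a : cterm) : cform :=
  ∃ d b n < c, a = osnoc d b n /\ 0 < b.

Definition judgement (t a x y : cterm) : cterm := pair t (pair a (pair x y)).
(* a[x] = y, for a limit *)
Definition jfund (a x y : cterm) : cterm := judgement 0 a x y.
(* F_a(x) = y *)
Definition jfast (a x y : cterm) : cterm := judgement 1 a x y.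
(* F_a^(k)(x) = y *)
Definition jiter (k a x y : cterm) : cterm := judgement (k + 2) a x y.

Definition fast_rule (c : cterm) (E : cterm -> cform) (j : cterm) : cform :=
  ∃ a x y < c,
    (j = jfund a x y /\
       ∃ d b n r < c, a = osnoc d b n /\ plus_pow_mul d b n r /\
         ((∃ g < c, osucc c b g /\ plus_pow_mul r g x y) \/
          (olimit c b /\ ∃ w < c, E (jfund b x w) /\ plus_pow_mul r w 1 y)))
    \/ (j = jfast a x y /\
         ((a = 0 /\ y = x + 1) \/
          (∃ b < c, osucc c a b /\ E (jiter (x + 1) b x y)) \/
          (olimit c a /\ ∃ b < c, E (jfund a x b) /\ E (jfast b x y))))
    \/ (j = jiter 0 a x y /\ y = x)
    \/ (∃ k z < c,
         j = jiter (k + 1) a x y /\ E (jiter k a x z) /\ E (jfast a z y)).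

(* F_a(x) = y *)
Definition fast (a x y : cterm) : cform := derivable fast_rule (jfast a x y).

(* F_a^{-1}(x) = y *)
Definition fast_inv (a x y : cterm) : cform :=
  ((∃ z, fast a y z /\ z <= x) /\ (∀ y' z, fast a y' z /\ z <= x ==> y' <= y))
  \/ (y = 0 /\ ~ ∃ y' z, fast a y' z /\ z <= x).

Definition log2 (x y : cterm) : cform :=
  (x = 0 /\ y = 0) \/ (2 ^ y <= x /\ x < 2 ^ (y + 1)).

Fixpoint iter_log (k : nat) (x y : cterm) : cform :=
  match k with
  | O => y = x
  | S k' => ∃ z, iter_log k' x z /\ log2 z y
  end.

(* [y] is the rounded down [r]-th root of [x] *)
Definition root (r x y : cterm) : cform :=
  (r = 0 /\ y = x) \/ (0 < r /\ y ^ r <= x /\ x < (y + 1) ^ r).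

Fixpoint cnum (n : nat) : cterm :=
  match n with O => 0 | S m => cnum m + 1 end.

(* code of a + o, where [acc] codes a and all exponents occurring in a exceed
   those occurring in o *)
Fixpoint ocode_from (acc : cterm) (o : ord) : cterm :=
  match o with
  | OZero => acc
  | OCons b n g => ocode_from (osnoc acc (ocode_from 0 b) (cnum n)) g
  end.
Definition ocode (o : ord) : cterm := ocode_from 0 o.

(* graph of f_alpha *)
Definition f_graph (d : nat) (alpha : ord) (x y : cterm) : cform :=
  ∃ i l, fast_inv (ocode alpha) x i /\ iter_log (d - 2)%nat x l /\ root i l y.

(** * Weak Paris-Harrington

    Finite objects are coded by numbers.  A coloring is a coded finite sequence
    that gives the color of the tuple (x_0,...,x_{d-1}) at position
    [tuple [x_0;...;x_{d-1}]].  A finite set is coded by its increasing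
    enumeration h_0 < ... < h_{l-1}. *)

Fixpoint forall_tuple (n : nat) (P : list cterm -> cform) : cform :=
  match n with
  | O => P []
  | S m => ∀ x, forall_tuple m (fun xs => P (x :: xs))
  end.

Definition tuple (xs : list cterm) : cterm := fold_right pair 0 xs.

(* a <= x_0 < x_1 < ... <= R *)
Fixpoint increasing (a R : cterm) (xs : list cterm) : cform :=
  match xs with
  | [] => ctrue
  | x :: xs' => a <= x /\ x <= R /\ increasing (x + 1) R xs'
  end.

(* [b], [s] code a coloring of [a,R]^d with values in {0,...,c-1} *)
Definition coloring (d : nat) (a R c b s : cterm) : cform :=
  forall_tuple d (fun xs =>
    increasing a R xs ==> ∃ v, v < c /\ entry b s (tuple xs) v).

(* [e], [h], [l] code the subset {h_0 < ... < h_{l-1}} of [a,R] *)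
Definition subset_enum (a R e h l : cterm) : cform :=
  (∀ i, i < l ==> ∃ x, entry e h i x /\ a <= x /\ x <= R) /\
  (∀ i x y, i + 1 < l /\ entry e h i x /\ entry e h (i + 1) y ==> x < y).

(* the consecutive entries of [e], [h] from position [i] on are [xs] *)
Fixpoint entries (e h i : cterm) (xs : list cterm) : cform :=
  match xs with
  | [] => ctrue
  | x :: xs' => entry e h i x /\ entries e h (i + 1) xs'
  end.

Definition weakly_homogeneous (d : nat) (b s e h l : cterm) : cform :=
  ∀ i, i + cnum d < l ==>
    forall_tuple (S d) (fun xs =>
      entries e h i xs ==>
      ∃ v, entry b s (tuple (firstn d xs)) v /\ entry b s (tuple (tl xs)) v).

Definition WPH (d : nat) (f : cterm -> cterm -> cform) : form :=
  sentence (
    ∀ c a, ∃ R, ∀ b s, coloring d a R c b s ==>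
      ∃ e h l,
        0 < l /\ subset_enum a R e h l /\ weakly_homogeneous d b s e h l /\
        ∃ m y, entry e h 0 m /\ f m y /\ y < l).

Local Close Scope fm_scope.

(* Main.v *)
(** Write [n = d - 1], so the theory is [RCA_0^* + ISigma_n].

    Provability: by completeness it suffices to work in an arbitrary model [M].  Totality of [F_alpha] is a
    [Pi_2] property, and Gentzen's jump trades [n - 1] quantifier alternations for [n - 1] exponentials, so
    [F_alpha] is total in [M] for [alpha < omega_n].  A colouring of [[a,R]^d] with [c] colours and no weakly
    homogeneous set of size [l] gives every [(d-1)]-tuple the vector, indexed by the colours, of the lengths of
    the longest homogeneous paths ending there.  This is a proper colouring of the shift graph with [l^c] colours;
    taking [d - 2] times the set of colours of the one-point extensions on the left gives an injection on points,
    hence [R - a < tower_(d-2)(l^c)].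

    Unprovability: fix [i] and let [R] be maximal such that some descending sequence of ordinals below
    [omega_(n+1)], with bottom exponents at most [i+4] and [y]-th member of norm [< y], lives on [[i+4,R]].  Every
    sequence of this kind, started anywhere, stays below [F_(omega_n)] of its starting point.  By maximality a
    sparse subset of [[i+4,R+1]] is [omega_n]-large; an [n]-fold estimation lemma thins it to a set [B] of more
    than [i] points such that, for the [r]-th thinning, no witness requested by [b] in [B] lies between the next
    point of [B] and a bound [t_r].
    In an ultraproduct over [i], the initial segment [I] with the points of the [B]'s cofinal is closed under
    exponentiation, and [t_1, ..., t_n] bound the quantifiers of [Sigma_n] formulas, whence [I] satisfies
    [ISigma_n]; adjoining the [Delta_1] sets gives a model of the theory.  Pulling back the maximal descending
    sequence along a slow growing function, and comparing iterated first differences of Cantor normal forms,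
    yields a colouring in [I] all of whose weakly homogeneous sets [H] satisfy
    [|H| <= (log^(n-1) (min H))^(1/e)] for every [e < i + 4], while [F_(omega_n)^(-1) < i + 4] in [I]. *)

From Stdlib Require Import List Arith Lia Classical ClassicalEpsilon
  FunctionalExtensionality PropExtensionality Ring Sorted Bool Cantor.
From HB Require structures.
From mathcomp Require ssreflect ssrfun ssrbool eqtype choice order ssralg ssrnum lra boolp
  classical_sets filter.

(** Both halves use one development of arithmetic inside an abstract [arithM]. The standard numbers
    form such a model, so the internal totality proof also yields actual totality of the functions
    [F]. Derivations of values of [F] are only moved from the cut to the standard numbers; hence the
    bounding theorem and the ordinal combinatorics of the unprovability half concern genuine
    ordinals and are never carried out inside the theory.

    In that half three demands meet in one set [B]: it must be sparse, for closure under
    exponentiation; it must answer requests, for induction; and it must lie below some [R] that [F]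
    exceeds from [i + 4] on, although the colouring needs a long descent. Maximality of [R]
    reconciles them: the descent used for the colouring exists up to [R], and the impossibility of
    prolonging it by one number makes sparse sets large. For this, chains on sparse sets use bottom
    exponents from 3 on, which leaves the exponents 0 and 1 to fill the gaps between their points.

    The root enters through blocks that begin at towers over [j^(K + 1)] with [K = i + 4]: an [e]-th
    root with [e < K] then still exceeds [j] by the required margin. *)

Section Quotient.
Variables (X : Type) (R : X -> X -> Prop).
(** A class is the predicate [R x] itself, so equality of classes follows from extensionality. The
    construction serves the term model, the ring of differences and the ultrapower. *)
Definition quot := {P : X -> Prop | exists x, P = R x}.
Definition cls (x : X) : quot := exist _ (R x) (ex_intro _ x eq_refl).
Definition rep (q : quot) : X :=
  proj1_sig (constructive_indefinite_description _ (proj2_sig q)).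
Lemma cls_rep q : cls (rep q) = q.
Proof.
  unfold rep; destruct constructive_indefinite_description as [x Hx]; destruct q as [P HP]; simpl in *.
  subst P; unfold cls; f_equal; apply proof_irrelevance.
Qed.
Hypothesis Rrefl : forall x, R x x.
Hypothesis Rsym : forall x y, R x y -> R y x.
Hypothesis Rtrans : forall x y z, R x y -> R y z -> R x z.
Lemma cls_eq x y : cls x = cls y <-> R x y.
Proof.
  split.
  - intro H. apply (f_equal (@proj1_sig _ _)) in H; simpl in H. rewrite H; apply Rrefl.
  - intro H. unfold cls.
    assert (E : R x = R y) by (extensionality z; apply propositional_extensionality; split; eauto).
    apply eq_sig_hprop; auto.
Qed.
Lemma rep_cls x : R (rep (cls x)) x.
Proof. apply cls_eq; rewrite cls_rep; auto. Qed.
End Quotient.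

(* Subtraction-free axioms of a discretely ordered semiring.  Its ring of differences is a [realDomainType],
   so that [lra] and [nra] decide inequalities between elements of a model of arithmetic. *)
Record OSR := {
  car :> Type; o0 : car; o1 : car; oadd : car -> car -> car; omul : car -> car -> car;
  oltR : car -> car -> Prop;
  addC : forall x y, oadd x y = oadd y x;
  addA : forall x y z, oadd x (oadd y z) = oadd (oadd x y) z;
  add0 : forall x, oadd o0 x = x;
  mulC : forall x y, omul x y = omul y x;
  mulA : forall x y z, omul x (omul y z) = omul (omul x y) z;
  mul1 : forall x, omul o1 x = x;
  mul0 : forall x, omul o0 x = o0;
  mulD : forall x y z, omul (oadd x y) z = oadd (omul x z) (omul y z);
  ltE : forall x y, oltR x y <-> exists k, y = oadd x (oadd k o1);
  addI : forall x y z, oadd x z = oadd y z -> x = y;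
  pos1 : forall x, oadd x o1 <> o0;
  tri : forall x y, oltR x y \/ x = y \/ oltR y x
}.

(** * The ring of differences of a discretely ordered semiring *)

Module OrderedRing.
Import HB.structures ssreflect ssrfun ssrbool eqtype choice order ssralg ssrnum lra boolp.
Import GRing.Theory Num.Theory.
Section Def.
Variable A : OSR.
Local Notation "x +' y" := (oadd A x y) (at level 50, left associativity).
Local Notation "x *' y" := (omul A x y) (at level 40, left associativity).

Lemma semi : semi_ring_theory (o0 A) (o1 A) (oadd A) (omul A) eq.
Proof.
  split; try solve [intros; first [apply add0 | apply addC | apply addA | apply mul1 | apply mul0 | apply mulC | apply mulA | apply mulD]].
Qed.
Add Ring Ar : semi.

Definition R (p q : A * A) : Prop := p.1 +' q.2 = q.1 +' p.2.
Lemma R_refl p : R p p. Proof. by []. Qed.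
Lemma R_sym p q : R p q -> R q p. Proof. by []. Qed.
Lemma R_trans p q r : R p q -> R q r -> R p r.
Proof.
  rewrite /R => H1 H2. apply (addI _ _ _ (q.2)).
  transitivity (p.1 +' q.2 +' r.2); first ring. rewrite H1. transitivity (q.1 +' r.2 +' p.2); first ring.
  rewrite H2; ring.
Qed.
Definition D : Type := quot _ R.
Definition mk (a b : A) : D := cls _ R (a, b).
Lemma mkE a b c d : mk a b = mk c d <-> a +' d = c +' b.
Proof. by rewrite /mk cls_eq //; exact R_trans. Qed.
Lemma mkP (x : D) : exists a b, x = mk a b.
Proof. exists (rep _ _ x).1, (rep _ _ x).2. rewrite /mk -surjective_pairing cls_rep //. Qed.

Definition dadd (x y : D) : D := mk ((rep _ _ x).1 +' (rep _ _ y).1) ((rep _ _ x).2 +' (rep _ _ y).2).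
Definition dopp (x : D) : D := mk (rep _ _ x).2 (rep _ _ x).1.
Definition dmul (x y : D) : D :=
  mk ((rep _ _ x).1 *' (rep _ _ y).1 +' (rep _ _ x).2 *' (rep _ _ y).2)
     ((rep _ _ x).1 *' (rep _ _ y).2 +' (rep _ _ x).2 *' (rep _ _ y).1).
Lemma repE a b : (rep _ _ (mk a b)).1 +' b = a +' (rep _ _ (mk a b)).2.
Proof. have := rep_cls _ R R_refl R_sym R_trans (a, b). by []. Qed.
Lemma daddE a b c d : dadd (mk a b) (mk c d) = mk (a +' c) (b +' d).
Proof.
  rewrite /dadd mkE. have := repE a b; have := repE c d.
  move: (rep _ _ (mk a b)) (rep _ _ (mk c d)) => [a' b'] [c' d'] /= H1 H2.
  transitivity ((a' +' b) +' (c' +' d)); first ring. rewrite H1 H2; ring.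
Qed.
Lemma doppE a b : dopp (mk a b) = mk b a.
Proof.
  rewrite /dopp mkE. have := repE a b. move: (rep _ _ (mk a b)) => [a' b'] /= H.
  rewrite addC -H addC //.
Qed.
Lemma dmulE a b c d : dmul (mk a b) (mk c d) = mk (a *' c +' b *' d) (a *' d +' b *' c).
Proof.
  rewrite /dmul mkE. have := repE a b; have := repE c d.
  move: (rep _ _ (mk a b)) (rep _ _ (mk c d)) => [a' b'] [c' d'] /= H1 H2.
  have E1 : a' *' c' +' b *' c' = a *' c' +' b' *' c' by rewrite -!mulD H2.
  have E2 : a *' d' +' b' *' d' = a' *' d' +' b *' d' by rewrite -!mulD H2.
  have E3 : a *' c' +' a *' d = a *' c +' a *' d' by rewrite -![a *' _]mulC -!mulD H1.
  have E4 : b *' c +' b *' d' = b *' c' +' b *' d by rewrite -![b *' _]mulC -!mulD H1.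
  apply (addI _ _ _ (b *' c' +' a *' d' +' a *' c' +' b *' d')).
  transitivity ((a' *' c' +' b *' c') +' (a *' d' +' b' *' d') +' (a *' c' +' a *' d) +' (b *' c +' b *' d')); first ring.
  rewrite E1 E2 E3 E4. ring.
Qed.
Ltac dring := rewrite ?(daddE, doppE, dmulE); apply/mkE; ring.
Lemma D_addA : associative dadd. Proof. move=> x y z. have [a [b ->]] := mkP x. have [c [d ->]] := mkP y. have [e [f ->]] := mkP z. dring. Qed.
Lemma D_addC : commutative dadd. Proof. move=> x y. have [a [b ->]] := mkP x. have [c [d ->]] := mkP y. dring. Qed.
Lemma D_add0 : left_id (mk (o0 A) (o0 A)) dadd. Proof. move=> x. have [a [b ->]] := mkP x. dring. Qed.
Lemma D_addN : left_inverse (mk (o0 A) (o0 A)) dopp dadd. Proof. move=> x. have [a [b ->]] := mkP x. dring. Qed.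
Lemma D_mulA : associative dmul. Proof. move=> x y z. have [a [b ->]] := mkP x. have [c [d ->]] := mkP y. have [e [f ->]] := mkP z. dring. Qed.
Lemma D_mulC : commutative dmul. Proof. move=> x y. have [a [b ->]] := mkP x. have [c [d ->]] := mkP y. dring. Qed.
Lemma D_mul1 : left_id (mk (o1 A) (o0 A)) dmul. Proof. move=> x. have [a [b ->]] := mkP x. dring. Qed.
Lemma D_mulD : left_distributive dmul dadd. Proof. move=> x y z. have [a [b ->]] := mkP x. have [c [d ->]] := mkP y. have [e [f ->]] := mkP z. dring. Qed.

HB.instance Definition _ := gen_eqMixin D.
HB.instance Definition _ := gen_choiceMixin D.
HB.instance Definition _ := GRing.isZmodule.Build D D_addA D_addC D_add0 D_addN.
Lemma D_10 : mk (o1 A) (o0 A) != mk (o0 A) (o0 A).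
Proof. apply/eqP => /mkE H. apply: (@pos1 A (o0 A)). by rewrite addC H add0. Qed.
HB.instance Definition _ := GRing.Zmodule_isComNzRing.Build D D_mulA D_mulC D_mul1 D_mulD D_10.
Local Open Scope ring_scope.
(** Integral domains in the hierarchy of structures are unit rings, so units and inverses are
    supplied by classical choice. *)
Definition dunit (x : D) : bool := `[< exists y, y * x = 1 >].
Definition dinv (x : D) : D := if pselect (exists y, y * x = 1) is left H then projT1 (cid H) else x.
Lemma D_mulV : {in dunit, left_inverse 1 dinv *%R}.
Proof. move=> x /asboolP H. rewrite /dinv; case: pselect => // H'. exact: (projT2 (cid H')). Qed.
Lemma D_unitP x y : y * x = 1 -> dunit x. Proof. by move=> H; apply/asboolP; exists y. Qed.
Lemma D_invout : {in [predC dunit], dinv =1 id}.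
Proof. move=> x /negP H. rewrite /dinv; case: pselect => // H'. by case: H; apply/asboolP. Qed.
HB.instance Definition _ := GRing.ComNzRing_hasMulInverse.Build D D_mulV D_unitP D_invout.

Definition dle (x y : D) : bool := `[< exists k, y = x + mk k (o0 A) >].
Lemma dle_sub x y : dle 0 (y - x) = dle x y.
Proof.
  apply/asboolP/asboolP => -[k H]; exists k.
  - by rewrite -H addrC add0r subrK || rewrite -(subrK x y) H add0r addrC.
  - by rewrite H add0r addrAC subrr add0r.
Qed.
Lemma dle_add x y : dle 0 x -> dle 0 y -> dle 0 (x + y).
Proof. move=> /asboolP[k ->] /asboolP[l ->]. apply/asboolP; exists (k +' l). rewrite !add0r [LHS]daddE; apply/mkE; ring. Qed.
Lemma dle_mul x y : dle 0 x -> dle 0 y -> dle 0 (x * y).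
Proof. move=> /asboolP[k ->] /asboolP[l ->]. apply/asboolP; exists (k *' l). rewrite !add0r [LHS]dmulE; apply/mkE; ring. Qed.
Lemma add_eq0 k l : k +' l = o0 A -> k = o0 A.
Proof.
  move=> H. have [|[|]] := tri _ (o0 A) k => //.
  - move/ltE => [m E]. case: (@pos1 A (m +' l)). by rewrite -H E; ring.
  - move/ltE => [m E]. case: (@pos1 A (k +' m)). by rewrite [RHS]E; ring.
Qed.
Lemma dle_anti x : dle 0 x -> dle x 0 -> x = 0.
Proof.
  move=> /asboolP[k ->] /asboolP[l]. rewrite !add0r [_ + _]daddE => /mkE H.
  apply/mkE. rewrite (@add_eq0 k l) //. transitivity (k +' l +' o0 A); first ring. rewrite -H; ring.
Qed.
Lemma dle_total x : dle 0 x || dle x 0.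
Proof.
  have [a [b ->]] := mkP x. have [|[|]] := tri _ a b.
  - move/ltE => [k ->]. apply/orP; right; apply/asboolP; exists (k +' o1 A). rewrite [_ + _]daddE; apply/mkE; ring.
  - move=> ->. apply/orP; right; apply/asboolP; exists (o0 A). rewrite [_ + _]daddE; apply/mkE; ring.
  - move/ltE => [k ->]. apply/orP; left; apply/asboolP; exists (k +' o1 A). rewrite [_ + _]daddE; apply/mkE; ring.
Qed.
(** Signs reduce the claim to nonnegative factors. A nonzero one has the form [m + 1], and the
    product of two such elements is again a successor. *)
Lemma D_integral : GRing.integral_domain_axiom D.
Proof.
  have P (a b : D) : a != 0 -> b != 0 -> dle 0 a -> dle 0 b -> a * b != 0.
    move=> Ha Hb /asboolP[k E] /asboolP[l F]. move: Ha Hb; rewrite {}E {}F !add0r => /eqP Hk /eqP Hl.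
    apply/eqP. rewrite [_ * _]dmulE => /mkE H.
    have [|[|]] := tri _ (o0 A) k; last by move/ltE => [m /esym]; rewrite addA => /pos1.
    2: by move=> E; apply: Hk; rewrite -E.
    have [|[|]] := tri _ (o0 A) l; last by move/ltE => [m /esym]; rewrite addA => /pos1.
    2: by move=> E; case: (Hl); rewrite -E.
    move=> /ltE[m E] /ltE[m' E']. subst. apply: (@pos1 A (m *' m' +' m +' m')).
    have H' : forall a b : A, a *' b +' o0 A *' o0 A +' o0 A = o0 A +' (a *' o0 A +' o0 A *' b) -> a *' b = o0 A.
      move=> k0 l0; have -> : k0 *' l0 +' o0 A *' o0 A +' o0 A = k0 *' l0 by ring.
      move=> ->; ring.
    rewrite -(H' _ _ H). ring.
  move=> x y H. apply/negPn/negP; rewrite negb_or => /andP[Hx Hy].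
  have Hn (z : D) : dle z 0 -> dle 0 (- z) by rewrite -(dle_sub z 0) add0r.
  have [a|/Hn a] := orP (dle_total x); have [b|/Hn b] := orP (dle_total y).
  - by have := P _ _ Hx Hy a b; rewrite H eqxx.
  - have := P x (- y) Hx; rewrite oppr_eq0 mulrN H oppr0 eqxx => /(_ Hy a b) //.
  - have := P (- x) y; rewrite oppr_eq0 mulNr H oppr0 eqxx => /(_ Hx Hy a b) //.
  - have := P (- x) (- y); rewrite !oppr_eq0 mulrNN H eqxx => /(_ Hx Hy a b) //.
Qed.
HB.instance Definition _ := GRing.ComUnitRing_isIntegral.Build D D_integral.
Definition dnorm (x : D) : D := if dle 0 x then x else - x.
Lemma D_normN x : dnorm (- x) = dnorm x.
Proof.
  have E : dle 0 (- x) = dle x 0 by rewrite -(dle_sub x 0) add0r.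
  rewrite /dnorm E opprK. case: ifP => H; case: ifP => H' //.
  - by rewrite (dle_anti _ H' H) oppr0.
  - by move: (dle_total x); rewrite H H'.
Qed.
Lemma D_ge0_norm x : dle 0 x -> dnorm x = x. Proof. by rewrite /dnorm => ->. Qed.
HB.instance Definition _ := Num.IntegralDomain_isLeReal.Build D dle_add dle_mul dle_anti dle_sub dle_total D_normN D_ge0_norm (fun _ _ => erefl).

Definition inj (x : A) : D := mk x (o0 A).
Lemma inj0 : inj (o0 A) = 0. Proof. by []. Qed.
Lemma inj1 : inj (o1 A) = 1. Proof. by []. Qed.
Lemma injD x y : inj (x +' y) = inj x + inj y. Proof. rewrite [RHS]daddE; apply/mkE; ring. Qed.
Lemma injM x y : inj (x *' y) = inj x * inj y. Proof. rewrite [RHS]dmulE; apply/mkE; ring. Qed.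
Lemma injE x y : x = y <-> inj x = inj y.
Proof. split=> [->//|/mkE]. by rewrite !(addC _ _ (o0 A)) !add0. Qed.
Lemma inj_ge0 x : is_true (0 <= inj x).
Proof. apply/asboolP; exists x. by rewrite add0r. Qed.
(** Discreteness is built into the translation: a strict inequality becomes a gap of one, which
    linear arithmetic over an ordered ring could not infer by itself. *)
Lemma injL x y : oltR A x y <-> is_true (inj x + 1 <= inj y).
Proof.
  rewrite ltE; split.
  - move=> [k ->]. apply/asboolP; exists k. rewrite -[mk k _]/(inj k) !injD inj1 [inj k + _]addrC addrA //.
  - move=> /asboolP[k H]; exists k. apply/injE. rewrite H -[mk k _]/(inj k) !injD inj1 [inj k + _]addrC addrA //.
Qed.
Definition DR : realDomainType := D.
Definition emb (x : A) : DR := inj x.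
Lemma emb0 : emb (o0 A) = 0. Proof. exact inj0. Qed.
Lemma emb1 : emb (o1 A) = 1. Proof. exact inj1. Qed.
Lemma embD x y : emb (x +' y) = emb x + emb y. Proof. exact: injD. Qed.
Lemma embM x y : emb (x *' y) = emb x * emb y. Proof. exact: injM. Qed.
Lemma embE x y : x = y <-> emb x = emb y. Proof. exact: injE. Qed.
Lemma emb_ge0 x : is_true (0 <= emb x). Proof. exact: inj_ge0. Qed.
Lemma embL x y : oltR A x y <-> is_true (emb x + 1 <= emb y). Proof. exact: injL. Qed.
End Def.
Ltac rlra := lra.
Ltac rnra := nra.
End OrderedRing.

Require Import Defs.
Import ListNotations.
Set Bullet Behavior "Strict Subproofs".

(** * Henkin models *)

Record model := {
  dom :> Type; sdom : Type;
  mz : dom; m1 : dom; madd : dom -> dom -> dom; mmul : dom -> dom -> dom; mexp : dom -> dom -> dom;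
  mlt : dom -> dom -> Prop; mmem : dom -> sdom -> Prop }.
Arguments mz {_}. Arguments m1 {_}. Arguments madd {_}. Arguments mmul {_}. Arguments mexp {_}.
Arguments mlt {_}. Arguments mmem {_}.

Lemma all_iff (X : Type) (P Q : X -> Prop) : (forall x, P x <-> Q x) -> (forall x, P x) <-> (forall x, Q x).
Proof. firstorder. Qed.

Section Sat.
Variable M : model.
Fixpoint eval (e : nat -> M) (t : term) : M :=
  match t with
  | Var n => e n | Zero => mz | One => m1
  | Add t u => madd (eval e t) (eval e u)
  | Mul t u => mmul (eval e t) (eval e u)
  | Exp t u => mexp (eval e t) (eval e u)
  end.
Fixpoint sat (e : nat -> M) (s : nat -> sdom M) (A : form) : Prop :=
  match A with
  | Eq t u => eval e t = eval e u
  | Lt t u => mlt (eval e t) (eval e u)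
  | Mem t X => mmem (eval e t) (s X)
  | Bot => False
  | Imp A B => sat e s A -> sat e s B
  | All A => forall x, sat (scons x e) s A
  | All2 A => forall X, sat e (scons X s) A
  end.

Lemma eval_tsub e f t : eval e (tsub f t) = eval (fun n => eval e (f n)) t.
Proof. induction t; simpl; congruence. Qed.
Lemma eval_tlift x e t : eval (scons x e) (tlift t) = eval e t.
Proof. unfold tlift; rewrite eval_tsub; reflexivity. Qed.
Lemma sat_fsub A : forall e s f r, sat e s (fsub f r A) <-> sat (fun n => eval e (f n)) (fun n => s (r n)) A.
Proof.
  induction A; intros e s f r; simpl; rewrite ?eval_tsub; try tauto.
  - rewrite IHA1, IHA2; tauto.
  - apply all_iff; intro x. rewrite IHA.
    replace (fun n => eval (scons x e) (scons (Var 0) (fun n0 => tlift (f n0)) n))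
      with (scons x (fun n => eval e (f n))); [tauto|].
    extensionality n; destruct n; simpl; auto. symmetry; apply eval_tlift.
  - apply all_iff; intro X. rewrite IHA.
    replace (fun n => scons X s (scons 0 (fun n0 => S (r n0)) n)) with (scons X (fun n => s (r n))); [tauto|].
    extensionality n; destruct n; simpl; auto.
Qed.
Lemma sat_lift x e s A : sat (scons x e) s (lift A) <-> sat e s A.
Proof. unfold lift; rewrite sat_fsub; reflexivity. Qed.
Lemma sat_lift2 X e s A : sat e (scons X s) (lift2 A) <-> sat e s A.
Proof. unfold lift2; rewrite sat_fsub; reflexivity. Qed.
Lemma sat_inst t e s A : sat e s (inst t A) <-> sat (scons (eval e t) e) s A.
Proof.
  unfold inst; rewrite sat_fsub.
  replace (fun n => eval e (scons t Var n)) with (scons (eval e t) e); [reflexivity|].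
  extensionality n; destruct n; reflexivity.
Qed.
Lemma sat_inst2 X e s A : sat e s (inst2 X A) <-> sat e (scons (s X) s) A.
Proof.
  unfold inst2; rewrite sat_fsub.
  replace (fun n => s (scons X id n)) with (scons (s X) s); [reflexivity|].
  extensionality n; destruct n; reflexivity.
Qed.

Definition models (T : form -> Prop) := forall A, T A -> forall e s, sat e s A.

Lemma soundness T G A : models T -> derives T G A -> forall e s, (forall B, In B G -> sat e s B) -> sat e s A.
Proof.
  intros HT; induction 1; intros e s HG; simpl in *.
  - auto.
  - apply HT; auto.
  - intro HA; apply IHderives; intros C [<-|HC]; auto.
  - apply (IHderives1 e s HG); auto.
  - apply NNPP; intro HA. apply (IHderives e s). intros C [<-|HC]; simpl; auto.
  - intro x; apply IHderives. intros C HC. apply in_map_iff in HC; destruct HC as (C' & <- & HC). apply sat_lift; auto.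
  - apply sat_inst. apply (IHderives e s HG).
  - intro x; apply IHderives. intros C HC. apply in_map_iff in HC; destruct HC as (C' & <- & HC). apply sat_lift2; auto.
  - apply sat_inst2. apply (IHderives e s HG).
  - reflexivity.
  - apply sat_inst. rewrite <- (IHderives1 e s HG). apply sat_inst; auto.
Qed.

Lemma sat_Not e s A : sat e s (Not A) <-> ~ sat e s A.
Proof. reflexivity. Qed.
Lemma sat_Or e s A B : sat e s (Or A B) <-> sat e s A \/ sat e s B.
Proof. unfold Or; simpl. split; [|tauto]. intros; destruct (classic (sat e s A)); auto. Qed.
Lemma sat_And e s A B : sat e s (And A B) <-> sat e s A /\ sat e s B.
Proof. unfold And; simpl. split; [|tauto]. intros; destruct (classic (sat e s A)); destruct (classic (sat e s B)); tauto. Qed.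
Lemma sat_Iff e s A B : sat e s (Iff A B) <-> (sat e s A <-> sat e s B).
Proof. unfold Iff; rewrite sat_And; simpl; tauto. Qed.
Lemma sat_Ex e s A : sat e s (Ex A) <-> exists x, sat (scons x e) s A.
Proof.
  unfold Ex; simpl. split.
  - intro H; apply NNPP; intro H'; apply H; intros x Hx; apply H'; eauto.
  - intros [x Hx] H; eapply H; eauto.
Qed.
Lemma sat_Ex2 e s A : sat e s (Ex2 A) <-> exists X, sat e (scons X s) A.
Proof.
  unfold Ex2; simpl. split.
  - intro H; apply NNPP; intro H'; apply H; intros x Hx; apply H'; eauto.
  - intros [x Hx] H; eapply H; eauto.
Qed.
End Sat.

(** * Composition of substitutions *)

Lemma tsub_comp s s' t : tsub s (tsub s' t) = tsub (fun n => tsub s (s' n)) t.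
Proof. induction t; simpl; congruence. Qed.
Lemma tsub_var t : tsub Var t = t.
Proof. induction t; simpl; congruence. Qed.
Definition up (s : nat -> term) : nat -> term := scons (Var 0) (fun n => tlift (s n)).
Definition up2 (r : nat -> nat) : nat -> nat := scons 0 (fun X => S (r X)).
Lemma up_comp s s' : (fun n => tsub (up s) (up s' n)) = up (fun n => tsub s (s' n)).
Proof.
  extensionality n; destruct n; simpl; auto. unfold tlift; rewrite !tsub_comp. f_equal.
Qed.
Lemma up2_comp r r' : (fun n => up2 r (up2 r' n)) = up2 (fun n => r (r' n)).
Proof. extensionality n; destruct n; reflexivity. Qed.
Lemma fsub_comp A : forall s r s' r',
  fsub s r (fsub s' r' A) = fsub (fun n => tsub s (s' n)) (fun n => r (r' n)) A.
Proof.
  induction A; intros; simpl; rewrite ?tsub_comp; auto.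
  - rewrite IHA1, IHA2; auto.
  - rewrite IHA. f_equal. f_equal. apply up_comp.
  - rewrite IHA. f_equal. f_equal. apply up2_comp.
Qed.
Lemma fsub_var A : fsub Var id A = A.
Proof.
  induction A; simpl; rewrite ?tsub_var; auto.
  - rewrite IHA1, IHA2; auto.
  - replace (scons (Var 0) _) with Var; [rewrite IHA; auto|]. extensionality n; destruct n; auto.
  - replace (scons 0 _) with (@id nat); [rewrite IHA; auto|]. extensionality n; destruct n; auto.
Qed.

Lemma sigma00_fsub A : sigma00 A -> forall s r, sigma00 (fsub s r A).
Proof.
  induction 1; intros s0 r; simpl; try constructor; auto.
  replace (tsub _ (tlift t)) with (tlift (tsub s0 t)).
  - constructor; auto.
  - unfold tlift; rewrite !tsub_comp. reflexivity.
Qed.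
Lemma sigma0_fsub k : (forall A, sigma0 k A -> forall s r, sigma0 k (fsub s r A)) /\
  (forall A, pi0 k A -> forall s r, pi0 k (fsub s r A)).
Proof.
  induction k as [|k [IH1 IH2]]; split; inversion 1; subst; intros; simpl; constructor; auto using sigma00_fsub.
Qed.

(** * Completeness *)

Section Derive.
Variable T : form -> Prop.
Hypothesis HT : forall A s r, T A -> T (fsub s r A).

(** Axioms may contain free variables, so the case [d_ax] rests on the closure of [T] under
    substitution. *)
Lemma derives_fsub G A : derives T G A -> forall s r, derives T (map (fsub s r) G) (fsub s r A).
Proof.
  induction 1; intros s r; simpl in *.
  - apply d_hyp, in_map; auto.
  - apply d_ax; auto.
  - apply d_impI; auto.
  - eapply d_impE; [apply (IHderives1 s r)|apply IHderives2].
  - apply d_raa. apply IHderives.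
  - apply d_allI. specialize (IHderives (up s) r). rewrite map_map in *.
    rewrite map_ext with (g := fun x => fsub (up s) r (lift x)); auto.
    intro a. unfold lift; rewrite !fsub_comp. reflexivity.
  - replace (fsub s r (inst t A)) with (inst (tsub s t) (fsub (up s) r A)).
    + apply d_allE. apply IHderives.
    + unfold inst; rewrite !fsub_comp. f_equal. extensionality n; destruct n; simpl; auto.
      unfold tlift; rewrite tsub_comp; simpl. apply tsub_var.
  - apply d_all2I. specialize (IHderives s (up2 r)). rewrite map_map in *.
    rewrite map_ext with (g := fun x => fsub s (up2 r) (lift2 x)); auto.
    intro a. unfold lift2; rewrite !fsub_comp. f_equal. extensionality n; simpl. apply tsub_var.
  - replace (fsub s r (inst2 X A)) with (inst2 (r X) (fsub s (up2 r) A)).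
    + apply d_all2E. apply IHderives.
    + unfold inst2; rewrite !fsub_comp. f_equal; extensionality n; try (destruct n; reflexivity). apply tsub_var.
  - apply d_refl.
  - replace (fsub s r (inst u A)) with (inst (tsub s u) (fsub (up s) r A)).
    + eapply d_subst; [apply IHderives1|].
      replace (inst (tsub s t) (fsub (up s) r A)) with (fsub s r (inst t A)); auto.
      unfold inst; rewrite !fsub_comp. f_equal. extensionality n; destruct n; simpl; auto.
      unfold tlift; rewrite tsub_comp; simpl. symmetry; apply tsub_var.
    + unfold inst; rewrite !fsub_comp. f_equal. extensionality n; destruct n; simpl; auto.
      unfold tlift; rewrite tsub_comp; simpl. apply tsub_var.
Qed.

Lemma weaken G A : derives T G A -> forall G', incl G G' -> derives T G' A.
Proof.
  induction 1; intros G' HG; try solve [econstructor; eauto].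
  - apply d_impI, IHderives. intros x [<-|Hx]; simpl; auto.
  - apply d_raa, IHderives. intros x [<-|Hx]; simpl; auto.
  - apply d_allI, IHderives. intros x Hx. apply in_map_iff in Hx; destruct Hx as (y & <- & Hy). apply in_map; auto.
  - apply d_all2I, IHderives. intros x Hx. apply in_map_iff in Hx; destruct Hx as (y & <- & Hy). apply in_map; auto.
Qed.

(** This says that all free variables of [A], of both sorts, lie below [k]; the form by
    substitutions is the one in which renaming arguments consume it. *)
Definition fresh k A := forall s s' r r', (forall i, i < k -> s i = s' i) -> (forall i, i < k -> r i = r' i) ->
  fsub s r A = fsub s' r' A.
Lemma tfresh_ex t : exists k, forall s s', (forall i, i < k -> s i = s' i) -> tsub s t = tsub s' t.
Proof.
  induction t as [n| | |t [k Hk] u [l Hl]|t [k Hk] u [l Hl]|t [k Hk] u [l Hl]]; simpl;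
    try (exists (k + l); intros; rewrite (Hk s s'), (Hl s s'); auto; intros; apply H; lia);
    try (exists 0; reflexivity).
  exists (S n); auto.
Qed.
Lemma fresh_mono k l A : fresh k A -> k <= l -> fresh l A.
Proof. unfold fresh; intros H Hk s s' r r' H1 H2; apply H; intros; [apply H1|apply H2]; lia. Qed.
Lemma fresh_ex A : exists k, fresh k A.
Proof.
  induction A as [t u|t u|t X| |A [k Hk] B [l Hl]|A [k Hk]|A [k Hk]]; unfold fresh; simpl.
  - destruct (tfresh_ex t) as [k Hk], (tfresh_ex u) as [l Hl]. exists (k + l); intros.
    rewrite (Hk s s'), (Hl s s'); auto; intros; apply H; lia.
  - destruct (tfresh_ex t) as [k Hk], (tfresh_ex u) as [l Hl]. exists (k + l); intros.
    rewrite (Hk s s'), (Hl s s'); auto; intros; apply H; lia.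
  - destruct (tfresh_ex t) as [k Hk]. exists (k + S X); intros.
    rewrite (Hk s s'), H0; auto; intros; try apply H; lia.
  - exists 0; auto.
  - exists (k + l); intros. rewrite (Hk s s' r r'), (Hl s s' r r'); auto; intros; first [apply H|apply H0]; lia.
  - exists k; intros. f_equal. apply Hk; auto. intros [|i] Hi; simpl; auto. rewrite H; auto; lia.
  - exists k; intros. f_equal. apply Hk; auto. intros [|i] Hi; simpl; auto. rewrite H0; auto; lia.
Qed.
Lemma fresh_list G : exists k, forall A, In A G -> fresh k A.
Proof.
  induction G as [|B G [k Hk]]; [exists 0; firstorder|].
  destruct (fresh_ex B) as [l Hl]. exists (k + l). intros A [<-|HA]; eapply fresh_mono; eauto; lia.
Qed.

(** The renaming [s] sends the variable [k] to index 0 and shifts all others. On formulas whose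
    variables lie below [k] it agrees with [lift], so it turns the derivation of the instance at
    [Var k] into the premise of [d_allI]. *)
Lemma gen_all G A k : (forall B, In B G -> fresh k B) -> fresh k (All A) ->
  derives T G (inst (Var k) A) -> derives T G (All A).
Proof.
  intros HG HA H. apply d_allI.
  set (s := fun i => if Nat.eqb i k then Var 0 else Var (S i)).
  apply (derives_fsub _ _) with (s := s) (r := id) in H.
  assert (Hs : forall i, i < k -> s i = shift i).
  { intros i Hi; unfold s. destruct (Nat.eqb_spec i k); auto; lia. }
  replace (map lift G) with (map (fsub s id) G).
  - replace A with (fsub s id (inst (Var k) A)); auto.
    unfold inst; rewrite fsub_comp.
    specialize (HA s shift id id Hs (fun i _ => eq_refl)). simpl in HA; injection HA as HA.
    transitivity (fsub (scons (Var 0) Var) id (fsub (up s) id A)).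
    + rewrite fsub_comp. f_equal. extensionality n; destruct n; simpl; auto.
      * unfold s; rewrite Nat.eqb_refl; auto.
      * unfold tlift; rewrite tsub_comp; simpl. symmetry; apply tsub_var.
    + unfold up; rewrite HA, fsub_comp. rewrite <- (fsub_var A) at 2. f_equal. extensionality n; destruct n; reflexivity.
  - apply map_ext_in. intros B HB. apply (HG B HB); auto.
Qed.
Lemma gen2 G A k : (forall B, In B G -> fresh k B) -> fresh k (All2 A) ->
  derives T G (inst2 k A) -> derives T G (All2 A).
Proof.
  intros HG HA H. apply d_all2I.
  set (r := fun i => if Nat.eqb i k then 0 else S i).
  apply (derives_fsub _ _) with (s := Var) (r := r) in H.
  assert (Hs : forall i, i < k -> r i = S i).
  { intros i Hi; unfold r. destruct (Nat.eqb_spec i k); auto; lia. }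
  replace (map lift2 G) with (map (fsub Var r) G).
  - replace A with (fsub Var r (inst2 k A)); auto.
    unfold inst2; rewrite fsub_comp.
    specialize (HA Var Var r S (fun i _ => eq_refl) Hs). simpl in HA; injection HA as HA.
    transitivity (fsub Var (scons 0 id) (fsub Var (up2 r) A)).
    + rewrite fsub_comp. f_equal. extensionality n; destruct n; simpl; auto.
      unfold r; rewrite Nat.eqb_refl; auto.
    + unfold up2; rewrite HA, fsub_comp. rewrite <- (fsub_var A) at 2. f_equal.
      extensionality n; destruct n; reflexivity.
  - apply map_ext_in. intros B HB. apply (HG B HB); auto.
Qed.
End Derive.

(* Numbering of terms and formulas *)
#[local] Opaque Cantor.to_nat.
Fixpoint tcode (t : term) : nat :=
  match t with
  | Var n => to_nat (0, n) | Zero => to_nat (1, 0) | One => to_nat (2, 0)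
  | Add t u => to_nat (3, to_nat (tcode t, tcode u))
  | Mul t u => to_nat (4, to_nat (tcode t, tcode u))
  | Exp t u => to_nat (5, to_nat (tcode t, tcode u))
  end.
Fixpoint fcode (A : form) : nat :=
  match A with
  | Eq t u => to_nat (0, to_nat (tcode t, tcode u))
  | Lt t u => to_nat (1, to_nat (tcode t, tcode u))
  | Mem t X => to_nat (2, to_nat (tcode t, X))
  | Bot => to_nat (3, 0)
  | Imp A B => to_nat (4, to_nat (fcode A, fcode B))
  | All A => to_nat (5, fcode A)
  | All2 A => to_nat (6, fcode A)
  end.
Lemma to_nat_inj p q : to_nat p = to_nat q -> p = q.
Proof. intro H. rewrite <- (cancel_of_to p), <- (cancel_of_to q); congruence. Qed.
Ltac injn := repeat match goal with H : to_nat (_, _) = to_nat (_, _) |- _ => apply to_nat_inj in H; inversion H; clear H; subst end.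
Lemma tcode_inj t : forall u, tcode t = tcode u -> t = u.
Proof. induction t; intros [] H; simpl in H; injn; f_equal; auto. Qed.
Lemma fcode_inj A : forall B, fcode A = fcode B -> A = B.
Proof. induction A; intros [] H; simpl in H; injn; f_equal; auto using tcode_inj. Qed.
Definition fenum (n : nat) : form := epsilon (inhabits Bot) (fun A => fcode A = n).
Lemma fenum_code A : fenum (fcode A) = A.
Proof. apply fcode_inj. unfold fenum. apply (epsilon_spec (inhabits Bot) (fun B => fcode B = fcode A)). eauto. Qed.

Section Completeness.
Variable T : form -> Prop.
Hypothesis HT : forall A s r, T A -> T (fsub s r A).
Notation "G |- A" := (derives T G A) (at level 70).

Lemma raa G A : (Not A :: G |- Bot) -> G |- A. Proof. apply d_raa. Qed.
Lemma cut G A B : G |- A -> A :: G |- B -> G |- B.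
Proof. intros H1 H2. eapply d_impE; [apply d_impI, H2|apply H1]. Qed.
Lemma neg_E G A : G |- Not A -> G |- A -> G |- Bot. Proof. apply d_impE. Qed.

Definition cons (G : list form) := ~ (G |- Bot).
Definition fr (G : list form) : nat := proj1_sig (constructive_indefinite_description _ (fresh_list G)).
Lemma fr_spec G A : In A G -> fresh (fr G) A.
Proof. unfold fr; destruct constructive_indefinite_description; simpl; auto. Qed.
(** Henkin witnesses: when a universal formula is rejected, the negation of an instance at a fresh
    variable is added along with it. *)
Definition wit (G : list form) (A : form) : list form :=
  match A with
  | Imp (All A) Bot => [Not (inst (Var (fr (All A :: G))) A)]
  | Imp (All2 A) Bot => [Not (inst2 (fr (All2 A :: G)) A)]
  | _ => []
  end.
Definition step (G : list form) (A : form) : list form :=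
  if excluded_middle_informative (cons (A :: G)) then wit (A :: G) A ++ A :: G else G.
Lemma wit_cons G A : cons (A :: G) -> cons (wit (A :: G) A ++ A :: G).
Proof.
  intro H. destruct A as [| | | |B C| |]; auto. destruct B; auto; destruct C; auto; simpl; intro H'; apply H.
  - eapply neg_E; [apply d_hyp; left; reflexivity|].
    apply (gen_all T HT _ _ (fr (All B :: Not (All B) :: G))); [intros; apply fr_spec; simpl in *; tauto|apply fr_spec; simpl; auto|].
    apply raa, H'.
  - eapply neg_E; [apply d_hyp; left; reflexivity|].
    apply (gen2 T HT _ _ (fr (All2 B :: Not (All2 B) :: G))); [intros; apply fr_spec; simpl in *; tauto|apply fr_spec; simpl; auto|].
    apply raa, H'.
Qed.
Lemma step_cons G A : cons G -> cons (step G A).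
Proof. intro H; unfold step; destruct excluded_middle_informative; auto using wit_cons. Qed.

Variable G0 : list form.
Hypothesis HG0 : cons G0.
Fixpoint seqG (n : nat) : list form := match n with 0 => G0 | S n => step (seqG n) (fenum n) end.
Lemma seqG_cons n : cons (seqG n).
Proof. induction n; simpl; auto using step_cons. Qed.
Lemma seqG_mono m n : m <= n -> incl (seqG m) (seqG n).
Proof.
  induction 1; [apply incl_refl|]. eapply incl_tran; [apply IHle|]. simpl; unfold step.
  destruct excluded_middle_informative; [|apply incl_refl]. intros x Hx; apply in_or_app; simpl; auto.
Qed.
Definition Th (A : form) := exists n, In A (seqG n).
Lemma Th_cons G : (forall A, In A G -> Th A) -> exists n, incl G (seqG n).
Proof.
  induction G as [|A G IH]; intro H; [exists 0; intros x []|].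
  destruct (IH (fun B HB => H B (or_intror HB))) as [n Hn]. destruct (H A (or_introl eq_refl)) as [m Hm].
  exists (n + m). intros x [<-|Hx]; [eapply seqG_mono; [|apply Hm]; lia|eapply seqG_mono; [|apply Hn, Hx]; lia].
Qed.
Lemma Th_derive G A : (forall B, In B G -> Th B) -> G |- A -> Th A.
Proof.
  intros HG H. destruct (Th_cons G HG) as [n Hn].
  set (m := fcode A). exists (S (n + m)).
  assert (Hc : cons (A :: seqG (n + m))).
  { intro H'. apply (seqG_cons (n + m)). eapply cut; [|apply H']. eapply weaken; [apply H|].
    eapply incl_tran; [apply Hn|]. apply seqG_mono; lia. }
  assert (H1 : cons (A :: seqG m)).
  { intro H'; apply Hc. eapply weaken; [apply H'|]. intros x [<-|Hx]; simpl; auto. right; eapply seqG_mono; [|apply Hx]; lia. }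
  apply (seqG_mono (S m)); [lia|]. cbn [seqG]. unfold m; rewrite fenum_code; fold m. unfold step.
  destruct excluded_middle_informative; [|contradiction]. apply in_or_app; simpl; auto.
Qed.
Lemma Th_neg A : Th (Not A) <-> ~ Th A.
Proof.
  split.
  - intros H1 H2. destruct (Th_cons [Not A; A]) as [n Hn]; [simpl; intuition congruence|].
    apply (seqG_cons n). eapply neg_E; apply d_hyp, Hn; simpl; auto.
  - intro H. destruct (classic (cons (Not A :: seqG (fcode (Not A))))) as [Hc|Hc].
    + exists (S (fcode (Not A))). cbn [seqG]. rewrite fenum_code. unfold step.
      destruct excluded_middle_informative; [|contradiction]. apply in_or_app; simpl; auto.
    + exfalso; apply H. apply NNPP in Hc. apply (Th_derive (seqG (fcode (Not A)))); [intros; eexists; eauto|].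
      apply raa; auto.
Qed.
Lemma Th_imp A B : Th (Imp A B) <-> (Th A -> Th B).
Proof.
  split.
  - intros H1 H2. apply (Th_derive [Imp A B; A]); [simpl; intuition congruence|].
    eapply d_impE; apply d_hyp; simpl; auto.
  - intro H. destruct (classic (Th A)) as [HA|HA].
    + apply (Th_derive [B]); [simpl; intuition congruence|]. apply d_impI, d_hyp; simpl; auto.
    + apply Th_neg in HA. apply (Th_derive [Not A]); [simpl; intuition congruence|].
      apply d_impI, raa. eapply neg_E; apply d_hyp; simpl; auto.
Qed.
Lemma Th_all A : Th (All A) <-> forall t, Th (inst t A).
Proof.
  split.
  - intros H t. apply (Th_derive [All A]); [simpl; intuition congruence|]. apply d_allE, d_hyp; simpl; auto.
  - intro H. apply NNPP; intro H'. apply Th_neg in H'.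
    set (m := fcode (Not (All A))).
    assert (Hc : cons (Not (All A) :: seqG m)).
    { intro H2. destruct H' as [n Hn]. apply (seqG_cons (n + m)). eapply weaken; [apply H2|].
      intros x [<-|Hx]; [eapply seqG_mono; [|apply Hn]; lia|eapply seqG_mono; [|apply Hx]; lia]. }
    set (x := Var (fr (All A :: Not (All A) :: seqG m))).
    assert (Hw : Th (Not (inst x A))).
    { exists (S m). cbn [seqG]. unfold m; rewrite fenum_code; fold m. unfold step.
      destruct excluded_middle_informative; [|contradiction]. apply in_or_app; left; left; reflexivity. }
    apply Th_neg in Hw. auto.
Qed.
Lemma Th_all2 A : Th (All2 A) <-> forall X, Th (inst2 X A).
Proof.
  split.
  - intros H t. apply (Th_derive [All2 A]); [simpl; intuition congruence|]. apply d_all2E, d_hyp; simpl; auto.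
  - intro H. apply NNPP; intro H'. apply Th_neg in H'.
    set (m := fcode (Not (All2 A))).
    assert (Hc : cons (Not (All2 A) :: seqG m)).
    { intro H2. destruct H' as [n Hn]. apply (seqG_cons (n + m)). eapply weaken; [apply H2|].
      intros x [<-|Hx]; [eapply seqG_mono; [|apply Hn]; lia|eapply seqG_mono; [|apply Hx]; lia]. }
    set (x := fr (All2 A :: Not (All2 A) :: seqG m)).
    assert (Hw : Th (Not (inst2 x A))).
    { exists (S m). cbn [seqG]. unfold m; rewrite fenum_code; fold m. unfold step.
      destruct excluded_middle_informative; [|contradiction]. apply in_or_app; left; left; reflexivity. }
    apply Th_neg in Hw. auto.
Qed.

Definition teq t u := Th (Eq t u).
Lemma teq_refl t : teq t t.
Proof. apply (Th_derive []); [intros B []|]. apply d_refl. Qed.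
Lemma Th_subst t u A : teq t u -> Th (inst t A) -> Th (inst u A).
Proof.
  intros H1 H2. apply (Th_derive [Eq t u; inst t A]); [intros B [<-|[<-|[]]]; auto|].
  eapply d_subst; apply d_hyp; simpl; auto.
Qed.
Lemma inst_lift t u : tsub (scons t Var) (tlift u) = u.
Proof. unfold tlift; rewrite tsub_comp; simpl. apply tsub_var. Qed.
Lemma teq_sym t u : teq t u -> teq u t.
Proof.
  intro H. pose proof (Th_subst t u (Eq (Var 0) (tlift t)) H) as H'. unfold inst in H'; simpl in H'.
  rewrite !inst_lift in H'. apply H', teq_refl.
Qed.
Lemma teq_trans t u v : teq t u -> teq u v -> teq t v.
Proof.
  intros H1 H2. pose proof (Th_subst u v (Eq (tlift t) (Var 0)) H2) as H'. unfold inst in H'; simpl in H'.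
  rewrite !inst_lift in H'. apply H', H1.
Qed.
Lemma Th_subst2 (A : form) t u t' u' : teq t t' -> teq u u' ->
  Th (fsub (scons t (scons u Var)) id A) -> Th (fsub (scons t' (scons u' Var)) id A).
Proof.
  intros H1 H2 H.
  assert (H3 : Th (fsub (scons t' (scons u Var)) id A)).
  { pose proof (Th_subst t t' (fsub (scons (Var 0) (scons (tlift u) (fun n => Var (S n)))) id A) H1) as H'.
    unfold inst in H'; rewrite !fsub_comp in H'.
    match goal with |- Th (fsub ?s _ _) => replace s with (fun n => tsub (scons t' Var) (scons (Var 0) (scons (tlift u) (fun n => Var (S n))) n)) end.
    - apply H'. match goal with |- Th (fsub ?s _ _) => replace s with (scons t (scons u Var)); auto end.
      extensionality n; destruct n as [|[|n]]; simpl; auto. symmetry; apply inst_lift.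
    - extensionality n; destruct n as [|[|n]]; simpl; auto. apply inst_lift. }
  pose proof (Th_subst u u' (fsub (scons (tlift t') (scons (Var 0) (fun n => Var (S n)))) id A) H2) as H'.
    unfold inst in H'; rewrite !fsub_comp in H'.
    match goal with |- Th (fsub ?s _ _) => replace s with (fun n => tsub (scons u' Var) (scons (tlift t') (scons (Var 0) (fun n => Var (S n))) n)) end.
    - apply H'. match goal with |- Th (fsub ?s _ _) => replace s with (scons t' (scons u Var)); auto end.
      extensionality n; destruct n as [|[|n]]; simpl; auto. symmetry; apply inst_lift.
    - extensionality n; destruct n as [|[|n]]; simpl; auto. apply inst_lift.
Qed.

Definition tdom := quot _ teq.
Definition tcl (t : term) : tdom := cls _ teq t.
Definition trp (x : tdom) : term := rep _ teq x.
Lemma tcl_eq t u : tcl t = tcl u <-> teq t u.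
Proof. apply cls_eq; [apply teq_refl|apply teq_sym|apply teq_trans]. Qed.
Lemma tcl_rp x : tcl (trp x) = x. Proof. apply cls_rep. Qed.
Lemma trp_cl t : teq (trp (tcl t)) t. Proof. apply tcl_eq, tcl_rp. Qed.
(** There are no set terms, so the indices of set variables serve as sets; number terms are taken
    modulo the equations of [Th]. *)
Definition termmodel : model := {|
  dom := tdom; sdom := nat; mz := tcl Zero; m1 := tcl One;
  madd := fun x y => tcl (Add (trp x) (trp y));
  mmul := fun x y => tcl (Mul (trp x) (trp y));
  mexp := fun x y => tcl (Exp (trp x) (trp y));
  mlt := fun x y => Th (Lt (trp x) (trp y));
  mmem := fun x X => Th (Mem (trp x) X) |}.
Lemma teq_cong c t u t' u' : (forall s t u, tsub s (c t u) = c (tsub s t) (tsub s u)) ->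
  teq t t' -> teq u u' -> teq (c t u) (c t' u').
Proof.
  intros Hc H1 H2.
  set (l := tsub (fun n => Var (S (S n)))).
  assert (Hl : forall a b v, tsub (scons a (scons b Var)) (l v) = v).
  { intros; unfold l; rewrite tsub_comp; simpl. apply tsub_var. }
  pose proof (Th_subst2 (Eq (l (c t u)) (c (Var 0) (Var 1))) t u t' u' H1 H2) as H.
  simpl in H; rewrite !Hl, !Hc in H. apply H, teq_refl.
Qed.
Lemma teval s t : eval termmodel (fun n => tcl (s n)) t = tcl (tsub s t).
Proof.
  induction t; simpl; auto; rewrite IHt1, IHt2; apply tcl_eq;
  (apply teq_cong; [reflexivity|apply trp_cl|apply trp_cl]).
Qed.
Lemma truth A : forall s r, sat termmodel (fun n => tcl (s n)) r A <-> Th (fsub s r A).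
Proof.
  induction A; intros s r; simpl.
  - rewrite !teval. apply tcl_eq.
  - rewrite !teval. split; intro H.
    + apply (Th_subst2 (Lt (Var 0) (Var 1)) _ _ (tsub s t) (tsub s u) (trp_cl _) (trp_cl _) H).
    + apply (Th_subst2 (Lt (Var 0) (Var 1)) _ _ _ _ (teq_sym _ _ (trp_cl (tsub s t))) (teq_sym _ _ (trp_cl (tsub s u))) H).
  - rewrite !teval. split; intro H.
    + apply (Th_subst2 (Mem (Var 0) (r X)) _ Zero (tsub s t) Zero (trp_cl _) (teq_refl _) H).
    + apply (Th_subst2 (Mem (Var 0) (r X)) _ Zero _ Zero (teq_sym _ _ (trp_cl (tsub s t))) (teq_refl _) H).
  - split; [tauto|]. intros [n Hn]. apply (seqG_cons n), d_hyp, Hn.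
  - rewrite Th_imp, IHA1, IHA2. tauto.
  - rewrite Th_all. split.
    + intros H t. specialize (H (tcl t)).
      replace (scons (tcl t) _) with (fun n => tcl (scons t s n)) in H by (extensionality n; destruct n; auto).
      apply IHA in H. unfold inst; rewrite fsub_comp.
      replace (fun n => tsub _ _) with (scons t s); auto.
      extensionality n; destruct n; simpl; auto. symmetry; apply inst_lift.
    + intros H x. rewrite <- (tcl_rp x). specialize (H (trp x)).
      replace (scons (tcl (trp x)) _) with (fun n => tcl (scons (trp x) s n)) by (extensionality n; destruct n; auto).
      apply IHA. unfold inst in H; rewrite fsub_comp in H.
      replace (fun n => tsub _ _) with (scons (trp x) s) in H; auto.
      extensionality n; destruct n; simpl; auto. symmetry; apply inst_lift.
  - rewrite Th_all2. apply all_iff; intro X. unfold inst2; rewrite fsub_comp.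
    rewrite IHA. replace (fun n => tsub Var (s n)) with s by (extensionality n; symmetry; apply tsub_var).
    replace (fun n => scons X id _) with (scons X r); [reflexivity|]. extensionality n; destruct n; auto.
Qed.
End Completeness.

Theorem completeness T A : (forall A s r, T A -> T (fsub s r A)) ->
  (forall M, models M T -> forall e s, sat M e s A) -> proves T A.
Proof.
  intros HT H. unfold proves. apply NNPP; intro Hn.
  assert (Hc : cons T [Not A]) by (intro Hc; apply Hn, raa, Hc).
  set (M := termmodel T [Not A]).
  assert (HM : models M T).
  { intros B HB e s.
    (* An assignment in the term model is a substitution, and [T] contains the substituted axiom. *)
    replace e with (fun n => tcl T [Not A] ((fun n => trp T [Not A] (e n)) n)) by (extensionality n; apply tcl_rp).
    refine (proj2 (truth _ _ _ _ B _ s) _); auto. eapply Th_derive with (G := []); auto; [intros C []|]. apply d_ax; auto. }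
  specialize (H M HM (fun n => tcl T [Not A] (Var n)) id).
  refine (_ (proj1 (truth _ _ _ _ A _ id) H)); auto. rewrite fsub_var.
  apply Th_neg; auto. exists 0; simpl; auto.
Qed.

Lemma RCA_fsub n A s r : RCA0star_ISigma n A -> RCA0star_ISigma n (fsub s r A).
Proof.
  intros H.
  assert (Hind : forall B, fsub s r (induction B) = induction (fsub (up s) r B)).
  { intro B. unfold induction; simpl. unfold inst; rewrite !fsub_comp. f_equal; [|f_equal].
    - f_equal. extensionality k; destruct k; simpl; auto. unfold tlift; rewrite tsub_comp; simpl. symmetry; apply tsub_var.
    - f_equal. f_equal. f_equal. extensionality k; destruct k; simpl; auto.
      unfold tlift; rewrite tsub_comp; reflexivity. }
  destruct H as [[P HP|B HB|B C HB HC]|[B HB]].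
  - left. assert (E : fsub s r (sentence P) = sentence P).
    { simpl in HP. unfold sentence. repeat destruct HP as [<-|HP]; try reflexivity; destruct HP. }
    rewrite E; constructor; auto.
  - left. rewrite Hind. constructor. apply sigma00_fsub; auto.
  - left. assert (E : fsub s r (comprehension B C) = comprehension (fsub (up s) r B) (fsub (up s) r C)).
    { unfold comprehension, Ex2, Iff, And, Not; simpl. unfold lift2; rewrite !fsub_comp.
      repeat f_equal; extensionality k; destruct k; simpl; auto; rewrite tsub_var; auto. }
    rewrite E. constructor; apply sigma0_fsub; auto.
  - right. rewrite Hind. constructor. apply sigma0_fsub; auto.
Qed.

(** * Definable relations of a model *)

Section Definable.
Variable M : model.
Variable s0 : nat -> sdom M.
Fixpoint ctx (n : nat) : Type := match n with 0 => unit | S n => (ctx n * M)%type end.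
Fixpoint push (n : nat) : ctx n -> (nat -> M) -> nat -> M :=
  match n with 0 => fun _ e => e | S n => fun g e => scons (snd g) (push n (fst g) e) end.
(* Two formulas with different parameters are combined by interleaving their environments: [rn n b] sends the
   parameters of the first ([b = 0]) or second ([b = 1]) formula to the even or odd positions beyond [n]. *)
Definition merge (e f : nat -> M) (k : nat) : M := if Nat.even k then e (Nat.div2 k) else f (Nat.div2 k).
Definition rn (n b v : nat) : term := Var (if v <? n then v else n + (2 * (v - n) + b)).
Lemma push_lt n g e f v : v < n -> push n g e v = push n g f v.
Proof. revert v; induction n; intros v Hv; [lia|]. destruct v; simpl; auto. apply IHn; lia. Qed.
Lemma push_ge n g e v : push n g e (n + v) = e v.
Proof. induction n; simpl; auto. Qed.
Lemma merge0 e f v : merge e f (2 * v) = e v.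
Proof. unfold merge. rewrite Nat.even_mul, Nat.div2_double. reflexivity. Qed.
Lemma merge1 e f v : merge e f (2 * v + 1) = f v.
Proof.
  unfold merge. replace (2 * v + 1) with (S (2 * v)) by lia. rewrite Nat.even_succ, Nat.div2_succ_double.
  replace (Nat.odd (2 * v)) with false; auto. symmetry. rewrite <- Nat.negb_even, Nat.even_mul. auto.
Qed.
Lemma rn0 n g e f v : eval M (push n g (merge e f)) (rn n 0 v) = push n g e v.
Proof.
  unfold rn; simpl. destruct (Nat.ltb_spec v n); [apply push_lt; auto|].
  rewrite push_ge. replace (v - n + (v - n + 0) + 0) with (2 * (v - n)) by lia. rewrite merge0.
  replace v with (n + (v - n)) at 2 by lia. symmetry; apply push_ge.
Qed.
Lemma rn1 n g e f v : eval M (push n g (merge e f)) (rn n 1 v) = push n g f v.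
Proof.
  unfold rn; simpl. destruct (Nat.ltb_spec v n); [apply push_lt; auto|].
  rewrite push_ge. replace (v - n + (v - n + 0) + 1) with (2 * (v - n) + 1) by lia. rewrite merge1.
  replace v with (n + (v - n)) at 2 by lia. symmetry; apply push_ge.
Qed.

(** Parameters are the values of [e], which sit beyond the first [n] positions; the first [n] hold
    the context, with the innermost variable as [snd]. *)
Definition Tm n (t : ctx n -> M) := exists u e, forall g, t g = eval M (push n g e) u.
Definition D0 n (P : ctx n -> Prop) := exists A e, sigma00 A /\ forall g, P g <-> sat M (push n g e) s0 A.

Lemma Tm2 n t u : Tm n t -> Tm n u -> exists a b e, forall g, t g = eval M (push n g e) a /\ u g = eval M (push n g e) b.
Proof.
  intros (a & e & Ha) (b & f & Hb). exists (tsub (rn n 0) a), (tsub (rn n 1) b), (merge e f).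
  intro g; rewrite Ha, Hb, !eval_tsub. split; f_equal; extensionality v; symmetry; [apply rn0|apply rn1].
Qed.
Lemma D02 n P Q : D0 n P -> D0 n Q -> exists A B e, sigma00 A /\ sigma00 B /\
  forall g, (P g <-> sat M (push n g e) s0 A) /\ (Q g <-> sat M (push n g e) s0 B).
Proof.
  intros (A & e & HA & H1) (B & f & HB & H2). exists (fsub (rn n 0) id A), (fsub (rn n 1) id B), (merge e f).
  split; [|split]; try apply sigma00_fsub; auto. intro g; rewrite H1, H2, !sat_fsub.
  replace (fun v => eval M (push n g (merge e f)) (rn n 0 v)) with (push n g e) by (extensionality v; symmetry; apply rn0).
  replace (fun v => eval M (push n g (merge e f)) (rn n 1 v)) with (push n g f) by (extensionality v; symmetry; apply rn1).
  split; reflexivity.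
Qed.
Lemma Tm_const n c : Tm n (fun _ => c).
Proof. exists (Var (n + 0)), (fun _ => c). intro g; simpl. symmetry; apply push_ge. Qed.
Lemma Tm_snd n : Tm (S n) (fun g => snd g).
Proof. exists (Var 0), (fun _ => mz). reflexivity. Qed.
Lemma Tm_fst n t : Tm n t -> Tm (S n) (fun g => t (fst g)).
Proof. intros (u & e & H). exists (tlift u), e. intro g; simpl. rewrite eval_tlift. apply H. Qed.
Lemma Tm_add n t u : Tm n t -> Tm n u -> Tm n (fun g => madd (t g) (u g)).
Proof. intros H1 H2. destruct (Tm2 _ _ _ H1 H2) as (a & b & e & H). exists (Add a b), e. intro g; simpl. destruct (H g); congruence. Qed.
Lemma Tm_mul n t u : Tm n t -> Tm n u -> Tm n (fun g => mmul (t g) (u g)).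
Proof. intros H1 H2. destruct (Tm2 _ _ _ H1 H2) as (a & b & e & H). exists (Mul a b), e. intro g; simpl. destruct (H g); congruence. Qed.
Lemma Tm_exp n t u : Tm n t -> Tm n u -> Tm n (fun g => mexp (t g) (u g)).
Proof. intros H1 H2. destruct (Tm2 _ _ _ H1 H2) as (a & b & e & H). exists (Exp a b), e. intro g; simpl. destruct (H g); congruence. Qed.
Lemma D0_ext n P Q : (forall g, P g <-> Q g) -> D0 n P -> D0 n Q.
Proof. intros H (A & e & HA & H1). exists A, e; split; auto. intro g; rewrite <- H; auto. Qed.
Lemma D0_eq n t u : Tm n t -> Tm n u -> D0 n (fun g => t g = u g).
Proof. intros H1 H2. destruct (Tm2 _ _ _ H1 H2) as (a & b & e & H). exists (Eq a b), e. split; [constructor|]. intro g; simpl. destruct (H g) as [-> ->]; tauto. Qed.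
Lemma D0_lt n t u : Tm n t -> Tm n u -> D0 n (fun g => mlt (t g) (u g)).
Proof. intros H1 H2. destruct (Tm2 _ _ _ H1 H2) as (a & b & e & H). exists (Lt a b), e. split; [constructor|]. intro g; simpl. destruct (H g) as [-> ->]; tauto. Qed.
Lemma D0_imp n P Q : D0 n P -> D0 n Q -> D0 n (fun g => P g -> Q g).
Proof.
  intros H1 H2. destruct (D02 _ _ _ H1 H2) as (A & B & e & HA & HB & H). exists (Imp A B), e. split; [constructor; auto|].
  intro g; simpl. destruct (H g) as [-> ->]; tauto.
Qed.
Lemma D0_prop n (P : Prop) : D0 n (fun _ => P).
Proof.
  destruct (classic P).
  - exists (Imp Bot Bot), (fun _ => mz). split; [repeat constructor|]. simpl; tauto.
  - exists Bot, (fun _ => mz). split; [repeat constructor|]. simpl; tauto.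
Qed.
Lemma D0_not n P : D0 n P -> D0 n (fun g => ~ P g).
Proof. intros; apply (D0_imp n P (fun _ => False)); auto using D0_prop. Qed.
Lemma D0_or n P Q : D0 n P -> D0 n Q -> D0 n (fun g => P g \/ Q g).
Proof.
  intros; apply D0_ext with (fun g => ~ P g -> Q g); [intro g; destruct (classic (P g)); tauto|].
  apply D0_imp; auto using D0_not.
Qed.
Lemma D0_and n P Q : D0 n P -> D0 n Q -> D0 n (fun g => P g /\ Q g).
Proof.
  intros; apply D0_ext with (fun g => ~ (P g -> ~ Q g)); [intro g; destruct (classic (P g)); destruct (classic (Q g)); tauto|].
  apply D0_not, D0_imp; auto using D0_not.
Qed.
Lemma D0_iff n P Q : D0 n P -> D0 n Q -> D0 n (fun g => P g <-> Q g).
Proof. intros; apply D0_and; apply D0_imp; auto. Qed.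
Lemma D0_ball n t P : Tm n t -> D0 (S n) (fun g => P (fst g) (snd g)) -> D0 n (fun g => forall y, mlt y (t g) -> P g y).
Proof.
  intros (u & e & Hu) (A & f & HA & H).
  exists (All (Imp (Lt (Var 0) (tlift (tsub (rn n 0) u))) (fsub (rn (S n) 1) id A))), (merge e f).
  split; [constructor; apply sigma00_fsub; auto|].
  intro g; simpl. apply all_iff; intro y. rewrite eval_tlift, eval_tsub, Hu.
  replace (fun v => eval M (push n g (merge e f)) (rn n 0 v)) with (push n g e) by (extensionality v; symmetry; apply rn0).
  rewrite sat_fsub. change (scons y (push n g (merge e f))) with (push (S n) (g, y) (merge e f)).
  replace (fun v => eval M (push (S n) (g, y) (merge e f)) (rn (S n) 1 v)) with (push (S n) (g, y) f) by (extensionality v; symmetry; apply rn1).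
  specialize (H (g, y)); simpl in H. simpl. rewrite H. tauto.
Qed.
Lemma D0_bex n t P : Tm n t -> D0 (S n) (fun g => P (fst g) (snd g)) -> D0 n (fun g => exists y, mlt y (t g) /\ P g y).
Proof.
  intros H1 H2; apply D0_ext with (fun g => ~ forall y, mlt y (t g) -> ~ P g y).
  - intro g; split; [|firstorder]. intro H; apply NNPP; intro H'; apply H; eauto.
  - apply D0_not, D0_ball; auto. apply (D0_not (S n) (fun g => P (fst g) (snd g))), H2.
Qed.

Fixpoint TmC n m : (ctx n -> ctx m) -> Prop :=
  match m with 0 => fun _ => True | S m => fun f => TmC n m (fun g => fst (f g)) /\ Tm n (fun g => snd (f g)) end.
Lemma TmC_env n m f e : TmC n m f -> exists us e', forall g v, push m (f g) e v = eval M (push n g e') (us v).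
Proof.
  induction m as [|m IH]; simpl.
  - intros _. exists (fun v => Var (n + v)), e. intros; simpl. symmetry; apply push_ge.
  - intros [H1 (u & e2 & H2)]. destruct (IH _ H1) as (us & e1 & H).
    exists (scons (tsub (rn n 1) u) (fun v => tsub (rn n 0) (us v))), (merge e1 e2).
    intros g [|v]; simpl; rewrite eval_tsub.
    + rewrite H2. f_equal. extensionality w; symmetry; apply rn1.
    + rewrite H. f_equal. extensionality w; symmetry; apply rn0.
Qed.
Lemma D0_comp n m f P : D0 m P -> TmC n m f -> D0 n (fun g => P (f g)).
Proof.
  intros (A & e & HA & H) Hf. destruct (TmC_env _ _ _ e Hf) as (us & e' & E).
  exists (fsub us id A), e'. split; [apply sigma00_fsub; auto|].
  intro g. rewrite sat_fsub, H. replace (fun v => eval M (push n g e') (us v)) with (push m (f g) e); [reflexivity|].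
  extensionality v; apply E.
Qed.
Lemma TmC_fst n m f : TmC n m f -> TmC (S n) m (fun g => f (fst g)).
Proof. revert f; induction m; simpl; auto. intros f [H1 H2]. split; [apply (IHm _ H1)|apply (Tm_fst _ _ H2)]. Qed.
Lemma TmC_id n : TmC n n (fun g => g).
Proof. induction n; simpl; auto. split; [apply (TmC_fst _ _ _ IHn)|apply Tm_snd]. Qed.
Lemma Tm_comp n m f t : Tm m t -> TmC n m f -> Tm n (fun g => t (f g)).
Proof.
  intros (u & e & H) Hf. destruct (TmC_env _ _ _ e Hf) as (us & e' & E).
  exists (tsub us u), e'. intro g. rewrite eval_tsub, H. f_equal. extensionality v; apply E.
Qed.

(** As in [sigma0], each level has exactly one quantifier. Closure under conjunction and under
    further quantifiers of the same kind therefore has to wait for a pairing function. *)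
Fixpoint Sg (k n : nat) (P : ctx n -> Prop) : Prop :=
  match k with 0 => D0 n P | S k => exists Q, Pi k (S n) Q /\ forall g, P g <-> exists y, Q (g, y) end
with Pi (k n : nat) (P : ctx n -> Prop) : Prop :=
  match k with 0 => D0 n P | S k => exists Q, Sg k (S n) Q /\ forall g, P g <-> forall y, Q (g, y) end.

Lemma Sg_ext k n P Q : (forall g, P g <-> Q g) -> Sg k n P -> Sg k n Q.
Proof. intros H. destruct k; simpl; [apply D0_ext; auto|]. intros (R & HR & E); exists R; split; auto. intro g; rewrite <- H; auto. Qed.
Lemma Pi_ext k n P Q : (forall g, P g <-> Q g) -> Pi k n P -> Pi k n Q.
Proof. intros H. destruct k; simpl; [apply D0_ext; auto|]. intros (R & HR & E); exists R; split; auto. intro g; rewrite <- H; auto. Qed.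
Lemma SP_comp k : forall n m f P, TmC n m f -> (Sg k m P -> Sg k n (fun g => P (f g))) /\ (Pi k m P -> Pi k n (fun g => P (f g))).
Proof.
  induction k as [|k IH]; intros n m f P Hf; simpl.
  - split; intro; apply D0_comp; auto.
  - assert (Hf' : TmC (S n) (S m) (fun g => (f (fst g), snd g))) by (split; simpl; [apply TmC_fst; auto|apply Tm_snd]).
    split; intros (Q & HQ & E); exists (fun g => Q (f (fst g), snd g)).
    + split; [apply (IH (S n) (S m) _ Q Hf'); auto|]. intro g; apply E.
    + split; [apply (IH (S n) (S m) _ Q Hf'); auto|]. intro g; apply E.
Qed.
Lemma Sg_comp k n m f P : TmC n m f -> Sg k m P -> Sg k n (fun g => P (f g)).
Proof. intros; apply (proj1 (SP_comp k n m f P H)); auto. Qed.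
Lemma Pi_comp k n m f P : TmC n m f -> Pi k m P -> Pi k n (fun g => P (f g)).
Proof. intros; apply (proj2 (SP_comp k n m f P H)); auto. Qed.
Lemma Sg_weak k n P : Sg k n P -> Sg k (S n) (fun g => P (fst g)).
Proof. apply (Sg_comp k (S n) n (fun g => fst g) P), (TmC_fst n n (fun g => g)), TmC_id. Qed.
Lemma Pi_weak k n P : Pi k n P -> Pi k (S n) (fun g => P (fst g)).
Proof. apply (Pi_comp k (S n) n (fun g => fst g) P), (TmC_fst n n (fun g => g)), TmC_id. Qed.
Lemma Pi_Sg k n P : Pi k n P -> Sg (S k) n P.
Proof. intro H. exists (fun g => P (fst g)). split; [apply Pi_weak; auto|]. intro g; simpl. split; [exists mz; auto|intros [_ ?]; auto]. Qed.
Lemma Sg_Pi k n P : Sg k n P -> Pi (S k) n P.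
Proof. intro H. exists (fun g => P (fst g)). split; [apply Sg_weak; auto|]. intro g; simpl. split; auto. intro H'; apply (H' mz). Qed.
Lemma SP_S k : forall n P, (Sg k n P -> Sg (S k) n P) /\ (Pi k n P -> Pi (S k) n P).
Proof.
  induction k as [|k IH]; intros n P; [split; [apply (Pi_Sg 0)|apply (Sg_Pi 0)]|].
  split; intros (Q & HQ & E); exists Q; split; auto; apply IH; auto.
Qed.
Lemma Sg_mono k l n P : k <= l -> Sg k n P -> Sg l n P.
Proof. induction 1; auto. intro; apply SP_S; auto. Qed.
Lemma Pi_mono k l n P : k <= l -> Pi k n P -> Pi l n P.
Proof. induction 1; auto. intro; apply SP_S; auto. Qed.
Lemma D0_Sg k n P : D0 n P -> Sg k n P.
Proof. intro; apply (Sg_mono 0); auto; lia. Qed.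
Lemma D0_Pi k n P : D0 n P -> Pi k n P.
Proof. intro; apply (Pi_mono 0); auto; lia. Qed.
Lemma SP_not k : forall n P, (Sg k n P -> Pi k n (fun g => ~ P g)) /\ (Pi k n P -> Sg k n (fun g => ~ P g)).
Proof.
  induction k as [|k IH]; intros n P; [split; apply D0_not|].
  split; intros (Q & HQ & E); exists (fun g => ~ Q g); (split; [apply IH; auto|]); intro g; rewrite E.
  - split; [eauto|]. intros H [y Hy]; eapply H; eauto.
  - split; [|firstorder]. intro H; apply NNPP; intro H'; apply H; intro y; apply NNPP; eauto.
Qed.
Lemma Sg_not k n P : Sg k n P -> Pi k n (fun g => ~ P g). Proof. apply SP_not. Qed.
Lemma Pi_not k n P : Pi k n P -> Sg k n (fun g => ~ P g). Proof. apply SP_not. Qed.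

Lemma SP_form k : forall n P, (Sg k n P -> exists A e, sigma0 k A /\ forall g, P g <-> sat M (push n g e) s0 A) /\
  (Pi k n P -> exists A e, pi0 k A /\ forall g, P g <-> sat M (push n g e) s0 A).
Proof.
  induction k as [|k IH]; intros n P.
  - split; intros (A & e & HA & H); exists A, e; split; auto; constructor; auto.
  - split; intros (Q & HQ & E); apply IH in HQ; destruct HQ as (A & e & HA & H).
    + exists (Ex A), e. split; [constructor; auto|]. intro g. rewrite sat_Ex, E.
      split; intros [y Hy]; exists y; apply (H (g, y)); auto.
    + exists (All A), e. split; [constructor; auto|]. intro g. simpl. rewrite E.
      apply all_iff; intro y. apply (H (g, y)).
Qed.

Variable N : nat.
Hypothesis IND : forall A, sigma0 N A -> forall e, sat M e s0 (induction A).
Lemma ind_Sg k (P : M -> Prop) : k <= N -> Sg k 1 (fun g => P (snd g)) ->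
  P mz -> (forall x, P x -> P (madd x m1)) -> forall x, P x.
Proof.
  intros Hk HP H0 HS. apply (Sg_mono k N) in HP; auto. apply SP_form in HP. destruct HP as (A & e & HA & H).
  assert (H' : forall x, P x <-> sat M (scons x e) s0 A) by (intro x; apply (H (tt, x))).
  specialize (IND A HA e). unfold induction in IND; simpl in IND. rewrite sat_inst in IND; simpl in IND.
  intro x; rewrite H'. apply IND.
  - apply H'; auto.
  - intros y Hy. rewrite sat_fsub. apply H' in Hy; apply HS, H' in Hy.
    replace (fun n => eval M (scons y e) (scons (Add (Var 0) One) shift n)) with (scons (madd y m1) e); auto.
    extensionality n; destruct n; reflexivity.
Qed.
Lemma ind_D0 (P : M -> Prop) : D0 1 (fun g => P (snd g)) ->
  P mz -> (forall x, P x -> P (madd x m1)) -> forall x, P x.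
Proof. apply (ind_Sg 0); lia. Qed.
End Definable.

(** * Ordinals and the fast growing hierarchy *)

Lemma ocmp_refl a : ocmp a a = Datatypes.Eq.
Proof. induction a; simpl; auto. rewrite IHa1, Nat.compare_refl; auto. Qed.
Lemma ocmp_eq a : forall b, ocmp a b = Datatypes.Eq -> a = b.
Proof.
  induction a as [|b IHb n g IHg]; intros [|b' n' g']; simpl; try discriminate; auto.
  destruct (ocmp b b') eqn:E1; try discriminate. destruct (Nat.compare_spec n n'); try discriminate.
  intro E2. f_equal; auto.
Qed.
Lemma ocmp_opp a : forall b, ocmp b a = CompOpp (ocmp a b).
Proof.
  induction a as [|b IHb n g IHg]; intros [|b' n' g']; simpl; auto.
  rewrite IHb. destruct (ocmp b b'); simpl; auto. rewrite Nat.compare_antisym.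
  destruct (n ?= n'); simpl; auto.
Qed.
Lemma olt_irr a : ~ olt a a.
Proof. unfold olt; rewrite ocmp_refl; discriminate. Qed.
Lemma ocons_lt b n g b' n' g' : olt (OCons b n g) (OCons b' n' g') <->
  olt b b' \/ (b = b' /\ (n < n' \/ (n = n' /\ olt g g'))).
Proof.
  unfold olt; simpl. destruct (ocmp b b') eqn:E.
  - apply ocmp_eq in E; subst. destruct (Nat.compare_spec n n') as [->|H|H].
    + split; [intro K; right; split; auto|]. intros [K|(_ & [K|(_ & K)])]; [discriminate|lia|auto].
    + split; [right; auto|auto].
    + split; [discriminate|]. intros [K|(_ & [K|(K & _)])]; [discriminate|lia|lia].
  - split; auto.
  - split; [discriminate|]. intros [K|(-> & _)]; [congruence|]. rewrite ocmp_refl in E; discriminate.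
Qed.
Lemma olt_trans b : forall a c, olt a b -> olt b c -> olt a c.
Proof.
  induction b as [|b IHb n g IHg]; intros [|b1 n1 g1] [|b2 n2 g2]; try (unfold olt; simpl; congruence).
  rewrite !ocons_lt. intros [H1|(-> & H1)] [H2|(<- & H2)].
  - left; eauto.
  - left; auto.
  - left; auto.
  - right; split; auto. destruct H1 as [H1|(-> & H1)], H2 as [H2|(<- & H2)]; try (left; lia). right; eauto.
Qed.
Lemma olt_total a b : olt a b \/ a = b \/ olt b a.
Proof.
  unfold olt. rewrite (ocmp_opp a b). destruct (ocmp a b) eqn:E; simpl; auto. apply ocmp_eq in E; auto.
Qed.
Lemma olt_0 a : ~ olt a OZero.
Proof. destruct a; unfold olt; simpl; congruence. Qed.
Lemma olt_0c b n g : olt OZero (OCons b n g).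
Proof. reflexivity. Qed.
Definition ole a b := olt a b \/ a = b.
Lemma ole_lt_trans a b c : ole a b -> olt b c -> olt a c.
Proof. intros [H| ->]; eauto using olt_trans. Qed.
Lemma lt_ole_trans a b c : olt a b -> ole b c -> olt a c.
Proof. intros H [H'| ->]; eauto using olt_trans. Qed.
Lemma nolt_ole a b : ~ olt a b <-> ole b a.
Proof.
  split.
  - intro H. destruct (olt_total a b) as [?|[?|?]]; [tauto|right; auto|left; auto].
  - intros [H| ->] H'; [apply (olt_irr a); eauto using olt_trans|eapply olt_irr; eauto].
Qed.

#[local] Arguments Nat.max : simpl never.

Fixpoint oapp (a u : ord) : ord := match a with OZero => u | OCons b n g => OCons b n (oapp g u) end.
Fixpoint ord_norm (a : ord) : nat := match a with OZero => 0 | OCons b n g => Nat.max (S n) (Nat.max (ord_norm b) (ord_norm g)) end.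
Definition omega_pow (b : ord) : ord := OCons b 0 OZero.

(* The recursion of [F] acts on the last term of the normal form; [Ss d b n] is [d + omega^b * (n + 1)]. *)
Inductive snoc_ord : Type := Sz | Ss (d b : snoc_ord) (n : nat).
Fixpoint ord_of (a : snoc_ord) : ord := match a with Sz => OZero | Ss d b n => oapp (ord_of d) (OCons (ord_of b) n OZero) end.
Definition snoc_pow (d b : snoc_ord) (m : nat) : snoc_ord := match m with O => d | S p => Ss d b p end.
Definition is_limit (a : snoc_ord) := exists d b n, a = Ss d b n /\ b <> Sz.
Inductive FundSeq : snoc_ord -> nat -> snoc_ord -> Prop :=
| Fun_S d b n m x : FundSeq (Ss d (Ss b Sz m) n) x (snoc_pow (snoc_pow d (Ss b Sz m) n) (snoc_pow b Sz m) x)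
| Fun_L d b n x w : is_limit b -> FundSeq b x w -> FundSeq (Ss d b n) x (snoc_pow (snoc_pow d b n) w 1).
Inductive FastRel : snoc_ord -> nat -> nat -> Prop :=
| Fr0 x : FastRel Sz x (S x)
| FrS d n x y : IterRel (S x) (snoc_pow d Sz n) x y -> FastRel (Ss d Sz n) x y
| FrL a x b y : is_limit a -> FundSeq a x b -> FastRel b x y -> FastRel a x y
with IterRel : nat -> snoc_ord -> nat -> nat -> Prop :=
| It0 a x : IterRel 0 a x x
| ItS k a x z y : IterRel k a x z -> FastRel a z y -> IterRel (S k) a x y.
Scheme Fr_mind := Induction for FastRel Sort Prop with Itr_mind := Induction for IterRel Sort Prop.
Combined Scheme FrItr_ind from Fr_mind, Itr_mind.

Lemma oapp_0 a : oapp a OZero = a.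
Proof. induction a; simpl; congruence. Qed.
Lemma oapp_A a u v : oapp (oapp a u) v = oapp a (oapp u v).
Proof. induction a; simpl; congruence. Qed.
Lemma oapp_lt d u v : olt u v -> olt (oapp d u) (oapp d v).
Proof. intro H; induction d; simpl; auto. apply ocons_lt; auto. Qed.
Lemma cnf_oapp d u : cnf (oapp d u) -> cnf u.
Proof. induction d; simpl; tauto. Qed.
Lemma on_oapp d u : ord_norm u <= ord_norm (oapp d u).
Proof. induction d; simpl; lia. Qed.
(** Either [be] begins with all terms of [d], or it already falls short at one of them, and then
    nothing appended to [d] matters. *)
Lemma lt_snoc d : forall be b n, olt be (oapp d (OCons b n OZero)) ->
  (exists r, be = oapp d r /\ olt r (OCons b n OZero)) \/ (forall v, olt be (oapp d v)).
Proof.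
  induction d as [|e _ k d IH]; intros be b n H; simpl in *; [eauto|].
  destruct be as [|e' k' be]; [right; intro; apply olt_0c|]. apply ocons_lt in H.
  destruct H as [H|(-> & [H|(-> & H)])].
  - right; intro v. apply ocons_lt; auto.
  - right; intro v. apply ocons_lt; auto.
  - apply IH in H. destruct H as [(r & -> & H)|H]; [left; eauto|right; intro v; apply ocons_lt; auto].
Qed.
Lemma lt_owp b e n g : olt (OCons e n g) (omega_pow b) <-> olt e b.
Proof.
  unfold omega_pow. rewrite ocons_lt. split; [|auto]. intros [H|(_ & [H|(_ & H)])]; auto; [lia|apply olt_0 in H; tauto].
Qed.
Lemma succ_le be d n : cnf be -> olt be (ord_of (Ss d Sz n)) -> ole be (ord_of (snoc_pow d Sz n)).
Proof.
  intros Hc H. simpl in H. apply lt_snoc in H. destruct H as [(r & -> & H)|H].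
  - destruct r as [|e m t].
    + rewrite oapp_0. destruct n; simpl; [right; auto|left]. rewrite <- (oapp_0 (ord_of d)) at 1. apply oapp_lt, olt_0c.
    + apply ocons_lt in H. destruct H as [H|(-> & [H|(_ & H)])]; try (apply olt_0 in H; tauto).
      apply cnf_oapp in Hc. destruct Hc as (_ & _ & Hc).
      destruct t as [|b k t]; [|apply lt_owp, olt_0 in Hc; tauto].
      destruct n as [|n]; [lia|]. simpl. destruct (Nat.eq_dec m n) as [->|]; [right; auto|left]. apply oapp_lt, ocons_lt. right; split; auto. left; lia.
  - destruct n; simpl; left; [rewrite <- (oapp_0 (ord_of d))|]; auto.
Qed.
(** Common core of both clauses of [FundSeq]. After the terms shared with [d] and with [n] copies of
    [omega^b], the rest of [be] begins with an exponent below [b] and a coefficient below [x];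
    comparing this single term with the new last term decides. *)
Lemma lim_gen d b n G p x be : cnf be -> ord_norm be < x -> olt be (ord_of (Ss d b n)) ->
  (forall e m t, cnf e -> ord_norm e < x -> S m < x -> olt e (ord_of b) -> olt (OCons e m t) (OCons G p OZero)) ->
  olt be (oapp (ord_of (snoc_pow d b n)) (OCons G p OZero)).
Proof.
  intros Hc Hn H HG. simpl in H. apply lt_snoc in H. destruct H as [(r & -> & H)|H].
  - pose proof (cnf_oapp _ _ Hc) as Hcr. pose proof (on_oapp (ord_of d) r) as Hnr.
    destruct n as [|n]; simpl; [|rewrite oapp_A]; apply oapp_lt; destruct r as [|e m t]; try apply olt_0c.
    + destruct Hcr as (He & Ht & Hte). simpl in Hnr. apply HG; auto; try lia.
      apply ocons_lt in H. destruct H as [H|(_ & [H|(_ & H)])]; auto; [lia|apply olt_0 in H; tauto].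
    + destruct Hcr as (He & Ht & Hte). simpl in Hnr. simpl. apply ocons_lt.
      apply ocons_lt in H. destruct H as [H|(-> & [H|(_ & H)])]; auto; [|apply olt_0 in H; tauto].
      right; split; auto. destruct (Nat.eq_dec m n) as [->|]; [|left; lia]. right; split; auto.
      destruct t as [|e' m' t']; [apply olt_0c|]. apply lt_owp in Hte. simpl in Hnr. apply HG; auto; try lia. apply Ht.
  - destruct n as [|n]; simpl; [|rewrite oapp_A]; auto.
Qed.
(** For a successor exponent, the deciding term of [be] has an exponent at most the predecessor and
    a coefficient below [x]. For a limit exponent, the exponent of that term has norm below [x], and
    the induction hypothesis applies to it. *)
Lemma Fun_lt a x a' : FundSeq a x a' -> forall be, cnf be -> ord_norm be < x -> olt be (ord_of a) -> olt be (ord_of a').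
Proof.
  induction 1 as [d b n m x|d b n x w Hb HF IH]; intros be Hc Hn H.
  - destruct x as [|x]; [lia|]. simpl (ord_of (snoc_pow _ _ (S x))). apply lim_gen with (x := S x); auto.
    intros e k t He Hne Hk Hlt. apply succ_le in Hlt; auto. apply ocons_lt. destruct Hlt as [Hlt| ->]; auto. right; split; auto. left; lia.
  - simpl. apply lim_gen with (x := x); auto.
    intros e k t He Hne Hk Hlt. apply ocons_lt. left. apply IH; auto.
Qed.
Lemma Fr_lt : (forall a x y, FastRel a x y -> x < y) /\ (forall k a x y, IterRel k a x y -> x + k <= y).
Proof. apply FrItr_ind; intros; auto; lia. Qed.

Definition slow_descent (al : nat -> ord) (x R : nat) := (forall y, x <= y <= R -> cnf (al y) /\ ord_norm (al y) < y) /\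
  (forall y, x <= y < R -> olt (al (S y)) (al y)).
Definition below_iter (a : snoc_ord) (k : nat) (be : ord) := match k with O => False | S p => olt be (OCons (ord_of a) p OZero) end.
Lemma seq_ole al x R : slow_descent al x R -> forall y, x <= y <= R -> ole (al y) (al x).
Proof.
  intros [_ H] y. induction y as [|y IH]; intro Hy.
  - right; f_equal; lia.
  - destruct (Nat.eq_dec x (S y)) as [->|]; [right; auto|]. left. eapply lt_ole_trans; [apply H; lia|apply IH; lia].
Qed.
Lemma seq_sub al x R x' R' : slow_descent al x R -> x <= x' -> R' <= R -> slow_descent al x' R'.
Proof. intros [H1 H2] Hx HR; split; intros; [apply H1|apply H2]; lia. Qed.
Lemma first_index (P : nat -> Prop) x R : (exists y, x <= y <= R /\ P y) -> exists y, x <= y <= R /\ P y /\ forall z, x <= z < y -> ~ P z.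
Proof.
  intros [y Hy]. revert Hy. induction y as [y IH] using lt_wf_ind. intros [Hy HP].
  destruct (classic (exists z, x <= z < y /\ P z)) as [(z & Hz & HPz)|Hn].
  - apply (IH z); [lia|split; auto; lia].
  - exists y. repeat split; try lia; auto. intros z Hz HPz; apply Hn; eauto.
Qed.
Definition drop_leading (be : ord) : ord := match be with OZero => OZero | OCons b O g => g | OCons b (S n) g => OCons b n g end.
(* A descending sequence below [omega^a] with norms below the argument is shorter than [F_a]: at a limit the
   norm bound pushes the leading exponent below [a[x]], and a [k]-fold iterate of [F_a] accounts for leading terms
   [omega^a * m] with [m < k], one application for each value of the coefficient. *)
Theorem bounding : (forall a x z, FastRel a x z -> forall al R, slow_descent al x R -> (forall y, x <= y <= R -> olt (al y) (omega_pow (ord_of a))) -> R < z) /\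
  (forall k a x z, IterRel k a x z -> forall al R, slow_descent al x R -> (forall y, x <= y <= R -> below_iter a k (al y)) -> R < z).
Proof.
  apply FrItr_ind.
  - intros x al R [_ H2] H. destruct (le_lt_dec (S x) R) as [HR|HR]; [|lia]. exfalso.
    specialize (H2 x ltac:(lia)). specialize (H x ltac:(lia)). destruct (al x) as [|b n g]; [eapply olt_0; eauto|].
    apply lt_owp, olt_0 in H; auto.
  - intros d n x z HI IH al R HS H. destruct (le_lt_dec x R) as [HR|HR].
    + apply (IH al R HS). intros y Hy. simpl. eapply ole_lt_trans; [apply (seq_ole _ _ _ HS y Hy)|].
      specialize (H x ltac:(lia)). destruct (proj1 HS x ltac:(lia)) as [Hc Hn]. destruct (al x) as [|b m g]; [apply olt_0c|].
      apply lt_owp in H. destruct Hc as (Hb & _). simpl in Hn. apply succ_le in H; auto. apply ocons_lt. destruct H as [H| ->]; auto. right; split; auto. left; lia.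
    + apply Fr_lt in HI. lia.
  - intros a x b z Hl HF HFr IH al R HS H. destruct (le_lt_dec x R) as [HR|HR]; [|apply Fr_lt in HFr; lia].
    apply (IH al R HS). intros y Hy. eapply ole_lt_trans; [apply (seq_ole _ _ _ HS y Hy)|].
    specialize (H x ltac:(lia)). destruct (proj1 HS x ltac:(lia)) as [Hc Hn]. destruct (al x) as [|e m g]; [apply olt_0c|].
    apply lt_owp in H. apply lt_owp. destruct Hc as (He & _). simpl in Hn. apply (Fun_lt _ _ _ HF); auto. lia.
  - intros a x al R _ H. destruct (le_lt_dec x R) as [HR|HR]; auto. destruct (H x ltac:(lia)).
  - intros k a x z y HI IHI HF IHF al R HS H.
    pose proof (proj2 Fr_lt _ _ _ _ HI) as Hxz. pose proof (proj1 Fr_lt _ _ _ HF) as Hzy.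
    set (P := fun w => olt (al w) (omega_pow (ord_of a))).
    assert (HP : forall w, x <= w <= R -> ~ P w -> exists m g, al w = OCons (ord_of a) m g /\ m < k /\ olt g (omega_pow (ord_of a))).
    { intros w Hw Hn. specialize (H w Hw). simpl in H. destruct (proj1 HS w Hw) as [Hc _]. unfold P in Hn.
      destruct (al w) as [|b m g]; [destruct Hn; apply olt_0c|]. rewrite lt_owp in Hn. apply ocons_lt in H.
      destruct H as [H|(-> & [H|(_ & H)])]; [contradiction| |apply olt_0 in H; tauto]. exists m, g. repeat split; auto. apply Hc. }
    (* While the leading term is [omega^a * (m + 1)] with [m < k], removing one copy of [omega^a]
       leaves a descent governed by [k] iterations. Hence this phase ends before [z], and the last
       application of [F_a], from [z] to [y], covers the phase below [omega^a]. *)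
    assert (G : forall R', R' <= R -> (forall w, x <= w <= R' -> ~ P w) -> R' < z).
    { intros R' HR' Hn. apply (IHI (fun w => drop_leading (al w)) R').
      - split.
        + intros w Hw. destruct (HP w ltac:(lia) (Hn w Hw)) as (m & g & E & Hm & Hg). destruct (proj1 HS w ltac:(lia)) as [Hc Hon].
          rewrite E in *. destruct Hc as (K1 & K2 & K3). destruct m; simpl in *; (split; [auto|lia]).
        + intros w Hw. destruct (HP w ltac:(lia) (Hn w ltac:(lia))) as (m & g & E & Hm & Hg).
          destruct (HP (S w) ltac:(lia) (Hn (S w) ltac:(lia))) as (m' & g' & E' & Hm' & Hg').
          pose proof (proj2 HS w ltac:(lia)) as Hlt. rewrite E, E' in *. apply ocons_lt in Hlt.
          destruct Hlt as [Hlt|(_ & [Hlt|(-> & Hlt)])]; [destruct (olt_irr _ Hlt)| |].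
          * destruct m as [|m]; [lia|]. destruct m' as [|m']; simpl.
            -- destruct g' as [|b'' n'' g'']; [apply olt_0c|]. apply lt_owp in Hg'. apply ocons_lt; auto.
            -- apply ocons_lt. right; split; auto. left; lia.
          * destruct m; simpl; auto. apply ocons_lt. auto.
      - intros w Hw. destruct (HP w ltac:(lia) (Hn w Hw)) as (m & g & -> & Hm & Hg).
        destruct k as [|k]; [lia|]. destruct m as [|m]; simpl.
        + destruct g as [|b'' n'' g'']; [apply olt_0c|]. apply lt_owp in Hg. apply ocons_lt; auto.
        + apply ocons_lt. right; split; auto. left; lia. }
    destruct (classic (exists w, x <= w <= R /\ P w)) as [Hex|Hn].
    + apply first_index in Hex. destruct Hex as (w & Hw & HPw & Hfirst).
      destruct (le_lt_dec z R) as [HzR|]; [|lia].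
      assert (Hwz : w <= z).
      { destruct (Nat.eq_dec w x) as [->|]; [lia|]. assert (w - 1 < z); [|lia]. apply G; [lia|]. intros w' Hw'; apply Hfirst; lia. }
      apply (IHF al R); [apply (seq_sub _ _ _ _ R HS); lia|]. intros w' Hw'.
      eapply ole_lt_trans; [refine (seq_ole al _ R (seq_sub _ _ _ _ R HS (proj1 Hw) (le_n R)) w' _); lia|auto].
    + assert (R < z); [|lia]. apply G; auto. intros w Hw HPw; eauto.
Qed.
Theorem bounding_F a x z al R : FastRel a x z -> slow_descent al x R -> (forall y, x <= y <= R -> olt (al y) (omega_pow (ord_of a))) -> R < z.
Proof. intros H; apply (proj1 bounding _ _ _ H). Qed.

Local Open Scope bool_scope.

(** * Estimation lemma *)

Fixpoint allexp (P : ord -> Prop) (a : ord) : Prop := match a with OZero => True | OCons b _ g => P b /\ allexp P g end.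
(** The bottom exponents are the numbers from 3 to [c + 3]: all exceed the exponents 0 and 1
    reserved for fillers, and there are enough of them for [large0]. *)
Fixpoint HighTower (k c : nat) (a : ord) : Prop :=
  match k with
  | O => exists m, 2 <= m <= c + 2 /\ a = OCons OZero m OZero
  | S k => a <> OZero /\ cnf a /\ allexp (HighTower k c) a
  end.
Lemma Good_cnf k c a : HighTower k c a -> cnf a.
Proof. destruct k; [intros (m & _ & ->); simpl; auto; repeat split; auto|simpl; tauto]. Qed.

Fixpoint ords_over (L : list ord) (b d : nat) : list ord :=
  match d with O => [OZero] | S d => OZero :: flat_map (fun e => flat_map (fun n => map (OCons e n) (ords_over L b d)) (seq 0 b)) L end.
Fixpoint exponents (a : ord) : list ord := match a with OZero => [] | OCons b _ g => b :: exponents g end.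
Lemma gen_in L b a : forall d, length (exponents a) <= d -> allexp (fun e => In e L) a -> ord_norm a < b -> In a (ords_over L b d).
Proof.
  induction a as [|e _ n g IH]; intros d Hd Ha Hn; [destruct d; simpl; auto|].
  destruct d as [|d]; simpl in *; [lia|]. right. destruct Ha as [He Hg].
  apply in_flat_map. exists e. split; auto. apply in_flat_map. exists n. split; [apply in_seq; lia|].
  apply in_map, IH; auto; lia.
Qed.
Lemma exps_lt a : forall b, cnf a -> olt a (omega_pow b) -> forall e, In e (exponents a) -> olt e b.
Proof.
  induction a as [|e _ n g IH]; intros b Hc Hb e' He; [destruct He|]. destruct Hc as (_ & Hg & Hgb).
  apply lt_owp in Hb. destruct He as [<-|He]; auto. eapply olt_trans; [apply (IH e); eauto|auto].
Qed.
Lemma exps_nodup a : cnf a -> NoDup (exponents a).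
Proof.
  induction a as [|e _ n g IH]; simpl; [constructor|]. intros (He & Hg & Hge). constructor; auto.
  intro H. apply (olt_irr e). eapply exps_lt; eauto.
Qed.
Lemma allexp_in P a : allexp P a <-> forall e, In e (exponents a) -> P e.
Proof. induction a as [|e _ n g IH]; simpl; [tauto|]. rewrite IH. split; [intros [H1 H2] x [<-|H]; auto|auto]. Qed.
Lemma on_exps a e : In e (exponents a) -> ord_norm e <= ord_norm a.
Proof. induction a as [|b _ n g IH]; simpl; [tauto|]. intros [<-|H]; [|apply IH in H]; lia. Qed.
(** The exponents of a normal form are distinct and inherit the norm bound. Over a finite list of
    exponents both the number of terms and the coefficients are therefore bounded. *)
Lemma Good_fin k c b : exists L, forall a, HighTower k c a -> ord_norm a < b -> In a L.
Proof.
  induction k as [|k [L IH]].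
  - exists (map (fun m => OCons OZero m OZero) (seq 0 (c + 3))). intros a (m & Hm & ->) _. apply in_map_iff. exists m. split; auto. apply in_seq; lia.
  - exists (ords_over L b (length L)). intros a (Ha & Hc & He) Hn.
    assert (HL : forall e, In e (exponents a) -> In e L).
    { intros e Hin. apply IH; [apply (proj1 (allexp_in _ _) He); auto|]. apply on_exps in Hin. lia. }
    apply gen_in; auto; [|apply allexp_in; auto].
    apply NoDup_incl_length; [apply exps_nodup; auto|exact HL].
Qed.
Lemma max_in (L : list ord) (P : ord -> Prop) : (exists a, P a) -> (forall a, P a -> In a L) -> exists a, P a /\ forall b, P b -> ole b a.
Proof.
  revert P. induction L as [|x L IH]; intros P [a Ha] HP; [destruct (HP a Ha)|].
  destruct (classic (exists b, P b /\ b <> x)) as [Hb|Hn].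
  - destruct (IH (fun b => P b /\ b <> x) Hb) as (m & [Hm Hmx] & Hmax).
    { intros b [Hb1 Hb2]. destruct (HP b Hb1) as [E|]; auto. congruence. }
    destruct (classic (P x /\ olt m x)) as [[Hx Hlt]|Hx].
    + exists x. split; auto. intros b Hb'. destruct (classic (b = x)) as [->|Hbx]; [right; auto|]. left. eapply ole_lt_trans; eauto.
    + exists m. split; auto. intros b Hb'. destruct (classic (b = x)) as [->|Hbx]; auto. apply nolt_ole. tauto.
  - exists a. split; auto. intros b Hb. destruct (classic (b = x)) as [->|]; [|exfalso; eauto]. right.
    destruct (classic (a = x)); auto. exfalso; eauto.
Qed.

Section Chain.
Variable G : ord -> Prop.
Hypothesis Gfin : forall b, exists L, forall a, G a -> ord_norm a < b -> In a L.
(* lists are in decreasing order: the head is the last element *)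
Inductive Chain : list nat -> ord -> Prop :=
| Ch1 b x : G x -> ord_norm x < b -> Chain [b] x
| ChS b l x y : Chain l y -> G x -> ord_norm x < b -> olt x y -> Chain (b :: l) x.
Lemma Ch_G l x : Chain l x -> G x.
Proof. destruct 1; auto. Qed.
Lemma Ch_on b l x : Chain (b :: l) x -> ord_norm x < b.
Proof. inversion 1; auto. Qed.
(* The maximum exists since only finitely many elements of [G] have norm below the head of [l]; junk if there is
   no chain on [l]. *)
Definition max_last (l : list nat) : ord := epsilon (inhabits OZero) (fun x => Chain l x /\ forall y, Chain l y -> ole y x).
Lemma mx_spec l : (exists x, Chain l x) -> Chain l (max_last l) /\ forall y, Chain l y -> ole y (max_last l).
Proof.
  intros [x Hx]. apply (epsilon_spec (inhabits OZero) (fun x => Chain l x /\ forall y, Chain l y -> ole y x)).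
  destruct l as [|b l]; [inversion Hx|]. destruct (Gfin b) as [L HL].
  apply (max_in L); [eauto|]. intros a Ha. apply HL; [eapply Ch_G; eauto|eapply Ch_on; eauto].
Qed.
Lemma Ch_tl b l : l <> [] -> (exists x, Chain (b :: l) x) -> exists x, Chain l x.
Proof. intros Hl [x Hx]. inversion Hx; subst; [congruence|eauto]. Qed.
Lemma mx_dec b l : l <> [] -> (exists x, Chain (b :: l) x) -> olt (max_last (b :: l)) (max_last l).
Proof.
  intros Hl H. pose proof (proj1 (mx_spec _ H)) as H1. inversion H1; subst; [congruence|].
  eapply lt_ole_trans; [eauto|]. apply mx_spec; eauto.
Qed.
Variable V : nat -> list nat.
Definition pending (a b : nat) : nat := length (filter (fun v => a <? v) (V b)).
Definition add_term (x : ord) (m : nat) (T : ord) : ord := match m with O => T | S p => OCons x p T end.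
(* A stack [b_0 < ... < b_r] held at stage [a] weighs
   [sum_(l < r) omega^(xi_l) * m_l + omega^(xi_r) * (m_r + 1)] where [xi_l = max_last] of its first [l + 1] points and
   [m_l] is the number of values requested by [b_l] beyond [a].  Passing to stage [a'] either pushes [a'] or pops down
   to a point one of whose requests was met, which lowers the weight. *)
Fixpoint inner_weight (a : nat) (st : list nat) (T : ord) : ord :=
  match st with [] => T | b :: st' => inner_weight a st' (add_term (max_last (b :: st')) (pending a b) T) end.
Definition stack_weight (a : nat) (st : list nat) : ord :=
  match st with [] => OZero | b :: st' => inner_weight a st' (OCons (max_last (b :: st')) (pending a b) OZero) end.
Definition hit (a a' b : nat) : bool := existsb (fun v => (a <? v) && (v <=? a')) (V b).
(** Pops until no point strictly below the top has been hit. The top itself may be hit: these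
    requests lie at or below [a'], the point pushed next. *)
Fixpoint cut_stack (a a' : nat) (st : list nat) : list nat :=
  match st with [] => [] | b :: st' => if existsb (hit a a') st' then cut_stack a a' st' else b :: st' end.
Lemma cutst_spec a a' st : st <> [] -> exists p b st', st = p ++ b :: st' /\ cut_stack a a' st = b :: st' /\
  (forall d, In d st' -> hit a a' d = false) /\ (p <> [] -> hit a a' b = true).
Proof.
  induction st as [|b st IH]; [congruence|]. intros _. simpl. destruct (existsb (hit a a') st) eqn:E.
  - destruct IH as (p & d & st' & -> & Hc & Hn & Hp); [intros ->; discriminate|].
    exists (b :: p), d, st'. repeat split; auto. intros _.
    apply existsb_exists in E. destruct E as (x & Hx & Hh). destruct p as [|q p]; [|apply Hp; congruence].
    simpl in Hx. destruct Hx as [<-|Hx]; auto. rewrite Hn in Hh; [discriminate|auto].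
  - exists [], b, st. split; [auto|split; [auto|split; [|congruence]]]. intros d Hd. destruct (hit a a' d) eqn:Hh; auto.
    exfalso. assert (existsb (hit a a') st = true) by (apply existsb_exists; eauto). congruence.
Qed.
Lemma pend_le a b : pending a b <= length (V b).
Proof. apply filter_length_le. Qed.
Lemma pend_mono_l (l : list nat) a a' : a <= a' -> length (filter (fun v => a' <? v) l) <= length (filter (fun v => a <? v) l) /\
  (existsb (fun v => (a <? v) && (v <=? a')) l = true -> length (filter (fun v => a' <? v) l) < length (filter (fun v => a <? v) l)) /\
  (existsb (fun v => (a <? v) && (v <=? a')) l = false -> length (filter (fun v => a' <? v) l) = length (filter (fun v => a <? v) l)).
Proof.
  intro Ha. induction l as [|v l (IH1 & IH2 & IH3)]; simpl; [repeat split; auto; discriminate|].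
  assert (K1 := IH2). assert (K2 := IH3).
  destruct (Nat.ltb_spec a v), (Nat.ltb_spec a' v), (Nat.leb_spec v a'); cbn [andb orb length] in *; try lia;
  split; try lia; split; intro K; try discriminate; try lia; try (specialize (IH2 K)); try (specialize (IH3 K)); lia.
Qed.
Lemma pend_mono a a' b : a <= a' -> pending a' b <= pending a b. Proof. intro; apply pend_mono_l; auto. Qed.
Lemma pend_hit a a' b : a <= a' -> hit a a' b = true -> pending a' b < pending a b. Proof. intro; apply pend_mono_l; auto. Qed.
Lemma pend_nohit a a' b : a <= a' -> hit a a' b = false -> pending a' b = pending a b. Proof. intro; apply pend_mono_l; auto. Qed.
Lemma ct_lt x m T T' : olt T T' -> olt (add_term x m T) (add_term x m T').
Proof. destruct m; simpl; auto. intro; apply ocons_lt; auto. Qed.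
Lemma wt_lt a st : forall T T', olt T T' -> olt (inner_weight a st T) (inner_weight a st T').
Proof. induction st; simpl; auto using ct_lt. Qed.
Lemma wt_nohit a a' st : a <= a' -> (forall d, In d st -> hit a a' d = false) -> forall T, inner_weight a' st T = inner_weight a st T.
Proof.
  intro Ha. induction st as [|b st IH]; intros Hn T; simpl; auto.
  rewrite (pend_nohit a a' b); auto; [|apply Hn; simpl; auto]. apply IH. intros d Hd; apply Hn; simpl; auto.
Qed.
Lemma wt_app a p l : forall T, exists T', inner_weight a (p ++ l) T = inner_weight a l T'.
Proof. induction p; intro T; simpl; eauto. Qed.
Lemma W_app a p b st : p <> [] -> exists T, stack_weight a (p ++ b :: st) = inner_weight a st (add_term (max_last (b :: st)) (pending a b) T).
Proof.
  destruct p as [|q p]; [congruence|]. intros _. simpl.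
  destruct (wt_app a p (b :: st) (OCons (max_last (q :: p ++ b :: st)) (pending a q) OZero)) as [T' ->]. exists T'. reflexivity.
Qed.
(** Without a pop, the last term [omega^xi * (m + 1)] turns into [omega^xi * m'] with [m' <= m],
    followed by a smaller power. After a pop, the coefficient at the new top has dropped because
    that point was hit, and this outweighs everything behind it. *)
Lemma W_dec a a' st : a <= a' -> st <> [] -> (exists x, Chain (a' :: cut_stack a a' st) x) -> olt (stack_weight a' (a' :: cut_stack a a' st)) (stack_weight a st).
Proof.
  intros Ha Hst HC. destruct (cutst_spec a a' st Hst) as (p & b & st' & E & Ec & Hn & Hp).
  rewrite Ec in *. assert (Hd : olt (max_last (a' :: b :: st')) (max_last (b :: st'))) by (apply mx_dec; auto; congruence).
  simpl stack_weight at 1. set (T' := OCons (max_last (a' :: b :: st')) (pending a' a') OZero). simpl. rewrite (wt_nohit a a'); auto.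
  assert (HT : forall m' m T, m' < m -> olt (add_term (max_last (b :: st')) m' T') (add_term (max_last (b :: st')) m T)).
  { intros m' m T Hm. destruct m as [|m]; [lia|]. destruct m' as [|m']; simpl; apply ocons_lt; auto. right; split; auto. left; lia. }
  destruct p as [|q p].
  - simpl in E. subst st. simpl. apply wt_lt.
    apply (HT (pending a' b) (S (pending a b)) OZero). pose proof (pend_mono a a' b Ha). lia.
  - destruct (W_app a (q :: p) b st') as [T ET]; [congruence|]. rewrite E, ET. apply wt_lt, HT. apply pend_hit; auto. apply Hp; congruence.
Qed.
Lemma wt_good (N : nat) a st : (forall b, In b st -> pending a b < N /\ b <= N) -> (st = [] \/ exists x, Chain st x) ->
  forall T, cnf T -> allexp G T -> ord_norm T < N -> T <> OZero -> (st = [] \/ olt T (omega_pow (max_last st))) ->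
  (forall x, G x -> cnf x) ->
  cnf (inner_weight a st T) /\ allexp G (inner_weight a st T) /\ ord_norm (inner_weight a st T) < N /\ inner_weight a st T <> OZero.
Proof.
  induction st as [|b st IH]; intros Hb HC T H1 H2 H3 H4 H5 HG; simpl; auto.
  destruct HC as [?|HC]; [congruence|]. destruct H5 as [?|H5]; [congruence|].
  pose proof (proj1 (mx_spec _ HC)) as Hm. destruct (Hb b (or_introl eq_refl)) as [Hp HbN].
  pose proof (Ch_on _ _ _ Hm) as Hon. pose proof (Ch_G _ _ Hm) as HGm.
  assert (Hst : st = [] \/ exists x, Chain st x).
  { destruct st; auto. right. apply (Ch_tl b); auto. congruence. }
  assert (HT : olt T (omega_pow (max_last (b :: st)))) by auto.
  apply IH; auto.
  - intros d Hd; apply Hb; simpl; auto.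
  - unfold add_term. destruct (pending a b); simpl; auto.
  - unfold add_term. destruct (pending a b); simpl; auto.
  - unfold add_term. destruct (pending a b); simpl; auto. lia.
  - unfold add_term. destruct (pending a b); simpl; auto. congruence.
  - destruct st as [|d st]; auto. right. assert (Hd : olt (max_last (b :: d :: st)) (max_last (d :: st))) by (apply mx_dec; auto; congruence).
    unfold add_term. destruct (pending a b).
    + eapply olt_trans; [apply HT|]. apply ocons_lt; auto.
    + apply ocons_lt; auto.
Qed.
Lemma W_good a st : (forall b, In b st -> length (V b) + 1 < b /\ b <= a) -> (exists x, Chain st x) -> st <> [] -> (forall x, G x -> cnf x) ->
  cnf (stack_weight a st) /\ allexp G (stack_weight a st) /\ ord_norm (stack_weight a st) < a /\ stack_weight a st <> OZero.
Proof.
  intros Hb HC Hst HG. destruct st as [|b st]; [congruence|]. simpl.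
  pose proof (proj1 (mx_spec _ HC)) as Hm. pose proof (Ch_on _ _ _ Hm) as Hon. pose proof (Ch_G _ _ Hm) as HGm.
  destruct (Hb b (or_introl eq_refl)) as [Hp HbN]. pose proof (pend_le a b).
  apply wt_good; auto.
  - intros d Hd. destruct (Hb d (or_intror Hd)). pose proof (pend_le a d). lia.
  - destruct st; auto. right. apply (Ch_tl b); auto. congruence.
  - simpl. repeat split; auto.
  - simpl; auto.
  - simpl. lia.
  - congruence.
  - destruct st as [|d st]; auto. right. apply ocons_lt. left. apply mx_dec; auto. congruence.
Qed.
End Chain.

Fixpoint stack (V : nat -> list nat) (l : list nat) : list nat :=
  match l with
  | [] => []
  | a' :: l' => a' :: match l' with [] => [] | a :: _ => cut_stack V a a' (stack V l') end
  end.
Definition decreasing (l : list nat) := StronglySorted (fun x y => y < x) l.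
Lemma cutst_incl V a a' st : incl (cut_stack V a a' st) st.
Proof. induction st as [|b st IH]; simpl; [apply incl_refl|]. destruct existsb; [|apply incl_refl]. apply incl_tl; auto. Qed.
Lemma stk_incl V l : incl (stack V l) l.
Proof.
  induction l as [|a' l IH]; simpl; [apply incl_refl|]. apply incl_cons; [left; auto|]. apply incl_tl.
  destruct l as [|a l]; [apply incl_refl|]. eapply incl_tran; [apply cutst_incl|auto].
Qed.
Lemma dec_cut V a a' st : decreasing st -> decreasing (cut_stack V a a' st).
Proof. induction 1; simpl; [constructor|]. destruct existsb; auto. constructor; auto. Qed.
Lemma dec_stk V l : decreasing l -> decreasing (stack V l).
Proof.
  induction 1 as [|a' l Hl IH Hf]; simpl; [constructor|]. constructor.
  - destruct l; [constructor|]. apply dec_cut; auto.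
  - destruct l as [|a l]; [constructor|]. apply Forall_forall. intros x Hx. apply cutst_incl, stk_incl in Hx.
    rewrite Forall_forall in Hf. auto.
Qed.
(** If [V b] lists least witnesses, this lets [t] act as infinity: a requested witness that exists
    up to [t] is found up to the next point of [B]. *)
Definition separated (V : nat -> list nat) (B : list nat) (t : nat) := forall b b', In b B -> In b' B -> b < b' -> forall v, In v (V b) -> v <= b' \/ t < v.
(** A point left strictly below the top was not hit between [a] and [a'], so its requests beyond [a]
    also lie beyond [a']. Pairs with the pushed point are trivial, since there [b'] and [t]
    coincide. *)
Lemma stk_est V l a : decreasing (a :: l) -> separated V (stack V (a :: l)) a.
Proof.
  revert a. induction l as [|a l IH]; intros a' Hd.
  - simpl. intros b b' [<-|[]] [<-|[]]; lia.
  - inversion Hd as [|? ? Hd' Hf]; subst. specialize (IH a Hd'). change (stack V (a' :: a :: l)) with (a' :: cut_stack V a a' (stack V (a :: l))).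
    destruct (cutst_spec V a a' (stack V (a :: l))) as (p & b0 & st' & E & Ec & Hn & Hp); [simpl; congruence|].
    assert (Haa : a < a') by (inversion Hf; auto).
    pose proof (dec_stk V _ Hd') as Hds. rewrite E in Hds.
    assert (Hle : forall x, In x (stack V (a :: l)) -> x <= a).
    { intros x Hx. apply stk_incl in Hx. destruct Hx as [<-|Hx]; auto. inversion Hd' as [|? ? _ Hf']; subst. rewrite Forall_forall in Hf'. apply Hf' in Hx. lia. }
    intros b b' Hb Hb' Hlt v Hv.
    assert (Hbin : In b (b0 :: st')).
    { rewrite Ec in Hb. destruct Hb as [<-|Hb]; auto. exfalso. destruct Hb' as [<-|Hb']; [lia|]. apply cutst_incl, Hle in Hb'. lia. }
    destruct Hb' as [<-|Hb']; [lia|].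
    assert (Hbs : In b (stack V (a :: l))) by (rewrite E; apply in_or_app; auto).
    destruct (IH b b' Hbs (cutst_incl _ _ _ _ _ Hb') Hlt v Hv) as [|Hva]; auto. right.
    destruct Hbin as [<-|Hbin].
    + exfalso. rewrite Ec in Hb'. destruct Hb' as [<-|Hb']; [lia|].
      assert (K : forall p, decreasing (p ++ b0 :: st') -> b' < b0).
      { intro q. induction q as [|y q IHq]; simpl; inversion 1 as [|? ? K1 K2]; subst; auto. rewrite Forall_forall in K2. auto. }
      apply K in Hds. lia.
    + specialize (Hn b Hbin). destruct (le_lt_dec v a') as [Hva'|]; auto. exfalso.
      assert (hit V a a' b = true); [|congruence]. apply existsb_exists. exists v. split; auto.
      apply andb_true_iff. split; [apply Nat.ltb_lt|apply Nat.leb_le]; lia.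
Qed.
Definition large k c l := ~ exists x, Chain (HighTower k c) l x.
(** If no stack met the conclusion, every stack would carry a chain, so its [max_last] would be
    meaningful, and the weights of the successive stacks would form a chain on [A] one level up.
    Coefficients of weights are at most [length (V b) + 1], which accounts for the bound on the
    number of requests. *)
Theorem estimation k c V A : A <> [] -> decreasing A -> (forall b, In b A -> length (V b) + 1 < b) -> large (S k) c A ->
  exists B t, B <> [] /\ decreasing B /\ incl B A /\ In t A /\ (forall b, In b B -> b <= t) /\ large k c B /\ separated V B t.
Proof.
  intros HA Hd HV HL. apply NNPP; intro Hno. apply HL. clear HL.
  assert (Gf : forall b, exists L, forall a, HighTower k c a -> ord_norm a < b -> In a L) by (apply Good_fin).
  assert (HS : forall a l p, A = p ++ a :: l -> exists x, Chain (HighTower k c) (stack V (a :: l)) x).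
  { intros a l p E. apply NNPP; intro Hn. apply Hno. exists (stack V (a :: l)), a.
    assert (Hdl : decreasing (a :: l)).
    { rewrite E in Hd. clear E. induction p; simpl in Hd; auto. inversion Hd; auto. }
    repeat split; auto.
    - simpl; congruence.
    - apply dec_stk; auto.
    - intros x Hx. apply stk_incl in Hx. rewrite E. apply in_or_app; auto.
    - rewrite E. apply in_or_app; simpl; auto.
    - intros b Hb. apply stk_incl in Hb. destruct Hb as [<-|Hb]; auto. inversion Hdl as [|? ? _ Hf]; subst. rewrite Forall_forall in Hf. apply Hf in Hb. lia.
    - apply stk_est; auto. }
  assert (HW : forall l a p, A = p ++ a :: l -> Chain (HighTower (S k) c) (a :: l) (stack_weight (HighTower k c) V a (stack V (a :: l)))).
  { induction l as [|a l IH]; intros a' p E.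
    - assert (Hg := W_good (HighTower k c) Gf V a' (stack V [a'])). destruct Hg as (g1 & g2 & g3 & g4).
      + intros b [<-|[]]. split; auto. apply HV. rewrite E; apply in_or_app; simpl; auto.
      + eapply HS; eauto.
      + simpl; congruence.
      + apply Good_cnf.
      + constructor; auto. simpl. auto.
    - assert (E' : A = (p ++ [a']) ++ a :: l) by (rewrite <- app_assoc; auto). specialize (IH a _ E').
      assert (Hdl : decreasing (a' :: a :: l)).
      { rewrite E in Hd. clear - Hd. induction p; simpl in Hd; auto. inversion Hd; auto. }
      inversion Hdl as [|? ? Hdl' Hf]; subst. rewrite Forall_forall in Hf.
      assert (Hg := W_good (HighTower k c) Gf V a' (stack V (a' :: a :: l))). destruct Hg as (g1 & g2 & g3 & g4).
      + intros b Hb. apply stk_incl in Hb. split; [apply HV; apply in_or_app; right; auto|].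
        destruct Hb as [<-|Hb]; auto. apply Hf in Hb. lia.
      + eapply HS; eauto.
      + simpl; congruence.
      + apply Good_cnf.
      + eapply ChS; [apply IH|simpl; auto|auto|].
        change (stack V (a' :: a :: l)) with (a' :: cut_stack V a a' (stack V (a :: l))). apply W_dec; auto.
        * specialize (Hf a (or_introl eq_refl)). lia.
        * simpl; congruence.
        * exact (HS a' (a :: l) p eq_refl). }
  destruct A as [|a l]; [congruence|]. eexists. apply (HW l a []). reflexivity.
Qed.
(** On at most [c] points the values [c + 2 - length l] would descend without falling below 2, and
    so form a chain. *)
Lemma large0 c B : B <> [] -> decreasing B -> (forall b, In b B -> c + 3 < b) -> large 0 c B -> c < length B.
Proof.
  intros HB Hd Hb HL. destruct (le_lt_dec (length B) c) as [Hc|]; [|auto]. exfalso. apply HL.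
  assert (K : forall l, l <> [] -> (forall b, In b l -> c + 3 < b) -> length l <= c -> Chain (HighTower 0 c) l (OCons OZero (c + 2 - length l) OZero)).
  { induction l as [|b l IH]; [congruence|]. intros _ Hbl Hl. simpl in Hl. destruct l as [|d l].
    - apply Ch1; simpl; [eexists; split; [|reflexivity]; lia|]. specialize (Hbl b (or_introl eq_refl)). lia.
    - eapply ChS; [apply IH; [congruence|intros; apply Hbl; simpl; auto|simpl in *; lia]| | |].
      + simpl. eexists; split; [|reflexivity]. simpl in Hl. lia.
      + specialize (Hbl b (or_introl eq_refl)). simpl. lia.
      + apply ocons_lt. right; split; auto. left. simpl in *. lia. }
  eexists. apply K; auto.
Qed.

(** * Sparse sets are large *)

Definition nat_ord (m : nat) : ord := match m with O => OZero | S p => OCons OZero p OZero end.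
Fixpoint TowerOrd (k c : nat) (a : ord) : Prop :=
  match k with O => exists m, m <= c /\ a = nat_ord m | S k => cnf a /\ allexp (TowerOrd k c) a end.
Lemma Hd_cnf k c a : TowerOrd k c a -> cnf a.
Proof. destruct k; [intros (m & _ & ->); destruct m; simpl; auto; repeat split; auto|simpl; tauto]. Qed.
Lemma allexp_imp (P Q : ord -> Prop) a : (forall e, P e -> Q e) -> allexp P a -> allexp Q a.
Proof. intro H. rewrite !allexp_in. auto. Qed.
Lemma Good_Hd k c c' : c + 3 <= c' -> forall a, HighTower k c a -> TowerOrd k c' a.
Proof.
  intro Hc. induction k as [|k IH]; simpl; intros a.
  - intros (m & Hm & ->). exists (S m). split; auto; lia.
  - intros (_ & Ha & He). split; auto. eapply allexp_imp; eauto.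
Qed.
Lemma Hd_0 k c : TowerOrd k c OZero.
Proof. destruct k; simpl; auto. exists 0; split; auto; lia. Qed.
Lemma Hd_1 k c : 1 <= c -> TowerOrd k c (omega_pow OZero).
Proof. intro. destruct k; simpl; [exists 1; auto|]. repeat split; auto. apply Hd_0. Qed.
Lemma Hd_lt k c : forall a, TowerOrd k c a -> olt a (omega_pow (omega_tower k)).
Proof.
  induction k as [|k IH]; simpl; intros a.
  - intros (m & _ & ->). destruct m; [apply olt_0c|]. apply lt_owp, olt_0c.
  - intros (Ha & He). destruct a as [|e n g]; [apply olt_0c|]. apply lt_owp, IH. apply He.
Qed.

Definition omega_pow0 : ord := omega_pow OZero.
(* [x] in [[y * 2^i, y * 2^(i+1))] receives [omega * (y - 1 - i) + (y * 2^(i+1) - 1 - x)], which interpolates between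
   consecutive points [y] and [y * 2^y] of the sparse set. *)
Definition filler (y x : nat) : ord :=
  let i := Nat.log2 (x / y) in add_term omega_pow0 (y - 1 - i) (add_term OZero (y * 2 ^ (i + 1) - 1 - x) OZero).
Definition high (a : ord) := forall e, In e (exponents a) -> olt omega_pow0 e.
Lemma ct_cases x m T : (m = 0 /\ add_term x m T = T) \/ exists p, m = S p /\ add_term x m T = OCons x p T.
Proof. destruct m; simpl; eauto. Qed.
Definition low (a : ord) := forall e, In e (exponents a) -> ole e omega_pow0.
(** Where [b] first exceeds [a], it does so by a term whose exponent is above 1, and this dominates
    any low tail of [a]. *)
Lemma app_lt a : forall b u v, high b -> olt a b -> low u -> olt (oapp a u) (oapp b v).
Proof.
  induction a as [|e _ m g IH]; intros [|e' m' g'] u v Hb H Hu; try (destruct (olt_0 _ H)).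
  - simpl. destruct u as [|e m g]; [apply olt_0c|]. apply ocons_lt. left.
    eapply ole_lt_trans; [apply Hu|apply Hb]; simpl; auto.
  - simpl. apply ocons_lt in H. apply ocons_lt. destruct H as [H|(-> & [H|(-> & H)])]; auto. right; split; auto. right; split; auto.
    apply IH; auto. intros x Hx; apply Hb; simpl; auto.
Qed.
Lemma exps_app a u : exponents (oapp a u) = exponents a ++ exponents u.
Proof. induction a; simpl; congruence. Qed.
Lemma on_app a u : ord_norm (oapp a u) = Nat.max (ord_norm a) (ord_norm u).
Proof. induction a; simpl; lia. Qed.
Lemma cnf_app a u : cnf a -> high a -> cnf u -> low u -> cnf (oapp a u).
Proof.
  induction a as [|e _ n g IH]; simpl; auto. intros (He & Hg & Hge) Hh Hu Hl. repeat split; auto.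
  - apply IH; auto. intros x Hx; apply Hh; simpl; auto.
  - destruct g as [|e' n' g']; simpl.
    + destruct u as [|e' n' g']; [apply olt_0c|]. apply lt_owp. eapply ole_lt_trans; [apply Hl|apply Hh]; simpl; auto.
    + apply lt_owp in Hge. apply lt_owp; auto.
Qed.
Lemma Good_high n c a : HighTower (S n) c a -> high a.
Proof.
  intros (_ & _ & H) e He. apply (proj1 (allexp_in _ _) H) in He. destruct n as [|n]; simpl in He.
  - destruct He as (m & Hm & ->). apply ocons_lt. right; split; auto. left; lia.
  - destruct He as (Hz & _ & He). destruct e as [|e m g]; [congruence|]. apply ocons_lt. left. destruct He as [He _].
    destruct n; simpl in He; [destruct He as (? & _ & ->)|destruct e; [destruct He; congruence|]]; apply olt_0c.
Qed.

Section Block.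
Variables (y x : nat).
Hypothesis (Hy : 2 <= y) (Hx : y <= x) (Hx' : x < y * 2 ^ y).
Lemma blk_i : Nat.log2 (x / y) < y /\ y * 2 ^ Nat.log2 (x / y) <= x < y * 2 ^ (Nat.log2 (x / y) + 1).
Proof.
  assert (H0 : 0 < x / y) by (apply Nat.div_str_pos; lia).
  pose proof (Nat.log2_spec _ H0) as [H1 H2]. rewrite Nat.add_1_r. set (i := Nat.log2 (x / y)) in *.
  assert (H3 : y * 2 ^ i <= x). { pose proof (Nat.mul_div_le x y ltac:(lia)). nia. }
  assert (H4 : x < y * 2 ^ S i). { pose proof (Nat.mul_succ_div_gt x y ltac:(lia)). nia. }
  repeat split; auto. apply (Nat.pow_lt_mono_r_iff 2); [lia|]. nia.
Qed.
Lemma ct_in e x' m T : In e (exponents (add_term x' m T)) -> e = x' \/ In e (exponents T).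
Proof. destruct m; simpl; [auto|intros [<-|]; auto]. Qed.
Lemma ins_low : low (filler y x).
Proof.
  intros e He. unfold filler in He. apply ct_in in He. destruct He as [->|He]; [right; auto|].
  apply ct_in in He. destruct He as [->|[]]. left; apply olt_0c.
Qed.
Lemma ins_on : ord_norm (filler y x) < x.
Proof.
  pose proof blk_i. unfold filler. set (i := Nat.log2 (x / y)) in *. rewrite Nat.add_1_r in *. rewrite Nat.pow_succ_r' in *.
  unfold add_term. destruct (y - 1 - i) eqn:E1, (y * (2 * 2 ^ i) - 1 - x) eqn:E2; simpl; lia.
Qed.
Lemma ins_cnf : cnf (filler y x).
Proof. unfold filler, add_term. destruct (y - 1 - _), (y * _ - 1 - x); simpl; repeat split; auto. Qed.
End Block.
Lemma ct_lt_n e m' m T' T : m' < m -> olt T' (omega_pow e) -> olt (add_term e m' T') (add_term e m T).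
Proof.
  intros Hm H. destruct m as [|m]; [lia|]. destruct m' as [|m']; simpl.
  - destruct T' as [|a p q]; [apply olt_0c|]. apply lt_owp in H. apply ocons_lt; auto.
  - apply ocons_lt. right; split; auto. left; lia.
Qed.
Lemma ins_dec y x : 2 <= y -> y <= x -> S x < y * 2 ^ y -> olt (filler y (S x)) (filler y x).
Proof.
  intros Hy Hx HS. pose proof (blk_i y x Hy Hx ltac:(lia)) as [H1 H2]. pose proof (blk_i y (S x) Hy ltac:(lia) HS) as [H3 H4].
  assert (Hm : Nat.log2 (x / y) <= Nat.log2 (S x / y)) by (apply Nat.log2_le_mono, Nat.Div0.div_le_mono; lia).
  unfold filler. set (i := Nat.log2 (x / y)) in *. set (i' := Nat.log2 (S x / y)) in *.
  destruct (Nat.eq_dec i i') as [<-|Hne].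
  - apply ct_lt, ct_lt_n; [lia|apply olt_0c].
  - apply ct_lt_n; [lia|]. destruct (y * 2 ^ (i' + 1) - 1 - S x); simpl; [apply olt_0c|apply lt_owp, olt_0c].
Qed.
Lemma ins_Hd y x k c : 1 <= c -> allexp (TowerOrd k c) (filler y x).
Proof.
  intro Hc. apply allexp_in. intros e He. unfold filler in He. apply ct_in in He. destruct He as [->|He]; [apply Hd_1; auto|].
  apply ct_in in He. destruct He as [->|[]]. apply Hd_0.
Qed.

Section Fill.
Variables (n c c' K : nat).
Hypothesis (HK : 2 <= K) (Hc : c + 3 <= c').
Fixpoint sparse_point (k : nat) : nat := match k with O => K | S k => sparse_point k * 2 ^ sparse_point k end.
Fixpoint sparse_list (k : nat) : list nat := match k with O => [K] | S j => sparse_point k :: sparse_list j end.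
Lemma ys_lt k : sparse_point k < sparse_point (S k).
Proof. simpl. assert (K <= sparse_point k) by (induction k; simpl; auto; assert (2 ^ sparse_point k <> 0) by (apply Nat.pow_nonzero; lia); nia). assert (sparse_point k < 2 ^ sparse_point k) by (apply Nat.pow_gt_lin_r; lia). nia. Qed.
Lemma ys_ge k : K + k <= sparse_point k.
Proof. induction k; [simpl; lia|]. pose proof (ys_lt k). lia. Qed.
Definition full_descent (R : nat) (al : nat -> ord) := slow_descent al K R /\ forall x, K <= x <= R -> TowerOrd (S n) c' (al x).
Lemma fill_block k xi x : HighTower (S n) c xi -> ord_norm xi < sparse_point k -> sparse_point k <= x < sparse_point (S k) ->
  let a := oapp xi (filler (sparse_point k) x) in cnf a /\ ord_norm a < x /\ TowerOrd (S n) c' a /\ (S x < sparse_point (S k) -> olt (oapp xi (filler (sparse_point k) (S x))) a).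
Proof.
  intros HG Hon Hx a. simpl sparse_point in Hx. pose proof (ys_ge k) as Hy.
  assert (Hca : cnf a) by (apply cnf_app; [apply (Good_cnf (S n) c); auto|apply (Good_high n c); auto|apply ins_cnf|apply ins_low]).
  repeat split; auto.
  - unfold a. rewrite on_app. pose proof (ins_on (sparse_point k) x ltac:(lia) ltac:(lia) ltac:(lia)). lia.
  - apply allexp_in. intros e He. unfold a in He. rewrite exps_app in He. apply in_app_or in He. destruct He as [He|He].
    + destruct HG as (_ & _ & HG). apply (proj1 (allexp_in _ _) HG) in He. apply (Good_Hd n c c' Hc); auto.
    + refine (proj1 (allexp_in _ _) (ins_Hd _ _ n c' ltac:(lia)) e He).
  - intro HS. apply oapp_lt, ins_dec; [lia|lia|exact HS].
Qed.
(** Between two sparse points the ordinal of the chain is kept and only the filler descends. At the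
    next point the chain descends, which by [app_lt] pays for restarting the filler. *)
Lemma fill_chain k : forall xi, Chain (HighTower (S n) c) (sparse_list k) xi ->
  exists al, (forall R, R < sparse_point (S k) -> full_descent R al) /\ forall x, sparse_point k <= x -> al x = oapp xi (filler (sparse_point k) x).
Proof.
  induction k as [|k IH]; intros xi HC.
  - inversion HC as [? ? HG Hon|]; subst; [|match goal with H : Chain _ [] _ |- _ => inversion H end].
    exists (fun x => oapp xi (filler K x)). split; auto. intros R HR.
    assert (F := fun x Hx => fill_block 0 xi x HG Hon Hx). simpl in F, HR.
    split; [split|]; intros x Hx; destruct (F x ltac:(lia)) as (F1 & F2 & F3 & F4); auto. apply F4; lia.
  - assert (HG := Ch_G _ _ _ HC). inversion HC as [? ? ? ? E|? l ? xi0 HC0 _ Hon Hlt]; subst; [destruct k; discriminate|].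
    destruct (IH xi0 HC0) as (al & Hal & Ea). change (sparse_point k * 2 ^ sparse_point k) with (sparse_point (S k)) in *.
    exists (fun x => if sparse_point (S k) <=? x then oapp xi (filler (sparse_point (S k)) x) else al x). split.
    2:{ intros x Hx. apply Nat.leb_le in Hx. rewrite Hx. reflexivity. }
    intros R HR. assert (F := fun x Hx => fill_block (S k) xi x HG Hon Hx).
    split; [split|]; intros x Hx.
    + destruct (Nat.leb_spec (sparse_point (S k)) x) as [H|H].
      * destruct (F x ltac:(lia)) as (F1 & F2 & F3 & F4); auto.
      * apply (Hal x H). lia.
    + destruct (Nat.leb_spec (sparse_point (S k)) x) as [H|H].
      * assert (E : (sparse_point (S k) <=? S x) = true) by (apply Nat.leb_le; lia). rewrite E. destruct (F x ltac:(lia)) as (F1 & F2 & F3 & F4). apply F4; lia.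
      * destruct (Nat.leb_spec (sparse_point (S k)) (S x)) as [H'|H'].
        -- rewrite Ea; [|pose proof (ys_lt k); lia]. apply app_lt; auto.
           ++ apply (Good_high n c), (Ch_G _ _ _ HC0).
           ++ apply ins_low.
        -- apply (Hal (S x) H'). lia.
    + destruct (Nat.leb_spec (sparse_point (S k)) x) as [H|H].
      * destruct (F x ltac:(lia)) as (F1 & F2 & F3 & F4); auto.
      * apply (Hal x H). lia.
Qed.
Lemma spl_dec k : decreasing (sparse_list k) /\ forall b, In b (sparse_list k) -> K <= b <= sparse_point k.
Proof.
  induction k as [|k [IH1 IH2]].
  - simpl. split; [repeat constructor|]. intros b [<-|[]]; lia.
  - pose proof (ys_lt k) as H. cbn [sparse_list]. split.
    + constructor; auto. apply Forall_forall. intros x Hx. apply IH2 in Hx. lia.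
    + intros b [<-|Hb]; [pose proof (ys_ge (S k)); lia|apply IH2 in Hb; lia].
Qed.
Lemma spl_sparse k : forall b b', In b (sparse_list k) -> In b' (sparse_list k) -> b < b' -> b * 2 ^ b <= b'.
Proof.
  induction k as [|k IH]; intros b b'; cbn [sparse_list].
  - intros [<-|[]] [<-|[]]; lia.
  - intros [<-|Hb] [<-|Hb'] Hlt; try lia.
    + apply spl_dec in Hb'. pose proof (ys_lt k). lia.
    + apply spl_dec in Hb. simpl. assert (2 ^ b <= 2 ^ sparse_point k) by (apply Nat.pow_le_mono_r; lia). nia.
    + auto.
Qed.
(** [R] is the last number up to which a full descent exists. The sparse list is cut so that its
    next point exceeds [R + 1]; a chain on it would be filled to a full descent on [[K, R + 1]]. *)
Theorem sparse_large z : (forall al R, full_descent R al -> R < z) ->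
  exists R al A, full_descent R al /\ K <= R /\ A <> [] /\ decreasing A /\ (forall b, In b A -> K <= b <= R + 1) /\
    (forall b b', In b A -> In b' A -> b < b' -> b * 2 ^ b <= b') /\ large (S n) c A.
Proof.
  intro Hz.
  assert (H0 : exists al, full_descent K al).
  { exists (fun _ => OZero). repeat split; simpl; auto; lia. }
  assert (Hm : exists R, K <= R /\ (exists al, full_descent R al) /\ ~ exists al, full_descent (S R) al).
  { apply NNPP; intro Hn. assert (G : forall i, exists al, full_descent (K + i) al).
    { induction i as [|i IH]; [rewrite Nat.add_0_r; auto|]. apply NNPP; intro H. apply Hn. exists (K + i). rewrite Nat.add_succ_r in H. split; [lia|auto]. }
    destruct (G z) as [al Hal]. apply Hz in Hal. lia. }
  destruct Hm as (R & HKR & [al Hal] & Hmax).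
  assert (Hk : exists k, sparse_point k <= S R < sparse_point (S k)).
  { apply NNPP; intro Hn. assert (G : forall k, sparse_point k <= S R). { induction k; [simpl; lia|]. destruct (le_lt_dec (sparse_point (S k)) (S R)); auto. exfalso; eauto. }
    specialize (G (S (S R))). pose proof (ys_ge (S (S R))). lia. }
  destruct Hk as [k Hk]. exists R, al, (sparse_list k). repeat split; auto; try apply Hal; auto.
  - destruct k; simpl; congruence.
  - apply spl_dec.
  - apply spl_dec in H; lia.
  - apply spl_dec in H; lia.
  - apply spl_sparse.
  - intros [xi HC]. apply fill_chain in HC. destruct HC as (al' & Hal' & _). apply Hmax. exists al'. apply Hal'. lia.
Qed.
End Fill.

(** * The colouring *)

Fixpoint coef (a e : ord) : nat :=
  match a with OZero => 0 | OCons b n g => match ocmp b e with Datatypes.Eq => S n | _ => coef g e end end.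
(** The largest exponent at which the coefficients of [a] and [b] differ, and 0 if [a = b]. *)
Fixpoint delta (a b : ord) : ord :=
  match a, b with
  | OZero, OZero => OZero
  | OZero, OCons e _ _ | OCons e _ _, OZero => e
  | OCons e n g, OCons e' n' g' =>
      match ocmp e e' with
      | Datatypes.Lt => e'
      | Datatypes.Gt => e
      | Datatypes.Eq => if n =? n' then delta g g' else e
      end
  end.
Lemma coef_in a e : 0 < coef a e -> In e (exponents a).
Proof.
  induction a as [|b _ n g IH]; simpl; [lia|]. destruct (ocmp b e) eqn:E; auto. apply ocmp_eq in E; auto.
Qed.
Lemma coef_on a e : coef a e <= ord_norm a.
Proof. induction a as [|b _ n g IH]; simpl; [lia|]. destruct ocmp; lia. Qed.
Lemma coef_hi a b e : cnf a -> olt a (omega_pow b) -> ole b e -> coef a e = 0.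
Proof.
  intros Hc H He. destruct (coef a e) eqn:E; auto. exfalso. assert (Hi : In e (exponents a)) by (apply coef_in; lia).
  eapply exps_lt in Hi; eauto. apply (olt_irr b). eapply ole_lt_trans; eauto.
Qed.
Lemma coef_hd e n g : coef (OCons e n g) e = S n.
Proof. simpl. rewrite ocmp_refl. auto. Qed.
Lemma coef_tl e n g x : olt x e \/ olt e x -> coef (OCons e n g) x = coef g x.
Proof. simpl. destruct (ocmp e x) eqn:E; auto. apply ocmp_eq in E; subst. intros [H|H]; destruct (olt_irr _ H). Qed.
Lemma coef_above e n g x : cnf (OCons e n g) -> olt e x -> coef (OCons e n g) x = 0.
Proof. intros Hc H. apply coef_hi with (b := x); auto; [apply lt_owp; auto|right; auto]. Qed.
Lemma delta_sym a : forall b, delta a b = delta b a.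
Proof.
  induction a as [|e _ n g IH]; intros [|e' n' g']; simpl; auto. rewrite (ocmp_opp e e').
  destruct (ocmp e e') eqn:E; simpl; auto. apply ocmp_eq in E; subst. rewrite (Nat.eqb_sym n' n). destruct (n =? n'); auto.
Qed.
Lemma delta_spec a : forall b, cnf a -> cnf b -> olt a b ->
  coef a (delta a b) < coef b (delta a b) /\ forall e, olt (delta a b) e -> coef a e = coef b e.
Proof.
  induction a as [|e _ n g IH]; intros [|e' n' g'] Ha Hb H; try (destruct (olt_0 _ H)).
  - cbn [delta]. rewrite coef_hd. split; [simpl; lia|]. intros x Hx. rewrite coef_above; auto.
  - apply ocons_lt in H. cbn [delta]. destruct H as [H|(-> & H)].
    + assert (E : ocmp e e' = Datatypes.Lt) by exact H. rewrite E. rewrite coef_hd, coef_above; auto. split; [lia|].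
      intros x Hx. rewrite !coef_above; auto. eapply olt_trans; eauto.
    + rewrite ocmp_refl. destruct H as [H|(-> & H)].
      * destruct (Nat.eqb_spec n n'); [lia|]. rewrite !coef_hd. split; [lia|]. intros x Hx. rewrite !coef_above; auto.
      * rewrite Nat.eqb_refl. destruct Ha as (He & Hg & Hge). destruct Hb as (_ & Hg' & Hge').
        destruct (IH g' Hg Hg' H) as [H1 H2].
        assert (Hd : olt (delta g g') e') by (apply (exps_lt g' e' Hg' Hge'), coef_in; lia).
        rewrite !coef_tl; auto. split; auto. intros x Hx. simpl. destruct ocmp; auto.
Qed.
Lemma delta_eq a : delta a a = OZero.
Proof. induction a; simpl; auto. rewrite ocmp_refl, Nat.eqb_refl; auto. Qed.
Lemma delta_in a b : cnf a -> cnf b -> olt a b -> In (delta a b) (exponents b).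
Proof. intros Ha Hb H. apply coef_in. pose proof (proj1 (delta_spec a b Ha Hb H)). lia. Qed.
Lemma delta_or a b : cnf a -> cnf b -> a <> b -> In (delta a b) (exponents a) \/ In (delta a b) (exponents b).
Proof.
  intros Ha Hb H. destruct (olt_total a b) as [K|[K|K]]; [right; apply delta_in; auto|congruence|].
  left. rewrite delta_sym. apply delta_in; auto.
Qed.
Lemma Hd_delta k c a b : TowerOrd (S k) c a -> TowerOrd (S k) c b -> TowerOrd k c (delta a b).
Proof.
  intros [Ha Ea] [Hb Eb]. destruct (classic (a = b)) as [->|H]; [rewrite delta_eq; apply Hd_0|].
  destruct (delta_or a b Ha Hb H) as [K|K]; [exact (proj1 (allexp_in _ _) Ea _ K)|exact (proj1 (allexp_in _ _) Eb _ K)].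
Qed.

Definition cmp_code (c : comparison) : nat := match c with Datatypes.Eq => 0 | Datatypes.Lt => 1 | Datatypes.Gt => 2 end.
Fixpoint deltas (l : list ord) : list ord :=
  match l with a :: t => match t with b :: _ => delta a b :: deltas t | [] => [] end | [] => [] end.
Definition nat_value (a : ord) : nat := match a with OZero => 0 | OCons _ m _ => S m end.
(** If this is constant along the windows of a sequence, each iterated difference sequence keeps the
    direction of its first step, and the last one, which consists of finite ordinals, is
    constant. *)
Fixpoint kappa (n : nat) (l : list ord) : nat :=
  match n with
  | O => nat_value (hd OZero l)
  | S n => cmp_code (ocmp (hd OZero l) (hd OZero (tl l))) + 3 * kappa n (deltas l)
  end.
Definition window {T} (f : nat -> T) (i m : nat) : list T := map f (seq i m).
Lemma dl_win (a : nat -> ord) m : forall i, deltas (window a i (S m)) = window (fun i => delta (a i) (a (S i))) i m.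
Proof.
  induction m as [|m IH]; intro i; [reflexivity|]. specialize (IH (S i)). unfold window in *. cbn [seq map] in *.
  change (deltas (a i :: a (S i) :: map a (seq (S (S i)) m))) with (delta (a i) (a (S i)) :: deltas (a (S i) :: map a (seq (S (S i)) m))).
  rewrite IH. reflexivity.
Qed.
Lemma kap_S n a i : kappa (S n) (window a i (S (S n))) = cmp_code (ocmp (a i) (a (S i))) + 3 * kappa n (window (fun i => delta (a i) (a (S i))) i (S n)).
Proof. cbn [kappa]. rewrite dl_win. reflexivity. Qed.
Lemma cn_lt c : cmp_code c < 3. Proof. destruct c; simpl; lia. Qed.
Lemma cn_inj c c' : cmp_code c = cmp_code c' -> c = c'. Proof. destruct c, c'; simpl; congruence. Qed.
Lemma natv_inj c a b : TowerOrd 0 c a -> TowerOrd 0 c b -> nat_value a = nat_value b -> a = b.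
Proof. intros (m & _ & ->) (m' & _ & ->). destruct m, m'; simpl; congruence. Qed.
Definition kappa_const n (a : nat -> ord) M := forall i, i < M -> kappa n (window a i (S n)) = kappa n (window a (S i) (S n)).
Lemma kconst_S n a M : kappa_const (S n) a M ->
  (forall i, i <= M -> ocmp (a i) (a (S i)) = ocmp (a 0) (a 1)) /\ kappa_const n (fun i => delta (a i) (a (S i))) M.
Proof.
  intro H. assert (K : forall i, i < M -> ocmp (a i) (a (S i)) = ocmp (a (S i)) (a (S (S i))) /\
     kappa n (window (fun i => delta (a i) (a (S i))) i (S n)) = kappa n (window (fun i => delta (a i) (a (S i))) (S i) (S n))).
  { intros i Hi. specialize (H i Hi). rewrite !kap_S in H.
    pose proof (cn_lt (ocmp (a i) (a (S i)))). pose proof (cn_lt (ocmp (a (S i)) (a (S (S i))))).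
    split; [apply cn_inj|]; lia. }
  split.
  - induction i as [|i IH]; intro Hi; auto. rewrite <- IH; [|lia]. symmetry. apply K; lia.
  - intros i Hi. apply K; auto.
Qed.
Lemma kconst_eq c n a M : (forall i, TowerOrd n c (a i)) -> kappa_const n a M -> n = 0 \/ a 0 = a 1 -> forall i, i <= M -> a i = a 0.
Proof.
  intros Ha HK Hor i. induction i as [|i IH]; intro Hi; auto. rewrite <- IH; [|lia].
  destruct n as [|n].
  - apply (natv_inj c); auto. symmetry. apply (HK i); lia.
  - destruct Hor as [?|E]; [discriminate|]. apply kconst_S in HK. destruct HK as [HK _]. specialize (HK i ltac:(lia)).
    rewrite E, ocmp_refl in HK. apply ocmp_eq in HK; auto.
Qed.
(* If [kappa] is constant then so is the direction of each iterated sequence of differences.  Either all norms are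
   bounded by [N], or the sequence descends from a bounded element; both pass to the differences, and when the
   differences stop changing a coefficient bounded by [N] is strictly monotone. *)
Lemma kappa_const_bound c n : forall a N M, (forall i, TowerOrd n c (a i)) -> kappa_const n a M -> a 0 <> a 1 ->
  ((olt (a 1) (a 0) /\ ord_norm (a 0) <= N) \/ (forall i, i <= M + 1 -> ord_norm (a i) <= N)) -> M <= N + n.
Proof.
  induction n as [|n IH]; intros a N M Ha HK Hne Hor.
  - destruct M as [|M]; [lia|]. exfalso. apply Hne. symmetry. apply (kconst_eq c 0 a (S M)); auto; lia.
  - apply kconst_S in HK. destruct HK as [HC HK]. set (D := fun i => delta (a i) (a (S i))) in *.
    assert (Hcn : forall i, cnf (a i)) by (intro i; apply (Hd_cnf (S n) c); auto).
    assert (HD : forall i, TowerOrd n c (D i)) by (intro; apply Hd_delta; auto).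
    assert (H0N : ord_norm (a 0) <= N) by (destruct Hor as [[_ ?]|H]; auto; apply H; lia).
    destruct (classic (forall i, i <= M -> D i = D 0)) as [Hcon|Hncon].
    (* If the difference is always [D 0], the coefficient at this one exponent moves strictly in one
       direction at every step, between 0 and [N]. *)
    + enough (M <= N) by lia. destruct (olt_total (a 0) (a 1)) as [H|[H|H]]; [|congruence|].
      * assert (HU : forall i, i <= M -> i <= coef (a i) (D 0)).
        { induction i as [|i IHi]; intro Hi; [lia|]. specialize (IHi ltac:(lia)).
          assert (Hlt : olt (a i) (a (S i))) by (unfold olt; rewrite HC; [exact H|lia]).
          pose proof (proj1 (delta_spec _ _ (Hcn i) (Hcn (S i)) Hlt)) as K. fold (D i) in K. rewrite Hcon in K; lia. }
        specialize (HU M ltac:(lia)). pose proof (coef_on (a M) (D 0)).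
        destruct Hor as [[Hlt _]|Hor]; [exfalso; apply (olt_irr (a 0)); eapply olt_trans; eauto|]. specialize (Hor M ltac:(lia)). lia.
      * assert (HU : forall i, i <= M + 1 -> i + coef (a i) (D 0) <= coef (a 0) (D 0)).
        { induction i as [|i IHi]; intro Hi; [lia|]. specialize (IHi ltac:(lia)).
          assert (Hlt : olt (a (S i)) (a i)).
          { unfold olt. rewrite ocmp_opp, HC; [|lia]. rewrite ocmp_opp, H. reflexivity. }
          pose proof (proj1 (delta_spec _ _ (Hcn (S i)) (Hcn i) Hlt)) as K. rewrite delta_sym in K. fold (D i) in K. rewrite Hcon in K; lia. }
        specialize (HU (M + 1) ltac:(lia)). pose proof (coef_on (a 0) (D 0)). lia.
    + destruct M as [|M]; [lia|].
      assert (Hn0 : n <> 0 /\ D 0 <> D 1).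
      { split; intro E; apply Hncon; apply (kconst_eq c n D (S M)); auto. }
      destruct Hn0 as [Hn0 HD01].
      enough (M <= N + n) by lia. apply (IH D N M); auto; [intros i Hi; apply HK; lia|].
      destruct Hor as [[Hlt _]|Hor].
      * assert (Hdec : forall i, i <= S M -> olt (a (S i)) (a i)).
        { intros i Hi. unfold olt. rewrite ocmp_opp, HC; [|lia]. rewrite ocmp_opp, Hlt. reflexivity. }
        assert (Hin : forall i, i <= S M -> In (D i) (exponents (a i))).
        { intros i Hi. unfold D. rewrite delta_sym. apply delta_in; auto. }
        destruct (olt_total (D 0) (D 1)) as [H|[H|H]]; [|congruence|].
        (* The sequence descends while its differences increase. Thus [D i] lies above all earlier
           differences, the coefficient at [D i] is the same in [a i] as in [a 0], and [D i] is an
           exponent of the bounded element [a 0]. *)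
        -- right. intros i Hi. enough (In (D i) (exponents (a 0))) by (etransitivity; [apply on_exps; eauto|lia]).
           destruct n as [|n]; [congruence|]. apply kconst_S in HK. destruct HK as [HDC _].
           assert (Hasc : forall i m, i <= S M -> m < i -> olt (D m) (D i)).
           { induction i0 as [|i0 IHi]; intros m Hi0 Hm; [lia|]. assert (Hl : olt (D i0) (D (S i0))) by (unfold olt; rewrite HDC; [exact H|lia]).
             destruct (Nat.eq_dec m i0) as [->|]; auto. eapply olt_trans; [apply IHi; lia|auto]. }
           assert (Hco : forall m, m <= i -> coef (a (i - m)) (D i) = coef (a i) (D i)).
           { induction m as [|m IHm]; intro Hm; [f_equal; f_equal; lia|]. rewrite <- IHm; [|lia].
             replace (i - m) with (S (i - S m)) by lia. symmetry.
             apply (delta_spec _ _ (Hcn (S (i - S m))) (Hcn (i - S m))); [apply Hdec; lia|].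
             rewrite delta_sym. apply Hasc; lia. }
           apply coef_in. replace 0 with (i - i) at 2 by lia. rewrite Hco; [|lia].
           pose proof (proj1 (delta_spec _ _ (Hcn (S i)) (Hcn i) (Hdec i ltac:(lia)))) as K. rewrite delta_sym in K. fold (D i) in K. lia.
        -- left. split; auto. etransitivity; [apply on_exps, Hin; lia|lia].
      * right. intros i Hi. assert (Hai : a i <> a (S i)).
        { intro E. apply Hne. specialize (HC i ltac:(lia)). rewrite E, ocmp_refl in HC. symmetry in HC. apply ocmp_eq in HC; auto. }
        destruct (delta_or _ _ (Hcn i) (Hcn (S i)) Hai) as [K|K]; apply on_exps in K; fold (D i) in K;
        [specialize (Hor i ltac:(lia))|specialize (Hor (S i) ltac:(lia))]; lia.
Qed.
Lemma dl_len l : length (deltas l) = length l - 1.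
Proof. induction l as [|a [|b t] IH]; auto. change (S (length (deltas (b :: t))) = S (S (length t)) - 1). rewrite IH. simpl. lia. Qed.
Lemma dl_Hd k c l : (forall x, In x l -> TowerOrd (S k) c x) -> forall x, In x (deltas l) -> TowerOrd k c x.
Proof.
  induction l as [|a [|b t] IH]; intros Hl x; [intros []|intros []|]. change (In x (delta a b :: deltas (b :: t)) -> TowerOrd k c x).
  intros [<-|Hx]; [apply Hd_delta; apply Hl; simpl; auto|]. apply IH; auto. intros y Hy; apply Hl; simpl in *; auto.
Qed.
Lemma kap_lt c n : forall l, length l = S n -> (forall x, In x l -> TowerOrd n c x) -> kappa n l < 3 ^ n * (c + 1).
Proof.
  induction n as [|n IH]; intros l Hl Hx.
  - destruct l as [|a l]; [discriminate|]. destruct (Hx a (or_introl eq_refl)) as (m & Hm & ->). destruct m; simpl; lia.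
  - cbn [kappa]. pose proof (cn_lt (ocmp (hd OZero l) (hd OZero (tl l)))). rewrite Nat.pow_succ_r'.
    enough (kappa n (deltas l) < 3 ^ n * (c + 1)) by nia. apply IH; [rewrite dl_len; lia|]. apply dl_Hd; auto.
Qed.

(** * Ordinals of small norm from base expansions *)

Fixpoint tower (m u : nat) : nat := match m with O => u | S m => 2 ^ tower m u end.
Lemma tw_ge m u : u <= tower m u.
Proof. induction m; simpl; auto. assert (tower m u < 2 ^ tower m u) by (apply Nat.pow_gt_lin_r; lia). lia. Qed.
Lemma tw_mono m u v : u <= v -> tower m u <= tower m v.
Proof. intro H. induction m; simpl; auto. apply Nat.pow_le_mono_r; lia. Qed.

Definition descending_list (L : list ord) := StronglySorted (fun x y => olt y x) L.
(* Numbers below [tower m ((j + 1)^k)] inject into ordinals of norm at most [j]: write them in base [j + 1] or 2 and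
   read the digit positions, recursively, as exponents. *)
Section Expansion.
Variable B : nat.
Hypothesis HB : 1 <= B.
Fixpoint expansion (L : list ord) (u : nat) : ord :=
  match L with [] => OZero | e :: L' => add_term e (u / B ^ length L') (expansion L' (u mod B ^ length L')) end.
Lemma mk_exps L : forall u, incl (exponents (expansion L u)) L.
Proof.
  induction L as [|e L IH]; intros u x Hx; simpl in *; auto. apply ct_in in Hx. destruct Hx as [->|Hx]; auto. right; eapply IH; eauto.
Qed.
Lemma pow_pos k : B ^ k <> 0. Proof. apply Nat.pow_nonzero; lia. Qed.
Lemma mk_owp L u e : (forall x, In x L -> olt x e) -> olt (expansion L u) (omega_pow e).
Proof.
  intro H. assert (K := mk_exps L u). destruct (expansion L u) as [|x n g]; [apply olt_0c|]. apply lt_owp, H, K. simpl; auto.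
Qed.
Lemma mk_spec N L : B - 1 <= N -> descending_list L -> (forall e, In e L -> cnf e /\ ord_norm e <= N) -> forall u, u < B ^ length L ->
  cnf (expansion L u) /\ ord_norm (expansion L u) <= N.
Proof.
  intros HN. induction 1 as [|e L HL IH Hf]; intros HE u Hu; simpl; [split; auto; lia|].
  rewrite Forall_forall in Hf.
  destruct (IH (fun x Hx => HE x (or_intror Hx)) (u mod B ^ length L)) as [H1 H2]; [apply Nat.mod_upper_bound, pow_pos|].
  assert (Hq : u / B ^ length L < B) by (apply Nat.Div0.div_lt_upper_bound; simpl in Hu; nia).
  destruct (HE e (or_introl eq_refl)) as [He Hon].
  destruct (ct_cases e (u / B ^ length L) (expansion L (u mod B ^ length L))) as [[-> ->]|(p & Ep & ->)]; [auto|].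
  split; [|simpl; lia]. split; auto. split; auto. apply mk_owp; auto.
Qed.
Lemma mk_lt L : descending_list L -> forall u v, u < v -> v < B ^ length L -> olt (expansion L u) (expansion L v).
Proof.
  induction 1 as [|e L HL IH Hf]; intros u v Huv Hv; simpl in *; [lia|]. rewrite Forall_forall in Hf.
  pose proof (pow_pos (length L)) as HP. set (P := B ^ length L) in *.
  pose proof (Nat.div_mod u P HP). pose proof (Nat.div_mod v P HP).
  pose proof (Nat.mod_upper_bound u P HP). pose proof (Nat.mod_upper_bound v P HP).
  destruct (Nat.lt_trichotomy (u / P) (v / P)) as [K|[K|K]]; [| |nia].
  - apply ct_lt_n; auto. apply mk_owp; auto.
  - rewrite K. apply ct_lt, IH; auto. nia.
Qed.
End Expansion.

Section Levels.
Variables (k j : nat).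
Hypothesis (Hk : 1 <= k) (Hkj : k <= j + 1) (Hj : 1 <= j).
Definition digit_base (m : nat) : nat := match m with O => j + 1 | _ => 2 end.
(** Every level is listed in descending order, because [expansion] takes the head of its list as the
    leading exponent. The list of level [m] serves as the exponents for level [m + 1]. *)
Fixpoint tower_level (m : nat) : list ord :=
  match m with
  | O => map nat_ord (rev (seq 0 k))
  | S i => map (expansion (digit_base i) (tower_level i)) (rev (seq 0 (digit_base i ^ length (tower_level i))))
  end.
Lemma lev_len m : length (tower_level (S m)) = tower m ((j + 1) ^ k).
Proof.
  assert (E : forall i, length (tower_level (S i)) = digit_base i ^ length (tower_level i)) by (intro; cbn [tower_level]; rewrite length_map, length_rev, length_seq; auto).
  induction m as [|m IH]; rewrite E; [|rewrite IH; reflexivity]. simpl. rewrite length_map, length_rev, length_seq. reflexivity.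
Qed.
Lemma base_ge m : 1 <= digit_base m /\ digit_base m - 1 <= j. Proof. destruct m; simpl; lia. Qed.
Lemma desc_map (f : nat -> ord) N : (forall u v, u < v -> v < N -> olt (f u) (f v)) -> descending_list (map f (rev (seq 0 N))).
Proof.
  induction N as [|N IH]; intro H; [constructor|]. rewrite seq_S, rev_app_distr. simpl. constructor.
  - apply IH. intros u v Hu Hv. apply H; lia.
  - apply Forall_forall. intros x Hx. apply in_map_iff in Hx. destruct Hx as (y & <- & Hy). apply in_rev, in_seq in Hy. apply H; lia.
Qed.
Lemma lev_spec c m : k <= c + 1 -> descending_list (tower_level m) /\ forall e, In e (tower_level m) -> TowerOrd m c e /\ ord_norm e <= j.
Proof.
  intro Hc. induction m as [|m [IH1 IH2]]; cbn [tower_level].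
  - split.
    + apply desc_map. intros u v Hu Hv. destruct v as [|v]; [lia|]. destruct u as [|u]; simpl; [apply olt_0c|]. apply ocons_lt. right; split; auto. left; lia.
    + intros e He. apply in_map_iff in He. destruct He as (u & <- & Hu). apply in_rev, in_seq in Hu. split; [exists u; split; auto; lia|].
      destruct u; simpl; lia.
  - destruct (base_ge m) as [Hb Hb']. split.
    + apply desc_map. apply mk_lt; auto.
    + intros e He. apply in_map_iff in He. destruct He as (u & <- & Hu). apply in_rev, in_seq in Hu.
      assert (K := mk_spec (digit_base m) Hb j (tower_level m) Hb' IH1). destruct (K (fun e He => conj (Hd_cnf _ _ _ (proj1 (IH2 e He))) (proj2 (IH2 e He))) u) as [K1 K2]; [lia|].
      split; auto. split; auto. apply allexp_in. intros e He. apply mk_exps in He. apply IH2; auto.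
Qed.
Definition nu_ord (m x : nat) : ord := expansion (digit_base m) (tower_level m) x.
Lemma nu_spec c m x : k <= c + 1 -> x < tower m ((j + 1) ^ k) -> TowerOrd (S m) c (nu_ord m x) /\ ord_norm (nu_ord m x) <= j.
Proof.
  intros Hc Hx. apply (lev_spec c (S m) Hc). cbn [tower_level]. apply in_map. rewrite <- in_rev. apply in_seq.
  rewrite <- lev_len in Hx. cbn [tower_level] in Hx. rewrite length_map, length_rev, length_seq in Hx. lia.
Qed.
Lemma nu_lt m x y : x < y -> y < tower m ((j + 1) ^ k) -> olt (nu_ord m x) (nu_ord m y).
Proof.
  intros Hx Hy. apply mk_lt; auto; [apply base_ge|apply (lev_spec k); lia|].
  rewrite <- lev_len in Hy. cbn [tower_level] in Hy. rewrite length_map, length_rev, length_seq in Hy. auto.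
Qed.
End Levels.

(** * Iterated logarithms and roots *)

Fixpoint iter_log_rel (m x y : nat) : Prop :=
  match m with
  | O => y = x
  | S m => exists z, iter_log_rel m x z /\ ((z = 0 /\ y = 0) \/ (2 ^ y <= z /\ z < 2 ^ (y + 1)))
  end.
Lemma ilog_tw m : forall p u x y, tower (m + p) u <= x -> iter_log_rel m x y -> tower p u <= y.
Proof.
  induction m as [|m IH]; simpl; intros p u x y Hx H; [subst; auto|]. destruct H as (z & Hz & H).
  replace (2 ^ tower (m + p) u) with (tower (m + S p) u) in Hx by (rewrite Nat.add_succ_r; auto).
  specialize (IH (S p) u x z Hx Hz). simpl in IH. assert (K : 2 ^ tower p u <> 0) by (apply Nat.pow_nonzero; lia).
  destruct H as [[-> _]|[_ H]]; [lia|]. assert (tower p u < y + 1); [|lia]. apply (Nat.pow_lt_mono_r_iff 2); lia.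
Qed.
Lemma root_bound K n j e l y : 1 <= K -> 2 ^ K <= j -> 2 * n + 2 <= j -> e < K -> j ^ (K + 1) <= l ->
  (e = 0 /\ y = l) \/ (0 < e /\ l < (y + 1) ^ e) -> j + 2 * n + 1 <= y.
Proof.
  intros HK HJ Hn He Hl H. assert (Hj : 2 <= j) by (destruct K; [lia|]; simpl in HJ; assert (2 ^ K <> 0) by (apply Nat.pow_nonzero; lia); lia).
  destruct H as [[_ ->]|[He0 H]].
  - assert (j ^ 2 <= j ^ (K + 1)) by (apply Nat.pow_le_mono_r; lia). simpl in H. nia.
  - destruct (le_lt_dec (j + 2 * n + 1) y) as [|Hy]; auto. exfalso.
    assert (H1 : (y + 1) ^ e <= (2 * j) ^ e) by (apply Nat.pow_le_mono_l; lia). rewrite Nat.pow_mul_l in H1.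
    assert (H2 : 2 ^ e <= j) by (etransitivity; [|apply HJ]; apply Nat.pow_le_mono_r; lia).
    assert (H3 : j ^ (S e) <= j ^ (K + 1)) by (apply Nat.pow_le_mono_r; lia). rewrite Nat.pow_succ_r' in H3.
    assert (j ^ e <> 0) by (apply Nat.pow_nonzero; lia). nia.
Qed.

Section Colouring.
Variables (m K c R : nat) (al : nat -> ord).
Let n := S m.
Hypothesis (HK : 2 <= K) (Hc : K <= c) (Hal : full_descent m c K R al).
(** The summands provide the two lower bounds on [j] in [root_bound]. *)
Definition block_start := 2 ^ K + 2 * n + 2.
Definition start := tower m (block_start ^ (K + 1)).
(** The slow growing function. The upper end of block [j] is the range in which [nu_ord] assigns
    distinct ordinals of norm at most [j]; the lower end keeps the [m]-fold logarithm at least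
    [j^(K + 1)]. *)
Definition block_index (x : nat) : nat := epsilon (inhabits 0) (fun j => block_start <= j /\ tower m (j ^ (K + 1)) <= x < tower m ((j + 1) ^ (K + 1))).
Lemma jf_spec x : start <= x -> block_start <= block_index x /\ tower m (block_index x ^ (K + 1)) <= x < tower m ((block_index x + 1) ^ (K + 1)).
Proof.
  intro Hx. apply (epsilon_spec (inhabits 0) (fun j => block_start <= j /\ tower m (j ^ (K + 1)) <= x < tower m ((j + 1) ^ (K + 1)))).
  apply NNPP; intro Hn. assert (G : forall i, tower m ((block_start + i) ^ (K + 1)) <= x).
  { induction i as [|i IH]; [rewrite Nat.add_0_r; exact Hx|]. destruct (le_lt_dec (tower m ((block_start + S i) ^ (K + 1))) x); auto.
    exfalso. apply Hn. exists (block_start + i). replace (block_start + i + 1) with (block_start + S i) by lia. repeat split; auto; lia. }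
  specialize (G (S x)). pose proof (tw_ge m ((block_start + S x) ^ (K + 1))). pose proof (Nat.pow_le_mono_r (block_start + S x) 1 (K + 1) ltac:(lia) ltac:(lia)). rewrite Nat.pow_1_r in *. lia.
Qed.
Lemma jf_mono x y : start <= x -> x <= y -> block_index x <= block_index y.
Proof.
  intros Hx Hy. destruct (jf_spec x Hx) as (_ & H1 & _). destruct (jf_spec y ltac:(lia)) as (_ & _ & H2).
  destruct (le_lt_dec (block_index x) (block_index y)) as [|H]; auto. exfalso.
  assert (tower m ((block_index y + 1) ^ (K + 1)) <= tower m (block_index x ^ (K + 1))) by (apply tw_mono, Nat.pow_le_mono_l; lia). lia.
Qed.
Lemma jf_le x : start <= x -> block_start <= block_index x <= x.
Proof.
  intro Hx. destruct (jf_spec x Hx) as (H0 & H1 & _). split; auto.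
  pose proof (tw_ge m (block_index x ^ (K + 1))). pose proof (Nat.pow_le_mono_r (block_index x) 1 (K + 1) ltac:(unfold block_start in *; lia) ltac:(lia)). rewrite Nat.pow_1_r in *. lia.
Qed.
Lemma K_J : K + 2 <= block_start. Proof. unfold block_start. assert (K < 2 ^ K) by (apply Nat.pow_gt_lin_r; lia). lia. Qed.
Definition block_ord (x : nat) : ord := al (block_index x).
Definition element_ord (x : nat) : ord := nu_ord (K + 1) (block_index x) m x.
Definition kappa_max := 3 ^ n * (c + 1).
(** The lowest digit is constant along a weakly homogeneous set. Either its points share a block and
    [element_ord] separates them, or the block changes from point to point and [block_ord] follows
    the descent [al]. *)
Definition tuple_colour (xs : list nat) : nat :=
  (if block_index (hd 0 xs) =? block_index (hd 0 (tl xs)) then 0 else 1) + 2 * (kappa n (map block_ord xs) + kappa_max * kappa n (map element_ord xs)).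
Lemma A1_Hd x : start <= x <= R -> TowerOrd n c (block_ord x).
Proof. intro H. apply Hal. pose proof (jf_le x ltac:(lia)). pose proof K_J. lia. Qed.
Lemma A2_Hd x : start <= x -> TowerOrd n c (element_ord x) /\ ord_norm (element_ord x) <= block_index x.
Proof. intro H. pose proof (jf_le x H). pose proof K_J. apply nu_spec; try lia. apply jf_spec; auto. Qed.
Lemma col_lt xs : length xs = S n -> (forall x, In x xs -> start <= x <= R) -> tuple_colour xs < 2 * (kappa_max * kappa_max) + 1.
Proof.
  intros Hl Hx. unfold tuple_colour.
  assert (H1 : kappa n (map block_ord xs) < kappa_max).
  { apply kap_lt; [rewrite length_map; auto|]. intros y Hy. apply in_map_iff in Hy. destruct Hy as (x & <- & Hi). apply A1_Hd; auto. }
  assert (H2 : kappa n (map element_ord xs) < kappa_max).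
  { apply kap_lt; [rewrite length_map; auto|]. intros y Hy. apply in_map_iff in Hy. destruct Hy as (x & <- & Hi). apply A2_Hd; apply Hx; auto. }
  destruct (_ =? _); nia.
Qed.
Lemma map_win {T U} (f : nat -> T) (g : T -> U) i l : map g (window f i l) = window (fun i => g (f i)) i l.
Proof. unfold window. rewrite map_map. reflexivity. Qed.
Lemma col_wh h L : (forall i, i < L -> start <= h i <= R) -> (forall i, S i < L -> h i < h (S i)) ->
  (forall i, i + S n < L -> tuple_colour (window h i (S n)) = tuple_colour (window h (S i) (S n))) -> 0 < L -> L <= block_index (h 0) + 2 * n + 1.
Proof.
  intros Hh Hinc Hcol HL. destruct (le_lt_dec L (S n)) as [|HLn]; [lia|]. remember (L - 1 - n) as M eqn:EM.
  (* [kappa_const_bound] speaks of infinite sequences of ordinals, so the last point is repeated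
     forever. *)
  set (h' := fun i => if i <? L then h i else h (L - 1)).
  assert (Eh : forall i, i < L -> h' i = h i) by (intros i Hi; unfold h'; apply Nat.ltb_lt in Hi; rewrite Hi; auto).
  assert (Hh' : forall i, start <= h' i <= R).
  { intro i. unfold h'. destruct (i <? L) eqn:E; [apply Nat.ltb_lt in E; auto|apply Hh; lia]. }
  assert (Ew : forall i, i + n < L -> window h i (S n) = window h' i (S n)).
  { intros i Hi. apply map_ext_in. intros x Hx. apply in_seq in Hx. symmetry; apply Eh. lia. }
  set (a1 := fun i => block_ord (h' i)). set (a2 := fun i => element_ord (h' i)).
  assert (H1 : forall i, TowerOrd n c (a1 i)) by (intro; apply A1_Hd; auto).
  assert (H2 : forall i, TowerOrd n c (a2 i)) by (intro; apply A2_Hd, Hh').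
  assert (HX : forall i, kappa n (window a1 i (S n)) < kappa_max /\ kappa n (window a2 i (S n)) < kappa_max).
  { intro i. split; apply kap_lt; try (unfold window; rewrite length_map, length_seq; reflexivity);
    intros x Hx; apply in_map_iff in Hx; destruct Hx as (y & <- & _); auto. }
  assert (HC : forall i, i < M -> (block_index (h' i) =? block_index (h' (S i))) = (block_index (h' (S i)) =? block_index (h' (S (S i)))) /\
     kappa n (window a1 i (S n)) = kappa n (window a1 (S i) (S n)) /\ kappa n (window a2 i (S n)) = kappa n (window a2 (S i) (S n))).
  { intros i Hi. specialize (Hcol i ltac:(lia)). rewrite !Ew in Hcol by lia. unfold tuple_colour in Hcol. rewrite !map_win in Hcol.
    fold a1 a2 in Hcol. destruct (HX i), (HX (S i)).
    change (hd 0 (window h' i (S n))) with (h' i) in Hcol. change (hd 0 (tl (window h' i (S n)))) with (h' (S i)) in Hcol.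
    change (hd 0 (window h' (S i) (S n))) with (h' (S i)) in Hcol. change (hd 0 (tl (window h' (S i) (S n)))) with (h' (S (S i))) in Hcol.
    destruct (_ =? _), (_ =? _); (split; [try reflexivity; exfalso; lia|]); assert (E : kappa n (window a1 i (S n)) + kappa_max * kappa n (window a2 i (S n)) = kappa n (window a1 (S i) (S n)) + kappa_max * kappa n (window a2 (S i) (S n))) by lia;
    clear Hcol; destruct (Nat.lt_trichotomy (kappa n (window a2 i (S n))) (kappa n (window a2 (S i) (S n)))) as [?|[?|?]]; try nia. }
  assert (HJ : forall i, i <= M -> (block_index (h' i) =? block_index (h' (S i))) = (block_index (h' 0) =? block_index (h' 1))).
  { induction i as [|i IH]; intro Hi; auto. rewrite <- IH by lia. symmetry. apply HC; lia. }
  assert (E0 : h' 0 = h 0) by (apply Eh; lia). rewrite <- E0.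
  assert (Hlt : h' 0 < h' 1) by (rewrite !Eh by lia; apply Hinc; lia).
  (* This is [kappa_const_bound] with [N] the block index of the first point: inside one block it
     bounds all norms, and across blocks it bounds the norm of the first ordinal of the descent. *)
  enough (M <= block_index (h' 0) + n) by lia.
  destruct (Nat.eqb_spec (block_index (h' 0)) (block_index (h' 1))) as [E|E].
  - assert (Hall : forall i, i <= M + 1 -> block_index (h' i) = block_index (h' 0)).
    { induction i as [|i IH]; intro Hi; auto. rewrite <- IH by lia. symmetry. apply Nat.eqb_eq. apply HJ. lia. }
    apply (kappa_const_bound c n a2); auto.
    + intros i Hi. apply HC; auto.
    + unfold a2, element_ord. rewrite <- E. intro E2. apply (olt_irr (nu_ord (K + 1) (block_index (h' 0)) m (h' 0))). rewrite E2 at 2.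
      pose proof (jf_le (h' 0) (proj1 (Hh' 0))). pose proof K_J. apply nu_lt; try lia. rewrite E. apply jf_spec, Hh'.
    + right. intros i Hi. rewrite <- (Hall i Hi). apply A2_Hd, Hh'.
  - assert (Hd' : olt (a1 1) (a1 0)).
    { pose proof (jf_mono (h' 0) (h' 1) (proj1 (Hh' 0)) ltac:(lia)). pose proof (jf_le _ (proj1 (Hh' 0))). pose proof (jf_le _ (proj1 (Hh' 1))). pose proof K_J.
      pose proof (Hh' 1). destruct Hal as [Hs _]. unfold a1, block_ord.
      assert (G : forall i, block_index (h' 0) + S i <= R -> olt (al (block_index (h' 0) + S i)) (al (block_index (h' 0)))).
      { intros i Hi. eapply ole_lt_trans; [apply (seq_ole al (S (block_index (h' 0))) R); [apply (seq_sub _ _ _ _ _ Hs); lia|lia]|]. apply Hs. lia. }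
      replace (block_index (h' 1)) with (block_index (h' 0) + S (block_index (h' 1) - S (block_index (h' 0)))) by lia. apply G. lia. }
    apply (kappa_const_bound c n a1); auto.
    + intros i Hi. apply HC; auto.
    + intro E2. rewrite E2 in Hd'. apply (olt_irr _ Hd').
    + left. split; auto. unfold a1, block_ord. pose proof (jf_le _ (proj1 (Hh' 0))). pose proof K_J. pose proof (Hh' 0). destruct Hal as [[Hs _] _].
      destruct (Hs (block_index (h' 0)) ltac:(lia)). lia.
Qed.
Theorem colouring h L e l y : (forall i, i < L -> start <= h i <= R) -> (forall i, S i < L -> h i < h (S i)) ->
  (forall i, i + S n < L -> tuple_colour (window h i (S n)) = tuple_colour (window h (S i) (S n))) -> 0 < L ->
  e < K -> iter_log_rel m (h 0) l -> (e = 0 /\ y = l) \/ (0 < e /\ l < (y + 1) ^ e) -> L <= y.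
Proof.
  intros Hh Hi Hcol HL He Hl Hy. pose proof (col_wh h L Hh Hi Hcol HL).
  destruct (jf_spec (h 0)) as (H0 & H1 & _); [apply Hh; auto|]. unfold block_start in H0.
  enough (block_index (h 0) + 2 * n + 1 <= y) by lia. apply (root_bound K n (block_index (h 0)) e l); auto; try lia.
  apply (ilog_tw m 0 (block_index (h 0) ^ (K + 1)) (h 0)); auto. rewrite Nat.add_0_r. auto.
Qed.
End Colouring.

Close Scope bool_scope.

(** * Arithmetic in a model *)

(** The set variables are frozen by [as0]. Instances are arbitrary models of the theory, the
    standard numbers and the cut before its sets are adjoined. *)
Record arithM := {
  am :> model; as0 : nat -> sdom am; aN : nat; aN1 : 1 <= aN;
  aB : forall P, In P basic_axioms -> forall e, sat am e as0 (sentence P);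
  aI : forall A, sigma0 aN A -> forall e, sat am e as0 (induction A) }.

Definition mle {M : model} (x y : M) := mlt x (madd y m1).
Declare Scope m_scope. Delimit Scope m_scope with m.
Local Open Scope m_scope.
Notation "x + y" := (madd x y) : m_scope.
Notation "x * y" := (mmul x y) : m_scope.
Notation "x ^ y" := (mexp x y) : m_scope.
Notation "x < y" := (mlt x y) : m_scope.
Notation "x <= y" := (mle x y) : m_scope.
Notation "0" := mz : m_scope.
Notation "1" := m1 : m_scope.

Section TmVars.
Variable M : model.
Variable s0 : nat -> sdom M.
Lemma D0_le n t u : Tm M n t -> Tm M n u -> D0 M s0 n (fun g => t g <= u g).
Proof. intros; apply D0_lt; auto. apply Tm_add; auto. apply Tm_const. Qed.
Lemma D0_balle n t P : Tm M n t -> D0 M s0 (S n) (fun g => P (fst g) (snd g)) -> D0 M s0 n (fun g => forall y, y <= t g -> P g y).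
Proof. intros; apply (D0_ball M s0 n (fun g => t g + 1)); auto. apply Tm_add; auto. apply Tm_const. Qed.
Lemma D0_bexe n t P : Tm M n t -> D0 M s0 (S n) (fun g => P (fst g) (snd g)) -> D0 M s0 n (fun g => exists y, y <= t g /\ P g y).
Proof. intros; apply (D0_bex M s0 n (fun g => t g + 1)); auto. apply Tm_add; auto. apply Tm_const. Qed.
End TmVars.

Ltac tmw := match goal with
  | H : Tm ?M ?n ?t |- Tm _ _ (fun g => ?t (fst g)) => exact (Tm_fst M _ _ H)
  | H : Tm ?M ?n ?t |- Tm _ _ (fun g => ?t (fst (fst g))) => exact (Tm_fst M _ _ (Tm_fst M _ _ H))
  | H : Tm ?M ?n ?t |- Tm _ _ (fun g => ?t (fst (fst (fst g)))) => exact (Tm_fst M _ _ (Tm_fst M _ _ (Tm_fst M _ _ H)))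
  | H : Tm ?M ?n ?t |- Tm _ _ (fun g => ?t (fst (fst (fst (fst g))))) => exact (Tm_fst M _ _ (Tm_fst M _ _ (Tm_fst M _ _ (Tm_fst M _ _ H))))
  | H : Tm ?M ?n ?t |- Tm _ _ (fun g => ?t (fst (fst (fst (fst (fst g)))))) => exact (Tm_fst M _ _ (Tm_fst M _ _ (Tm_fst M _ _ (Tm_fst M _ _ (Tm_fst M _ _ H)))))
  end.
Ltac tmv k t := lazymatch k with O => fail | S ?k' => first [exact t | tmv k' uconstr:(Tm_fst _ _ _ t)] end.
Ltac tm := lazy beta; first
  [ assumption | apply Tm_const
  | tmv 25 uconstr:(Tm_snd _ _)
  | apply Tm_add; tm | apply Tm_mul; tm | apply Tm_exp; tm
  | tmw ].
Ltac ddh := fail.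
(* The order matters: [D0_imp] would also match negations. *)
Ltac dd := lazy beta; first
  [ assumption | apply D0_prop | ddh | apply D0_eq; tm | apply D0_le; tm | apply D0_lt; tm
  | apply D0_not; dd | apply D0_and; dd | apply D0_or; dd | apply D0_iff; dd
  | apply D0_balle; [tm|dd] | apply D0_bexe; [tm|dd]
  | apply D0_ball; [tm|dd] | apply D0_bex; [tm|dd]
  | apply D0_imp; dd ].

Section Arithmetic.
Variable A : arithM.
Implicit Types x y z : A.
Ltac ax k := let H := fresh in pose proof (aB A _ (nth_In basic_axioms (nth 0%nat basic_axioms (fun _ => Bot)) (n := k) (ltac:(simpl; lia))) (fun _ => 0)) as H;
  simpl in H; unfold sentence, Iff, And, Or, Not in H; simpl in H; first [exact H|idtac].
Lemma a_S0 x : x + 1 <> 0. Proof. revert x. ax 0%nat. Qed.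
Lemma a_SI x y : x + 1 = y + 1 -> x = y. Proof. revert x y. ax 1%nat. Qed.
Lemma a_add0 x : x + 0 = x. Proof. revert x. ax 2%nat. Qed.
Lemma a_addS x y : x + (y + 1) = (x + y) + 1. Proof. revert x y. ax 3%nat. Qed.
Lemma a_mul0 x : x * 0 = 0. Proof. revert x. ax 4%nat. Qed.
Lemma a_mulS x y : x * (y + 1) = x * y + x. Proof. revert x y. ax 5%nat. Qed.
Lemma a_lt0 x : ~ x < 0. Proof. revert x. ax 6%nat. Qed.
Lemma a_ltS x y : x < y + 1 <-> x < y \/ x = y.
Proof. revert x y. ax 7%nat. intros x y. specialize (H x y). destruct (classic (x < y)), (classic (x = y)), (classic (x < y + 1)); tauto. Qed.
Lemma a_exp0 x : x ^ 0 = 1. Proof. revert x. ax 8%nat. Qed.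
Lemma a_expS x y : x ^ (y + 1) = x * x ^ y. Proof. revert x y. ax 9%nat. Qed.

Lemma ind0 (P : A -> Prop) : D0 A (as0 A) 1 (fun g => P (snd g)) -> P 0 -> (forall x, P x -> P (x + 1)) -> forall x, P x.
Proof. apply (ind_D0 A (as0 A) (aN A) (aI A)). Qed.

Lemma p_add0 x : 0 + x = x.
Proof. revert x; apply ind0; [dd| |]. - apply a_add0. - intros x H. rewrite a_addS, H; auto. Qed.
Lemma p_addA x y z : x + (y + z) = x + y + z.
Proof. revert z; apply ind0; [dd| |]. - rewrite !a_add0; auto. - intros z H. rewrite !a_addS, H; auto. Qed.
Lemma p_addS x y : (x + 1) + y = (x + y) + 1.
Proof. revert y; apply ind0; [dd| |]. - rewrite !a_add0; auto. - intros z H. rewrite !a_addS, H; auto. Qed.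
Lemma p_addC x y : x + y = y + x.
Proof. revert y; apply ind0; [dd| |]. - rewrite a_add0, p_add0; auto. - intros z H. rewrite a_addS, p_addS, H; auto. Qed.
Lemma p_mul0 x : 0 * x = 0.
Proof. revert x; apply ind0; [dd| |]. - apply a_mul0. - intros x H. rewrite a_mulS, H, a_add0; auto. Qed.
Lemma p_mulSl x y : (x + 1) * y = x * y + y.
Proof.
  revert y; apply ind0; [dd| |]. - rewrite !a_mul0, a_add0; auto.
  - intros y H. rewrite !a_mulS, H. rewrite !a_addS. f_equal. rewrite <- !p_addA. f_equal. apply p_addC.
Qed.
Lemma p_mulC x y : x * y = y * x.
Proof. revert y; apply ind0; [dd| |]. - rewrite a_mul0, p_mul0; auto. - intros z H. rewrite a_mulS, p_mulSl, H; auto. Qed.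
Lemma p_mul1 x : 1 * x = x.
Proof. rewrite p_mulC. rewrite <- (p_add0 1) at 1. rewrite a_mulS, a_mul0. apply p_add0. Qed.
Lemma p_mulD x y z : (x + y) * z = x * z + y * z.
Proof.
  revert y; apply ind0; [dd| |]. - rewrite p_mul0, !a_add0; auto.
  - intros y H. rewrite a_addS, !p_mulSl, H, p_addA; auto.
Qed.
Lemma p_mulA x y z : x * (y * z) = x * y * z.
Proof.
  revert x; apply ind0; [dd| |]. - rewrite !p_mul0; auto.
  - intros x H. rewrite !p_mulSl, H, p_mulD; auto.
Qed.
Lemma p_addI x y z : x + z = y + z -> x = y.
Proof. revert z; apply (ind0 (fun z => x + z = y + z -> x = y)); [dd| |]. - rewrite !a_add0; auto. - intros z H. rewrite !a_addS. intro H'; apply H, a_SI, H'. Qed.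
Lemma p_lt_add x k : x < x + (k + 1).
Proof.
  revert k; apply ind0; [dd| |].
  - rewrite p_add0. apply a_ltS; auto.
  - intros k H. rewrite a_addS. apply a_ltS; auto.
Qed.
Lemma p_ltE x y : x < y <-> exists k, y = x + (k + 1).
Proof.
  split; [|intros [k ->]; apply p_lt_add].
  intro H. assert (H' : exists k, k < y /\ y = x + (k + 1)); [|destruct H' as (k & _ & H'); eauto].
  revert y H; apply (ind0 (fun y => x < y -> exists k, k < y /\ y = x + (k + 1))); [dd| |].
  - intro H; apply a_lt0 in H; tauto.
  - intros y IH H. apply a_ltS in H. destruct H as [H| ->].
    + apply IH in H. destruct H as (k & Hk & ->). exists (k + 1). split; [|rewrite <- a_addS; auto].
      rewrite (p_addC x (k + 1)), <- (p_addA (k + 1)). apply p_lt_add.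
    + exists 0. split; [rewrite <- (p_add0 (y + 1)); apply p_lt_add|]. rewrite p_add0; auto.
Qed.
Lemma p_tri x y : x < y \/ x = y \/ y < x.
Proof.
  revert y; apply ind0; [dd| |].
  - revert x; apply ind0; [dd| |]; auto. intros x _. right; right. rewrite <- (p_add0 (x + 1)); apply p_lt_add.
  - intros y [H|[->|H]].
    + left; apply a_ltS; auto.
    + left; apply a_ltS; auto.
    + apply p_ltE in H; destruct H as [k ->]. rewrite p_addA.
      assert (H : k = 0 \/ exists l, k = l + 1).
      { assert (H : k = 0 \/ exists l, l < k /\ k = l + 1); [|destruct H as [H|(l & _ & H)]; eauto].
        revert k; apply ind0; [dd| |]; auto. intros k _; right; exists k; split; auto. apply a_ltS; auto. }
      destruct H as [->|[l ->]].
      * right; left. rewrite a_add0; auto.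
      * right; right. apply p_ltE. exists l. rewrite (p_addS y (l + 1)). auto.
Qed.
Definition osr : OSR := {|
  car := A; o0 := 0; o1 := 1; oadd := madd; omul := mmul; oltR := mlt;
  addC := p_addC; addA := p_addA; add0 := p_add0; mulC := p_mulC; mulA := p_mulA; mul1 := p_mul1;
  mul0 := p_mul0; mulD := p_mulD; ltE := p_ltE; addI := p_addI; pos1 := a_S0; tri := p_tri |}.
End Arithmetic.

(* Linear arithmetic in models *)
From mathcomp Require Import lra.
Import mathcomp.order.preorder.Order.Preorder.Exports mathcomp.order.order.Order.POrder.Exports orderedzmod.Num.POrderedZmodule.Exports numdomain.Num.RealDomain.Exports numdomain.Num.NumDomain.Exports ssralg.GRing.IntegralDomain.Exports ssralg.GRing.ComUnitRing.Exports ssralg.GRing.PzSemiRing.Exports nmodule.Algebra.BaseAddMagma.Exports nmodule.Algebra.BaseAddUMagma.Exports nmodule.Algebra.Zmodule.Exports nmodule.Algebra.Nmodule.Exports order.Order.Total.Exports.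
Import OrderedRing.
Ltac cbnT t := let T := type of t in let T' := eval cbn [oadd omul o0 o1 oltR osr car] in T in exact T'.
Section Embed.
Variable A : arithM.
Definition iD (x y : A) : ltac:(cbnT (embD (osr A) x y)) := embD (osr A) x y.
Definition iM (x y : A) : ltac:(cbnT (embM (osr A) x y)) := embM (osr A) x y.
Definition i0 : ltac:(cbnT (emb0 (osr A))) := emb0 (osr A).
Definition i1 : ltac:(cbnT (emb1 (osr A))) := emb1 (osr A).
Definition iE (x y : A) : ltac:(cbnT (embE (osr A) x y)) := embE (osr A) x y.
Definition iL (x y : A) : ltac:(cbnT (embL (osr A) x y)) := embL (osr A) x y.
Definition ige (x : A) : ltac:(cbnT (emb_ge0 (osr A) x)) := emb_ge0 (osr A) x.
Lemma le_lt (x y : A) : x <= y <-> ~ y < x.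
Proof.
  unfold mle. rewrite a_ltS. split.
  - intros H1 H2. assert (H : x < x); [|apply p_ltE in H; destruct H as [k H]; apply (a_S0 A k), (p_addI A _ _ x); rewrite p_add0, (p_addC A (k + 1)); symmetry; exact H].
    destruct H1 as [H1| ->]; auto. apply p_ltE in H1, H2. destruct H1 as [k E1], H2 as [l E2].
    apply p_ltE. exists (k + 1 + l). rewrite E2 at 1. rewrite E1. rewrite !p_addA; auto.
  - intro H. destruct (p_tri A x y) as [?|[?|?]]; tauto.
Qed.
Lemma nlt_le (x y : A) : ~ x < y <-> y <= x.
Proof. symmetry; apply le_lt. Qed.
Lemma nle_lt (x y : A) : ~ x <= y <-> y < x.
Proof. rewrite le_lt. destruct (classic (y < x)); tauto. Qed.
Definition iLe (x y : A) : ltac:(cbnT (embL (osr A) x (y + 1))) := embL (osr A) x (y + 1).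
End Embed.

#[global] Hint Rewrite iD iM i0 i1 : emb.
(** Order facts are moved to the ring of differences; [arabs] then generalizes the embedded elements
    together with their nonnegativity, so that the solvers see only an ordered ring. *)
Ltac arpre :=
  repeat match goal with
  | H : @mlt (am _) _ _ |- _ => apply iL in H
  | H : @mle (am _) _ _ |- _ => apply iLe in H
  | H : ~ @mlt (am _) _ _ |- _ => apply nlt_le in H
  | H : ~ @mle (am _) _ _ |- _ => apply nle_lt in H
  | H : @eq (dom (am _)) _ _ |- _ => apply iE in H
  | H : ~ (_ = _) |- _ => clear H
  | |- @mlt (am _) _ _ => apply iL
  | |- @mle (am _) _ _ => apply iLe
  | |- ~ @mlt (am _) _ _ => apply nlt_le
  | |- ~ @mle (am _) _ _ => apply nle_lt
  | |- @eq (dom (am _)) _ _ => apply iE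
  | |- _ /\ _ => split
  end;
  autorewrite with emb in *;
  idtac.
Ltac arclear := clear.
Ltac arabs :=
  repeat match goal with
  | H : is_true (@preorder.Order.le _ _ _ _) |- _ => revert H
  | H : @eq (numdomain.Num.RealDomain.sort _) _ _ |- _ => revert H
  end;
  repeat match goal with |- context [emb (osr ?A) ?x] =>
    generalize (ige A x); generalize (emb (osr A) x) end;
  match goal with |- context [DR (osr ?A)] => generalize (DR (osr A)) end;
  arclear; repeat (let H := fresh "AR" in intro H).
Ltac ar := intros; arpre; arabs; [> rlra ..].
Ltac nar := intros; arpre; arabs; [> rnra ..].

(** * Digits, coded sequences and pairs *)

Definition Entry {M : model} (b s i v : M) := v < b /\ exists q, q < s + 1 /\ exists r, r < b ^ i /\ s = (q * b + v) * b ^ i + r.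
Definition mp {M : model} (x y : M) := (x + y) * (x + y) + x.

Section Digits.
Variable A : arithM.
Implicit Types x y z b s i v : A.
Lemma a_ring : semi_ring_theory (0 : A) 1 madd mmul eq.
Proof.
  split; intros; first [apply p_add0|apply p_addC|apply p_addA|apply p_mul1|apply p_mul0|apply p_mulC|apply p_mulA|apply p_mulD].
Qed.
Add Ring Aring : a_ring.

Lemma exp_add b i j : b ^ (i + j) = b ^ i * b ^ j.
Proof.
  revert j; apply ind0; [dd| |].
  - rewrite a_add0, a_exp0. ring.
  - intros j H. rewrite a_addS, !a_expS, H. ring.
Qed.
Lemma exp1 b : b ^ 1 = b.
Proof. rewrite <- (p_add0 A 1) at 1. rewrite a_expS, a_exp0. ring. Qed.
Lemma exp_pos b i : 0 < b -> 0 < b ^ i.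
Proof.
  intro Hb; revert i; apply ind0; [dd| |].
  - rewrite a_exp0. ar.
  - intros i H. rewrite a_expS. nar.
Qed.
Lemma le_ex x y : x <= y -> exists k, y = x + k.
Proof.
  unfold mle. intro H; apply a_ltS in H. destruct H as [H| ->].
  - apply p_ltE in H. destruct H as [k ->]. exists (k + 1). auto.
  - exists 0. rewrite a_add0; auto.
Qed.
Lemma exp_mono b i j : 0 < b -> i <= j -> b ^ i <= b ^ j.
Proof.
  intros Hb H. apply le_ex in H. destruct H as [k ->]. rewrite exp_add.
  pose proof (exp_pos b i Hb). pose proof (exp_pos b k Hb). nar.
Qed.
Lemma exp_base b c i : b <= c -> b ^ i <= c ^ i.
Proof.
  intro H. revert i; apply ind0; [dd| |].
  - rewrite !a_exp0. ar.
  - intros i Hi. rewrite !a_expS. nar.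
Qed.
Lemma lt_2exp x : x < (1 + 1) ^ x.
Proof.
  revert x; apply ind0; [dd| |].
  - rewrite a_exp0. ar.
  - intros x H. rewrite a_expS. ar.
Qed.
Lemma exp_lt b i j : 1 < b -> b ^ i < b ^ j -> i < j.
Proof.
  intros Hb H. destruct (classic (i < j)) as [?|Hn]; auto. exfalso.
  assert (Hji : j <= i) by ar.
  pose proof (exp_mono b j i ltac:(ar) Hji). apply (le_lt A) in H0. auto.
Qed.
Lemma sind (P : A -> Prop) : D0 A (as0 A) 1 (fun g => P (snd g)) -> (forall x, (forall y, y < x -> P y) -> P x) -> forall x, P x.
Proof.
  intros HP H x. apply H. revert x. apply (ind0 A (fun x => forall y, y < x -> P y)).
  - apply D0_ball; [tm|]. apply (D0_comp A (as0 A) 2 1 (fun g => (tt, snd g)) _ HP). simpl; split; auto. tm.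
  - intros y Hy. apply a_lt0 in Hy; tauto.
  - intros x Hx y Hy. apply a_ltS in Hy. destruct Hy as [Hy| ->]; auto.
Qed.
Lemma div_ex b x : 0 < b -> exists q r, x = q * b + r /\ r < b.
Proof.
  intro Hb. assert (H : exists q, q <= x /\ exists r, r < b /\ x = q * b + r).
  - revert x; apply ind0; [dd| |].
    + exists 0. split; [ar|]. exists 0; split; auto. ring.
    + intros x (q & Hq & r & Hr & E). destruct (p_tri A (r + 1) b) as [H|[H|H]].
      * exists q. split; [ar|]. exists (r + 1). split; auto. rewrite E; ring.
      * exists (q + 1). split; [ar|]. exists 0. split; auto. rewrite E, <- H; ring.
      * exfalso. assert (b <= r) by ar. apply (le_lt A) in H0. auto.
  - destruct H as (q & _ & r & Hr & E). eauto.
Qed.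
Lemma lt_irr x : ~ x < x. Proof. apply (le_lt A). ar. Qed.
Lemma div_un b q r q' r' : r < b -> r' < b -> q * b + r = q' * b + r' -> q = q' /\ r = r'.
Proof.
  assert (G : forall q r k r', r < b -> q * b + r = (q + (k + 1)) * b + r' -> False).
  { clear. intros q r k r' H1 E. apply (lt_irr b).
    assert (E' : r = k * b + b + r') by (apply (p_addI A _ _ (q * b)); transitivity (q * b + r); [ring|rewrite E; ring]).
    pose proof (ige A (k * b)). ar. }
  intros H1 H2 E.
  assert (Hq : q = q').
  { destruct (p_tri A q q') as [H|[H|H]]; auto; exfalso; apply p_ltE in H; destruct H as [k ->].
    - apply (G q r k r'); auto.
    - apply (G q' r' k r); auto. }
  split; auto. subst q'. apply (p_addI A _ _ (q * b)). rewrite !(p_addC A _ (q * b)). auto.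
Qed.

Lemma Entry_I b s i v q r : v < b -> r < b ^ i -> s = (q * b + v) * b ^ i + r -> Entry b s i v.
Proof.
  intros Hv Hr E. split; auto. exists q. split; [|eauto].
  assert (H : q <= s); [|exact H].
  assert (0 < b) by ar. assert (0 < b ^ i) by ar.
  assert (q <= q * b + v) by nar. rewrite E.
  generalize dependent (q * b + v). intros. nar.
Qed.
Lemma Entry_fun b s i v w : Entry b s i v -> Entry b s i w -> v = w.
Proof.
  intros (H1 & q & _ & r & H2 & E1) (H3 & q' & _ & r' & H4 & E2).
  rewrite E1 in E2. apply div_un in E2; auto. destruct E2 as [E2 _]. apply div_un in E2; tauto.
Qed.
Lemma Entry_ex b s i : 0 < b -> exists v, Entry b s i v.
Proof.
  intro Hb. destruct (div_ex (b ^ i) s (exp_pos _ i Hb)) as (t & r & E & Hr).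
  destruct (div_ex b t Hb) as (q & v & E' & Hv). exists v. apply (Entry_I b s i v q r); auto. congruence.
Qed.
Lemma Entry_low b s i v w n : i < n -> Entry b s i v -> Entry b (s + w * b ^ n) i v.
Proof.
  intros Hi (H1 & q & _ & r & H2 & E). apply p_ltE in Hi. destruct Hi as [k ->].
  apply (Entry_I _ _ _ _ (q + w * b ^ k) r); auto.
  rewrite E, exp_add, a_expS. ring.
Qed.
Lemma Entry_top b s w n : w < b -> s < b ^ n -> Entry b (s + w * b ^ n) n w.
Proof. intros H1 H2. apply (Entry_I _ _ _ _ 0 s); auto. ring. Qed.
(** A sequence of length [m] over the base [b] has a code below [b^m]. Exponentiation thus keeps the
    induction hypothesis bounded, and [ind0] can collect the values one at a time. *)
Lemma seq_comp (Q : A -> A -> Prop) b n : D0 A (as0 A) 2 (fun g => Q (snd (fst g)) (snd g)) ->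
  (forall i, i < n -> exists v, v < b /\ Q i v) ->
  exists s, s < b ^ n /\ forall i, i < n -> exists v, v < b /\ Q i v /\ Entry b s i v.
Proof.
  intros HQ H.
  assert (G : forall m, m <= n -> exists s, s < b ^ m /\ forall i, i < m -> exists v, v < b /\ Q i v /\ Entry b s i v); [|apply G; ar].
  apply (ind0 A (fun m => m <= n -> exists s, s < b ^ m /\ forall i, i < m -> exists v, v < b /\ Q i v /\ Entry b s i v)).
  - apply D0_imp; [dd|]. apply D0_bex; [tm|]. apply D0_ball; [tm|]. apply D0_bex; [tm|]. apply D0_and; [|unfold Entry; dd].
    lazy beta. apply (D0_comp A (as0 A) 4 2 (fun g => ((tt, snd (fst g)), snd g)) _ HQ). simpl. repeat split; tm.
  - intros _. exists 0. rewrite a_exp0. split; [ar|]. intros i Hi; apply a_lt0 in Hi; tauto.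
  - intros m IH Hm. destruct IH as (s & Hs & IH); [ar|]. destruct (H m) as (w & Hw & HQw); [ar|].
    exists (s + w * b ^ m). split.
    + rewrite a_expS. generalize dependent (b ^ m). intros c Hc. nar.
    + intros i Hi. apply a_ltS in Hi. destruct Hi as [Hi| ->].
      * destruct (IH i Hi) as (v & Hv & HQv & HE). exists v. repeat split; auto. apply Entry_low; auto.
      * exists w; repeat split; auto. apply Entry_top; auto.
Qed.

Lemma mp_inj x y x' y' : mp x y = mp x' y' -> x = x' /\ y = y'.
Proof.
  unfold mp. assert (G : forall x y x' y' : A, x + y < x' + y' -> mp x y < mp x' y') by (unfold mp; nar).
  intro H. destruct (p_tri A (x + y) (x' + y')) as [E|[E|E]].
  - apply G in E. unfold mp in E; rewrite H in E. apply lt_irr in E; tauto.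
  - rewrite E in H. assert (Hx : x = x').
    { apply (p_addI A _ _ ((x' + y') * (x' + y'))). rewrite !(p_addC A _ ((x' + y') * (x' + y'))); auto. }
    split; auto. subst x'. apply (p_addI A _ _ x). rewrite !(p_addC A _ x); auto.
  - apply G in E. unfold mp in E; rewrite H in E. apply lt_irr in E; tauto.
Qed.
Lemma mp_l x y : x <= mp x y. Proof. unfold mp. nar. Qed.
Lemma mp_r x y : y <= mp x y. Proof. unfold mp. assert (y <= y * y); [|nar].
  destruct (p_tri A y 0) as [H|[->|H]]; [apply a_lt0 in H; tauto|ar|nar]. Qed.
End Digits.

Section Classes.
Variable A : arithM.
Implicit Types x y z : A.
Notation D0 := (D0 A (as0 A)). Notation Sg := (Sg A (as0 A)). Notation Pi := (Pi A (as0 A)). Notation Tm := (Tm A). Notation ctx := (ctx A).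
Notation TmC := (TmC A).

(** Such functions may be substituted into bounded formulas: their value is found below [b] by a
    bounded quantifier. *)
Definition DF n (t : ctx n -> A) := exists b, Tm n b /\ (forall g, t g <= b g) /\ D0 (S n) (fun g => snd g = t (fst g)).
Lemma DF_comp n m f t : DF m t -> TmC n m f -> DF n (fun g => t (f g)).
Proof.
  intros (b & Hb & H1 & H2) Hf. exists (fun g => b (f g)). split; [|split]; auto.
  - apply (Tm_comp A n m f b); auto.
  - apply (D0_comp A (as0 A) (S n) (S m) (fun g => (f (fst g), snd g)) _ H2).
    split; simpl; [apply TmC_fst; auto|apply Tm_snd].
Qed.
Lemma DF_weak n t : DF n t -> DF (S n) (fun g => t (fst g)).
Proof. intro H. apply (DF_comp (S n) n (fun g => fst g)); auto. apply (TmC_fst A n n (fun g => g)), TmC_id. Qed.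
Lemma D0_fun n t P : DF n t -> D0 (S n) P -> D0 n (fun g => P (g, t g)).
Proof.
  intros (b & Hb & H1 & H2) HP. apply D0_ext with (fun g => exists y, y <= b g /\ (y = t g /\ P (g, y))).
  - intro g; split; [intros (y & _ & -> & H); auto|]. intro H; exists (t g); auto.
  - apply D0_bexe; auto. apply (D0_and A (as0 A) (S n) (fun g => snd g = t (fst g)) (fun g => P (fst g, snd g))); auto.
    apply D0_ext with P; auto. intros [g y]; reflexivity.
Qed.
Lemma swap_TmC n : TmC (S (S n)) (S (S n)) (fun g => ((fst (fst g), snd g), snd (fst g))).
Proof. simpl. split; [split|]; try tm. apply (TmC_fst A (S n) n (fun g => fst g)), (TmC_fst A n n (fun g => g)), TmC_id. Qed.
Lemma SP_fun k : forall n t P, DF n t -> (Sg k (S n) P -> Sg k n (fun g => P (g, t g))) /\ (Pi k (S n) P -> Pi k n (fun g => P (g, t g))).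
Proof.
  induction k as [|k IH]; intros n t P Ht; [split; apply D0_fun; auto|].
  split; intros (Q & HQ & E).
  - exists (fun h => Q ((fst h, t (fst h)), snd h)). split; [|intro g; apply E].
    apply (proj2 (IH (S n) (fun h => t (fst h)) (fun h => Q ((fst (fst h), snd h), snd (fst h))) (DF_weak _ _ Ht))).
    apply (Pi_comp A (as0 A) k (S (S n)) (S (S n)) _ Q (swap_TmC n)). auto.
  - exists (fun h => Q ((fst h, t (fst h)), snd h)). split; [|intro g; apply E].
    apply (proj1 (IH (S n) (fun h => t (fst h)) (fun h => Q ((fst (fst h), snd h), snd (fst h))) (DF_weak _ _ Ht))).
    apply (Sg_comp A (as0 A) k (S (S n)) (S (S n)) _ Q (swap_TmC n)). auto.
Qed.
Lemma Pi_fun k n t P : DF n t -> Pi k (S n) P -> Pi k n (fun g => P (g, t g)).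
Proof. intros H; apply (SP_fun k n t P H). Qed.

Definition isp w := exists x, x <= w /\ exists y, y <= w /\ w = mp x y.
Definition p1 (w : A) : A := epsilon (inhabits 0) (fun x => (exists y, y <= w /\ w = mp x y) \/ (~ isp w /\ x = 0)).
Definition p2 (w : A) : A := epsilon (inhabits 0) (fun y => (exists x, x <= w /\ w = mp x y) \/ (~ isp w /\ y = 0)).
Lemma p1_spec w : (exists y, y <= w /\ w = mp (p1 w) y) \/ (~ isp w /\ p1 w = 0).
Proof. unfold p1. apply epsilon_spec. destruct (classic (isp w)) as [(x & _ & y & Hy & E)|H]; eauto. Qed.
Lemma p2_spec w : (exists x, x <= w /\ w = mp x (p2 w)) \/ (~ isp w /\ p2 w = 0).
Proof. unfold p2. apply epsilon_spec. destruct (classic (isp w)) as [(x & Hx & y & _ & E)|H]; eauto. Qed.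
Lemma isp_mp x y : isp (mp x y).
Proof. exists x; split; [apply mp_l|]. exists y; split; [apply mp_r|auto]. Qed.
Lemma p1_mp x y : p1 (mp x y) = x.
Proof. destruct (p1_spec (mp x y)) as [(z & _ & E)|[H _]]; [apply mp_inj in E; symmetry; tauto|destruct H; apply isp_mp]. Qed.
Lemma p2_mp x y : p2 (mp x y) = y.
Proof. destruct (p2_spec (mp x y)) as [(z & _ & E)|[H _]]; [apply mp_inj in E; symmetry; tauto|destruct H; apply isp_mp]. Qed.
Lemma p1_graph w x : x = p1 w <-> (exists y, y <= w /\ w = mp x y) \/ (~ isp w /\ x = 0).
Proof.
  split; [intros ->; apply p1_spec|].
  intros [(y & Hy & ->)|[H ->]]; [rewrite p1_mp; auto|].
  destruct (p1_spec w) as [(z & Hz & E)|[_ E]]; auto. destruct H; rewrite E; apply isp_mp.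
Qed.
Lemma p2_graph w x : x = p2 w <-> (exists y, y <= w /\ w = mp y x) \/ (~ isp w /\ x = 0).
Proof.
  split; [intros ->; apply p2_spec|].
  intros [(y & Hy & ->)|[H ->]]; [rewrite p2_mp; auto|].
  destruct (p2_spec w) as [(z & Hz & E)|[_ E]]; auto. destruct H; rewrite E; apply isp_mp.
Qed.
Lemma DF_p1 n t : Tm n t -> DF n (fun g => p1 (t g)).
Proof.
  intro Ht. exists t. split; [|split]; auto.
  - intro g. destruct (p1_spec (t g)) as [(y & _ & E)|[_ ->]]; [rewrite E at 2; apply mp_l|ar].
  - eapply D0_ext; [intro g; symmetry; apply p1_graph|]. unfold isp, mp. dd.
Qed.
Lemma DF_p2 n t : Tm n t -> DF n (fun g => p2 (t g)).
Proof.
  intro Ht. exists t. split; [|split]; auto.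
  - intro g. destruct (p2_spec (t g)) as [(y & _ & E)|[_ ->]]; [rewrite E at 2; apply mp_r|ar].
  - eapply D0_ext; [intro g; symmetry; apply p2_graph|]. unfold isp, mp. dd.
Qed.
Lemma wk_TmC n : TmC (S (S n)) (S n) (fun g => (fst (fst g), snd g)).
Proof. simpl. split; try tm. apply (TmC_fst A (S n) n (fun g => fst g)), (TmC_fst A n n (fun g => g)), TmC_id. Qed.

(** For conjunctions the two leading quantifiers become one, ranging over pairs. Off the pairs the
    projections return 0, so every element still names two witnesses. *)
Lemma SP_andor k : forall n P Q, (Sg k n P -> Sg k n Q -> Sg k n (fun g => P g /\ Q g)) /\ (Sg k n P -> Sg k n Q -> Sg k n (fun g => P g \/ Q g)).
Proof.
  induction k as [|k IH]; intros n P Q; [split; [apply D0_and|apply D0_or]|].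
  assert (HI : (forall n P Q, Pi k n P -> Pi k n Q -> Pi k n (fun g => P g /\ Q g)) /\ (forall n P Q, Pi k n P -> Pi k n Q -> Pi k n (fun g => P g \/ Q g))).
  { split; intros n' P' Q' HP HQ; apply Pi_not in HP, HQ.
    - eapply Pi_ext; [|apply Sg_not, (proj2 (IH n' _ _) HP HQ)]. intro g; simpl. tauto.
    - eapply Pi_ext; [|apply Sg_not, (proj1 (IH n' _ _) HP HQ)]. intro g; simpl. tauto. }
  split; intros (P' & HP & EP) (Q' & HQ & EQ).
  - exists (fun h => P' (fst h, p1 (snd h)) /\ Q' (fst h, p2 (snd h))). split.
    + apply HI.
      * apply (Pi_fun k (S n) (fun h => p1 (snd h)) (fun g => P' (fst (fst g), snd g))); [apply DF_p1; tm|].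
        apply (Pi_comp A (as0 A) k (S (S n)) (S n) _ P' (wk_TmC n)); auto.
      * apply (Pi_fun k (S n) (fun h => p2 (snd h)) (fun g => Q' (fst (fst g), snd g))); [apply DF_p2; tm|].
        apply (Pi_comp A (as0 A) k (S (S n)) (S n) _ Q' (wk_TmC n)); auto.
    + intro g; rewrite EP, EQ; simpl. split.
      * intros [[y Hy] [z Hz]]. exists (mp y z). rewrite p1_mp, p2_mp; auto.
      * intros [w [H1 H2]]; eauto.
  - exists (fun h => P' h \/ Q' h). split; [apply HI; auto|]. intro g; rewrite EP, EQ. firstorder.
Qed.
Lemma Sg_and k n P Q : Sg k n P -> Sg k n Q -> Sg k n (fun g => P g /\ Q g). Proof. apply SP_andor. Qed.
Lemma Sg_or k n P Q : Sg k n P -> Sg k n Q -> Sg k n (fun g => P g \/ Q g). Proof. apply SP_andor. Qed.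
Lemma Pi_or k n P Q : Pi k n P -> Pi k n Q -> Pi k n (fun g => P g \/ Q g).
Proof. intros HP HQ; apply Pi_not in HP, HQ. eapply Pi_ext; [|apply Sg_not, (Sg_and _ _ _ _ HP HQ)]. intro g; simpl. tauto. Qed.
Lemma Sg_imp k n P Q : Pi k n P -> Sg k n Q -> Sg k n (fun g => P g -> Q g).
Proof. intros HP HQ; apply Pi_not in HP. eapply Sg_ext; [|apply (Sg_or _ _ _ _ HP HQ)]. intro g; simpl. tauto. Qed.
Lemma Pi_imp k n P Q : Sg k n P -> Pi k n Q -> Pi k n (fun g => P g -> Q g).
Proof. intros HP HQ; apply Sg_not in HP. eapply Pi_ext; [|apply (Pi_or _ _ _ _ HP HQ)]. intro g; simpl. tauto. Qed.
Lemma Sg_ex k n P : Sg (S k) (S n) (fun g => P (fst g) (snd g)) -> Sg (S k) n (fun g => exists y, P g y).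
Proof.
  intros (Q & HQ & E). exists (fun h => Q ((fst h, p1 (snd h)), p2 (snd h))). split.
  - apply (Pi_fun k (S n) (fun h => p1 (snd h)) (fun h => Q ((fst (fst h), snd h), p2 (snd (fst h))))); [apply DF_p1; tm|].
    apply (Pi_fun k (S (S n)) (fun h => p2 (snd (fst h))) (fun h => Q ((fst (fst (fst h)), snd (fst h)), snd h))); [apply DF_p2; tm|].
    apply (Pi_comp A (as0 A) k (S (S (S n))) (S (S n)) (fun h => ((fst (fst (fst h)), snd (fst h)), snd h)) Q); auto.
    simpl. split; [split|]; try tm. apply (TmC_fst A (S (S n)) n (fun g => fst (fst g))), (TmC_fst A (S n) n (fun g => fst g)), (TmC_fst A n n (fun g => g)), TmC_id.
  - intro g; simpl. split.
    + intros [y Hy]. apply (E (g, y)) in Hy. destruct Hy as [z Hz]. exists (mp y z). rewrite p1_mp, p2_mp; auto.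
    + intros [w Hw]. exists (p1 w). apply (E (g, p1 w)). eauto.
Qed.
Lemma Pi_all k n P : Pi (S k) (S n) (fun g => P (fst g) (snd g)) -> Pi (S k) n (fun g => forall y, P g y).
Proof.
  intro H; apply Pi_not in H. apply (Sg_ex k n (fun g y => ~ P g y)) in H. apply Sg_not in H.
  eapply Pi_ext; [|apply H]. intro g; simpl. split; [|firstorder]. intros H' y; apply NNPP; eauto.
Qed.
Lemma iSg k (P : A -> Prop) : (k <= aN A)%nat -> Sg k 1 (fun g => P (snd g)) ->
  P 0 -> (forall x, P x -> P (x + 1)) -> forall x, P x.
Proof. apply (ind_Sg A (as0 A) (aN A) (aI A)). Qed.
(** From a counterexample [x] one descends: that [x - u] is a counterexample is inductive in [u] and
    absurd at [x + 1]. The difference is introduced by an existential quantifier, which the positive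
    levels absorb. *)
Lemma iPi k (P : A -> Prop) : (k <= aN A)%nat -> Pi k 1 (fun g => P (snd g)) ->
  P 0 -> (forall x, P x -> P (x + 1)) -> forall x, P x.
Proof.
  intros Hk HP H0 HS x. apply NNPP; intro Hx.
  destruct k as [|k]; [apply Hx; apply (iSg 0 P); auto; lia|].
  assert (G : forall u, exists v, v + u = x /\ ~ P v).
  { apply (iSg (S k)); auto.
    - apply (Sg_ex k 1 (fun g v => v + snd g = x /\ ~ P v)). apply (Sg_and (S k) 2 (fun g => snd g + snd (fst g) = x) (fun g => ~ P (snd g))).
      + apply D0_Sg. dd.
      + apply (Sg_comp A (as0 A) (S k) 2 1 (fun g => (tt, snd g)) (fun g => ~ P (snd g))); [simpl; split; auto; tm|]. apply Pi_not, HP.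
    - exists x. rewrite a_add0; auto.
    - intros u (v & E & Hv). destruct (classic (v = 0)) as [->|Hv0]; [contradiction|].
      assert (H : exists w, v = w + 1).
      { destruct (p_tri A 0 v) as [H|[H|H]]; [|congruence|apply a_lt0 in H; tauto]. apply p_ltE in H. destruct H as [w ->]. exists w. ar. }
      destruct H as [w ->]. exists w. split; [|intro; auto]. rewrite <- E. ar. }
  destruct (G (x + 1)) as (v & E & _). apply (lt_irr A x). ar.
Qed.
(** Without a maximum, induction on [u] would find elements of [P] beyond every [u], also beyond
    [b]. *)
Lemma maxP k (P : A -> Prop) b : (S k <= aN A)%nat -> Sg (S k) 1 (fun g => P (snd g)) ->
  (exists x, P x) -> (forall x, P x -> x <= b) -> exists x, P x /\ forall y, P y -> y <= x.
Proof.
  intros Hk HP [x0 H0] Hb. apply NNPP; intro Hn.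
  assert (G : forall u, exists v, u <= v /\ P v).
  { apply (iSg (S k)); auto.
    - apply (Sg_ex k 1 (fun g v => snd g <= v /\ P v)). apply (Sg_and (S k) 2 (fun g => snd (fst g) <= snd g) (fun g => P (snd g))).
      + apply D0_Sg. dd.
      + apply (Sg_comp A (as0 A) (S k) 2 1 (fun g => (tt, snd g)) (fun g => P (snd g))); [simpl; split; auto; tm|]. auto.
    - exists x0. split; auto. ar.
    - intros u (v & Hv & HPv). apply NNPP; intro H. apply Hn. exists v; split; auto.
      intros y Hy. apply (le_lt A). intro Hlt. apply H. exists y; split; auto. ar. }
  destruct (G (b + 1)) as (v & H1 & H2). apply Hb in H2. apply (lt_irr A b). ar.
Qed.
(** Collection: induction on [v] yields a common bound for witnesses of all [y < v], and below it
    the witnesses can be sought by a bounded quantifier. *)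
Lemma Sg1_ball n t P : Tm n t -> Sg 1 (S n) (fun g => P (fst g) (snd g)) -> Sg 1 n (fun g => forall y, y < t g -> P g y).
Proof.
  intros Ht (Q & HQ & E).
  exists (fun h => forall y, y < t (fst h) -> exists z, z < snd h /\ Q ((fst h, y), z)). split.
  - apply D0_ball; [apply (Tm_fst A _ _ Ht)|]. apply D0_bex; [tm|]. lazy beta.
    apply (D0_comp A (as0 A) (S (S (S n))) (S (S n)) (fun h => ((fst (fst (fst h)), snd (fst h)), snd h)) Q HQ).
    simpl. split; [split|]; try tm. apply (TmC_fst A (S (S n)) n (fun g => fst (fst g))), (TmC_fst A (S n) n (fun g => fst g)), (TmC_fst A n n (fun g => g)), TmC_id.
  - intro g; simpl. split; [|intros [Z HZ] y Hy; destruct (HZ y Hy) as (z & _ & Hz); apply (E (g, y)); eauto].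
    intro H. assert (G : forall v, v <= t g -> exists Z, forall y, y < v -> exists z, z < Z /\ Q ((g, y), z)); [|apply G; ar].
    apply (iSg 1 (fun v => v <= t g -> exists Z, forall y, y < v -> exists z, z < Z /\ Q ((g, y), z))); [apply aN1| | |].
    + apply Sg_imp; [apply D0_Pi; dd|]. exists (fun h => forall y, y < snd (fst h) -> exists z, z < snd h /\ Q ((g, y), z)).
      split; [|reflexivity]. apply D0_ball; [tm|]. apply D0_bex; [tm|]. lazy beta.
      apply (D0_comp A (as0 A) 4 (S (S n)) (fun h => ((g, snd (fst h)), snd h)) Q HQ).
      simpl. split; [split|]; try tm. clear. induction n as [|n IH]; simpl; auto. split; [apply IH|apply Tm_const].
    + intros _. exists 0. intros y Hy. apply a_lt0 in Hy; tauto.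
    + intros v IH Hv. destruct IH as [Z HZ]; [ar|]. destruct (proj1 (E (g, v))) as [z Hz]; [apply (H v); ar|].
      exists (Z + z + 1). intros y Hy. apply a_ltS in Hy. destruct Hy as [Hy| ->].
      * destruct (HZ y Hy) as (w & Hw & HQw). exists w; split; auto. ar.
      * exists z; split; auto. ar.
Qed.
End Classes.

(** * Meaning of the arithmetized statement *)

Section Semantics.
Context {M : model}.
Implicit Types a b c d e g h i j k l m n r s t v w x y z : M.
(** These definitions repeat the arithmetized ones connective by connective, so that the denotation
    lemmas reduce to matching shapes. *)
Definition sosnoc d b n := mp d (mp b n) + 1.
Definition spow d b m r := (m = 0 /\ r = d) \/ exists p, p < m /\ (m = p + 1 /\ r = sosnoc d b p).
Definition sosucc c a a' := exists d, d < c /\ exists n, n < c /\ (a = sosnoc d 0 n /\ spow d 0 n a').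
Definition solimit c a := exists d, d < c /\ exists b, b < c /\ exists n, n < c /\ (a = sosnoc d b n /\ 0 < b).
Definition sjud t a x y := mp t (mp a (mp x y)).
Definition srule c (E : M -> Prop) j :=
  exists a, a < c /\ exists x, x < c /\ exists y, y < c /\
    ((j = sjud 0 a x y /\
       exists d, d < c /\ exists b, b < c /\ exists n, n < c /\ exists r, r < c /\ (a = sosnoc d b n /\ (spow d b n r /\
         ((exists g, g < c /\ (sosucc c b g /\ spow r g x y)) \/
          (solimit c b /\ exists w, w < c /\ (E (sjud 0 b x w) /\ spow r w 1 y))))))
    \/ ((j = sjud 1 a x y /\
         ((a = 0 /\ y = x + 1) \/
          ((exists b, b < c /\ (sosucc c a b /\ E (sjud (x + 1 + (1 + 1)) b x y))) \/
          (solimit c a /\ exists b, b < c /\ (E (sjud 0 a x b) /\ E (sjud 1 b x y))))))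
    \/ ((j = sjud (0 + (1 + 1)) a x y /\ y = x)
    \/ (exists k, k < c /\ exists z, z < c /\
         (j = sjud (k + 1 + (1 + 1)) a x y /\ (E (sjud (k + (1 + 1)) a x z) /\ E (sjud 1 a z y))))))).
Definition sderB b s n := forall i, i < n + 1 -> forall j, j < b -> Entry b s i j -> srule b (fun w => exists k, k < i /\ Entry b s k w) j.
Definition sder v := exists b s n, sderB b s n /\ Entry b s n v.
Definition Fd a x y := sder (sjud 1 a x y).
Definition sfinv a x y := ((exists z, Fd a y z /\ z <= x) /\ (forall y' z, Fd a y' z /\ z <= x -> y' <= y))
  \/ (y = 0 /\ ~ exists y' z, Fd a y' z /\ z <= x).
Definition slog2 x y := (x = 0 /\ y = 0) \/ ((1 + 1) ^ y <= x /\ x < (1 + 1) ^ (y + 1)).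
Fixpoint siterlog (k : nat) x y : Prop := match k with O => y = x | S k' => exists z, siterlog k' x z /\ slog2 z y end.
Definition sroot r x y := (r = 0 /\ y = x) \/ (0 < r /\ (y ^ r <= x /\ x < (y + 1) ^ r)).
Definition sfgraph (d : nat) al x y := exists i l, sfinv al x i /\ (siterlog (d - 2)%nat x l /\ sroot i l y).
Fixpoint snum (n : nat) : M := match n with O => 0 | S m => snum m + 1 end.
Fixpoint scode_from (acc : M) (o : ord) : M :=
  match o with OZero => acc | OCons b n g => scode_from (sosnoc acc (scode_from 0 b) (snum n)) g end.
Definition stuple (xs : list M) : M := fold_right mp 0 xs.
Fixpoint sincr a R (xs : list M) : Prop :=
  match xs with [] => True | x :: xs' => a <= x /\ (x <= R /\ sincr (x + 1) R xs') end.
Definition scoloring (d : nat) a R c b s :=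
  forall xs, length xs = d -> sincr a R xs -> exists v, v < c /\ Entry b s (stuple xs) v.
Definition ssubset a R e h l :=
  (forall i, i < l -> exists x, Entry e h i x /\ (a <= x /\ x <= R)) /\
  (forall i x y, i + 1 < l /\ (Entry e h i x /\ Entry e h (i + 1) y) -> x < y).
Fixpoint sentries e h i (xs : list M) : Prop :=
  match xs with [] => True | x :: xs' => Entry e h i x /\ sentries e h (i + 1) xs' end.
Definition swh (d : nat) b s e h l := forall i, i + snum d < l -> forall xs, length xs = S d -> sentries e h i xs ->
  exists v, Entry b s (stuple (firstn d xs)) v /\ Entry b s (stuple (tl xs)) v.
Definition sWPH (d : nat) (f : M -> M -> Prop) := forall c a, exists R, forall b s, scoloring d a R c b s ->
  exists e h l, 0 < l /\ (ssubset a R e h l /\ (swh d b s e h l /\ exists m y, Entry e h 0 m /\ (f m y /\ y < l))).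
End Semantics.

Section Denotation.
Variable M : model.
Variable s : nat -> sdom M.
Inductive ext (n : nat) (e : nat -> M) : nat -> (nat -> M) -> Prop :=
| ext0 : ext n e n e
| extS n' e' x : ext n e n' e' -> ext n e (S n') (scons x e').
(** A named term is compiled anew at every depth below its binder, so its value has to be the same
    in all extensions of the environment. *)
Definition td n e (t : cterm) (v : M) := forall n' e', ext n e n' e' -> eval M e' (t n') = v.
Definition fd n e (P : cform) (Q : Prop) := forall n' e', ext n e n' e' -> (sat M e' s (P n') <-> Q).
Lemma ext_trans n e n' e' n'' e'' : ext n e n' e' -> ext n' e' n'' e'' -> ext n e n'' e''.
Proof. intros H; induction 1; auto. constructor; auto. Qed.
Lemma ext_le n e n' e' : ext n e n' e' -> (n <= n')%nat.
Proof. induction 1; lia. Qed.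
Lemma td_mono n e n' e' t v : td n e t v -> ext n e n' e' -> td n' e' t v.
Proof. intros H H' m f Hf; apply H. eapply ext_trans; eauto. Qed.
Lemma fd_mono n e n' e' P Q : fd n e P Q -> ext n e n' e' -> fd n' e' P Q.
Proof. intros H H' m f Hf; apply H. eapply ext_trans; eauto. Qed.
Lemma td_var n e x : td (S n) (scons x e) (fun m => Var (m - S n)) x.
Proof.
  intros n' e' H. simpl. induction H; [rewrite Nat.sub_diag; reflexivity|].
  replace (S n' - S n)%nat with (S (n' - S n)); auto. apply ext_le in H. lia.
Qed.
Lemma td_0 n e : td n e czero 0. Proof. intros n' e' _; reflexivity. Qed.
Lemma td_1 n e : td n e cone 1. Proof. intros n' e' _; reflexivity. Qed.
Lemma td_add n e t u x y : td n e t x -> td n e u y -> td n e (cadd t u) (x + y).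
Proof. intros H1 H2 n' e' H; simpl. rewrite (H1 _ _ H), (H2 _ _ H); auto. Qed.
Lemma td_mul n e t u x y : td n e t x -> td n e u y -> td n e (cmul t u) (x * y).
Proof. intros H1 H2 n' e' H; simpl. rewrite (H1 _ _ H), (H2 _ _ H); auto. Qed.
Lemma td_exp n e t u x y : td n e t x -> td n e u y -> td n e (cexp t u) (x ^ y).
Proof. intros H1 H2 n' e' H; simpl. rewrite (H1 _ _ H), (H2 _ _ H); auto. Qed.
Lemma fd_eq n e t u x y : td n e t x -> td n e u y -> fd n e (ceq t u) (x = y).
Proof. intros H1 H2 n' e' H; simpl. rewrite (H1 _ _ H), (H2 _ _ H); tauto. Qed.
Lemma fd_lt n e t u x y : td n e t x -> td n e u y -> fd n e (clt t u) (x < y).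
Proof. intros H1 H2 n' e' H; simpl. rewrite (H1 _ _ H), (H2 _ _ H); tauto. Qed.
Lemma fd_le n e t u x y : td n e t x -> td n e u y -> fd n e (clt t (cadd u cone)) (x <= y).
Proof. intros; apply fd_lt; auto. apply td_add; auto. apply td_1. Qed.
Lemma fd_not n e P P' : fd n e P P' -> fd n e (cnot P) (~ P').
Proof. intros H n' e' E; unfold cnot. rewrite sat_Not, (H _ _ E); tauto. Qed.
Lemma fd_imp n e P P' Q Q' : fd n e P P' -> fd n e Q Q' -> fd n e (cimp P Q) (P' -> Q').
Proof. intros H1 H2 n' e' E; unfold cimp; simpl. rewrite (H1 _ _ E), (H2 _ _ E); tauto. Qed.
Lemma fd_and n e P P' Q Q' : fd n e P P' -> fd n e Q Q' -> fd n e (cand P Q) (P' /\ Q').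
Proof. intros H1 H2 n' e' E; unfold cand. rewrite sat_And, (H1 _ _ E), (H2 _ _ E); tauto. Qed.
Lemma fd_or n e P P' Q Q' : fd n e P P' -> fd n e Q Q' -> fd n e (cor P Q) (P' \/ Q').
Proof. intros H1 H2 n' e' E; unfold cor. rewrite sat_Or, (H1 _ _ E), (H2 _ _ E); tauto. Qed.
Lemma fd_true n e : fd n e ctrue True.
Proof. intros n' e' E; simpl; tauto. Qed.
Lemma fd_call n e P Q : (forall n' e', ext n e n' e' -> forall x v, td n' e' v x -> fd n' e' (P v) (Q x)) -> fd n e (call P) (forall x, Q x).
Proof.
  intros H n' e' E; unfold call; simpl. apply all_iff; intro x.
  apply (H (S n') (scons x e')); [constructor; auto|apply td_var|constructor].
Qed.
Lemma fd_iff_r n e P Q Q' : (Q <-> Q') -> fd n e P Q -> fd n e P Q'.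
Proof. intros H H1 n' e' E. rewrite (H1 _ _ E); auto. Qed.
Lemma fd_cex n e P Q : (forall n' e', ext n e n' e' -> forall x v, td n' e' v x -> fd n' e' (P v) (Q x)) -> fd n e (cex P) (exists x, Q x).
Proof.
  intros H; apply fd_iff_r with (~ forall x, ~ Q x).
  - split; [|firstorder]. intro H'; apply NNPP; intro H2; apply H'; intros x Hx; eauto.
  - apply fd_not, fd_call. intros; apply fd_not; auto.
Qed.
Lemma fd_cball n e t c P Q : td n e t c -> (forall n' e', ext n e n' e' -> forall x v, td n' e' v x -> fd n' e' (P v) (Q x)) -> fd n e (cball t P) (forall x, x < c -> Q x).
Proof. intros Ht H. apply fd_call. intros. apply fd_imp; auto. apply fd_lt; auto. eapply td_mono; eauto. Qed.
Lemma fd_cbex n e t c P Q : td n e t c -> (forall n' e', ext n e n' e' -> forall x v, td n' e' v x -> fd n' e' (P v) (Q x)) -> fd n e (cbex t P) (exists x, x < c /\ Q x).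
Proof.
  intros Ht H; apply fd_iff_r with (~ forall x, x < c -> ~ Q x).
  - split; [|firstorder]. intro H'; apply NNPP; intro H2; apply H'; intros x Hc Hx; eauto.
  - apply fd_not, fd_cball; auto. intros; apply fd_not; auto.
Qed.
End Denotation.

Ltac tds := first [eassumption | apply td_0 | apply td_1 | apply td_add; tds | apply td_mul; tds | apply td_exp; tds | (unfold osnoc, pair, judgement, jfund, jfast, jiter, sosnoc, sjud, mp; progress idtac; fail) | idtac].
Ltac wintro := let n := fresh "n" in let e := fresh "e" in let H := fresh "E" in let x := fresh "x" in let v := fresh "v" in let K := fresh "K" in
  intros n e H x v K;
  repeat match goal with
  | T : td _ ?n0 ?e0 _ _ |- _ => lazymatch type of H with ext _ n0 e0 n e => apply (fun X => td_mono _ _ _ _ _ _ _ X H) in T end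
  | T : fd _ _ ?n0 ?e0 _ _ |- _ => lazymatch type of H with ext _ n0 e0 n e => apply (fun X => fd_mono _ _ _ _ _ _ _ _ X H) in T end
  end.
Ltac fdh := fail.
Ltac fds := first [ eassumption | fdh
  | apply fd_true | apply fd_eq; tds | apply fd_le; tds | apply fd_lt; tds | apply fd_and; fds | apply fd_or; fds | apply fd_not; fds
  | apply fd_cbex; [tds|wintro; fds] | apply fd_cball; [tds|wintro; fds]
  | apply fd_cex; wintro; fds | apply fd_call; wintro; fds | apply fd_imp; fds ].

Section Den.
Variable M : model.
Variable s0 : nat -> sdom M.
Notation td := (td M). Notation fd := (fd M s0).
Lemma td_pair n e t u x y : td n e t x -> td n e u y -> td n e (pair t u) (mp x y).
Proof. intros; unfold pair, mp; tds. Qed.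
Lemma td_osnoc n e t u r x y z : td n e t x -> td n e u y -> td n e r z -> td n e (osnoc t u r) (sosnoc x y z).
Proof. intros; unfold osnoc, sosnoc. apply td_add; [|tds]. repeat apply td_pair; auto. Qed.
Lemma td_jud n e t u r p x y z w : td n e t x -> td n e u y -> td n e r z -> td n e p w -> td n e (judgement t u r p) (sjud x y z w).
Proof. intros; unfold judgement, sjud. repeat apply td_pair; auto. Qed.
Lemma fd_entry n e t u r p x y z w : td n e t x -> td n e u y -> td n e r z -> td n e p w -> fd n e (entry t u r p) (Entry x y z w).
Proof. intros; unfold entry, Entry. fds. Qed.
End Den.
Ltac tds ::= first [eassumption | apply td_0 | apply td_1 | apply td_add; tds | apply td_mul; tds | apply td_exp; tds
  | apply td_pair; tds | apply td_osnoc; tds | apply td_jud; tds ].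
Ltac fdh ::= apply fd_entry; tds.

Section Den2.
Variable M : model.
Variable s0 : nat -> sdom M.
Notation td := (td M). Notation fd := (fd M s0).
Lemma fd_pow n e t u r p x y z w : td n e t x -> td n e u y -> td n e r z -> td n e p w -> fd n e (plus_pow_mul t u r p) (spow x y z w).
Proof. intros; unfold plus_pow_mul, spow. fds. Qed.
Lemma fd_succ n e c a a' x y z : td n e c x -> td n e a y -> td n e a' z -> fd n e (osucc c a a') (sosucc x y z).
Proof. intros; unfold osucc, sosucc. repeat first [apply fd_cbex; [tds|wintro]|apply fd_and]; try fds. Qed.
Lemma fd_limit n e c a x y : td n e c x -> td n e a y -> fd n e (olimit c a) (solimit x y).
Proof. intros; unfold olimit, solimit. fds. Qed.
End Den2.
Ltac fdh ::= first [apply fd_entry; tds|apply fd_pow; tds|apply fd_succ; tds|apply fd_limit; tds].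
Section Den3.
Variable M : model.
Variable s0 : nat -> sdom M.
Notation td := (td M). Notation fd := (fd M s0).
Lemma fd_rule n e c j x y (E : cterm -> cform) (E' : M -> Prop) : td n e c x -> td n e j y ->
  (forall n' e', ext M n e n' e' -> forall v z, td n' e' v z -> fd n' e' (E v) (E' z)) ->
  fd n e (fast_rule c E j) (srule x E' y).
Proof.
  intros Hc Hj HE. unfold fast_rule, srule, jfund, jfast, jiter.
  repeat first [apply fd_cbex; [tds|wintro] | apply fd_and | apply fd_or | apply fd_eq; tds | apply fd_lt; tds | fdh
    | apply HE; [|tds]; repeat match goal with
        | |- ext _ ?a ?b ?a ?b => apply ext0
        | H : ext _ _ _ ?m ?f |- ext _ _ _ ?m ?f => refine (ext_trans _ _ _ _ _ _ _ _ H); clear H end ].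
Qed.
Lemma fd_fast n e a x y va vx vy : td n e a va -> td n e x vx -> td n e y vy -> fd n e (fast a x y) (Fd va vx vy).
Proof.
  intros Ha Hx Hy. unfold fast, Fd, derivable, sder, sderB, jfast.
  do 3 (apply fd_cex; wintro). apply fd_and; [|fds].
  do 2 (apply fd_cball; [tds|wintro]). apply fd_imp; [fds|]. apply fd_rule; try tds.
  intros n' e' E' vv zz Hv.
  repeat match goal with T : td _ _ _ _ |- _ => first [ lazymatch type of T with td n' e' _ _ => fail end | apply (fun X => td_mono _ _ _ _ _ _ _ X E') in T ] end.
  fds.
Qed.
End Den3.
Ltac fdh ::= first [apply fd_entry; tds|apply fd_pow; tds|apply fd_succ; tds|apply fd_limit; tds|apply fd_fast; tds].
Section Den4.
Variable M : model.
Variable s0 : nat -> sdom M.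
Notation td := (td M). Notation fd := (fd M s0).
Lemma fd_finv n e a x y va vx vy : td n e a va -> td n e x vx -> td n e y vy -> fd n e (fast_inv a x y) (sfinv va vx vy).
Proof. intros. unfold fast_inv, sfinv. fds. Qed.
Lemma fd_log n e x y vx vy : td n e x vx -> td n e y vy -> fd n e (log2 x y) (slog2 vx vy).
Proof. intros. unfold log2, slog2. fds. Qed.
Lemma fd_root n e r x y vr vx vy : td n e r vr -> td n e x vx -> td n e y vy -> fd n e (root r x y) (sroot vr vx vy).
Proof. intros. unfold root, sroot. fds. Qed.
Lemma fd_iterlog k : forall n e x y vx vy, td n e x vx -> td n e y vy -> fd n e (iter_log k x y) (siterlog k vx vy).
Proof.
  induction k; intros; simpl; [fds|]. apply fd_cex; wintro. apply fd_and; [apply IHk; tds|apply fd_log; tds].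
Qed.
Lemma td_num n e k : td n e (cnum k) (snum k).
Proof. induction k; simpl; tds. Qed.
Lemma td_code_from o : forall n e acc v, td n e acc v -> td n e (ocode_from acc o) (scode_from v o).
Proof. induction o; intros; simpl; auto. apply IHo2. apply td_osnoc; auto using td_num, td_0. Qed.
Lemma fd_fgraph d al n e x y vx vy : td n e x vx -> td n e y vy -> fd n e (f_graph d al x y) (sfgraph d (scode_from 0 al) vx vy).
Proof.
  intros. unfold f_graph, sfgraph. do 2 (apply fd_cex; wintro).
  apply fd_and; [apply fd_finv; try tds; apply td_code_from, td_0|]. apply fd_and; [apply fd_iterlog; tds|apply fd_root; tds].
Qed.
Lemma fd_forall_tuple k : forall n e P Q,
  (forall n' e', ext M n e n' e' -> forall xs vs, Forall2 (td n' e') vs xs -> length xs = k -> fd n' e' (P vs) (Q xs)) ->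
  fd n e (forall_tuple k P) (forall xs, length xs = k -> Q xs).
Proof.
  induction k; intros n e P Q H; simpl.
  - apply fd_iff_r with (Q []).
    + split; auto. intros HQ [|]; simpl; auto; discriminate.
    + apply H; constructor.
  - apply fd_iff_r with (forall x xs, length xs = k -> Q (x :: xs)).
    + split; [|intros HQ x xs Hx; apply HQ; simpl; auto]. intros HQ [|x xs] Hx; simpl in *; [discriminate|]. apply HQ; auto.
    + apply fd_call. intros n' e' E x v Hv. apply IHk. intros n'' e'' E' xs vs Hxs Hl.
      apply H; [eapply ext_trans; eauto| |simpl; auto]. constructor; auto. eapply td_mono; eauto.
Qed.
Lemma fd_incr n e R vR : td n e R vR -> forall xs vs, Forall2 (td n e) vs xs -> forall a va, td n e a va -> fd n e (increasing a R vs) (sincr va vR xs).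
Proof.
  intros HR. induction 1; intros a va Ha; simpl; [fds|].
  apply fd_and; [fds|]. apply fd_and; [fds|]. apply IHForall2. tds.
Qed.
Lemma td_tuple n e xs vs : Forall2 (td n e) vs xs -> td n e (tuple vs) (stuple xs).
Proof. induction 1; simpl; tds. Qed.
Lemma fd_entries n e e0 h ve vh : td n e e0 ve -> td n e h vh -> forall xs vs, Forall2 (td n e) vs xs -> forall i vi, td n e i vi ->
  fd n e (entries e0 h i vs) (sentries ve vh vi xs).
Proof.
  intros He Hh. induction 1; intros i vi Hi; simpl; [fds|]. apply fd_and; [fds|]. apply IHForall2. tds.
Qed.
Lemma F2_firstn {X Y} (R : X -> Y -> Prop) k : forall xs ys, Forall2 R xs ys -> Forall2 R (firstn k xs) (firstn k ys).
Proof. induction k; simpl; [constructor|]. destruct 1; simpl; constructor; auto. Qed.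
Lemma fd_coloring d n e a R c b s va vR vc vb vs : td n e a va -> td n e R vR -> td n e c vc -> td n e b vb -> td n e s vs ->
  fd n e (coloring d a R c b s) (scoloring d va vR vc vb vs).
Proof.
  intros. unfold coloring, scoloring.
  apply (fd_forall_tuple d n e _ (fun xs => sincr va vR xs -> exists v, v < vc /\ Entry vb vs (stuple xs) v)). intros n' e' E xs us Hxs Hl.
  repeat match goal with T : td n e _ _ |- _ => apply (fun X => td_mono _ _ _ _ _ _ _ X E) in T end.
  apply fd_imp; [apply fd_incr; auto|]. apply td_tuple in Hxs. fds.
Qed.
Lemma fd_wh d n e b s e0 h l vb vs ve vh vl : td n e b vb -> td n e s vs -> td n e e0 ve -> td n e h vh -> td n e l vl ->
  fd n e (weakly_homogeneous d b s e0 h l) (swh d vb vs ve vh vl).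
Proof.
  intros. unfold weakly_homogeneous, swh. apply fd_call; wintro.
  apply fd_imp; [apply fd_lt; try tds; apply td_add; try tds; apply td_num|].
  apply (fd_forall_tuple (S d) _ _ _ (fun xs => sentries ve vh x xs -> exists v, Entry vb vs (stuple (firstn d xs)) v /\ Entry vb vs (stuple (tl xs)) v)).
  intros n' e' E' xs us Hxs Hl.
  repeat match goal with T : td n0 e1 _ _ |- _ => apply (fun X => td_mono _ _ _ _ _ _ _ X E') in T end.
  apply fd_imp; [apply fd_entries; auto|].
  assert (T1 : td n' e' (tuple (firstn d us)) (stuple (firstn d xs))) by (apply td_tuple, F2_firstn; auto).
  assert (T2 : td n' e' (tuple (tl us)) (stuple (tl xs))) by (apply td_tuple; destruct Hxs; simpl; auto).
  fds.
Qed.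
Lemma sat_WPH d al e : sat M e s0 (WPH d (f_graph d al)) <-> sWPH d (sfgraph d (scode_from (0 : M) al)).
Proof.
  assert (H : fd 0%nat e (fun n => sentence (fun k => WPH d (f_graph d al))) True -> True) by auto. clear H.
  match goal with |- _ <-> ?Q => assert (H : forall P, fd 0%nat e P Q -> (sat M e s0 (sentence P) <-> Q)) end.
  { intros P HP. apply HP. constructor. }
  unfold WPH. apply H. clear H. unfold sWPH.
  do 2 (apply fd_call; wintro). apply fd_cex; wintro. do 2 (apply fd_call; wintro).
  apply fd_imp; [apply fd_coloring; tds|]. do 3 (apply fd_cex; wintro).
  apply fd_and; [fds|]. apply fd_and; [unfold subset_enum, ssubset; fds|]. apply fd_and; [apply fd_wh; tds|].
  do 2 (apply fd_cex; wintro). apply fd_and; [fds|]. apply fd_and; [apply fd_fgraph; tds|fds].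
Qed.
End Den4.

(** * Totality of the fast growing functions *)

Section Hierarchy.
Variable A : arithM.
Implicit Types a b c d e i j l m r s v w x y z : A.
Notation D0 := (D0 A (as0 A)). Notation Sg := (Sg A (as0 A)). Notation Pi := (Pi A (as0 A)). Notation Tm := (Tm A).

Lemma D0_Entry (n : nat) (b s i v : ctx A n -> A) : Tm n b -> Tm n s -> Tm n i -> Tm n v -> D0 n (fun g => Entry (b g) (s g) (i g) (v g)).
Proof. intros. unfold Entry. dd. Qed.
Lemma Tm_mp (n : nat) t u : Tm n t -> Tm n u -> Tm n (fun g => mp (t g) (u g)).
Proof. intros; unfold mp; tm. Qed.
Lemma D0_spow (n : nat) (d b m r : ctx A n -> A) : Tm n d -> Tm n b -> Tm n m -> Tm n r -> D0 n (fun g => spow (d g) (b g) (m g) (r g)).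
Proof. intros. unfold spow, sosnoc, mp. dd. Qed.
Ltac ddh ::= first [apply D0_Entry; tm | apply D0_spow; tm].
Lemma D0_sosucc (n : nat) (c a b : ctx A n -> A) : Tm n c -> Tm n a -> Tm n b -> D0 n (fun g => sosucc (c g) (a g) (b g)).
Proof. intros. unfold sosucc, sosnoc, mp. dd. Qed.
Lemma D0_solimit (n : nat) (c a : ctx A n -> A) : Tm n c -> Tm n a -> D0 n (fun g => solimit (c g) (a g)).
Proof. intros. unfold solimit, sosnoc, mp. dd. Qed.
Ltac ddh ::= first [apply D0_Entry; tm | apply D0_spow; tm | apply D0_sosucc; tm | apply D0_solimit; tm].
(** Checking a coded derivation is a bounded matter. Hence [Fd] is at level [Sg 1], and [Tot] at
    level [Pi 2]. *)
Lemma D0_sder (n : nat) (t : ctx A n -> A) : Tm n t -> Sg 1 n (fun g => sder (t g)).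
Proof.
  intro Ht. unfold sder. apply Sg_ex. apply (Sg_ex A 0 (S n) (fun g s0 => exists n0, sderB (snd g) s0 n0 /\ Entry (snd g) s0 n0 (t (fst g)))).
  apply (Sg_ex A 0 (S (S n)) (fun g n0 => sderB (snd (fst g)) (snd g) n0 /\ Entry (snd (fst g)) (snd g) n0 (t (fst (fst g))))).
  apply D0_Sg. lazy beta. apply D0_and; [|apply D0_Entry; tm].
  unfold sderB, srule, sjud, sosnoc, mp. dd.
Qed.

(** Here [n] is the number of entries, whereas in [sderB] it is the last position. This admits the
    empty derivation, from which the axioms of [sder_I0] start. *)
Definition Vs b s n := 0 < b /\ forall i, i < n -> forall j, j < b -> Entry b s i j -> srule b (fun w => exists k, k < i /\ Entry b s k w) j.
Definition InS b s n w := exists k, k < n /\ Entry b s k w.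
Lemma sder_V w : sder w <-> exists b s n, Vs b s n /\ InS b s n w.
Proof.
  split.
  - intros (b & s & n & H & E). exists b, s, (n + 1). split; [split|]; auto; [destruct E; ar|]. exists n. split; auto. ar.
  - intros (b & s & n & (H1 & H2) & (k & Hk & E)). exists b, s, k. split; auto. intros i Hi. apply H2. ar.
Qed.
Lemma sosucc_mono c c' a a' : c <= c' -> sosucc c a a' -> sosucc c' a a'.
Proof. intros H (d & Hd & n & Hn & K). exists d; split; [ar|]. exists n; split; [ar|auto]. Qed.
Lemma solimit_mono c c' a : c <= c' -> solimit c a -> solimit c' a.
Proof. intros H (d & Hd & b & Hb & n & Hn & K). exists d; split; [ar|]. exists b; split; [ar|]. exists n; split; [ar|auto]. Qed.
Lemma srule_mono c c' (E E' : A -> Prop) j : c <= c' -> (forall w, E w -> E' w) -> srule c E j -> srule c' E' j.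
Proof.
  intros Hc HE (a & Ha & x & Hx & y & Hy & H).
  assert (Hb : forall z, z < c -> z < c') by ar. pose proof (sosucc_mono c c'). pose proof (solimit_mono c c').
  exists a; split; auto. exists x; split; auto. exists y; split; auto.
  destruct H as [(-> & d & Hd & b & Hbb & n & Hn & r & Hr & E1 & E2 & H)|[(-> & H)|[(-> & H)|(k & Hk & z & Hz & -> & H)]]].
  - left. split; auto. exists d; split; auto. exists b; split; auto. exists n; split; auto. exists r; split; auto. repeat split; auto.
    destruct H as [(g & Hg & H)|(H & w & Hw & H3)]; [left; exists g|right]; intuition. exists w; intuition.
  - right; left. split; auto. destruct H as [?|[(b & Hbb & H)|(H & b & Hbb & H3)]]; auto.
    + right; left. exists b; intuition.
    + right; right. split; auto. exists b; intuition.
  - right; right; left. auto.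
  - right; right; right. exists k; split; auto. exists z; split; auto. intuition.
Qed.
(** The two derivations are concatenated over a larger common base and [j] is appended. The rules
    look only at earlier entries, so they survive the shift by [n1]. *)
Lemma merge_der c j b1 s1 n1 b2 s2 n2 : Vs b1 s1 n1 -> Vs b2 s2 n2 ->
  srule c (fun w => InS b1 s1 n1 w \/ InS b2 s2 n2 w) j -> sder j.
Proof.
  intros (Hb1 & V1) (Hb2 & V2) HJ.
  set (b := b1 + b2 + c + j + 1). set (N := n1 + n2 + 1).
  set (Q := fun i v => (i < n1 /\ Entry b1 s1 i v) \/ ((exists k, k < n2 /\ (i = n1 + k /\ Entry b2 s2 k v)) \/ (i = n1 + n2 /\ v = j))).
  destruct (seq_comp A Q b N) as (s & _ & Hs).
  - unfold Q, Entry. dd.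
  - intros i Hi. destruct (classic (i < n1)) as [H|H].
    + destruct (Entry_ex A b1 s1 i Hb1) as [v Hv]. exists v. split; [|left; auto]. destruct Hv. unfold b. ar.
    + apply (nlt_le A) in H. apply le_ex in H. destruct H as [k ->].
      destruct (classic (k < n2)) as [H|H].
      * destruct (Entry_ex A b2 s2 k Hb2) as [v Hv]. exists v. split; [|right; left; eauto]. destruct Hv. unfold b. ar.
      * assert (k = n2) by (unfold N in Hi; ar). subst k. exists j. split; [|right; right; auto]. unfold b. ar.
  - assert (S1 : forall i v, i < n1 -> Entry b1 s1 i v -> Entry b s i v).
    { intros i v Hi Hv. destruct (Hs i) as (w & Hw & HQ & HE); [unfold N; ar|].
      destruct HQ as [(_ & Hq)|[(k & Hk & -> & _)|(-> & _)]].
      - rewrite (Entry_fun A _ _ _ _ _ Hv Hq); auto.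
      - exfalso. apply (lt_irr A n1). ar.
      - exfalso. apply (lt_irr A n1). ar. }
    assert (S2 : forall k v, k < n2 -> Entry b2 s2 k v -> Entry b s (n1 + k) v).
    { intros i v Hi Hv. destruct (Hs (n1 + i)) as (w & Hw & HQ & HE); [unfold N; ar|].
      destruct HQ as [(Hlt & Hq)|[(k & Hk & E & Hq)|(E & _)]].
      - exfalso. apply (lt_irr A n1). ar.
      - assert (k = i) by ar. subst k. rewrite (Entry_fun A _ _ _ _ _ Hv Hq); auto.
      - exfalso. apply (lt_irr A n2). ar. }
    exists b, s, (n1 + n2). split.
    + intros i Hi v Hv HE. destruct (Hs i) as (w & Hw & HQ & HE'); [unfold N; ar|].
      rewrite (Entry_fun A _ _ _ _ _ HE HE') in *. clear HE'.
      destruct HQ as [(Hlt & Hq)|[(k & Hk & -> & Hq)|(-> & ->)]].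
      * eapply srule_mono; [| |apply (V1 i Hlt w)]; auto; [unfold b; ar| |destruct Hq; auto].
        intros u (k & Hk & Hu). exists k; split; auto. apply S1; auto. ar.
      * eapply srule_mono; [| |apply (V2 k Hk w)]; auto; [unfold b; ar| |destruct Hq; auto].
        intros u (k' & Hk' & Hu). exists (n1 + k'); split; [ar|]. apply S2; auto. ar.
      * eapply srule_mono; [| |apply HJ]; [unfold b; ar|].
        intros u [(k & Hk & Hu)|(k & Hk & Hu)]; [exists k|exists (n1 + k)]; (split; [ar|auto]).
    + destruct (Hs (n1 + n2)) as (w & Hw & HQ & HE); [unfold N; ar|].
      destruct HQ as [(Hlt & Hq)|[(k & Hk & E & Hq)|(_ & ->)]]; auto; exfalso.
      * apply (lt_irr A n1). ar.
      * apply (lt_irr A n2). ar.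
Qed.
Lemma sder_I c j w1 w2 : sder w1 -> sder w2 -> srule c (fun w => w = w1 \/ w = w2) j -> sder j.
Proof.
  rewrite !sder_V. intros (b1 & s1 & n1 & V1 & I1) (b2 & s2 & n2 & V2 & I2) H.
  apply sder_V, (merge_der c j _ _ _ _ _ _ V1 V2). eapply srule_mono; [| |apply H]; [ar|].
  intros w [->| ->]; auto.
Qed.
Lemma sder_I0 c j : srule c (fun w => False) j -> sder j.
Proof.
  intro H. assert (V : Vs 1 0 0) by (split; [ar|]; intros i Hi; apply a_lt0 in Hi; tauto).
  apply (merge_der c j _ _ _ _ _ _ V V). eapply srule_mono; [| |apply H]; [ar|intros w []].
Qed.

Definition Succ a a' := exists d n, a = sosnoc d 0 n /\ spow d 0 n a'.
Definition Lim a := exists d b n, a = sosnoc d b n /\ 0 < b.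
Definition Fu a x y := sder (sjud 0 a x y).
Definition It k a x y := sder (sjud (k + (1 + 1)) a x y).
Lemma R_F0 x : Fd 0 x (x + 1).
Proof. apply (sder_I0 (x + 1 + 1)). exists 0; split; [ar|]. exists x; split; [ar|]. exists (x + 1); split; [ar|]. right; left; auto. Qed.
Lemma R_FS a b x y : Succ a b -> It (x + 1) b x y -> Fd a x y.
Proof.
  intros (d & n & -> & H) HI. apply (sder_I (sosnoc d 0 n + x + y + b + d + n + 1) _ _ _ HI HI).
  exists (sosnoc d 0 n); split; [ar|]. exists x; split; [ar|]. exists y; split; [ar|]. right; left. split; auto. right; left.
  exists b; split; [ar|]. split; auto. exists d; split; [ar|]. exists n; split; [ar|auto].
Qed.
Lemma R_FL a b x y : Lim a -> Fu a x b -> Fd b x y -> Fd a x y.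
Proof.
  intros (d & e & n & -> & H) HI HF. apply (sder_I (sosnoc d e n + x + y + b + d + e + n + 1) _ _ _ HI HF).
  exists (sosnoc d e n); split; [ar|]. exists x; split; [ar|]. exists y; split; [ar|]. right; left. split; auto. right; right.
  split; [|exists b; split; [ar|auto]]. exists d; split; [ar|]. exists e; split; [ar|]. exists n; split; [ar|auto].
Qed.
Lemma R_I0 a x : It 0 a x x.
Proof. apply (sder_I0 (a + x + 1)). exists a; split; [ar|]. exists x; split; [ar|]. exists x; split; [ar|]. right; right; left; auto. Qed.
Lemma R_IS k a x y z : It k a x z -> Fd a z y -> It (k + 1) a x y.
Proof.
  intros H1 H2. apply (sder_I (a + x + y + z + k + 1) _ _ _ H1 H2). exists a; split; [ar|]. exists x; split; [ar|]. exists y; split; [ar|].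
  right; right; right. exists k; split; [ar|]. exists z; split; [ar|auto].
Qed.
Lemma R_US d b n r g x y : spow d b n r -> Succ b g -> spow r g x y -> Fu (sosnoc d b n) x y.
Proof.
  intros H1 (d' & n' & -> & H2) H3. apply (sder_I0 (sosnoc d (sosnoc d' 0 n') n + x + y + d + sosnoc d' 0 n' + n + r + g + d' + n' + 1)).
  exists (sosnoc d (sosnoc d' 0 n') n); split; [ar|]. exists x; split; [ar|]. exists y; split; [ar|]. left. split; auto.
  exists d; split; [ar|]. exists (sosnoc d' 0 n'); split; [ar|]. exists n; split; [ar|]. exists r; split; [ar|]. repeat split; auto.
  left. exists g; split; [ar|]. split; auto. exists d'; split; [ar|]. exists n'; split; [ar|auto].
Qed.
Lemma R_UL d b n r w x y : spow d b n r -> Lim b -> Fu b x w -> spow r w 1 y -> Fu (sosnoc d b n) x y.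
Proof.
  intros H1 (d' & b' & n' & -> & H2) H3 H4.
  apply (sder_I (sosnoc d (sosnoc d' b' n') n + x + y + d + sosnoc d' b' n' + n + r + w + d' + b' + n' + 1) _ _ _ H3 H3).
  exists (sosnoc d (sosnoc d' b' n') n); split; [ar|]. exists x; split; [ar|]. exists y; split; [ar|]. left. split; auto.
  exists d; split; [ar|]. exists (sosnoc d' b' n'); split; [ar|]. exists n; split; [ar|]. exists r; split; [ar|]. repeat split; auto.
  right. split; [|exists w; split; [ar|auto]]. exists d'; split; [ar|]. exists b'; split; [ar|]. exists n'; split; [ar|auto].
Qed.

Lemma spow0 d b r : spow d b 0 r <-> r = d.
Proof.
  unfold spow. split; [|auto]. intros [[_ H]|(p & Hp & _)]; auto. apply a_lt0 in Hp; tauto.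
Qed.
Lemma spowS d b m r : spow d b (m + 1) r <-> r = sosnoc d b m.
Proof.
  unfold spow. split.
  - intros [[H _]|(p & Hp & E & ->)]; [apply a_S0 in H; tauto|]. apply a_SI in E; subst; auto.
  - intros ->. right. exists m. split; [ar|auto].
Qed.
Lemma zeroS m : m = 0 \/ exists p, m = p + 1.
Proof. destruct (p_tri A 0 m) as [H|[H|H]]; auto; [|apply a_lt0 in H; tauto]. apply p_ltE in H. destruct H as [p ->]. right; exists p. ar. Qed.
Lemma spow_ex d b m : exists r, spow d b m r.
Proof. destruct (zeroS m) as [->|[p ->]]; [exists d; apply spow0; auto|eexists; apply spowS; auto]. Qed.

Lemma mp_mono x y y' : y <= y' -> mp x y <= mp x y'.
Proof. unfold mp. nar. Qed.
Lemma spow_le d b m r : spow d b m r -> r <= d + sosnoc d b m.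
Proof.
  destruct (zeroS m) as [->|[p ->]]; rewrite ?spow0, ?spowS; intros ->; [ar|].
  assert (H : sosnoc d b p <= sosnoc d b (p + 1)); [|ar].
  unfold sosnoc. assert (mp d (mp b p) <= mp d (mp b (p + 1))); [|ar]. apply mp_mono, mp_mono. ar.
Qed.
Definition Prog (P : A -> Prop) := P 0 /\ (forall a a', Succ a a' -> P a' -> P a) /\
  (forall a, Lim a -> (forall x, exists w, Fu a x w /\ P w) -> P a).
(* Gentzen's jump: [P] is closed under adding [omega^b]. *)
Definition Jump (P : A -> Prop) b := forall d m r r', spow d b m r -> spow d b (m + 1) r' -> P r -> P r'.
(** For a successor exponent, [P] climbs from [r] through [r + omega^g * x] by induction on [x] at
    the level of [P], and the limit clause of [Prog] gives the next power. For a limit exponent, the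
    fundamental sequence leads to the jump at smaller exponents. *)
Lemma Prog_Jump (P : A -> Prop) (k : nat) : (k <= aN A)%nat -> Pi k 1 (fun g => P (snd g)) -> Prog P -> Prog (Jump P).
Proof.
  intros Hk HP (H0 & HS & HL). split; [|split].
  - intros d m r r' H1 H2 HPr. apply spowS in H2; subst. apply (HS _ r); auto. exists d, m; auto.
  - intros b g Hb Hg d m r r' H1 H2 HPr. apply spowS in H2; subst.
    assert (Hlim : Lim (sosnoc d b m)).
    { destruct Hb as (d' & n' & -> & _). exists d, (sosnoc d' 0 n'), m. split; auto. unfold sosnoc. ar. }
    apply HL; auto. intro x.
    assert (G : forall x, forall y, spow r g x y -> P y).
    { apply (iPi A k (fun x => forall y, spow r g x y -> P y)); auto.
      - apply (Pi_ext A (as0 A) k 1 (fun h => forall y, spow r g (snd h) y -> P y)); [reflexivity|].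
        destruct k as [|k].
        + apply D0_ext with (fun h : ctx A 1 => forall y, y <= r + sosnoc r g (snd h) -> spow r g (snd h) y -> P y).
          * intro h; split; auto. intros H y Hy. apply H; auto.
            apply spow_le; auto.
          * apply D0_balle; [unfold sosnoc, mp; tm|]. apply D0_imp; [apply D0_spow; tm|]. lazy beta.
            apply (D0_comp A (as0 A) 2 1 (fun h => (tt, snd h)) _ HP). simpl; split; auto; tm.
        + apply Pi_all, Pi_imp; [apply D0_Sg, D0_spow; tm|]. apply (Pi_comp A (as0 A) (S k) 2 1 (fun h => (tt, snd h)) (fun g => P (snd g))); auto. simpl; split; auto; tm.
      - intros y Hy. apply spow0 in Hy; subst; auto.
      - intros z IH y Hy. destruct (spow_ex r g z) as [r' Hr']. apply (Hg r z r' y); auto. }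
    destruct (spow_ex r g x) as [y Hy]. exists y. split; [|eapply G; eauto]. eapply R_US; eauto.
  - intros b Hb Hw d m r r' H1 H2 HPr. apply spowS in H2; subst.
    apply HL; [destruct Hb as (d' & b' & n' & -> & Hb'); exists d, (sosnoc d' b' n'), m; split; auto; unfold sosnoc; ar|].
    intro x. destruct (Hw x) as (w & Hu & Hj). exists (sosnoc r w 0). split.
    + eapply R_UL; eauto. rewrite <- (p_add0 A 1). apply spowS; auto.
    + apply (Hj r 0 r); auto; [apply spow0; auto|apply spowS; auto].
Qed.
Definition Tot a := forall x, exists y, Fd a x y.
Lemma Prog_Tot : Prog Tot.
Proof.
  split; [|split].
  - intro x. exists (x + 1). apply R_F0.
  - intros a b Hab HT x.
    assert (G : forall k, exists y, It k b x y).
    { apply (iSg A 1); [apply aN1| | |].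
      - apply (Sg_ex A 0 1 (fun h y => It (snd h) b x y)). unfold It. apply (D0_sder 2). unfold sjud, mp. tm.
      - exists x; apply R_I0.
      - intros k [z Hz]. destruct (HT z) as [y Hy]. exists y. eapply R_IS; eauto. }
    destruct (G (x + 1)) as [y Hy]. exists y. eapply R_FS; eauto.
  - intros a Ha H x. destruct (H x) as (w & Hu & Hw). destruct (Hw x) as [y Hy]. exists y. eapply R_FL; eauto.
Qed.
Fixpoint Phi (k : nat) : A -> Prop := match k with O => Tot | S k => Jump (Phi k) end.
Lemma Pi_Phi (k : nat) : Pi (S (S k)) 1 (fun g => Phi k (snd g)).
Proof.
  induction k as [|k IH].
  - apply (Pi_all A 1 1 (fun h x => exists y, Fd (snd h) x y)).
    apply (Sg_Pi A (as0 A) 1 2), (Sg_ex A 0 2 (fun h y => Fd (snd (fst h)) (snd h) y)). apply (D0_sder 3). unfold sjud, mp. tm.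
  - simpl Phi. unfold Jump.
    apply Pi_all. apply (Pi_all A (S (S k)) 2 (fun h m => forall r r', spow (snd h) (snd (fst h)) m r -> spow (snd h) (snd (fst h)) (m + 1) r' -> Phi k r -> Phi k r')).
    apply (Pi_all A (S (S k)) 3 (fun h r => forall r', spow (snd (fst h)) (snd (fst (fst h))) (snd h) r -> spow (snd (fst h)) (snd (fst (fst h))) (snd h + 1) r' -> Phi k r -> Phi k r')).
    apply (Pi_all A (S (S k)) 4 (fun h r' => spow (snd (fst (fst h))) (snd (fst (fst (fst h)))) (snd (fst h)) (snd h) -> spow (snd (fst (fst h))) (snd (fst (fst (fst h)))) (snd (fst h) + 1) r' -> Phi k (snd h) -> Phi k r')).
    lazy beta. apply Pi_imp; [apply D0_Sg, D0_spow; tm|]. apply Pi_imp; [apply D0_Sg, D0_spow; tm|].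
    apply Pi_imp.
    + apply (Pi_Sg A (as0 A) (S (S k)) 5). apply (Pi_comp A (as0 A) (S (S k)) 5 1 (fun h => (tt, snd (fst h))) (fun g => Phi k (snd g))); auto. simpl; split; auto; tm.
    + apply (Pi_mono A (as0 A) (S (S k)) (S (S (S k))) 5); [lia|]. apply (Pi_comp A (as0 A) (S (S k)) 5 1 (fun h => (tt, snd h)) (fun g => Phi k (snd g))); auto. simpl; split; auto; tm.
Qed.
(** [Phi k] is at level [Pi (k + 2)]. The step to the next jump uses induction at that level, while
    [Tot] itself asks for level 1. *)
Lemma Prog_Phi (k : nat) : (S k <= aN A)%nat -> Prog (Phi k).
Proof.
  induction k as [|k IH]; intro Hk; [apply Prog_Tot|]. simpl. apply (Prog_Jump _ (S (S k))); [lia|apply Pi_Phi|apply IH; lia].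
Qed.
End Hierarchy.

Section Totality.
Variable A : arithM.
Lemma Phi_finite K m : (S K <= aN A)%nat -> Phi A K (sosnoc 0 0 (snum m)).
Proof.
  intro HK. destruct (Prog_Phi A K HK) as (H0 & HS & _). induction m as [|m IH].
  - apply (HS _ 0); auto. exists 0, 0. split; auto. apply spow0; auto.
  - apply (HS _ (sosnoc 0 0 (snum m))); auto. exists 0, (snum (S m)). split; auto. apply spowS; auto.
Qed.
Lemma Phi_add k b acc m : Phi A (S k) b -> Phi A k acc -> Phi A k (sosnoc acc b (snum m)).
Proof.
  intros Hb Hacc. induction m as [|m IH].
  - apply (Hb acc 0 acc); auto; [apply spow0; auto|]. rewrite p_add0. rewrite <- (p_add0 A 1). apply spowS; auto.
  - apply (Hb acc (snum m + 1) (sosnoc acc b (snum m))); auto; apply spowS; auto.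
Qed.
(** Each jump lowers the tower by one: [Phi (k + 1)] at an exponent lets [Phi k] absorb the
    corresponding term. Coefficients and bottom exponents are standard, so they are reached by
    induction outside the model. *)
Lemma Phi_tower i : forall k, (S (k + i) <= aN A)%nat -> forall al, cnf al -> olt al (omega_tower (S i)) ->
  forall acc, (i = 0%nat -> acc = 0) -> Phi A k acc -> Phi A k (scode_from acc al).
Proof.
  induction i as [|i IHi]; intros k Hk al.
  - intros Hc Hal acc Ha Hacc. rewrite (Ha eq_refl) in *. destruct al as [|b n g]; simpl; auto.
    simpl in Hal. apply ocons_lt in Hal. destruct Hal as [Hal|(-> & [?|(-> & H)])]; [|lia|apply olt_0 in H; tauto].
    destruct b as [|b' n' g']; [|apply ocons_lt in Hal; destruct Hal as [Hal|(_ & [Hal|(_ & Hal)])]; [apply olt_0 in Hal; tauto|lia|apply olt_0 in Hal; tauto]].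
    destruct Hc as (_ & _ & Hg). destruct g as [|b n' g']; [|apply ocons_lt in Hg; destruct Hg as [Hg|(_ & [Hg|(_ & Hg)])]; [apply olt_0 in Hg; tauto|lia|apply olt_0 in Hg; tauto]].
    simpl. apply Phi_finite. lia.
  - induction al as [|b _ n g IHg]; intros Hc Hal acc _ Hacc; simpl; auto.
    destruct Hc as (Hb & Hg & Hgb).
    assert (Hbt : olt b (omega_tower (S i))).
    { apply ocons_lt in Hal. destruct Hal as [Hal|(-> & [?|(-> & H)])]; [auto|lia|apply olt_0 in H; tauto]. }
    apply IHg; auto; [|discriminate|].
    + destruct g as [|b' n' g']; [reflexivity|]. apply ocons_lt in Hgb. destruct Hgb as [H|(-> & [H|(_ & H)])]; [|lia|apply olt_0 in H; tauto].
      apply ocons_lt. left. eapply olt_trans; eauto.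
    + apply Phi_add; auto. apply IHi; auto; [lia|]. apply (proj1 (Prog_Phi A (S k) ltac:(lia))).
Qed.
Theorem Tot_below al n : aN A = S n -> cnf al -> olt al (omega_tower (S n)) -> Tot A (scode_from 0 al).
Proof. intros HN Hc Hal. apply (Phi_tower n 0 ltac:(lia) al Hc Hal 0); auto. exact (proj1 (Prog_Tot A)). Qed.

Implicit Types x y z w : A.
(** This bounds the set whose maximum is the inverse of [F]. The induction runs along the positions
    of the derivation, with all arguments below its base, so that the hypothesis stays bounded;
    values and iterates are treated together. *)
Lemma Fd_le a x y : Fd a x y -> x <= y.
Proof.
  intros (b & s & n & HV & HE).
  assert (G : forall i, i < n + 1 -> forall j, j < b -> Entry b s i j ->
    (forall a, a < b -> forall x, x < b -> forall y, y < b -> j = sjud 1 a x y -> x <= y) /\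
    (forall k, k < b -> forall a, a < b -> forall x, x < b -> forall y, y < b -> j = sjud (k + (1 + 1)) a x y -> x <= y)).
  { apply (sind A (fun i => i < n + 1 -> forall j, j < b -> Entry b s i j ->
    (forall a, a < b -> forall x, x < b -> forall y, y < b -> j = sjud 1 a x y -> x <= y) /\
    (forall k, k < b -> forall a, a < b -> forall x, x < b -> forall y, y < b -> j = sjud (k + (1 + 1)) a x y -> x <= y))).
    - unfold sjud, mp. dd.
    - intros i IH Hi j Hj Hij. specialize (HV i Hi j Hj Hij).
      assert (IH' : forall w, (exists k, k < i /\ Entry b s k w) ->
         (forall a, a < b -> forall x, x < b -> forall y, y < b -> w = sjud 1 a x y -> x <= y) /\
         (forall k, k < b -> forall a, a < b -> forall x, x < b -> forall y, y < b -> w = sjud (k + (1 + 1)) a x y -> x <= y)).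
      { intros w (k & Hk & Hw). apply (IH k Hk); auto; [ar|]. destruct Hw; auto. }
      clear IH. destruct HV as (a0 & Ha0 & x0 & Hx0 & y0 & Hy0 & HR).
      assert (B : forall w, (exists k, k < i /\ Entry b s k w) -> w < b) by (intros w (k & _ & Hw); destruct Hw; auto).
      assert (N02 : forall k : A, k + (1 + 1) <> 0) by (intros k H; rewrite p_addA in H; apply a_S0 in H; auto).
      assert (N12 : forall k : A, k + (1 + 1) <> 1) by (intros k H; rewrite p_addA in H; rewrite <- (p_add0 A 1) in H at 3; apply a_SI, a_S0 in H; auto).
      assert (N01 : (1 : A) <> 0) by (intro H; apply (a_S0 A 0); rewrite p_add0; auto).
      destruct HR as [(-> & _)|[(-> & HR)|[(-> & ->)|(k0 & Hk0 & z0 & Hz0 & -> & H1 & H2)]]].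
      + split; intros; unfold sjud in *; match goal with H : mp _ _ = mp _ _ |- _ => apply mp_inj in H; destruct H as [H _] end; [congruence|].
        exfalso; eapply N02; eauto.
      + split; intros; unfold sjud in *; match goal with H : mp _ _ = mp _ _ |- _ => apply mp_inj in H; destruct H as [? H]; apply mp_inj in H; destruct H as [? H]; apply mp_inj in H; destruct H as [? ?] end;
          [|exfalso; eapply N12; eauto]. subst.
        destruct HR as [(-> & ->)|[(b' & Hb' & _ & HE')|(_ & b' & Hb' & _ & HE')]]; [ar| |].
        * pose proof (B _ HE') as HB. apply IH' in HE'. destruct HE' as [_ HE'].
          apply (HE' (x1 + 1)) with (a := b'); auto. unfold sjud in HB.
          pose proof (mp_l A (x1 + 1 + (1 + 1)) (mp b' (mp x1 y1))). ar.
        * apply IH' in HE'. destruct HE' as [HE' _]. eapply (HE' b'); eauto.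
      + split; intros; unfold sjud in *; match goal with H : mp _ _ = mp _ _ |- _ => apply mp_inj in H; destruct H as [? H]; apply mp_inj in H; destruct H as [? H]; apply mp_inj in H; destruct H as [? ?] end;
          [exfalso; eapply N12; eauto|].
        subst. ar.
      + split; intros; unfold sjud in *; match goal with H : mp _ _ = mp _ _ |- _ => apply mp_inj in H; destruct H as [? H]; apply mp_inj in H; destruct H as [? H]; apply mp_inj in H; destruct H as [? ?] end;
          [exfalso; eapply N12; eauto|]. subst.
        pose proof (proj2 (IH' _ H1) k0 Hk0 _ Ha0 _ Hx0 z0 Hz0 eq_refl).
        pose proof (proj1 (IH' _ H2) _ Ha0 z0 Hz0 _ Hy0 eq_refl). ar. }
  assert (Hb : sjud 1 a x y < b) by (destruct HE; auto).
  assert (B : 1 < b /\ a < b /\ x < b /\ y < b).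
  { unfold sjud in Hb. pose proof (mp_l A 1 (mp a (mp x y))). pose proof (mp_r A 1 (mp a (mp x y))).
    pose proof (mp_l A a (mp x y)). pose proof (mp_r A a (mp x y)). pose proof (mp_l A x y). pose proof (mp_r A x y).
    repeat split; ar. }
  destruct B as (_ & B1 & B2 & B3). apply (G n) with (j := sjud 1 a x y) (a := a); auto. ar.
Qed.
End Totality.

Ltac ddh ::= first [apply D0_Entry; tm | apply D0_spow; tm | apply D0_sosucc; tm | apply D0_solimit; tm].

(** * Weakly homogeneous sets exist *)

Section Combinatorics.
Variable A : arithM.
Notation D0 := (D0 A (as0 A)). Notation Tm := (Tm A). Notation ctx := (ctx A).
Implicit Types x y z w : A.

(** Induction on the number of values: the position of the top value is deleted and the later ones
    move down. Maps are given by codes below [b^B], so quantifying over all of them stays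
    bounded. *)
Lemma php_code b B N : forall m, m <= B -> forall s, s < b ^ B ->
  (forall i, i < m -> exists w, w < N /\ Entry b s i w) ->
  (forall i, i < m -> forall j, j < m -> forall w, w < N -> Entry b s i w -> Entry b s j w -> i = j) -> m <= N.
Proof.
  revert N. apply (ind0 A (fun N => forall m, m <= B -> forall s, s < b ^ B ->
  (forall i, i < m -> exists w, w < N /\ Entry b s i w) ->
  (forall i, i < m -> forall j, j < m -> forall w, w < N -> Entry b s i w -> Entry b s j w -> i = j) -> m <= N)).
  - dd.
  - intros m Hm s Hs H _. destruct (zeroS A m) as [->|[p ->]]; [ar|]. destruct (H p) as (w & Hw & _); [ar|]. apply a_lt0 in Hw; tauto.
  - intros N IH m Hm s Hs Ht Hi.
    destruct (classic (exists i, i < m /\ Entry b s i N)) as [(i0 & Hi0 & E0)|Hn].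
    + destruct (zeroS A m) as [->|[p ->]]; [apply a_lt0 in Hi0; tauto|].
      set (Q := fun i w => (i < i0 /\ Entry b s i w) \/ (i0 <= i /\ Entry b s (i + 1) w)).
      assert (Hb : 0 < b) by (destruct E0; ar).
      destruct (seq_comp A Q b p) as (s' & Hs' & HE).
      { unfold Q. dd. }
      { intros i Hip. destruct (classic (i < i0)) as [H|H].
        - destruct (Entry_ex A b s i Hb) as [w Hw]. exists w. split; [destruct Hw; auto|left; auto].
        - destruct (Entry_ex A b s (i + 1) Hb) as [w Hw]. exists w. split; [destruct Hw; auto|right; split; auto]. apply (nlt_le A); auto. }
      assert (Q1 : forall i w, i < p -> Entry b s' i w -> Q i w).
      { intros i w Hip Hw. destruct (HE i Hip) as (w' & _ & HQ & HE'). rewrite (Entry_fun A _ _ _ _ _ Hw HE'); auto. }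
      assert (Q2 : forall i w, i < p -> Q i w -> w < N).
      { intros i w Hip [[H1 H2]|[H1 H2]].
        - destruct (Ht i) as (w' & Hw' & HE'); [ar|]. rewrite (Entry_fun A _ _ _ _ _ H2 HE') in *.
          apply a_ltS in Hw'. destruct Hw' as [?| ->]; auto. exfalso.
          assert (i = i0) by (apply (Hi i ltac:(ar) i0 ltac:(ar) N ltac:(ar)); auto). subst. apply (lt_irr A i0); auto.
        - destruct (Ht (i + 1)) as (w' & Hw' & HE'); [ar|]. rewrite (Entry_fun A _ _ _ _ _ H2 HE') in *.
          apply a_ltS in Hw'. destruct Hw' as [?| ->]; auto. exfalso.
          assert (i + 1 = i0) by (apply (Hi (i + 1) ltac:(ar) i0 ltac:(ar) N ltac:(ar)); auto). subst. apply (lt_irr A i). ar. }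
      assert (p <= N); [|ar]. apply (IH p ltac:(ar) s').
      * assert (b ^ p <= b ^ B) by (apply exp_mono; auto; ar). ar.
      * intros i Hip. destruct (HE i Hip) as (w' & _ & HQ & HE'). exists w'; split; auto. eapply Q2; eauto.
      * intros i Hip j Hjp w Hw H1 H2. apply Q1 in H1; auto. apply Q1 in H2; auto.
        destruct H1 as [[H1 H3]|[H1 H3]], H2 as [[H2 H4]|[H2 H4]].
        -- apply (Hi i ltac:(ar) j ltac:(ar) w ltac:(ar)); auto.
        -- assert (i = j + 1) by (apply (Hi i ltac:(ar) (j + 1) ltac:(ar) w ltac:(ar)); auto). exfalso; apply (lt_irr A i). ar.
        -- assert (i + 1 = j) by (apply (Hi (i + 1) ltac:(ar) j ltac:(ar) w ltac:(ar)); auto). exfalso; apply (lt_irr A i0). ar.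
        -- apply (a_SI A). apply (Hi (i + 1) ltac:(ar) (j + 1) ltac:(ar) w ltac:(ar)); auto.
    + assert (H : m <= N); [|ar]. apply (IH m Hm s Hs).
      * intros i Him. destruct (Ht i Him) as (w & Hw & HE). exists w; split; auto. apply a_ltS in Hw. destruct Hw as [?| ->]; auto. exfalso; eauto.
      * intros i Him j Hjm w Hw. apply (Hi i Him j Hjm w). ar.
Qed.
Lemma pigeonhole (Q : A -> A -> Prop) m N : D0 2 (fun g => Q (snd (fst g)) (snd g)) ->
  (forall i, i < m -> exists w, w < N /\ Q i w) -> (forall i j w, i < j -> j < m -> Q i w -> Q j w -> False) -> m <= N.
Proof.
  intros HQ Ht Hi. destruct (seq_comp A Q N m HQ Ht) as (s & Hs & HE).
  apply (php_code N m N m ltac:(ar) s Hs).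
  - intros i Him. destruct (HE i Him) as (w & Hw & _ & H). eauto.
  - intros i Him j Hjm w Hw H1 H2.
    destruct (HE i Him) as (w1 & _ & HQ1 & E1). destruct (HE j Hjm) as (w2 & _ & HQ2 & E2).
    rewrite (Entry_fun A _ _ _ _ _ E1 H1) in *. rewrite (Entry_fun A _ _ _ _ _ E2 H2) in *.
    destruct (p_tri A i j) as [H|[H|H]]; auto; exfalso; [apply (Hi i j w)|apply (Hi j i w)]; auto.
Qed.

Definition ev n (ts : list (ctx n -> A)) (g : ctx n) : list A := map (fun t => t g) ts.
Lemma Tm_stuple n ts : Forall (Tm n) ts -> Tm n (fun g => stuple (ev n ts g)).
Proof. induction 1; simpl; [tm|]. apply Tm_mp; auto. Qed.
Lemma D0_sentries (n : nat) (e h : ctx n -> A) ts : Tm n e -> Tm n h -> Forall (Tm n) ts -> forall i : ctx n -> A, Tm n i ->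
  D0 n (fun g => sentries (e g) (h g) (i g) (ev n ts g)).
Proof.
  intros He Hh. induction 1; intros i Hi; simpl; [dd|]. apply D0_and; [dd|]. apply (IHForall (fun g => i g + 1)). tm.
Qed.
Lemma D0_sincr (n : nat) (R : ctx n -> A) ts : Tm n R -> Forall (Tm n) ts -> forall a : ctx n -> A, Tm n a -> D0 n (fun g => sincr (a g) (R g) (ev n ts g)).
Proof.
  intros HR. induction 1; intros a Ha; simpl; [dd|]. apply D0_and; [dd|]. apply D0_and; [dd|]. apply (IHForall (fun g => x g + 1)). tm.
Qed.
Definition wkl n (ts : list (ctx n -> A)) : list (ctx (S n) -> A) := map (fun t (g : ctx (S n)) => t (fst g)) ts.
Lemma wkl_Tm n ts : Forall (Tm n) ts -> Forall (Tm (S n)) (wkl n ts).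
Proof. induction 1; simpl; constructor; auto. apply Tm_fst; auto. Qed.
Lemma wkl_ev n ts g : ev (S n) (wkl n ts) g = ev n ts (fst g).
Proof. unfold ev, wkl. rewrite map_map. reflexivity. Qed.
Lemma wkl_len n ts : length (wkl n ts) = length ts.
Proof. apply length_map. Qed.
Definition DL (n k : nat) (P : ctx n -> list A -> Prop) := forall m f ts, TmC A m n f -> length ts = k -> Forall (Tm m) ts -> D0 m (fun g => P (f g) (ev m ts g)).
Lemma D0_exlist k : forall n P (B : ctx n -> A), DL n k P -> Tm n B -> D0 n (fun g => exists xs, length xs = k /\ (Forall (fun x => x < B g) xs /\ P g xs)).
Proof.
  induction k as [|k IH]; intros n P B HP HB.
  - apply D0_ext with (fun g => P g []); [|apply (HP n (fun g => g) []); auto; apply TmC_id].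
    intro g; split; [intro H; exists []; auto|]. intros ([|] & H & _ & H'); [auto|discriminate].
  - apply D0_ext with (fun g => exists x, x < B g /\ exists xs, length xs = k /\ (Forall (fun x => x < B g) xs /\ P g (x :: xs))).
    + intro g; split.
      * intros (x & Hx & xs & Hl & H1 & H2). exists (x :: xs). simpl; repeat split; auto.
      * intros ([|x xs] & Hl & H1 & H2); [discriminate|]. inversion H1; subst. exists x; split; auto. exists xs. simpl in Hl. auto.
    + apply D0_bex; auto. lazy beta. apply (IH (S n) (fun g xs => P (fst g) (snd g :: xs)) (fun g => B (fst g))); [|apply Tm_fst; auto].
      intros m f ts [Hf1 Hf2] Hl Ht. apply (HP m (fun g => fst (f g)) ((fun g => snd (f g)) :: ts)); simpl; auto.
Qed.

Lemma sentries_fun (e h : A) xs : forall ys i, length xs = length ys -> sentries e h i xs -> sentries e h i ys -> xs = ys.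
Proof.
  induction xs as [|x xs IH]; intros [|y ys] i Hl; simpl in *; try discriminate; auto.
  intros [H1 H2] [H3 H4]. f_equal; [eapply Entry_fun; eauto|]. injection Hl as Hl. eapply IH; eauto.
Qed.
Lemma sentries_firstn (e h : A) k : forall xs i, sentries e h i xs -> sentries e h i (firstn k xs).
Proof. induction k; intros [|x xs] i; simpl; auto. intros [H1 H2]; auto. Qed.
Lemma sentries_tl (e h : A) xs i : sentries e h i xs -> sentries e h (i + 1) (tl xs).
Proof. destruct xs; simpl; tauto. Qed.
Lemma snum_S (k : nat) : (snum (S k) : A) = snum k + 1. Proof. reflexivity. Qed.
Lemma sentries_app (e h : A) xs : forall ys i, sentries e h i (xs ++ ys) <-> sentries e h i xs /\ sentries e h (i + snum (length xs)) ys.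
Proof.
  induction xs as [|x xs IH]; intros ys i; simpl; [rewrite a_add0; tauto|]. rewrite IH.
  replace (i + 1 + snum (length xs)) with (i + (snum (length xs) + 1)); [tauto|]. ar.
Qed.
Lemma sentries_low (e h w n : A) xs : forall i, i + snum (length xs) <= n -> sentries e h i xs -> sentries e (h + w * e ^ n) i xs.
Proof.
  induction xs as [|x xs IH]; intros i Hi; simpl; auto. intros [H1 H2]. rewrite snum_S || simpl in Hi. simpl in Hi. split.
  - apply Entry_low; auto. ar.
  - apply IH; auto. ar.
Qed.
Lemma code_list (e : A) xs : 0 < e -> Forall (fun x => x < e) xs -> exists h, h < e ^ snum (length xs) /\ sentries e h 0 xs.
Proof.
  intro He. induction xs as [|x xs IH] using rev_ind; intro H.
  - exists 0. simpl. rewrite a_exp0. split; auto. ar.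
  - apply Forall_app in H. destruct H as [H1 H2]. inversion H2; subst. destruct (IH H1) as (h & Hh & HE).
    exists (h + x * e ^ snum (length xs)). rewrite length_app. simpl length. rewrite Nat.add_1_r, snum_S, a_expS. split.
    + generalize dependent (e ^ snum (length xs)). intros. nar.
    + apply sentries_app. split; [apply sentries_low; auto; ar|]. simpl. split; auto. rewrite p_add0. apply Entry_top; auto.
Qed.
End Combinatorics.

Lemma lt02 (A : arithM) : (0 : A) < 1 + 1. Proof. ar. Qed.
Lemma lt12 (A : arithM) : (1 : A) < 1 + 1. Proof. ar. Qed.
Ltac sp := repeat match goal with |- _ /\ _ => split end.
Lemma snum_pos (A : arithM) k : (1 <= k)%nat -> 1 <= (snum k : A).
Proof. intro H. destruct k; [lia|]. rewrite snum_S. ar. Qed.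
Lemma ev_wk (A : arithM) n (ts : list (ctx A n -> A)) g : ev A (S n) ((fun g => snd g) :: wkl A n ts) g = snd g :: ev A n ts (fst g).
Proof. unfold ev, wkl; simpl. rewrite map_map. reflexivity. Qed.
Section UpperBound.
Variable A : arithM.
Notation D0 := (D0 A (as0 A)). Notation Tm := (Tm A). Notation ctx := (ctx A). Notation ev := (ev A).
Variables a R c b s l : A.
Variable D : nat.
Hypothesis HD : (1 <= D)%nat.
Hypothesis Hcol : scoloring (S D) a R c b s.
Hypothesis NW : forall e h : A, ssubset a R e h l -> swh (S D) b s e h l -> False.
Local Notation e := (R + 1).
Ltac arclear ::= clear - A a R c b s l D.

Definition isseq (h m : A) := (forall i, i < m -> exists x, x < e /\ (Entry e h i x /\ a <= x)) /\
  (forall i, i < m -> i + 1 < m -> forall x, x < e -> forall y, y < e -> Entry e h i x -> Entry e h (i + 1) y -> x < y).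
(* [h] enumerates an increasing path of [r + D] points ending in the [D]-tuple [t], all of whose [r] consecutive
   [S D]-tuples have colour [v]. *)
Definition Path (v : A) (t : list A) (r : A) := exists h, h < e ^ (r + snum D) /\ (isseq h (r + snum D) /\ (sentries e h r t /\
  forall i, i < r -> exists xs, length xs = S D /\ (Forall (fun x => x < e) xs /\ (sentries e h i xs /\ Entry b s (stuple xs) v)))).
Lemma D0_Path (n : nat) (v r : ctx n -> A) ts : Tm n v -> Tm n r -> Forall (Tm n) ts -> D0 n (fun g => Path (v g) (ev n ts g) (r g)).
Proof.
  intros Hv Hr Ht. unfold Path. apply D0_bex; [tm|]. lazy beta. apply D0_and; [unfold isseq; dd|]. apply D0_and.
  - eapply D0_ext; [|apply (D0_sentries A (S n) (fun _ => e) (fun g => snd g) (wkl A n ts) ltac:(tm) ltac:(tm) (wkl_Tm A n ts Ht) (fun g => r (fst g)) ltac:(tm))].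
    intro g. cbv beta. rewrite wkl_ev. reflexivity.
  - apply D0_ball; [tm|]. lazy beta.
    apply (D0_exlist A (S D) (S (S n)) (fun g xs => sentries e (snd (fst g)) (snd g) xs /\ Entry b s (stuple xs) (v (fst (fst g)))) (fun _ => e)); [|tm].
    intros m f us Hf Hl Hus. destruct Hf as [[Hf1 Hf2] Hf3]. apply D0_and.
    + apply (D0_sentries A m (fun _ => e) (fun g => snd (fst (f g))) us); auto. tm.
    + apply D0_Entry; try tm; [apply Tm_stuple; auto|]. apply (Tm_comp A m n (fun g => fst (fst (f g))) v); auto.
Qed.
Lemma seq_list (h : A) xs : forall a' j, sentries e h j xs -> sincr a' R xs ->
  (forall i, j <= i -> i < j + snum (length xs) -> exists y, y < e /\ (Entry e h i y /\ a' <= y)) /\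
  (forall i x y, j <= i -> i + 1 < j + snum (length xs) -> Entry e h i x -> Entry e h (i + 1) y -> x < y).
Proof.
  induction xs as [|x xs IH]; intros a' j; simpl.
  - intros _ _. rewrite a_add0. split; intros; exfalso; [apply (lt_irr A i); ar|apply (lt_irr A i); ar].
  - intros [H1 H2] (K1 & K2 & K3). destruct (IH (x + 1) (j + 1) H2 K3) as [IH1 IH2]. split.
    + intros i Hi Hi2. destruct (classic (i = j)) as [->|Hij]; [exists x; sp; auto; ar|].
      destruct (IH1 i) as (y & Hy & HE & Hxy); [destruct (p_tri A i j) as [?|[?|?]]; [exfalso; apply (lt_irr A i); ar|tauto|ar]|ar|].
      exists y. sp; auto. ar.
    + intros i z y Hi Hi2 E1 E2. destruct (classic (i = j)) as [->|Hij].
      * rewrite (Entry_fun A _ _ _ _ _ E1 H1). destruct (IH1 (j + 1)) as (y' & _ & HE & Hxy); [ar|ar|].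
        rewrite (Entry_fun A _ _ _ _ _ E2 HE). ar.
      * apply (IH2 i); auto; [destruct (p_tri A i j) as [?|[?|?]]; [exfalso; apply (lt_irr A i); ar|tauto|ar]|ar].
Qed.
Lemma sincr_lt xs : forall a', sincr a' R xs -> Forall (fun x => x < e) xs.
Proof. induction xs as [|x xs IH]; intros a' H; [constructor|]. destruct H as (H1 & H2 & H3). constructor; [ar|eauto]. Qed.
Lemma path0 v t : length t = D -> sincr a R t -> Path v t 0.
Proof.
  intros Hl Ht. destruct (code_list A e t) as (h & Hh & HE); [ar|eapply sincr_lt; eauto|].
  unfold Path. rewrite p_add0. rewrite Hl in Hh. exists h. split; auto. destruct (seq_list h t a 0 HE Ht) as [S1 S2].
  rewrite Hl in *. rewrite p_add0 in *. split; [split|split; auto].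
  - intros i Hi. apply S1; auto. ar.
  - intros i Hi Hi2 x _ y _. apply S2; auto. ar.
  - intros i Hi; apply a_lt0 in Hi; tauto.
Qed.
Lemma sincr_last t z y : forall a', sincr a' R (t ++ [z; y]) -> z < y /\ a' <= y /\ y <= R.
Proof.
  induction t as [|x t IH]; intros a'; simpl.
  - intros (H1 & H2 & H3 & H4 & _). sp; auto; ar.
  - intros (H1 & H2 & H3). apply IH in H3. destruct H3 as (K1 & K2 & K3). sp; auto. ar.
Qed.
Lemma pathS v xs r : length xs = S D -> sincr a R xs -> Entry b s (stuple xs) v -> Path v (firstn D xs) r -> Path v (tl xs) (r + 1).
Proof.
  intros Hl Hx Hv (h & Hh & (I1 & I2) & HS & HW).
  destruct (exists_last (l := xs)) as (t & y & E); [intros ->; discriminate|].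
  assert (Ht : length t = D) by (rewrite E, length_app in Hl; simpl in Hl; lia).
  assert (Et : firstn D xs = t) by (rewrite E, firstn_app, Ht, Nat.sub_diag, <- Ht, firstn_all, app_nil_r; auto).
  rewrite Et in HS.
  destruct (exists_last (l := t)) as (t0 & z & E0); [intros ->; simpl in Ht; lia|].
  assert (Hzy : z < y /\ a <= y /\ y <= R) by (apply (sincr_last t0); rewrite E, E0, <- app_assoc in Hx; exact Hx).
  destruct Hzy as (Hzy & Hay & HyR).
  assert (Hye : y < e) by (ar).
  set (n := r + snum D) in *. set (h' := h + y * e ^ n).
  assert (HS' : sentries e h' r xs).
  { rewrite E. apply sentries_app. split; [apply sentries_low; auto; rewrite Ht; unfold n; ar|]. rewrite Ht. simpl. split; auto. apply Entry_top; auto. }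
  assert (En : r + 1 + snum D = n + 1) by (unfold n; ar).
  exists h'. rewrite En. split; [|split; [split|split]].
  - rewrite a_expS. unfold h'. generalize dependent (e ^ n). intros. nar.
  - intros i Hi. apply a_ltS in Hi. destruct Hi as [Hi| ->].
    + destruct (I1 i Hi) as (x & Hxe & HE & Hax). exists x. sp; auto. apply Entry_low; auto.
    + exists y. sp; auto. apply Entry_top; auto.
  - intros i Hi Hi2 x Hxe w Hwe E1 E2. apply a_ltS in Hi2.
    assert (Hin : i < n) by (destruct Hi2 as [?|Hi2]; [ar|rewrite <- Hi2; ar]).
    assert (L1 : forall x', Entry e h i x' -> x = x') by (intros x' Hx'; eapply (Entry_fun A); [apply E1|apply Entry_low; auto]).
    destruct (I1 i Hin) as (x' & Hxe' & HE1 & _). rewrite (L1 _ HE1) in *.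
    destruct Hi2 as [Hi2|Hi2].
    + destruct (I1 (i + 1) Hi2) as (w' & Hwe' & HE2 & _).
      rewrite (Entry_fun A _ _ _ _ _ E2 (Entry_low A _ _ _ _ _ _ Hi2 HE2)) in *. apply (I2 i); auto.
    + assert (w = y) by (eapply (Entry_fun A); [apply E2|rewrite Hi2; apply Entry_top; auto]). subst w.
      assert (x' = z); [|subst; auto]. eapply (Entry_fun A); [apply HE1|].
      rewrite E0 in HS. apply sentries_app in HS. destruct HS as [_ [HS _]].
      replace i with (r + snum (length t0)); auto. apply (a_SI A). rewrite Hi2. unfold n. rewrite <- Ht, E0, length_app. simpl length. rewrite Nat.add_1_r, snum_S. ar.
  - apply sentries_tl; auto.
  - intros i Hi. apply a_ltS in Hi. destruct Hi as [Hi| ->].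
    + destruct (HW i Hi) as (us & Hul & Hu1 & Hu2 & Hu3). exists us. sp; auto. apply sentries_low; auto. rewrite Hul, snum_S. unfold n. ar.
    + exists xs. sp; auto. eapply sincr_lt; eauto.
Qed.
Lemma pathB v t r : Path v t r -> r < l.
Proof.
  intros (h & Hh & (I1 & I2) & HS & HW). apply NNPP; intro H. apply (nlt_le A) in H.
  assert (HD1 : 1 <= (snum D : A)) by (apply snum_pos; exact HD).
  apply (NW e h).
  - split.
    + intros i Hi. destruct (I1 i) as (x & Hx & HE & Hax); [ar|]. exists x. sp; auto.
    + intros i x y (Hi & E1 & E2). apply (I2 i); auto; try ar; [destruct E1; auto|destruct E2; auto].
  - intros i Hi xs Hl HE. rewrite snum_S in Hi.
    assert (K : forall j ys, j < r -> length ys = S D -> sentries e h j ys -> Entry b s (stuple ys) v).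
    { intros j ys Hj Hys HEy. destruct (HW j Hj) as (us & Hul & _ & Hu2 & Hu3). rewrite (sentries_fun A e h ys us j); auto; congruence. }
    exists v. split.
    + apply (K i); [ar|rewrite length_firstn, Hl; lia|apply sentries_firstn; auto].
    + apply (K (i + 1)); [ar|destruct xs; simpl in *; lia|apply sentries_tl; auto].
Qed.
Definition Vm (v : A) t (r : A) := Path v t r /\ forall r', r' < l -> r < r' -> ~ Path v t r'.
Lemma D0_Vm (n : nat) (v r : ctx n -> A) ts : Tm n v -> Tm n r -> Forall (Tm n) ts -> D0 n (fun g => Vm (v g) (ev n ts g) (r g)).
Proof.
  intros Hv Hr Ht. unfold Vm. apply D0_and; [apply D0_Path; auto|]. apply D0_ball; [tm|]. lazy beta. apply D0_imp; [dd|]. apply D0_not.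
  eapply D0_ext; [|apply (D0_Path (S n) (fun g => v (fst g)) (fun g => snd g) (wkl A n ts)); [tm|tm|apply wkl_Tm; auto]].
  intro g; cbv beta; rewrite wkl_ev; reflexivity.
Qed.
Lemma Vm_ex v t : length t = D -> sincr a R t -> exists r, r < l /\ Vm v t r.
Proof.
  intros Hl Ht. destruct (maxP A 0 (Path v t) l) as (r & Hr & Hm).
  - apply aN1.
  - apply D0_Sg. eapply D0_ext; [|apply (D0_Path 1 (fun _ => v) (fun g => snd g) (map (fun x (_ : ctx 1) => x) t)); [tm|tm|]].
    + intro g. cbv beta. unfold ev. rewrite map_map, map_id. reflexivity.
    + apply Forall_map, Forall_forall. intros x _. tm.
  - exists 0. apply path0; auto.
  - intros x Hx. apply pathB in Hx. ar.
  - exists r. split; [eapply pathB; eauto|]. split; auto. intros r' _ Hlt Hp. apply Hm in Hp. apply (lt_irr A r). ar.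
Qed.

(* [F] relates each increasing [k]-tuple to colours below [N], and consecutive [k]-tuples share no colour *)
Record proper (k : nat) (N : A) (F : list A -> A -> Prop) : Prop := {
  pr_def : forall n ts (w : ctx n -> A), Forall (Tm n) ts -> length ts = k -> Tm n w -> D0 n (fun g => F (ev n ts g) (w g));
  pr_tot : forall t, length t = k -> sincr a R t -> exists w, w < N /\ F t w;
  pr_prop : forall xs w, length xs = S k -> sincr a R xs -> F (firstn k xs) w -> F (tl xs) w -> False }.
Lemma sincr_weak xs a1 a2 : a1 <= a2 -> sincr a2 R xs -> sincr a1 R xs.
Proof. destruct xs; simpl; auto. intros H (H1 & H2 & H3). sp; auto. ar. Qed.
Definition F0 (t : list A) (w : A) := forall v, v < c -> exists r, r < l /\ (Vm v t r /\ Entry l w v r).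
(** If [xs] has colour [v], every [v]-path ending in its first [D] points extends by one to a path
    ending in its last [D], so the [v]-th digit strictly grows. *)
Lemma proper_top : proper D (l ^ c) F0.
Proof.
  split.
  - intros n ts w Hts Hl Hw. unfold F0. apply D0_ball; [tm|]. apply D0_bex; [tm|]. lazy beta. apply D0_and; [|apply D0_Entry; tm].
    eapply D0_ext; [|apply (D0_Vm (S (S n)) (fun g => snd (fst g)) (fun g => snd g) (wkl A (S n) (wkl A n ts))); [tm|tm|apply wkl_Tm, wkl_Tm; auto]].
    intro g; cbv beta; rewrite !wkl_ev; reflexivity.
  - intros t Hl Ht. destruct (seq_comp A (fun v r => Vm v t r) l c) as (w & Hw & HE).
    + eapply D0_ext; [|apply (D0_Vm 2 (fun g => snd (fst g)) (fun g => snd g) (map (fun x (_ : ctx 2) => x) t)); [tm|tm|]].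
      * intro g. cbv beta. unfold ev. rewrite map_map, map_id. reflexivity.
      * apply Forall_map, Forall_forall. intros x _. tm.
    + intros v _. apply Vm_ex; auto.
    + exists w; split; auto.
  - intros xs w Hl Hx H1 H2. destruct (Hcol xs Hl Hx) as (v & Hv & HE).
    destruct (H1 v Hv) as (r & Hr & (P1 & _) & E1). destruct (H2 v Hv) as (r' & Hr' & (_ & M2) & E2).
    rewrite (Entry_fun A _ _ _ _ _ E2 E1) in *. pose proof (pathS v xs r Hl Hx HE P1) as HP. pose proof (pathB _ _ _ HP).
    apply (M2 (r + 1)); auto. ar.
Qed.
Definition ex1 (F : list A -> A -> Prop) (t : list A) (w : A) := exists x, x < e /\ (sincr a R (x :: t) /\ F (x :: t) w).
Definition Fdown (F : list A -> A -> Prop) (N : A) (t : list A) (W : A) :=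
  forall w, w < N -> (Entry (1 + 1) W w 1 <-> ex1 F t w).
(** Suppose [firstn k xs] and [tl xs] had the same set of extension colours. A colour of [xs]
    belongs to the set of [tl xs], hence is also the colour of some [x :: firstn k xs]; this tuple
    and [xs] overlap, against properness. *)
Lemma proper_down k N F : (1 <= k)%nat -> proper (S k) N F -> proper k ((1 + 1) ^ N) (Fdown F N).
Proof.
  intros Hk [Pd Pt Pp].
  assert (Dex : forall n ts (w : ctx n -> A), Forall (Tm n) ts -> length ts = k -> Tm n w -> D0 n (fun g => ex1 F (ev n ts g) (w g))).
  { intros n ts w Hts Hl Hw. unfold ex1. apply D0_bex; [tm|]. lazy beta. apply D0_and.
    - eapply D0_ext; [|apply (D0_sincr A (S n) (fun _ => R) ((fun g => snd g) :: wkl A n ts)) with (a := fun _ : ctx (S n) => a); [tm|constructor; [tm|apply wkl_Tm; auto]|tm]].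
      intro g. cbv beta. rewrite ev_wk. reflexivity.
    - eapply D0_ext; [|apply (Pd (S n) ((fun g => snd g) :: wkl A n ts) (fun g => w (fst g))); [constructor; [tm|apply wkl_Tm; auto]|cbn [length]; rewrite wkl_len; auto|tm]].
      intro g. cbv beta. rewrite ev_wk. reflexivity. }
  split.
  - intros n ts W Hts Hl HW. unfold Fdown. apply D0_ball; [tm|]. lazy beta. apply D0_iff; [dd|].
    eapply D0_ext; [|apply (Dex (S n) (wkl A n ts) (fun g => snd g)); [apply wkl_Tm; auto|rewrite wkl_len; auto|tm]].
    intro g; cbv beta; rewrite wkl_ev; reflexivity.
  - intros t Hl Ht.
    assert (Dt : D0 2 (fun g => ex1 F t (snd (fst g)))).
    { eapply D0_ext; [|apply (Dex 2 (map (fun x (_ : ctx 2) => x) t) (fun g => snd (fst g))); [|rewrite length_map; auto|tm]].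
      - intro g. cbv beta. unfold ev. rewrite map_map, map_id. reflexivity.
      - apply Forall_map, Forall_forall. intros x _. tm. }
    destruct (seq_comp A (fun w v => (ex1 F t w /\ v = 1) \/ (~ ex1 F t w /\ v = 0)) (1 + 1) N) as (W & HW & HE).
    + apply D0_or; apply D0_and; try dd.
    + intros w _. destruct (classic (ex1 F t w)); [exists 1; split; [apply lt12|auto]|exists 0; split; [apply lt02|auto]].
    + exists W; split; auto. intros w Hw. destruct (HE w Hw) as (v & Hv & HQ & HE1). split.
      * intro HE2. rewrite (Entry_fun A _ _ _ _ _ HE1 HE2) in *. destruct HQ as [[H _]|[_ H]]; auto.
        exfalso. apply (a_S0 A 0). rewrite p_add0; auto.
      * intro H. destruct HQ as [[_ ->]|[H' _]]; [auto|tauto].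
  - intros xs W Hl Hx H1 H2. destruct (Pt xs Hl Hx) as (w & Hw & HF).
    assert (E : ex1 F (tl xs) w).
    { destruct xs as [|x xs]; [discriminate|]. exists x. split; [|split; auto]. destruct Hx as (_ & Hx & _). ar. }
    apply H2 in E; auto. apply H1 in E; auto. destruct E as (x & Hxe & Hxi & HFx).
    apply (Pp (x :: xs) w); simpl; auto.
    destruct Hxi as (K1 & K2 & K3). sp; auto.
    destruct xs as [|x0 xs]; [discriminate|]. destruct k as [|k]; [lia|]. simpl in K3. destruct K3 as (K3 & _).
    destruct Hx as (L1 & L2 & L3). simpl. auto.
Qed.
Fixpoint Tw (k : nat) (x : A) : A := match k with O => x | S k => (1 + 1) ^ Tw k x end.
Lemma proper_tower k : (k < D)%nat -> exists F, proper (D - k) (Tw k (l ^ c)) F.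
Proof.
  induction k as [|k IH]; intro Hk.
  - exists F0. rewrite Nat.sub_0_r. apply proper_top.
  - destruct IH as [F HF]; [lia|]. exists (Fdown F (Tw k (l ^ c))). simpl. apply proper_down; [lia|].
    replace (S (D - S k)) with (D - k)%nat by lia. auto.
Qed.
(** On single points every increasing pair is consecutive, so properness is injectivity and the
    pigeonhole principle applies. *)
Theorem upper_bound : R + 1 <= a + Tw (D - 1) (l ^ c).
Proof.
  destruct (proper_tower (D - 1)) as [F [Pd Pt Pp]]; [lia|]. replace (D - (D - 1))%nat with 1%nat in * by lia.
  apply NNPP; intro H. apply (nle_lt A) in H.
  assert (HR : exists m, R + 1 = a + m) by (apply le_ex; ar). destruct HR as [m Hm].
  assert (G : m <= Tw (D - 1) (l ^ c)); [|apply (lt_irr A (R + 1)); ar].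
  apply (pigeonhole A (fun i w => F [a + i] w)).
  - apply (Pd 2%nat [fun g => a + snd (fst g)] (fun g => snd g)); auto; [constructor; auto|]; tm.
  - intros i Hi. apply Pt; auto. simpl. sp; ar.
  - intros i j w Hij Hj H1 H2. apply (Pp [a + i; a + j] w); auto. simpl. sp; ar.
Qed.
End UpperBound.

Ltac arclear ::= clear.

Section Provable.
Variable A : arithM.
Implicit Types x y z w : A.
Notation "2" := (1 + 1) : m_scope.

Lemma max0 (P : A -> Prop) (b : A) : D0 A (as0 A) 1 (fun g => P (snd g)) -> (exists x, P x) -> (forall x, P x -> x <= b) ->
  exists x, P x /\ forall y, P y -> y <= x.
Proof. intros HP. apply (maxP A 0); [apply aN1|]. apply D0_Sg, HP. Qed.
Lemma slog2_ex x : exists y, slog2 x y.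
Proof.
  destruct (classic (x = 0)) as [->|Hx]; [exists 0; left; auto|].
  assert (H1 : 1 <= x) by (destruct (zeroS A x) as [->|[p ->]]; [tauto|ar]).
  destruct (max0 (fun y => 2 ^ y <= x) x) as (y & Hy & Hm); [dd|exists 0; rewrite a_exp0; auto| |].
  - intros z Hz. pose proof (lt_2exp A z). ar.
  - exists y. right. split; auto. apply (nle_lt A). intro H. apply Hm in H. apply (lt_irr A y). ar.
Qed.
Lemma siterlog_ex k : forall x, exists y, siterlog k x y.
Proof. induction k as [|k IH]; intro x; simpl; [eauto|]. destruct (IH x) as [z Hz]. destruct (slog2_ex z) as [y Hy]. eauto. Qed.
Lemma sroot_ex r x : 0 < r -> exists y, sroot r x y.
Proof.
  intro Hr. destruct (zeroS A r) as [->|[p ->]]; [apply a_lt0 in Hr; tauto|].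
  destruct (max0 (fun y => y ^ (p + 1) <= x) x) as (y & Hy & Hm); [dd| | |].
  - exists 0. rewrite a_expS, p_mul0. ar.
  - intros z Hz. destruct (classic (z = 0)) as [->|Hz0]; [ar|].
    assert (0 < z) by (destruct (zeroS A z) as [->|[q ->]]; [tauto|ar]).
    pose proof (exp_pos A z p ltac:(auto)). rewrite a_expS in Hz. nar.
  - exists y. right. split; auto. split; auto. apply (nle_lt A). intro H. apply Hm in H. apply (lt_irr A y). ar.
Qed.
Lemma Tw_S k x : Tw A (S k) x = Tw A k (2 ^ x).
Proof. revert x. induction k as [|k IH]; intro x; auto. simpl in *. rewrite <- IH. reflexivity. Qed.
Lemma siterlog_lt k : forall x w X, 0 < X -> siterlog k x w -> x < Tw A k X -> w < X.
Proof.
  induction k as [|k IH]; intros x w X HX; [simpl; intros ->; auto|]. intros (z & Hz & Hw) Hx.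
  rewrite Tw_S in Hx. apply (IH _ _ _ (exp_pos A 2 X ltac:(ar)) Hz) in Hx.
  destruct Hw as [[-> ->]|[H1 H2]]; auto. apply (exp_lt A 2); ar.
Qed.
Lemma Tw_lt (a l : A) k x : 1 <= x -> a + 2 <= l -> a + Tw A k x < Tw A k (l * x).
Proof.
  intros Hx Hl. induction k as [|k IH]; simpl; [nar|].
  assert (H1 : 2 ^ (a + Tw A k x + 1) <= 2 ^ Tw A k (l * x)) by (apply exp_mono; ar).
  rewrite exp_add, exp_add, exp1 in H1. pose proof (lt_2exp A a). pose proof (exp_pos A 2 (Tw A k x) ltac:(ar)).
  generalize dependent (2 ^ Tw A k x). generalize dependent (2 ^ a). intros. nar.
Qed.
Lemma sincr_mono (a a' R : A) xs : a <= a' -> sincr a' R xs -> sincr a R xs.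
Proof. apply sincr_weak. Qed.

Theorem WPH_holds D al : aN A = S D -> cnf al -> olt al (omega_tower (S D)) -> sWPH (S (S D)) (sfgraph (S (S D)) (scode_from (0 : A) al)).
Proof.
  intros HN Hc Hal. pose proof (Tot_below A al D HN Hc Hal) as HT. set (ca := scode_from 0 al) in *.
  intros c a. destruct (HT (c + 1 + 1)) as [z Hz].
  (* Raising the left end above [z], the value of [F] at [c + 2], forces the inverse at [min H] to
     be at least [c1 + 1]. The choice of [l] lets [Tw_lt] absorb the summand [a'] of [R] at the cost
     of one factor [l]. *)
  set (a' := a + z). set (l := a' + 2). set (c1 := c + 1). set (R := a' + Tw A D (l ^ c1)). exists R.
  intros b s Hcol.
  assert (H : exists e h : A, ssubset a' R e h l /\ swh (S (S D)) b s e h l).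
  { apply NNPP; intro H. apply (lt_irr A R).
    assert (G : R + 1 <= a' + Tw A (S D - 1) (l ^ c1)).
    - apply (upper_bound A a' R c1 b s l (S D)); [lia| |].
      + intros xs Hxs Hi. destruct (Hcol xs Hxs) as (v & Hv & HE); [eapply sincr_mono; [|eauto]; unfold a'; ar|].
        exists v. split; auto. unfold c1. ar.
      + intros e h H1 H2. apply H. eauto.
    - replace (S D - 1)%nat with D in G by lia. fold R in G. ar. }
  destruct H as (e & h & Hs & Hw). exists e, h, l.
  assert (Hl : 0 < l) by (unfold l; ar).
  split; auto. split; [|split; auto].
  - destruct Hs as [H1 H2]. split; auto. intros i Hi. destruct (H1 i Hi) as (x & Hx & Hax & HxR). exists x. split; auto. split; auto. unfold a' in Hax. ar.
  - destruct Hs as [H1 _]. destruct (H1 0 Hl) as (m & Hm & Ham & HmR). exists m.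
    destruct (maxP A 0 (fun y => exists z, Fd ca y z /\ z <= m) m) as (i & Hi & Him).
    + apply aN1.
    + apply (Sg_ex A 0 1 (fun g z => Fd ca (snd g) z /\ z <= m)). apply Sg_and; [|apply D0_Sg; dd].
      apply (D0_sder A 2). unfold sjud, mp. tm.
    + exists (c + 1 + 1), z. split; auto. unfold a' in Ham. ar.
    + intros y (z' & Hz' & Hzm). apply Fd_le in Hz'. ar.
    + assert (Hic : c + 1 + 1 <= i) by (apply Him; exists z; split; auto; unfold a' in Ham; ar).
      destruct (siterlog_ex D m) as [w Hwl]. destruct (sroot_ex i w) as [y Hy]; [ar|].
      exists y. split; auto. split.
      * exists i, w. split; [|split; auto].
        -- left. split; auto. intros y' z' Hz'. apply Him. eauto.
        -- replace (S (S D) - 2)%nat with D by lia. auto.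
      (* The iterated logarithm of [m] is below [l^(c1 + 1)], hence below [l^i], so its [i]-th root
         is below [l]. *)
      * apply (nle_lt A). intro Hly. destruct Hy as [[-> _]|(_ & Hy1 & Hy2)]; [apply (lt_irr A 0); ar|].
        assert (K : w < l * l ^ c1).
        { apply (siterlog_lt D m); auto.
          - pose proof (exp_pos A l c1 Hl). nar.
          - assert (R < Tw A D (l * l ^ c1)); [|ar]. apply Tw_lt; [pose proof (exp_pos A l c1 Hl); ar|unfold l; ar]. }
        rewrite <- a_expS in K.
        assert (K1 : l ^ (c1 + 1) <= l ^ i) by (apply exp_mono; auto; unfold c1; ar).
        pose proof (exp_base A l y i Hly). apply (lt_irr A w). ar.
Qed.
End Provable.

Theorem WPH_provable D al : cnf al -> olt al (omega_tower (S D)) ->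
  proves (RCA0star_ISigma (S D)) (WPH (S (S D)) (f_graph (S (S D)) al)).
Proof.
  intros Hc Hal. apply completeness; [apply RCA_fsub|]. intros M HM e s.
  unshelve refine (let A := {| am := M; as0 := s; aN := S D |} in _); try lia.
  - intros P HP e0. apply HM. left. constructor; auto.
  - intros B HB e0. apply HM. right. constructor; auto.
  - apply sat_WPH. apply (WPH_holds A D al); auto.
Qed.

Close Scope m_scope.

(** * The cut *)

Definition natM : model := {| dom := nat; sdom := unit; mz := 0; m1 := 1; madd := Nat.add; mmul := Nat.mul; mexp := Nat.pow;
  mlt := lt; mmem := fun _ _ => False |}.
Lemma nat_basic P : In P basic_axioms -> forall e s, sat natM e s (sentence P).
Proof.
  intros HP e s. simpl in HP. unfold sentence.
  repeat destruct HP as [<-|HP]; try destruct HP; simpl; intros; try lia; auto.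
  replace (x0 + 1) with (S x0) by lia. reflexivity.
Qed.
Lemma nat_ind_ax A e s : sat natM e s (induction A).
Proof.
  unfold induction; simpl. rewrite sat_inst; simpl. intros H0 HS x. induction x as [|x IH]; auto.
  specialize (HS x IH). rewrite sat_fsub in HS.
  replace (fun n => eval natM (scons x e) (scons (Add (Var 0) One) shift n)) with (@scons natM (S x) e) in HS; auto.
  extensionality n; destruct n; simpl; auto. lia.
Qed.
(** Through this instance the lemmas about models apply to the standard numbers: totality in
    [soT_total], injectivity of pairing and uniqueness of digits. *)
Definition natA (N : nat) : arithM := {| am := natM; as0 := fun _ => tt; aN := S N; aN1 := le_n_S 0 N (Nat.le_0_l N);
  aB := fun P HP e => nat_basic P HP e _; aI := fun A _ e => nat_ind_ax A e _ |}.

(** * Decoding derivations in the standard numbers *)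

Fixpoint so_code (a : snoc_ord) : natM := match a with Sz => 0 | Ss d b n => sosnoc (so_code d) (so_code b) (n : natM) end.
Lemma mp_injN (x y x' y' : natM) : mp x y = mp x' y' -> x = x' /\ y = y'.
Proof. apply (mp_inj (natA 0)). Qed.
Lemma sosnoc_inj (d b n d' b' n' : natM) : sosnoc d b n = sosnoc d' b' n' -> d = d' /\ b = b' /\ n = n'.
Proof.
  unfold sosnoc. intro H. apply (a_SI (natA 0)) in H. apply mp_injN in H. destruct H as [-> H]. apply mp_injN in H. tauto.
Qed.
Lemma cd_snoc a d b n : so_code a = sosnoc d b n -> exists d0 b0, a = Ss d0 b0 n /\ d = so_code d0 /\ b = so_code b0.
Proof.
  destruct a as [|d0 b0 n0]; simpl; intro H.
  - exfalso. symmetry in H. apply (a_S0 (natA 0)) in H. auto.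
  - apply sosnoc_inj in H. destruct H as (<- & <- & <-). eauto.
Qed.
Lemma cd_0 a : so_code a = 0 -> a = Sz.
Proof. destruct a; auto. intro H; exfalso. apply (a_S0 (natA 0)) in H. auto. Qed.
Lemma spow_cd d b m r : @spow natM (so_code d) (so_code b) m r -> r = so_code (snoc_pow d b m).
Proof.
  intros [[-> ->]|(p & Hp & -> & ->)]; auto. simpl. replace (p + 1) with (S p) by lia. reflexivity.
Qed.
Lemma succ_cd c a g : @sosucc natM c (so_code a) g -> exists d n, a = Ss d Sz n /\ g = so_code (snoc_pow d Sz n).
Proof.
  intros (d & _ & n & _ & E & H). apply cd_snoc in E. destruct E as (d0 & b0 & -> & -> & E). symmetry in E. apply cd_0 in E. subst.
  exists d0, n. split; auto. apply spow_cd; auto.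
Qed.
Lemma lim_cd c a : @solimit natM c (so_code a) -> is_limit a.
Proof.
  intros (d & _ & b & _ & n & _ & E & H). apply cd_snoc in E. destruct E as (d0 & b0 & -> & -> & ->).
  exists d0, b0, n. split; auto. intros ->. simpl in H. lia.
Qed.
(** Induction on the position in the derivation. Whenever the ordinal argument of a judgement is the
    code of an ordinal, so are those of its premises and the value of a fundamental sequence. *)
Lemma decode a x y : @Fd natM (so_code a) x y -> FastRel a x y.
Proof.
  intros (b & s & n & HV & HE).
  assert (G : forall i, i < n + 1 -> forall j, @Entry natM b s i j ->
    (forall a x y, j = @sjud natM 0 (so_code a) x y -> exists a', y = so_code a' /\ FundSeq a x a') /\
    (forall a x y, j = @sjud natM 1 (so_code a) x y -> FastRel a x y) /\
    (forall k a x y, j = @sjud natM (k + 2) (so_code a) x y -> IterRel k a x y)).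
  { intro i. induction i as [i IH] using lt_wf_ind. intros Hi j Hj.
    assert (IH' : forall j, (exists k, k < i /\ @Entry natM b s k j) ->
    (forall a x y, j = @sjud natM 0 (so_code a) x y -> exists a', y = so_code a' /\ FundSeq a x a') /\
    (forall a x y, j = @sjud natM 1 (so_code a) x y -> FastRel a x y) /\
    (forall k a x y, j = @sjud natM (k + 2) (so_code a) x y -> IterRel k a x y)) by (intros j0 (k & Hk & HE0); apply (IH k Hk); auto; lia).
    clear IH. assert (Hjb : j < b) by (destruct Hj; auto).
    specialize (HV i Hi j Hjb Hj). destruct HV as (a0 & _ & x0 & _ & y0 & _ & HR).
    assert (J : forall t u a a' x x' y y', @sjud natM t a x y = @sjud natM u a' x' y' -> t = u /\ a = a' /\ x = x' /\ y = y').
    { unfold sjud. intros t u a1 a' x1 x' y1 y' E. apply mp_injN in E. destruct E as [? E]. apply mp_injN in E. destruct E as [? E]. apply mp_injN in E. tauto. }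
    destruct HR as [(-> & d & _ & b1 & _ & m & _ & r & _ & E & Hr & HR)|[(-> & HR)|[(-> & ->)|(k & _ & z & _ & -> & H1 & H2)]]];
      (split; [|split]); intros; match goal with H : sjud _ _ _ _ = sjud _ _ _ _ |- _ => apply J in H; destruct H as (Ht & Ha & Hx & Hy) end;
      simpl in Ht; try (exfalso; lia); rewrite Ha in *; clear Ha a0; try subst x0; try subst y0.
    - apply cd_snoc in E. destruct E as (d0 & b0 & -> & -> & ->). apply spow_cd in Hr. subst r.
      destruct HR as [(g & _ & Hs & Hp)|(Hl & w & _ & HE' & Hp)].
      + apply succ_cd in Hs. destruct Hs as (d' & n' & -> & ->). apply spow_cd in Hp. eexists; split; [apply Hp|]. constructor.
      + apply lim_cd in Hl. apply IH' in HE'. destruct HE' as (HF & _). destruct (HF _ _ _ eq_refl) as (a' & -> & HFu).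
        apply spow_cd in Hp. eexists; split; [apply Hp|]. constructor; auto.
    - destruct HR as [(E & ->)|[(b' & _ & Hs & HE')|(Hl & b' & _ & HE1 & HE2)]].
      + apply cd_0 in E. subst. simpl. replace (x1 + 1) with (S x1) by lia. constructor.
      + apply succ_cd in Hs. destruct Hs as (d' & n' & -> & ->). apply IH' in HE'. destruct HE' as (_ & _ & HI).
        constructor. apply HI. f_equal. simpl. lia.
      + apply lim_cd in Hl. apply IH' in HE1. destruct HE1 as (HF & _). destruct (HF _ _ _ eq_refl) as (a' & -> & HFu).
        apply IH' in HE2. destruct HE2 as (_ & HFr & _). econstructor; eauto.
    - assert (k = 0) by lia. subst. constructor.
    - assert (k0 = S k) by lia. subst. apply IH' in H1, H2. destruct H1 as (_ & _ & HI). destruct H2 as (_ & HF & _).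
      econstructor; [apply HI; f_equal; simpl; lia|apply HF; reflexivity]. }
  assert (Hn : n < n + 1) by lia. destruct (G n Hn _ HE) as (_ & HF & _). apply HF; reflexivity.
Qed.
Fixpoint so_from (acc : snoc_ord) (o : ord) : snoc_ord := match o with OZero => acc | OCons b n g => so_from (Ss acc (so_from Sz b) n) g end.
Lemma snum_nat n : @snum natM n = n.
Proof. induction n; simpl; auto. rewrite IHn. lia. Qed.
Lemma scode_cd o : forall acc, @scode_from natM (so_code acc) o = so_code (so_from acc o).
Proof.
  induction o as [|b IHb n g IHg]; intro acc; cbn [scode_from so_from]; [reflexivity|]. rewrite snum_nat. replace (@scode_from natM (@mz natM) b) with (so_code (so_from Sz b)) by (symmetry; exact (IHb Sz)).
  change (@sosnoc natM (so_code acc) (so_code (so_from Sz b)) n) with (so_code (Ss acc (so_from Sz b) n)). apply IHg.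
Qed.
Lemma toO_from o : forall acc, ord_of (so_from acc o) = oapp (ord_of acc) o.
Proof.
  induction o as [|b IHb n g IHg]; intro acc; simpl; [rewrite oapp_0; auto|]. rewrite IHg. simpl. rewrite oapp_A, IHb. reflexivity.
Qed.
Definition tower_so (n : nat) : snoc_ord := so_from Sz (omega_tower n).
Lemma soT_total n K : exists z, FastRel (tower_so (S n)) K z.
Proof.
  destruct (Tot_below (natA (S n)) (omega_tower (S n)) (S n) eq_refl) with (x := K : natM) as [z Hz].
  - generalize (S n). clear. induction n as [|n IH]; simpl; repeat split; auto.
  - simpl. apply ocons_lt. left. induction n; simpl; [reflexivity|]. apply ocons_lt; auto.
  - exists z. apply decode. unfold tower_so. rewrite <- (scode_cd (omega_tower (S n)) Sz). exact Hz.
Qed.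

(** * Requests and separated sets *)

Definition nat_sets : nat -> sdom natM := fun _ => tt.
(* [exists y_1 <= t_1, ~ exists y_2 <= t_2, ~ ...]: every second negation turns into a universal quantifier. *)
Fixpoint bounded_E (ts : list nat) (A : form) (e : nat -> nat) : Prop :=
  match ts with [] => sat natM e nat_sets A | t :: ts => exists y, y <= t /\ ~ bounded_E ts A (scons y e) end.
Fixpoint decode_env (v i : nat) : nat := match i with O => fst (of_nat v) | S i => decode_env (snd (of_nat v)) i end.
Fixpoint encode_env (N : nat) (r : nat -> nat) : nat := match N with O => 0 | S N => to_nat (r 0, encode_env N (fun i => r (S i))) end.
Lemma envd_enc N : forall r i, i < N -> decode_env (encode_env N r) i = r i.
Proof.
  induction N as [|N IH]; intros r i Hi; [lia|]. destruct i as [|i]; cbn [encode_env decode_env]; rewrite cancel_of_to; auto.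
  simpl. apply (IH (fun i => r (S i))). lia.
Qed.
Definition least (P : nat -> Prop) : nat := epsilon (inhabits 0) (fun y => P y /\ forall z, z < y -> ~ P z).
Lemma least_spec (P : nat -> Prop) : (exists y, P y) -> P (least P) /\ forall z, z < least P -> ~ P z.
Proof.
  intros [y Hy]. apply (epsilon_spec (inhabits 0) (fun y => P y /\ forall z, z < y -> ~ P z)).
  induction y as [y IH] using lt_wf_ind. destruct (classic (exists z, z < y /\ P z)) as [(z & Hz & HP)|Hn]; [eauto|].
  exists y. split; auto. intros z Hz HP; eauto.
Qed.
Definition least_wit (ts : list nat) (w : nat) : nat :=
  least (fun y => ~ bounded_E ts (fenum (fst (of_nat w))) (scons y (decode_env (snd (of_nat w))))).
(* A request [w < b - 2] codes a formula and an environment for its free variables. *)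
Definition request_witnesses (ts : list nat) (b : nat) : list nat := map (least_wit ts) (seq 0 (b - 2)).
Fixpoint cut_data (B ts : list nat) : Prop :=
  match ts with [] => True | t :: ts => separated (request_witnesses ts) B t /\ (forall b, In b B -> b <= t) /\ cut_data B ts end.
Lemma Cut_incl B B' ts : incl B' B -> cut_data B ts -> cut_data B' ts.
Proof.
  intro H. induction ts as [|t ts IH]; simpl; auto. intros (H1 & H2 & H3). repeat split; auto. intros b b' Hb Hb'. apply H1; auto.
Qed.
(** Each round of [estimation] puts a new bound in front, for formulas with one more quantifier; its
    requests are the least witnesses relative to the bounds [ts] already found. *)
Lemma cut_exists c k : forall A ts, A <> [] -> decreasing A -> (forall b, In b A -> 2 <= b) -> large k c A -> cut_data A ts ->
  exists B ts', B <> [] /\ decreasing B /\ incl B A /\ large 0 c B /\ cut_data B (ts' ++ ts) /\ length ts' = k.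
Proof.
  induction k as [|k IH]; intros A ts HA Hd Hb HL HC.
  - exists A, []. repeat split; auto. apply incl_refl.
  - destruct (estimation k c (request_witnesses ts) A) as (B & t & H1 & H2 & H3 & H4 & H5 & H6 & H7); auto.
    { intros b Hi. unfold request_witnesses. rewrite length_map, length_seq. apply Hb in Hi. lia. }
    destruct (IH B (t :: ts)) as (B' & ts' & K1 & K2 & K3 & K4 & K5 & K6); auto.
    { simpl. repeat split; auto. eapply Cut_incl; eauto. }
    exists B', (ts' ++ [t]). repeat split; auto.
    + eapply incl_tran; eauto.
    + rewrite <- app_assoc. auto.
    + rewrite length_app. simpl. lia.
Qed.

(** With [c = i], the value [i + 4] satisfies [c + 3 <= c'] for [sparse_large] and makes all points
    exceed [c + 3] for [large0]. By [s_F] arguments from [i + 4] up to [sR] have values of [F]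
    beyond [sR], which keeps the inverse below [i + 4]. *)
Record stage (m i : nat) := {
  sK := i + 4;
  sR : nat; sal : nat -> ord; sB : list nat; sts : list nat;
  s_ok : full_descent m sK sK sR sal;
  s_F : forall e z, sK <= e <= sR -> FastRel (tower_so (S m)) e z -> sR < z;
  s_dec : decreasing sB; s_len : i < length sB;
  s_rng : forall b, In b sB -> sK <= b <= sR + 1;
  s_sp : forall b b', In b sB -> In b' sB -> b < b' -> b * 2 ^ b <= b';
  s_cut : cut_data sB sts; s_ts : length sts = S m }.
Theorem stage_exists m i : inhabited (stage m i).
Proof.
  set (K := i + 4).
  assert (HF : forall R al e z, full_descent m K K R al -> K <= e <= R -> FastRel (tower_so (S m)) e z -> R < z).
  { intros R al e z [HS HH] He Hz. apply (bounding_F _ _ _ al R Hz).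
    - apply (seq_sub al K R); auto; lia.
    - intros y Hy. unfold tower_so. rewrite toO_from. apply (Hd_lt (S m) K). apply HH; lia. }
  destruct (soT_total m K) as [z Hz].
  destruct (sparse_large m i K K ltac:(unfold K; lia) ltac:(unfold K; lia) z) as (R & al & A & H1 & H2 & H3 & H4 & H5 & H6 & H7).
  { intros al R Hok. destruct (le_lt_dec K R); [apply (HF R al K z); auto; lia|]. apply Fr_lt in Hz. lia. }
  destruct (cut_exists i (S m) A []) as (B & ts & K1 & K2 & K3 & K4 & K5 & K6); simpl; auto.
  { intros b Hb. apply H5 in Hb. unfold K in *; lia. }
  rewrite app_nil_r in K5. constructor.
  apply (Build_stage m i R al B ts); auto.
  - intros e z' He. apply (HF R al); auto.
  - apply (large0 i); auto. intros b Hb. apply K3, H5 in Hb. unfold K in *; lia.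
Qed.

Lemma leN x y : @mle natM x y <-> x <= y.
Proof. unfold mle; simpl. lia. Qed.
Lemma digits_exist b N (g : nat -> nat) : (forall t, t < N -> g t < b) -> exists s, s < b ^ N /\ forall t, t < N -> @Entry natM b s t (g t).
Proof.
  induction N as [|N IH]; intro H; [exists 0; simpl; split; [lia|intros; lia]|].
  destruct IH as (s & Hs & HE); [intros; apply H; lia|]. pose proof (H N ltac:(lia)) as HN.
  exists (g N * b ^ N + s). split; [simpl; nia|]. intros t Ht. destruct (Nat.eq_dec t N) as [->|].
  - split; [exact HN|]. exists 0. split; [simpl; lia|]. exists s. split; [exact Hs|]. simpl. lia.
  - destruct (HE t ltac:(lia)) as (H1 & q & Hq & r & Hr & E). split; [exact H1|]. simpl in *.
    exists (q + g N * b ^ (N - S t)). assert (EN : b ^ N = b ^ (N - S t) * b * b ^ t).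
    { rewrite <- Nat.mul_assoc, <- Nat.pow_succ_r', <- Nat.pow_add_r. f_equal; lia. }
    split.
    + assert (b ^ (N - S t) <= b ^ N) by (apply Nat.pow_le_mono_r; lia). nia.
    + exists r. split; auto. rewrite EN, E. ring.
Qed.
Lemma sincr_in R xs : forall a, @sincr natM a R xs -> forall x, In x xs -> a <= x <= R.
Proof.
  induction xs as [|y xs IH]; intros a; [intros _ x []|]. intros (H1 & H2 & H3) x [<-|Hx]; rewrite leN in *; [lia|].
  apply (IH _ H3) in Hx. simpl in Hx. lia.
Qed.
Fixpoint tuple_bound (d R : nat) : nat := match d with O => 0 | S d => (R + tuple_bound d R) * (R + tuple_bound d R) + R end.
Lemma stuple_le R (xs : list nat) : (forall x, In x xs -> x <= R) -> @stuple natM xs <= tuple_bound (length xs) R.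
Proof.
  induction xs as [|x xs IH]; intro H; simpl; auto. unfold mp; simpl.
  specialize (IH (fun y Hy => H y (or_intror Hy))). specialize (H x (or_introl eq_refl)).
  apply Nat.add_le_mono; auto. apply Nat.mul_le_mono; lia.
Qed.
Lemma stuple_inj (xs : list nat) : forall ys : list nat, length xs = length ys -> @stuple natM xs = @stuple natM ys -> xs = ys.
Proof.
  induction xs as [|x xs IH]; intros [|y ys] Hl H; try discriminate; auto. simpl in H. apply mp_injN in H. destruct H as [-> H].
  f_equal. apply IH; auto.
Qed.
Lemma colour_code d a R b (col : list nat -> nat) : 0 < b -> (forall xs, length xs = d -> @sincr natM a R xs -> col xs < b) ->
  exists s, s < b ^ (tuple_bound d R + 1) /\ forall xs, length xs = d -> @sincr natM a R xs -> @Entry natM b s (@stuple natM xs) (col xs).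
Proof.
  intros Hb Hc. set (P := fun t xs => length xs = d /\ @sincr natM a R xs /\ @stuple natM xs = t).
  set (g := fun t => if excluded_middle_informative (exists xs, P t xs) then col (epsilon (inhabits []) (P t)) else 0).
  assert (Hg : forall xs, length xs = d -> @sincr natM a R xs -> g (@stuple natM xs) = col xs).
  { intros xs Hl Hs. unfold g. destruct excluded_middle_informative as [e|n].
    - destruct (epsilon_spec (inhabits []) _ e) as (H1 & H2 & H3). f_equal. apply stuple_inj; [exact (eq_trans H1 (eq_sym Hl))|exact H3].
    - exfalso. apply n. exists xs. repeat split; auto. }
  destruct (digits_exist b (tuple_bound d R + 1) g) as (s & Hs & HE).
  - intros t _. unfold g. destruct excluded_middle_informative as [e|n]; auto.
    destruct (epsilon_spec (inhabits []) _ e) as (H1 & H2 & H3). apply Hc; auto.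
  - exists s. split; auto. intros xs Hl Hx. rewrite <- Hg; auto. apply HE.
    pose proof (stuple_le R xs (fun x H => proj2 (sincr_in R xs a Hx x H))) as K. change (@length (dom natM) xs) with (@length nat xs) in Hl. rewrite Hl in K. simpl in *. lia.
Qed.
Lemma win_sincr (h : nat -> nat) R d : forall a t, (forall j, t <= j < t + d -> a <= h j <= R) -> (forall j, t <= j -> S j < t + d -> h j < h (S j)) ->
  @sincr natM a R (window h t d).
Proof.
  induction d as [|d IH]; intros a t H1 H2; [exact Logic.I|]. unfold window in *. cbn [seq map sincr]. rewrite !leN.
  split; [apply H1; lia|]. split; [apply H1; lia|]. apply IH.
  - intros j Hj. simpl. split; [|apply H1; lia].
    assert (G : forall i, t + S i < t + S d -> h t < h (t + S i)).
    { induction i as [|i IHi]; intro Hi; [rewrite Nat.add_1_r; apply H2; lia|]. specialize (IHi ltac:(lia)).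
      specialize (H2 (t + S i) ltac:(lia) ltac:(lia)). replace (t + S (S i)) with (S (t + S i)) by lia. lia. }
    specialize (G (j - S t) ltac:(lia)). replace (t + S (j - S t)) with j in G by lia. lia.
  - intros j Hj Hj'. apply H2; lia.
Qed.
Lemma sentries_win (e h : nat) (g : nat -> nat) n : forall t, (forall j, t <= j < t + n -> @Entry natM e h j (g j)) -> @sentries natM e h t (window g t n).
Proof.
  induction n as [|n IH]; intros t H; [exact Logic.I|]. split; [apply H; lia|]. simpl. rewrite Nat.add_1_r. apply IH. intros j Hj. apply H; lia.
Qed.

(** * A nonprincipal ultrafilter and changes of environments *)

Theorem ultrafilter : exists U : (nat -> Prop) -> Prop,
  (forall P Q : nat -> Prop, (forall i, P i -> Q i) -> U P -> U Q) /\ (forall P Q, U P -> U Q -> U (fun i => P i /\ Q i)) /\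
  ~ U (fun _ => False) /\ (forall P, U P \/ U (fun i => ~ P i)) /\ (forall N, U (fun i => N <= i)).
Proof.
  set (F := fun A : nat -> Prop => exists N, forall n, N <= n -> A n).
  assert (HF : @filter.ProperFilter nat F).
  { constructor.
    - intros [N H]. exact (H N (le_n N)).
    - constructor.
      + exists 0. intros; exact Logic.I.
      + intros A B [N HN] [N' HN']. exists (N + N'). intros n Hn. split; [apply HN|apply HN']; lia.
      + intros P Q HPQ [N HN]. exists N. intros n Hn. apply HPQ. auto. }
  destruct (@filter.ultraFilterLemma _ _ HF) as (U & HU & HFU).
  pose proof (@filter.ultra_proper _ _ HU) as HP. pose proof (@filter.filter_filter _ _ HP) as HP'.
  exists U. repeat split.
  - intros P Q HPQ. exact (@filter.filterS _ _ HP' P Q HPQ).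
  - intros P Q H1 H2. exact (@filter.filterI _ _ HP' P Q H1 H2).
  - exact (@filter.filter_not_empty _ _ HP).
  - intro P. exact (@filter.in_ultra_setVsetC _ U P HU).
  - intro N. apply HFU. exists N. auto.
Qed.

(** Freshness speaks of substitutions, so the two environments are interleaved in [E]: reading the
    even positions only, or switching to the odd ones from [k] on, are substitutions that agree
    below [k]. *)
Lemma sat_fresh k A e e' s : fresh k A -> (forall i, i < k -> e i = e' i) -> sat natM e s A <-> sat natM e' s A.
Proof.
  intros HF H. set (E := fun v => if Nat.even v then e (Nat.div2 v) else e' (Nat.div2 v)).
  assert (E1 : forall v, E (2 * v) = e v) by (intro v; unfold E; rewrite Nat.even_mul, Nat.div2_double; reflexivity).
  assert (E2 : forall v, E (2 * v + 1) = e' v).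
  { intro v; unfold E. replace (2 * v + 1) with (S (2 * v)) by lia. rewrite Nat.even_succ, Nat.odd_mul, Nat.div2_succ_double; reflexivity. }
  pose proof (HF (fun v => Var (2 * v)) (fun v => Var (if v <? k then 2 * v else 2 * v + 1)) id id) as HH.
  assert (K : fsub (fun v => Var (2 * v)) id A = fsub (fun v => Var (if v <? k then 2 * v else 2 * v + 1)) id A).
  { apply HH; auto. intros i Hi. apply Nat.ltb_lt in Hi. rewrite Hi. reflexivity. }
  pose proof (sat_fsub natM A E s (fun v => Var (2 * v)) id) as K1. rewrite K, sat_fsub in K1.
  replace (fun n => eval natM E (Var (2 * n))) with e in K1 by (extensionality v; symmetry; apply E1).
  replace (fun n => eval natM E (Var (if n <? k then 2 * n else 2 * n + 1))) with e' in K1.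
  - symmetry; exact K1.
  - extensionality v. simpl eval. destruct (Nat.ltb_spec v k) as [Hv|Hv]; [rewrite <- H; auto; symmetry; apply E1|symmetry; apply E2].
Qed.
Lemma Eb_fresh k A ts : fresh k A -> forall e e', (forall i, i < k -> e i = e' i) -> bounded_E ts A e <-> bounded_E ts A e'.
Proof.
  intro HF. induction ts as [|t ts IH]; intros e e' H; [apply (sat_fresh k); auto|]. simpl.
  assert (K : forall y, bounded_E ts A (scons y e) <-> bounded_E ts A (scons y e')).
  { intro y. apply IH. intros [|i] Hi; simpl; auto. apply H; lia. }
  split; intros (y & Hy & HE); exists y; split; auto; rewrite <- ?K; auto; rewrite K; auto.
Qed.

(* The ultrapower of the naturals is cut down to the functions bounded, for some [k], by the [k]-th point of the
   sets [sB]. *)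
Section Ultra.
Variables (m : nat) (st : forall i, stage m i) (U : (nat -> Prop) -> Prop).
Hypothesis U_mono : forall P Q : nat -> Prop, (forall i, P i -> Q i) -> U P -> U Q.
Hypothesis U_and : forall P Q, U P -> U Q -> U (fun i => P i /\ Q i).
Hypothesis U_no : ~ U (fun _ => False).
Hypothesis U_or : forall P, U P \/ U (fun i => ~ P i).
Hypothesis U_ge : forall N, U (fun i => N <= i).
Lemma U_all (P : nat -> Prop) : (forall i, P i) -> U P.
Proof. intro H. apply (U_mono (fun i => 0 <= i)); auto. Qed.
Lemma U_2 (P Q S : nat -> Prop) : U P -> U Q -> (forall i, P i -> Q i -> S i) -> U S.
Proof. intros HP HQ H. apply (U_mono (fun i => P i /\ Q i)); [|auto]. intros i [? ?]; auto. Qed.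
Lemma U_3 (P Q R S : nat -> Prop) : U P -> U Q -> U R -> (forall i, P i -> Q i -> R i -> S i) -> U S.
Proof. intros HP HQ HR H. apply (U_2 (fun i => P i /\ Q i) R); auto. intros i [? ?]; auto. Qed.
Lemma U_not P : U (fun i => ~ P i) <-> ~ U P.
Proof.
  split; [|destruct (U_or P); tauto]. intros H1 H2. apply U_no. apply (U_2 _ _ _ H1 H2). auto.
Qed.
Lemma U_imp P Q : U (fun i => P i -> Q i) <-> (U P -> U Q).
Proof.
  split.
  - intros H HP. apply (U_2 _ _ _ H HP). auto.
  - intro H. destruct (U_or P) as [HP|HP]; [apply (U_mono Q)|apply (U_mono (fun i => ~ P i))]; auto; tauto.
Qed.

(** The lists [sB] are decreasing, hence [rev]. The default 0 can occur only for [i < k], a finite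
    set that [U] ignores. *)
Definition cut_point (k i : nat) : nat := nth k (rev (sB m i (st i))) 0.
Lemma lv_in k i : k <= i -> In (cut_point k i) (sB m i (st i)).
Proof. intro H. apply in_rev. apply nth_In. rewrite length_rev. pose proof (s_len m i (st i)). lia. Qed.
Lemma lv_ge k i : k <= i -> i + 4 <= cut_point k i.
Proof. intro H. apply (s_rng m i (st i)), lv_in; auto. Qed.
Lemma lv_lt k i : S k <= i -> cut_point k i < cut_point (S k) i.
Proof.
  intro H. unfold cut_point. pose proof (s_dec m i (st i)) as Hd. pose proof (s_len m i (st i)) as Hl. revert Hd Hl.
  generalize (sB m i (st i)) as l. intros l Hd Hl. rewrite !rev_nth by lia.
  assert (G : forall l a b, decreasing l -> a < b < length l -> nth b l 0 < nth a l 0).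
  { clear. induction l as [|x l IH]; intros a b Hd Hab; simpl in *; [lia|]. inversion Hd as [|? ? Hd' Hf]; subst.
    destruct b as [|b]; [lia|]. destruct a as [|a]; [|apply IH; auto; lia].
    rewrite Forall_forall in Hf. apply Hf, nth_In. lia. }
  apply G; auto. lia.
Qed.
Lemma lv_exp k i : S k <= i -> cut_point k i * 2 ^ cut_point k i <= cut_point (S k) i.
Proof. intro H. apply (s_sp m i (st i)); try apply lv_in; try lia. apply lv_lt; auto. Qed.
Lemma lv_mono k j i : k + j <= i -> cut_point k i <= cut_point (k + j) i.
Proof. induction j as [|j IH]; intro H; [rewrite Nat.add_0_r; auto|]. rewrite Nat.add_succ_r in *. pose proof (lv_lt (k + j) i H). lia. Qed.

Definition below_cut (x : nat -> nat) := exists k, U (fun i => x i <= cut_point k i).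
Lemma Fin_le x y : below_cut y -> U (fun i => x i <= y i) -> below_cut x.
Proof. intros [k Hk] H. exists k. apply (U_2 _ _ _ Hk H). intros; lia. Qed.
Lemma Fin_const N : below_cut (fun _ => N).
Proof. exists 0. apply (U_mono (fun i => N <= i)); auto. intros i Hi. pose proof (lv_ge 0 i ltac:(lia)). lia. Qed.
Lemma Fin_2 x y : below_cut x -> below_cut y -> exists k, U (fun i => x i <= cut_point k i /\ y i <= cut_point k i /\ S (S k) <= i).
Proof.
  intros [k Hk] [j Hj]. exists (k + j). apply (U_3 _ _ _ _ Hk Hj (U_ge (S (S (k + j))))). intros i H1 H2 H3.
  pose proof (lv_mono k j i ltac:(lia)). pose proof (lv_mono j k i ltac:(lia)). rewrite (Nat.add_comm j k) in *. lia.
Qed.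
(** Two sparse steps suffice: [b^b <= 2^(b * b)], where [b * b] is at most the next point, and 2 to
    the power of that point is at most the one after it. *)
Lemma Fin_exp x y : below_cut x -> below_cut y -> below_cut (fun i => x i ^ y i).
Proof.
  intros Hx Hy. destruct (Fin_2 x y Hx Hy) as [k Hk]. exists (S (S k)). revert Hk. apply U_mono. intros i (H1 & H2 & H3).
  pose proof (lv_ge k i ltac:(lia)). pose proof (lv_exp k i ltac:(lia)). pose proof (lv_exp (S k) i H3). set (b := cut_point k i) in *.
  assert (x i ^ y i <= b ^ b).
  { etransitivity; [apply Nat.pow_le_mono_l; eauto|]. apply Nat.pow_le_mono_r; lia. }
  assert (b < 2 ^ b) by (apply Nat.pow_gt_lin_r; lia).
  assert (b ^ b <= (2 ^ b) ^ b) by (apply Nat.pow_le_mono_l; lia). rewrite <- Nat.pow_mul_r in *.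
  assert (2 ^ (b * b) <= 2 ^ cut_point (S k) i) by (apply Nat.pow_le_mono_r; nia).
  assert (1 * 2 ^ cut_point (S k) i <= cut_point (S k) i * 2 ^ cut_point (S k) i) by (apply Nat.mul_le_mono_r; pose proof (lv_ge (S k) i ltac:(lia)); lia). lia.
Qed.
Lemma Fin_mul x y : below_cut x -> below_cut y -> below_cut (fun i => x i * y i).
Proof.
  intros Hx Hy. destruct (Fin_2 x y Hx Hy) as [k Hk]. exists (S k). revert Hk. apply U_mono. intros i (H1 & H2 & H3).
  pose proof (lv_exp k i ltac:(lia)). assert (cut_point k i < 2 ^ cut_point k i) by (apply Nat.pow_gt_lin_r; lia).
  etransitivity; [apply Nat.mul_le_mono; eauto|]. etransitivity; [|eauto]. apply Nat.mul_le_mono_l. lia.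
Qed.
Lemma Fin_add x y : below_cut x -> below_cut y -> below_cut (fun i => x i + y i).
Proof.
  intros Hx Hy. destruct (Fin_2 x y Hx Hy) as [k Hk]. exists (S k). revert Hk. apply U_mono. intros i (H1 & H2 & H3).
  pose proof (lv_ge k i ltac:(lia)). pose proof (lv_exp k i ltac:(lia)). assert (cut_point k i < 2 ^ cut_point k i) by (apply Nat.pow_gt_lin_r; lia).
  enough (2 * cut_point k i <= 2 ^ cut_point k i * cut_point k i) by lia. apply Nat.mul_le_mono_r. lia.
Qed.
Lemma Fin_pair x y : below_cut x -> below_cut y -> below_cut (fun i => to_nat (x i, y i)).
Proof.
  intros Hx Hy. apply Fin_le with (y := fun i => y i * 2 + (y i + x i) * (1 + (y i + x i))).
  - repeat first [apply Fin_add|apply Fin_mul|apply Fin_const|auto].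
  - apply U_all. intro i. pose proof (to_nat_spec (x i) (y i)). simpl in *. lia.
Qed.

Definition cut_fun := {x : nat -> nat | below_cut x}.
Definition eqU (x y : cut_fun) := U (fun i => proj1_sig x i = proj1_sig y i).
Definition ultra_dom := quot cut_fun eqU.
Lemma eqU_refl x : eqU x x. Proof. apply U_all; auto. Qed.
Lemma eqU_sym x y : eqU x y -> eqU y x. Proof. apply U_mono; auto. Qed.
Lemma eqU_trans x y z : eqU x y -> eqU y z -> eqU x z.
Proof. intros H1 H2. apply (U_2 _ _ _ H1 H2). intros; congruence. Qed.
Definition ultra_class (x : nat -> nat) (H : below_cut x) : ultra_dom := cls cut_fun eqU (exist _ x H).
Definition repr (q : ultra_dom) : nat -> nat := proj1_sig (rep cut_fun eqU q).
Lemma rp_fin q : below_cut (repr q). Proof. apply (proj2_sig (rep cut_fun eqU q)). Qed.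
Lemma rp_mk x H : U (fun i => repr (ultra_class x H) i = x i).
Proof. exact (rep_cls cut_fun eqU eqU_refl eqU_sym eqU_trans (exist _ x H)). Qed.
Lemma I_eq p q : p = q <-> U (fun i => repr p i = repr q i).
Proof.
  rewrite <- (cls_eq cut_fun eqU eqU_refl eqU_sym eqU_trans (rep cut_fun eqU p) (rep cut_fun eqU q)) at 1.
  rewrite !cls_rep. split; auto.
Qed.
Definition ultra_model : model := {| dom := ultra_dom; sdom := unit;
  mz := ultra_class (fun _ => 0) (Fin_const 0); m1 := ultra_class (fun _ => 1) (Fin_const 1);
  madd := fun p q => ultra_class _ (Fin_add _ _ (rp_fin p) (rp_fin q));
  mmul := fun p q => ultra_class _ (Fin_mul _ _ (rp_fin p) (rp_fin q));
  mexp := fun p q => ultra_class _ (Fin_exp _ _ (rp_fin p) (rp_fin q));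
  mlt := fun p q => U (fun i => repr p i < repr q i); mmem := fun _ _ => False |}.
Definition local_env (e : nat -> ultra_model) (i v : nat) : nat := repr (e v) i.
Lemma env_scons q e i : local_env (scons q e) i = scons (repr q i) (local_env e i).
Proof. extensionality v; destruct v; reflexivity. Qed.
Lemma los_t e t : U (fun i => repr (eval ultra_model e t) i = eval natM (local_env e i) t).
Proof.
  induction t as [v| | |t IHt u IHu|t IHt u IHu|t IHt u IHu]; simpl eval.
  - apply U_all; reflexivity.
  - apply rp_mk.
  - apply rp_mk.
  - eapply (U_3 _ _ _ _ IHt IHu (rp_mk _ _)). intros i H1 H2 H3. cbv beta in *. rewrite H3, H1, H2. reflexivity.
  - eapply (U_3 _ _ _ _ IHt IHu (rp_mk _ _)). intros i H1 H2 H3. cbv beta in *. rewrite H3, H1, H2. reflexivity.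
  - eapply (U_3 _ _ _ _ IHt IHu (rp_mk _ _)). intros i H1 H2 H3. cbv beta in *. rewrite H3, H1, H2. reflexivity.
Qed.
Lemma los_lt e t u : mlt (eval ultra_model e t) (eval ultra_model e u) <-> U (fun i => eval natM (local_env e i) t < eval natM (local_env e i) u).
Proof.
  split; intro H; simpl in *; apply (U_3 _ _ _ _ (los_t e t) (los_t e u) H); intros; lia.
Qed.
(** The least counterexample to a bounded quantifier stays below the value of a term, hence inside
    the cut; this is why bounded formulas transfer although the model is only an initial segment of
    the ultrapower. *)
Theorem los_sigma00 A : sigma00 A -> forall e s, sat ultra_model e s A <-> U (fun i => sat natM (local_env e i) nat_sets A).
Proof.
  induction 1 as [t u|t u|t X| |A B HA IHA HB IHB|t A HA IHA]; intros e s.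
  - simpl. rewrite I_eq. split; intro H; simpl in *; apply (U_3 _ _ _ _ (los_t e t) (los_t e u) H); intros; congruence.
  - apply los_lt.
  - simpl. split; [tauto|exact U_no].
  - simpl. split; [tauto|exact U_no].
  - simpl. rewrite U_imp, IHA, IHB. reflexivity.
  - change (sat ultra_model e s (All (Imp (Lt (Var 0) (tlift t)) A))) with (forall q : ultra_model, mlt q (eval ultra_model (scons q e) (tlift t)) -> sat ultra_model (scons q e) s A).
    assert (K : forall i, sat natM (local_env e i) nat_sets (All (Imp (Lt (Var 0) (tlift t)) A)) <-> forall y, y < eval natM (local_env e i) t -> sat natM (scons y (local_env e i)) nat_sets A).
    { intro i. cbn. split; intros H y; specialize (H y); rewrite eval_tlift in *; auto. }
    split.
    + intro H. destruct (U_or (fun i => sat natM (local_env e i) nat_sets (All (Imp (Lt (Var 0) (tlift t)) A)))) as [|Hn]; auto. exfalso.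
      set (y := fun i => least (fun y => y < eval natM (local_env e i) t /\ ~ sat natM (scons y (local_env e i)) nat_sets A)).
      assert (Hy : U (fun i => y i < eval natM (local_env e i) t /\ ~ sat natM (scons (y i) (local_env e i)) nat_sets A)).
      { revert Hn. apply U_mono. intros i Hi. rewrite K in Hi. unfold y.
        apply (least_spec (fun y => y < eval natM (local_env e i) t /\ ~ sat natM (scons y (local_env e i)) nat_sets A)).
        apply not_all_ex_not in Hi. destruct Hi as [z Hz]. exists z. tauto. }
      assert (Fy : below_cut y).
      { apply (Fin_le _ _ (rp_fin (eval ultra_model e t))). apply (U_2 _ _ _ Hy (los_t e t)). intros i [H1 _] H2. rewrite H2. lia. }
      specialize (H (ultra_class y Fy)). rewrite eval_tlift in H.
      assert (H1 : mlt (ultra_class y Fy : ultra_model) (eval ultra_model e t)).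
      { simpl. apply (U_3 _ _ _ _ Hy (los_t e t) (rp_mk y Fy)). intros i [K1 _] K2 K3. rewrite K2, K3. auto. }
      specialize (H H1). rewrite IHA in H. apply U_no. apply (U_3 _ _ _ _ Hy H (rp_mk y Fy)).
      intros i [_ K1] K2 K3. rewrite env_scons, K3 in K2. auto.
    + intros H q Hq. rewrite eval_tlift in Hq. apply IHA. simpl in Hq. apply (U_3 _ _ _ _ H Hq (los_t e t)).
      intros i K1 K2 K3. rewrite env_scons. apply (proj1 (K i) K1). lia.
Qed.

Definition ultra_sets : nat -> sdom ultra_model := fun _ => tt.
Fixpoint ultra_E (k : nat) (A : form) (e : nat -> ultra_model) : Prop :=
  match k with O => sat ultra_model e ultra_sets A | S k => exists q, ~ ultra_E k A (scons q e) end.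
Definition cut_suffix (k i : nat) := skipn (S m - k) (sts m i (st i)).
Lemma sk_0 i : cut_suffix 0 i = [].
Proof. unfold cut_suffix. apply skipn_all2. pose proof (s_ts m i (st i)). lia. Qed.
Lemma sk_S k i : k < S m -> exists t, cut_suffix (S k) i = t :: cut_suffix k i.
Proof.
  intro Hk. unfold cut_suffix. pose proof (s_ts m i (st i)) as Hl. set (l := sts m i (st i)) in *. replace (S m - k) with (S (S m - S k)) by lia.
  assert (Hj : S m - S k < length l) by lia. revert Hj. generalize (S m - S k). generalize l. clear.
  induction l as [|t l IH]; intros j Hj; simpl in Hj; [lia|]. destruct j as [|j]; [exists t; reflexivity|]. simpl. apply IH. lia.
Qed.
Lemma Cut_skip B ts j : cut_data B ts -> cut_data B (skipn j ts).
Proof. revert j. induction ts as [|t ts IH]; intros [|j]; simpl; auto. intros (_ & _ & H). auto. Qed.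
Lemma Fin_enc N : forall e : nat -> ultra_model, below_cut (fun i => encode_env N (local_env e i)).
Proof.
  induction N as [|N IH]; intro e; cbn [encode_env]; [apply Fin_const|]. apply Fin_pair; [apply rp_fin|]. apply (IH (fun v => e (S v))).
Qed.
(** Members of the cut lie below the bound [t], which gives one direction. Conversely, the formula
    and its environment are coded by some [w] in the cut, so a point of [B] in the cut requests the
    least witness. Separation puts it below the next point, since lying beyond [t] would contradict
    the witness that exists up to [t]. *)
Theorem los_E A k : sigma00 A -> k <= S m -> forall e, ultra_E k A e <-> U (fun i => bounded_E (cut_suffix k i) A (local_env e i)).
Proof.
  intro HA. induction k as [|k IH]; intros Hk e.
  - cbn [ultra_E]. rewrite los_sigma00; auto. split; apply U_mono; intros i; rewrite sk_0; auto.
  - cbn [ultra_E]. assert (Hcut : forall i, exists t, cut_suffix (S k) i = t :: cut_suffix k i /\ separated (request_witnesses (cut_suffix k i)) (sB m i (st i)) t /\ forall b, In b (sB m i (st i)) -> b <= t).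
    { intro i. destruct (sk_S k i ltac:(lia)) as [t Ht]. exists t. split; auto.
      pose proof (Cut_skip _ _ (S m - S k) (s_cut m i (st i))) as HC. fold (cut_suffix (S k) i) in HC. rewrite Ht in HC. simpl in HC. tauto. }
    split.
    + intros [q Hq]. rewrite IH, <- U_not in Hq by lia. destruct (rp_fin q) as [j Hj]. apply (U_3 _ _ _ _ Hq Hj (U_ge j)).
      intros i H1 H2 H3. destruct (Hcut i) as (t & -> & _ & Ht). simpl. exists (repr q i). split; [|rewrite env_scons in H1; auto].
      etransitivity; [exact H2|]. apply Ht, lv_in; auto.
    + intro H. destruct (fresh_ex A) as [N HN].
      set (w := fun i => to_nat (fcode A, encode_env N (local_env e i))).
      assert (Fw : below_cut (fun i => w i + 3)) by (apply Fin_add; [apply Fin_pair; [apply Fin_const|apply Fin_enc]|apply Fin_const]).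
      set (y := fun i => least_wit (cut_suffix k i) (w i)).
      assert (Hfr : forall i z, bounded_E (cut_suffix k i) A (scons z (local_env e i)) <-> bounded_E (cut_suffix k i) (fenum (fst (of_nat (w i)))) (scons z (decode_env (snd (of_nat (w i)))))).
      { intros i z. unfold w. rewrite cancel_of_to. simpl. rewrite fenum_code. apply (Eb_fresh N); auto.
        intros [|v] Hv; simpl; auto. symmetry. apply envd_enc. lia. }
      assert (Hy : U (fun i => ~ bounded_E (cut_suffix k i) A (scons (y i) (local_env e i)))).
      { revert H. apply U_mono. intros i Hi. destruct (Hcut i) as (t & E & _). rewrite E in Hi. simpl in Hi. destruct Hi as (z & _ & Hz).
        rewrite Hfr in *. unfold y, least_wit. apply (least_spec (fun y => ~ bounded_E (cut_suffix k i) (fenum (fst (of_nat (w i)))) (scons y (decode_env (snd (of_nat (w i))))))). eauto. }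
      assert (Fy : below_cut y).
      { destruct Fw as [j Hj]. exists (S j). apply (U_3 _ _ _ _ Hj H (U_ge (S j))). intros i H1 H2 H3.
        destruct (Hcut i) as (t & E & Hest & Ht). rewrite E in H2. simpl in H2. destruct H2 as (z & Hzt & Hz).
        destruct (Hest (cut_point j i) (cut_point (S j) i)) with (v := y i) as [|Hlt]; auto; try (apply lv_in; lia); [apply lv_lt; lia| |exfalso].
        - apply (in_map (least_wit (cut_suffix k i)) _ (w i)), in_seq. lia.
        - rewrite Hfr in Hz. unfold y, least_wit in Hlt. set (P := fun y => ~ bounded_E (cut_suffix k i) (fenum (fst (of_nat (w i)))) (scons y (decode_env (snd (of_nat (w i)))))) in *.
          apply (proj2 (least_spec P (ex_intro _ z Hz)) z); [lia|auto]. }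
      exists (ultra_class y Fy). rewrite IH, <- U_not by lia. apply (U_2 _ _ _ Hy (rp_mk y Fy)). intros i H1 H2. rewrite env_scons, H2. auto.
Qed.
Lemma EI_form k : forall A, (sigma0 k A -> exists B, sigma00 B /\ forall e, sat ultra_model e ultra_sets A <-> ultra_E k B e) /\
  (pi0 k A -> exists B, sigma00 B /\ forall e, sat ultra_model e ultra_sets A <-> ~ ultra_E k B e).
Proof.
  induction k as [|k IH]; intro A; split; intro H.
  - inversion H; subst. exists A. split; auto. intro e; simpl; tauto.
  - inversion H; subst. exists (Not A). split; [repeat constructor; auto|]. intro e. simpl. tauto.
  - inversion H as [|? A' HA]; subst. destruct (proj2 (IH A') HA) as (B & HB & E). exists B. split; auto. intro e.
    rewrite sat_Ex. simpl. split; intros [q Hq]; exists q; apply E; auto.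
  - inversion H as [|? A' HA]; subst. destruct (proj1 (IH A') HA) as (B & HB & E). exists B. split; auto. intro e. simpl. split.
    + intros Hq [q Hn]. apply Hn, E, Hq.
    + intros Hn q. apply NNPP; intro Hq. apply Hn. exists q. rewrite <- E. auto.
Qed.
Inductive Pi1 : form -> Prop := P1_0 A : sigma00 A -> Pi1 A | P1_S A : Pi1 A -> Pi1 (All A).
Lemma Pi1_los A : Pi1 A -> (forall e, sat natM e nat_sets A) -> forall e s, sat ultra_model e s A.
Proof.
  induction 1 as [A HA|A HA IH]; intros H e s.
  - apply los_sigma00; auto. apply U_all. auto.
  - intro q. apply IH. intro e'. specialize (H (fun v => e' (S v)) (e' 0)). replace e' with (scons (e' 0) (fun v => e' (S v))); auto.
    extensionality v; destruct v; reflexivity.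
Qed.
Lemma I_basic P : In P basic_axioms -> forall e, sat ultra_model e ultra_sets (sentence P).
Proof.
  intros HP e. apply Pi1_los; [|intro; apply nat_basic; auto]. simpl in HP. unfold sentence.
  repeat destruct HP as [<-|HP]; try destruct HP; cbn; repeat first [apply P1_S|apply P1_0; repeat constructor].
Qed.
(** In the bounded form given by [los_E], the formula has a least failure [y] up to [a] in each
    factor. It is positive, and [y - 1] is a member of the cut at which the induction step breaks
    down. *)
Lemma I_ind A : sigma0 (S m) A -> forall e, sat ultra_model e ultra_sets (induction A).
Proof.
  intros HA e. unfold induction. cbn [sat]. rewrite sat_inst. cbn [eval]. intros H0 HS a.
  apply NNPP; intro Ha. destruct (proj1 (EI_form (S m) A) HA) as (B & HB & E).
  assert (HS' : forall q : ultra_model, ultra_E (S m) B (scons q e) -> ultra_E (S m) B (scons (madd q m1) e)).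
  { intros q Hq. apply E in Hq. specialize (HS q Hq). rewrite sat_fsub in HS. apply E.
    replace (scons (madd q m1) e) with (fun n => eval ultra_model (scons q e) (scons (Add (Var 0) One) shift n)); auto.
    extensionality v; destruct v; reflexivity. }
  rewrite E in H0, Ha. rewrite los_E in H0, Ha by auto. rewrite <- U_not in Ha.
  set (y := fun i => least (fun y => ~ bounded_E (cut_suffix (S m) i) B (scons y (local_env e i)))).
  assert (Hy : U (fun i => y i <= repr a i /\ ~ bounded_E (cut_suffix (S m) i) B (scons (y i) (local_env e i)) /\ forall z, z < y i -> bounded_E (cut_suffix (S m) i) B (scons z (local_env e i)))).
  { revert Ha. apply U_mono. intros i Hi. rewrite env_scons in Hi. set (P := fun y => ~ bounded_E (cut_suffix (S m) i) B (scons y (local_env e i))) in *.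
    destruct (least_spec P (ex_intro P (repr a i) Hi)) as [K1 K2]. change (least P) with (y i) in *. repeat split; auto.
    - destruct (le_lt_dec (y i) (repr a i)) as [|Hl]; auto. destruct (K2 _ Hl Hi).
    - intros z Hz. apply NNPP. intro Hn. apply (K2 z Hz Hn). }
  assert (Fy : below_cut (fun i => y i - 1)) by (apply (Fin_le _ _ (rp_fin a)); revert Hy; apply U_mono; intros i (K & _); lia).
  set (q := ultra_class _ Fy).
  assert (Hpos : U (fun i => y i <> 0)).
  { apply (U_3 _ _ _ _ Hy H0 (rp_mk (fun _ => 0) (Fin_const 0))). intros i (_ & K1 & _) K2 K3 K4. rewrite env_scons in K2.
    simpl in K2. rewrite K3 in K2. rewrite K4 in K1. auto. }
  assert (Hq : ultra_E (S m) B (scons q e)).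
  { rewrite los_E by auto. apply (U_3 _ _ _ _ Hy Hpos (rp_mk _ Fy)). intros i (_ & _ & K1) K2 K3. rewrite env_scons. unfold q. rewrite K3. apply K1. lia. }
  apply HS' in Hq. rewrite los_E in Hq by auto.
  assert (Eq1 : U (fun i => repr (@madd ultra_model q m1) i = y i)).
  { apply (U_mono (fun i => y i <> 0 /\ repr q i = y i - 1 /\ repr (@m1 ultra_model) i = 1 /\ repr (@madd ultra_model q m1) i = repr q i + repr (@m1 ultra_model) i)).
    - intros i (K0 & K1 & K2 & K3). lia.
    - repeat apply U_and; auto; [apply (rp_mk _ Fy)|apply (rp_mk _ (Fin_const 1))|apply (rp_mk _ (Fin_add _ _ (rp_fin q) (rp_fin (@m1 ultra_model))))]. }
  apply U_no. apply (U_3 _ _ _ _ Hy Hq Eq1). intros i (_ & K1 & _) K2 K3. rewrite env_scons, K3 in K2. auto.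
Qed.

(** Los equivalences between a statement about the cut and a family of statements about numbers,
    kept as one notion so that they compose along the shape of a bounded formula. *)
Definition transfers (P : Prop) (Q : nat -> Prop) := P <-> U Q.
Definition represents (p : ultra_model) (f : nat -> natM) := U (fun i => repr p i = f i).
Lemma trt_rp p : represents p (repr p). Proof. apply U_all; reflexivity. Qed.
Lemma trt_mk x H : represents (ultra_class x H) x. Proof. apply rp_mk. Qed.
Lemma trt_0 : represents mz (fun _ => mz). Proof. apply rp_mk. Qed.
Lemma trt_1 : represents m1 (fun _ => m1). Proof. apply rp_mk. Qed.
Lemma trt_add p q f g : represents p f -> represents q g -> represents (madd p q) (fun i => madd (f i) (g i)).
Proof. intros H1 H2. eapply (U_3 _ _ _ _ H1 H2 (rp_mk _ _)). intros i K1 K2 K3. cbv beta in *. refine (eq_trans K3 _). rewrite K1, K2. reflexivity. Qed.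
Lemma trt_mul p q f g : represents p f -> represents q g -> represents (mmul p q) (fun i => mmul (f i) (g i)).
Proof. intros H1 H2. eapply (U_3 _ _ _ _ H1 H2 (rp_mk _ _)). intros i K1 K2 K3. cbv beta in *. refine (eq_trans K3 _). rewrite K1, K2. reflexivity. Qed.
Lemma trt_exp p q f g : represents p f -> represents q g -> represents (mexp p q) (fun i => mexp (f i) (g i)).
Proof. intros H1 H2. eapply (U_3 _ _ _ _ H1 H2 (rp_mk _ _)). intros i K1 K2 K3. cbv beta in *. refine (eq_trans K3 _). rewrite K1, K2. reflexivity. Qed.
Lemma tr_eq p q f g : represents p f -> represents q g -> transfers (p = q) (fun i => f i = g i).
Proof. intros H1 H2. unfold transfers. rewrite I_eq. split; intro H; apply (U_3 _ _ _ _ H1 H2 H); intros; congruence. Qed.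
Lemma tr_lt p q f g : represents p f -> represents q g -> transfers (mlt p q) (fun i => mlt (f i) (g i)).
Proof. intros H1 H2. split; intro H; simpl in *; apply (U_3 _ _ _ _ H1 H2 H); intros; simpl in *; congruence. Qed.
Lemma tr_and P Q P' Q' : transfers P P' -> transfers Q Q' -> transfers (P /\ Q) (fun i => P' i /\ Q' i).
Proof.
  unfold transfers. intros -> ->. split; [intros [? ?]; auto|]. intro H; split; revert H; apply U_mono; tauto.
Qed.
Lemma tr_not P P' : transfers P P' -> transfers (~ P) (fun i => ~ P' i).
Proof. unfold transfers. intros ->. symmetry. apply U_not. Qed.
Lemma tr_imp P Q P' Q' : transfers P P' -> transfers Q Q' -> transfers (P -> Q) (fun i => P' i -> Q' i).
Proof. unfold transfers. rewrite U_imp. tauto. Qed.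
Lemma tr_or P Q P' Q' : transfers P P' -> transfers Q Q' -> transfers (P \/ Q) (fun i => P' i \/ Q' i).
Proof.
  unfold transfers. intros -> ->. split; [intros [H|H]; revert H; apply U_mono; auto|]. intro H.
  destruct (U_or P') as [|HP]; auto. right. apply (U_2 _ _ _ H HP). tauto.
Qed.
Lemma tr_bex (c : ultra_model) cf (P : ultra_model -> Prop) (Q : nat -> natM -> Prop) : represents c cf -> (forall q f, represents q f -> transfers (P q) (fun i => Q i (f i))) ->
  transfers (exists q, mlt q c /\ P q) (fun i => exists y, mlt y (cf i) /\ Q i y).
Proof.
  intros Hc HP. split.
  - intros [q [H1 H2]]. apply (HP q _ (trt_rp q)) in H2. apply (tr_lt _ _ _ _ (trt_rp q) Hc) in H1. apply (U_2 _ _ _ H1 H2). eauto.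
  - intro H. set (y := fun i => least (fun y => @mlt natM y (cf i) /\ Q i y)).
    assert (Hy : U (fun i => @mlt natM (y i) (cf i) /\ Q i (y i))).
    { revert H. apply U_mono. intros i Hi. apply (least_spec (fun y => @mlt natM y (cf i) /\ Q i y) Hi). }
    assert (Fy : below_cut y).
    { apply (Fin_le _ _ (rp_fin c)). apply (U_2 _ _ _ Hy Hc). intros i [K1 _] K2. simpl in K1. rewrite K2. lia. }
    exists (ultra_class y Fy). split.
    + apply (tr_lt _ _ _ _ (trt_mk y Fy) Hc). revert Hy. apply U_mono. tauto.
    + apply (HP _ _ (trt_mk y Fy)). revert Hy. apply U_mono. tauto.
Qed.
Lemma tr_ball (c : ultra_model) cf (P : ultra_model -> Prop) (Q : nat -> natM -> Prop) : represents c cf -> (forall q f, represents q f -> transfers (P q) (fun i => Q i (f i))) ->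
  transfers (forall q, mlt q c -> P q) (fun i => forall y, mlt y (cf i) -> Q i y).
Proof.
  intros Hc HP. assert (H := tr_not _ _ (tr_bex c cf (fun q => ~ P q) (fun i y => ~ Q i y) Hc (fun q f Hq => tr_not _ _ (HP q f Hq)))).
  assert (E : forall (T : Type) (L R : T -> Prop), (~ exists y, L y /\ ~ R y) <-> forall y, L y -> R y).
  { intros T L R. split; [intros H1 y H2; apply NNPP; eauto|]. intros H1 (y & H2 & H3); auto. }
  unfold transfers in *. rewrite E in H. rewrite H. split; apply U_mono; intro i; apply E.
Qed.
Ltac trh := fail.
Ltac trts := first [eassumption | apply trt_0 | apply trt_1 | apply trt_add; trts | apply trt_mul; trts | apply trt_exp; trts | apply trt_mk | apply trt_rp].
Ltac trs := cbv beta; first [eassumption | trh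
  | apply tr_bex; [trts|intros; trs] | apply tr_ball; [trts|intros; trs]
  | apply tr_and; trs | apply tr_or; trs | apply tr_not; trs | apply tr_imp; trs | apply tr_eq; trts | apply tr_lt; trts | unfold mle; apply tr_lt; trts ].
Lemma tr_Entry b s i v bf sf f vf : represents b bf -> represents s sf -> represents i f -> represents v vf -> transfers (Entry b s i v) (fun k => Entry (bf k) (sf k) (f k) (vf k)).
Proof. intros. unfold Entry. trs. Qed.
Lemma trt_mp p q f g : represents p f -> represents q g -> represents (mp p q) (fun i => mp (f i) (g i)).
Proof. intros. unfold mp. trts. Qed.
Lemma trt_osnoc d b n df bf nf : represents d df -> represents b bf -> represents n nf -> represents (sosnoc d b n) (fun i => sosnoc (df i) (bf i) (nf i)).
Proof. intros. unfold sosnoc. apply trt_add; [|apply trt_1]. apply trt_mp; auto. apply trt_mp; auto. Qed.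
Lemma trt_jud t a x y tf af xf yf : represents t tf -> represents a af -> represents x xf -> represents y yf -> represents (sjud t a x y) (fun i => sjud (tf i) (af i) (xf i) (yf i)).
Proof. intros. unfold sjud. apply trt_mp; auto. apply trt_mp; auto. apply trt_mp; auto. Qed.
Ltac trts ::= first [eassumption | apply trt_0 | apply trt_1 | apply trt_add; trts | apply trt_mul; trts | apply trt_exp; trts
  | apply trt_osnoc; trts | apply trt_jud; trts | apply trt_mk | apply trt_rp].
Ltac trh ::= first [apply tr_Entry; trts].
Lemma tr_pow d b n r df bf nf rf : represents d df -> represents b bf -> represents n nf -> represents r rf -> transfers (spow d b n r) (fun i => spow (df i) (bf i) (nf i) (rf i)).
Proof. intros. unfold spow. trs. Qed.
Ltac trh ::= first [apply tr_Entry; trts|apply tr_pow; trts].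
Lemma tr_succ c a b cf af bf : represents c cf -> represents a af -> represents b bf -> transfers (sosucc c a b) (fun i => sosucc (cf i) (af i) (bf i)).
Proof. intros. unfold sosucc. trs. Qed.
Lemma tr_limit c a cf af : represents c cf -> represents a af -> transfers (solimit c a) (fun i => solimit (cf i) (af i)).
Proof. intros. unfold solimit. trs. Qed.
Ltac trh ::= first [apply tr_Entry; trts|apply tr_pow; trts|apply tr_succ; trts|apply tr_limit; trts].
Lemma tr_rule c j cf jf (E : ultra_model -> Prop) Ef : represents c cf -> represents j jf -> (forall q f, represents q f -> transfers (E q) (fun i => Ef i (f i))) ->
  transfers (srule c E j) (fun i => srule (cf i) (Ef i) (jf i)).
Proof. intros Hc Hj HE. unfold srule. Ltac trh ::= first [apply tr_Entry; trts|apply tr_pow; trts|apply tr_succ; trts|apply tr_limit; trts|match goal with H : forall q f, represents q f -> transfers _ _ |- _ => apply H; trts end]. trs. Qed.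
Lemma tr_derB b s n bf sf nf : represents b bf -> represents s sf -> represents n nf -> transfers (sderB b s n) (fun i => sderB (bf i) (sf i) (nf i)).
Proof.
  intros. unfold sderB. Ltac trh ::= first [apply tr_Entry; trts|apply tr_rule; [trts|trts|intros; trs]]. trs.
Qed.
(** A derivation in the cut is checked by a bounded formula, hence is a derivation in almost all
    factors. The converse is not claimed: codes of derivations among the numbers may lie beyond the
    cut. *)
Lemma Fd_lower a x y af : represents a af -> Fd a x y -> U (fun i => @Fd natM (af i) (repr x i) (repr y i)).
Proof.
  intros Ha (b & s & n & H1 & H2).
  apply (tr_derB _ _ _ _ _ _ (trt_rp b) (trt_rp s) (trt_rp n)) in H1.
  assert (H2' := proj1 (tr_Entry _ _ _ _ _ _ _ _ (trt_rp b) (trt_rp s) (trt_rp n) (trt_jud _ _ _ _ _ _ _ _ trt_1 Ha (trt_rp x) (trt_rp y))) H2).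
  apply (U_2 _ _ _ H1 H2'). intros i K1 K2. exists (repr b i), (repr s i), (repr n i). split; [exact K1|exact K2].
Qed.
Lemma trt_num n : represents (snum n) (fun _ => snum n).
Proof. induction n; simpl snum; trts. Qed.
Lemma trt_code o : forall acc accf, represents acc accf -> represents (scode_from acc o) (fun i => scode_from (accf i) o).
Proof.
  induction o as [|b IHb n g IHg]; intros acc accf H; cbn [scode_from]; auto.
  apply (IHg (sosnoc acc (scode_from mz b) (snum n)) (fun i => sosnoc (accf i) (scode_from mz b) (snum n))).
  apply trt_osnoc; auto; [|apply trt_num]. apply (IHb mz (fun _ => mz)). apply trt_0.
Qed.
Lemma ilog_lower n : forall x y : ultra_model, siterlog n x y -> U (fun i => iter_log_rel n (repr x i) (repr y i)).
Proof.
  induction n as [|n IH]; intros x y H; cbn [siterlog iter_log_rel] in *.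
  - subst. apply U_all; auto.
  - destruct H as (z & Hz & H). apply IH in Hz.
    assert (K : U (fun i => @slog2 natM (repr z i) (repr y i))).
    { revert H. unfold slog2. apply (fun X : transfers _ _ => proj1 X). trs. }
    apply (U_2 _ _ _ Hz K). intros i K1 K2. exists (repr z i). split; auto. unfold slog2 in K2. rewrite !leN in K2. exact K2.
Qed.
Definition local_values (i : nat) (xs : list ultra_model) : list nat := map (fun q => repr q i) xs.
Lemma trt_tuple xs : represents (stuple xs) (fun i => stuple (M := natM) (local_values i xs)).
Proof. induction xs as [|x xs IH]; [apply trt_0|]. apply (trt_mp x (stuple xs)); [apply trt_rp|exact IH]. Qed.
Lemma tr_sincr R Rf xs : represents R Rf -> forall a af, represents a af -> transfers (sincr a R xs) (fun i => sincr (M := natM) (af i) (Rf i) (local_values i xs)).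
Proof.
  intro HR. induction xs as [|x xs IH]; intros a af Ha; cbn [sincr local_values map].
  - split; auto. intros _. apply U_all; auto.
  - pose proof (trt_rp x) as Hx. apply tr_and; [trs|]. apply tr_and; [trs|]. apply (IH (madd x m1) (fun i => madd (repr x i : natM) m1)). trts.
Qed.
Lemma tr_sentries e h ef hf xs : represents e ef -> represents h hf -> forall t tf, represents t tf -> transfers (sentries e h t xs) (fun i => sentries (M := natM) (ef i) (hf i) (tf i) (local_values i xs)).
Proof.
  intros He Hh. induction xs as [|x xs IH]; intros t tf Ht; cbn [sentries local_values map].
  - split; auto. intros _. apply U_all; auto.
  - pose proof (trt_rp x) as Hx. apply tr_and; [trs|]. apply (IH (madd t m1) (fun i => madd (tf i) m1)). trts.
Qed.
Lemma low_map (F : nat -> ultra_model) (f : nat -> nat -> nat) l : (forall j, U (fun i => repr (F j) i = f i j)) -> U (fun i => local_values i (map F l) = map (f i) l).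
Proof.
  intro H. induction l as [|j l IH]; [apply U_all; auto|]. apply (U_2 _ _ _ (H j) IH). intros i K1 K2. cbn. rewrite K1. f_equal. exact K2.
Qed.
Lemma Fin_tw x p : below_cut x -> below_cut (fun i => tower p (x i)).
Proof. intro H. induction p as [|p IH]; simpl; auto. apply Fin_exp; auto. apply Fin_const. Qed.
Lemma Fin_tb x p : below_cut x -> below_cut (fun i => tuple_bound p (x i)).
Proof. intro H. induction p as [|p IH]; cbn [tuple_bound]; [apply Fin_const|]. repeat first [apply Fin_add|apply Fin_mul]; auto. Qed.

(** The least counterexamples below [b] would form a member of the cut, so it is enough to test
    members of the cut. *)
Lemma U_find (P : nat -> nat -> Prop) (b : nat -> nat) : below_cut b -> (forall y, below_cut y -> U (fun i => y i <= b i) -> U (fun i => P i (y i))) -> U (fun i => forall y, y <= b i -> P i y).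
Proof.
  intros Fb H. destruct (U_or (fun i => forall y, y <= b i -> P i y)) as [|Hn]; auto. exfalso.
  set (y := fun i => least (fun y => y <= b i /\ ~ P i y)).
  assert (Hy : U (fun i => y i <= b i /\ ~ P i (y i))).
  { revert Hn. apply U_mono. intros i Hi. apply (least_spec (fun y => y <= b i /\ ~ P i y)).
    apply not_all_ex_not in Hi. destruct Hi as [z Hz]. exists z. tauto. }
  assert (Hb : U (fun i => y i <= b i)) by (revert Hy; apply U_mono; tauto).
  assert (Fy : below_cut y) by (apply (Fin_le _ _ Fb Hb)).
  apply U_no. apply (U_2 _ _ _ Hy (H y Fy Hb)). tauto.
Qed.
Theorem no_WPH : ~ @sWPH ultra_model (S (S m)) (sfgraph (S (S m)) (scode_from mz (omega_tower (S m)))).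
Proof.
  intro H. set (n := S (S m)) in *.
  set (K := fun i => i + 4).
  assert (FK : below_cut K). { exists 0. apply (U_mono (fun i => 0 <= i)); auto. intros i Hi. apply lv_ge. lia. }
  set (cN := fun i => 2 * (kappa_max m (K i) * kappa_max m (K i)) + 1).
  assert (FcN : below_cut cN).
  { assert (FX : below_cut (fun i => kappa_max m (K i))) by (apply Fin_mul; [apply Fin_const|apply Fin_add; auto; apply Fin_const]).
    apply Fin_add; [|apply Fin_const]. apply Fin_mul; [apply Fin_const|]. apply Fin_mul; auto. }
  set (aN := fun i => start m (K i)).
  assert (FaN : below_cut aN).
  { apply (Fin_tw (fun i => block_start m (K i) ^ (K i + 1))). apply Fin_exp; [|apply Fin_add; auto; apply Fin_const].
    unfold block_start. apply Fin_add; [apply Fin_add|]; try apply Fin_const. apply Fin_exp; auto. apply Fin_const. }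
  destruct (H (ultra_class cN FcN) (ultra_class aN FaN)) as [R HR].
  set (cl := fun i => tuple_colour m (K i) (K i) (sal m i (st i))).
  (* [R] lies below some point of [sB] that has a successor in [sB], and that successor is at most
     [sR + 1]. *)
  assert (HRs : U (fun i => repr R i <= sR m i (st i))).
  { destruct (rp_fin R) as [j Hj]. apply (U_2 _ _ _ Hj (U_ge (S j))). intros i H1 H2.
    pose proof (lv_lt j i H2). pose proof (s_rng m i (st i) _ (lv_in (S j) i H2)). lia. }
  assert (Hcl : forall i, repr R i <= sR m i (st i) -> forall xs, length xs = n -> @sincr natM (aN i) (repr R i) xs -> cl i xs < cN i).
  { intros i Hi xs Hl Hx. apply (col_lt m (K i) (K i) (sR m i (st i))); auto; try (unfold K; lia); [apply s_ok|].
    intros x Hin. apply (sincr_in _ _ _ Hx) in Hin. fold (aN i). lia. }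
  (* The explicit bound on the code of the colouring is a member of the cut, so the codes chosen
     factor by factor form one too. The value 0 serves the factors where [repr R] exceeds [sR]. *)
  assert (Hs : forall i, exists s, s <= cN i ^ (tuple_bound n (repr R i) + 1) /\ (repr R i <= sR m i (st i) -> forall xs, length xs = n -> @sincr natM (aN i) (repr R i) xs ->
    @Entry natM (cN i) s (@stuple natM xs) (cl i xs))).
  { intro i. destruct (le_lt_dec (repr R i) (sR m i (st i))) as [Hi|Hi]; [|exists 0; split; lia].
    destruct (colour_code n (aN i) (repr R i) (cN i) (cl i)) as (s & H1 & H2); [unfold cN; lia|apply Hcl; auto|]. exists s. split; [lia|auto]. }
  set (sf := fun i => proj1_sig (constructive_indefinite_description _ (Hs i))).
  assert (Hsf : forall i, sf i <= cN i ^ (tuple_bound n (repr R i) + 1) /\ (repr R i <= sR m i (st i) -> forall xs, length xs = n -> @sincr natM (aN i) (repr R i) xs ->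
    @Entry natM (cN i) (sf i) (@stuple natM xs) (cl i xs))) by (intro i; exact (proj2_sig (constructive_indefinite_description _ (Hs i)))).
  clearbody sf. clear Hs.
  assert (Fsf : below_cut sf).
  { apply (Fin_le _ (fun i => cN i ^ (tuple_bound n (repr R i) + 1))); [|apply U_all; apply Hsf].
    apply Fin_exp; auto. apply Fin_add; [|apply Fin_const]. apply Fin_tb, rp_fin. }
  pose proof (trt_mk cN FcN) as Tc. pose proof (trt_mk aN FaN) as Ta. pose proof (trt_mk sf Fsf) as Ts.
  set (cI := ultra_class cN FcN) in *. set (aI := ultra_class aN FaN) in *. set (sI' := ultra_class sf Fsf) in *.
  assert (Hcol : @scoloring ultra_model n aI R cI cI sI').
  { intros xs Hl Hx. apply (tr_sincr R (repr R) xs (trt_rp R) aI aN Ta) in Hx.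
    assert (Hv : U (fun i => cl i (local_values i xs) < cN i)).
    { apply (U_2 _ _ _ Hx HRs). intros i H1 H2. apply Hcl; auto. unfold local_values. rewrite length_map. exact Hl. }
    assert (Fv : below_cut (fun i => cl i (local_values i xs))) by (apply (Fin_le _ _ FcN); revert Hv; apply U_mono; intros; lia).
    exists (ultra_class _ Fv). split.
    - apply (proj2 (tr_lt _ _ _ _ (trt_mk _ Fv) Tc)). exact Hv.
    - apply (proj2 (tr_Entry _ _ _ _ _ _ _ _ Tc Ts (trt_tuple xs) (trt_mk _ Fv))). apply (U_2 _ _ _ Hx HRs). intros i H1 H2.
      apply Hsf; auto. unfold local_values. rewrite length_map. exact Hl. }
  destruct (HR cI sI' Hcol) as (e & h & l & Hl & [Hs1 Hs2] & Hw & x0 & y & Hx0 & (ii & lg & Hinv & Hlog & Hroot) & Hy).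
  pose proof (trt_rp R) as TR. pose proof (trt_rp e) as Te. pose proof (trt_rp h) as Th. pose proof (trt_rp l) as Tl.
  set (hh := fun i t => epsilon (inhabits 0) (fun v => @Entry natM (repr e i) (repr h i) t v)).
  assert (B1 : U (fun i => forall t, t < repr l i -> @Entry natM (repr e i) (repr h i) t (hh i t) /\ aN i <= hh i t <= repr R i)).
  { assert (K1 : forall t : ultra_model, mlt t l -> exists x : ultra_model, mlt x e /\ (Entry e h t x /\ (@mle ultra_model aI x /\ mle x R))).
    { intros t Ht. destruct (Hs1 t Ht) as (x & H1 & H2). exists x. split; [apply H1|auto]. }
    assert (K2 : U (fun i => forall t : natM, mlt t (repr l i) -> exists x : natM, mlt x (repr e i) /\ (Entry (repr e i : natM) (repr h i) t x /\ (mle (aN i : natM) x /\ mle x (repr R i))))).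
    { revert K1. apply (fun X : transfers _ _ => proj1 X). Ltac trh ::= apply tr_Entry; trts. trs. }
    revert K2. apply U_mono. intros i Hi t Ht. destruct (Hi t Ht) as (x & _ & H1 & H2 & H3).
    assert (H4 : @Entry natM (repr e i) (repr h i) t (hh i t)) by (apply (epsilon_spec (inhabits 0) (fun v => @Entry natM (repr e i) (repr h i) t v)); eauto).
    split; auto. rewrite leN in *. rewrite (Entry_fun (natA 0) _ _ _ _ _ H4 H1). auto. }
  assert (B2 : U (fun i => forall t, S t < repr l i -> hh i t < hh i (S t))).
  { assert (K1 : forall t : ultra_model, mlt t l -> forall x : ultra_model, mlt x e -> forall y : ultra_model, mlt y e -> mlt (madd t m1) l -> Entry e h t x -> Entry e h (madd t m1) y -> mlt x y).
    { intros t _ x _ z _ H1 H2 H3. apply (Hs2 t x z). auto. }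
    assert (K2 : U (fun i => forall t : natM, mlt t (repr l i) -> forall x : natM, mlt x (repr e i) -> forall y : natM, mlt y (repr e i) -> mlt (madd t m1) (repr l i) ->
       Entry (repr e i : natM) (repr h i) t x -> Entry (repr e i : natM) (repr h i) (madd t m1) y -> mlt x y)).
    { revert K1. apply (fun X : transfers _ _ => proj1 X). trs. }
    apply (U_2 _ _ _ K2 B1). intros i H1 H2 t Ht. destruct (H2 t ltac:(lia)) as [H3 _]. destruct (H2 (S t) Ht) as [H4 _].
    apply (H1 t); simpl; auto; try lia; try (rewrite Nat.add_1_r; auto).
    - apply H3.
    - apply H4. }
  assert (B3 : U (fun i => forall t, t <= repr l i -> t + n < repr l i -> cl i (window (hh i) t n) = cl i (window (hh i) (S t) n))).
  { apply (U_find (fun i t => t + n < repr l i -> cl i (window (hh i) t n) = cl i (window (hh i) (S t) n)) (repr l) (rp_fin l)). intros t Ft _. apply U_imp. intro Htl.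
    (* Cutting off at [repr R] makes every [f j] a member of the cut; on a set in [U] nothing is cut
       off. *)
    set (f := fun j i => Nat.min (hh i (t i + j)) (repr R i)).
    assert (Ff : forall j, below_cut (f j)) by (intro j; apply (Fin_le _ _ (rp_fin R)); apply U_all; intro i; unfold f; lia).
    set (xs := map (fun j => ultra_class (f j) (Ff j)) (seq 0 (S n))).
    assert (Lx : U (fun i => local_values i xs = window (hh i) (t i) (S n))).
    { apply (U_3 _ _ _ _ (low_map (fun j => ultra_class (f j) (Ff j)) (fun i j => f j i) (seq 0 (S n)) (fun j => rp_mk _ (Ff j))) B1 Htl).
      intros i H1 H2 H3. refine (eq_trans H1 _). unfold window. rewrite <- (Nat.add_0_r (t i)) at 1.
      assert (G : forall k s, s + k <= S n -> map (fun j => f j i) (seq s k) = map (hh i) (seq (t i + s) k)).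
      { induction k as [|k IH]; intros s Hsk; auto. cbn [seq map]. rewrite IH by lia. rewrite Nat.add_succ_r. f_equal.
        unfold f. destruct (H2 (t i + s) ltac:(lia)) as [_ H5]. lia. }
      apply G. lia. }
    pose proof (trt_mk t Ft) as Tt.
    assert (Hlen : length xs = S n) by (unfold xs; rewrite length_map, length_seq; auto).
    assert (Hse : @sentries ultra_model e h (ultra_class t Ft) xs).
    { apply (tr_sentries e h _ _ xs Te Th _ _ Tt). apply (U_3 _ _ _ _ Lx B1 Htl). intros i H1 H2 H3. rewrite H1.
      apply sentries_win. intros j Hj. apply H2. lia. }
    assert (Htn : @mlt ultra_model (@madd ultra_model (ultra_class t Ft) (@snum ultra_model n)) l).
    { apply (proj2 (tr_lt _ _ _ _ (trt_add _ _ _ _ Tt (trt_num n)) Tl)). revert Htl. apply U_mono. intros i Hi. rewrite snum_nat. exact Hi. }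
    destruct (Hw (ultra_class t Ft) Htn xs Hlen Hse) as (v & Hv1 & Hv2).
    apply (proj1 (tr_Entry _ _ _ _ _ _ _ _ Tc Ts (trt_tuple _) (trt_rp v))) in Hv1, Hv2.
    apply (U_mono (fun i => ((@Entry natM (cN i) (sf i) (@stuple natM (local_values i (firstn n xs))) (repr v i) /\ @Entry natM (cN i) (sf i) (@stuple natM (local_values i (tl xs))) (repr v i)) /\
       (local_values i xs = window (hh i) (t i) (S n) /\ t i + n < repr l i)) /\ ((forall t, t < repr l i -> @Entry natM (repr e i) (repr h i) t (hh i t) /\ aN i <= hh i t <= repr R i) /\
        (forall t, S t < repr l i -> hh i t < hh i (S t)) /\ repr R i <= sR m i (st i)))); [|exact (U_and _ _ (U_and _ _ (U_and _ _ Hv1 Hv2) (U_and _ _ Lx Htl)) (U_and _ _ B1 (U_and _ _ B2 HRs)))].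
    intros i [[[E1 E2] [E3 E4]] [E5 [E6 E7]]].
    assert (W : forall t, t + n <= repr l i -> length (window (hh i) t n) = n /\ @sincr natM (aN i) (repr R i) (window (hh i) t n)).
    { intros s Hs. split; [unfold window; rewrite length_map, length_seq; auto|]. apply win_sincr; intros; [apply E5|apply E6]; lia. }
    assert (F1 : local_values i (firstn n xs) = window (hh i) (t i) n).
    { unfold local_values in *. rewrite <- firstn_map, E3. unfold window. rewrite firstn_map. f_equal. rewrite seq_S, firstn_app, length_seq, Nat.sub_diag, firstn_all2, app_nil_r; auto. rewrite length_seq; auto. }
    assert (F2 : local_values i (tl xs) = window (hh i) (S (t i)) n).
    { unfold local_values in *. transitivity (tl (map (fun q => repr q i) xs)); [destruct xs; reflexivity|]. rewrite E3. reflexivity. }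
    rewrite F1 in E1. rewrite F2 in E2. destruct (W (t i)) as [W1 W2]; [lia|]. destruct (W (S (t i))) as [W3 W4]; [lia|].
    pose proof (proj2 (Hsf i) E7 _ W1 W2) as E8. pose proof (proj2 (Hsf i) E7 _ W3 W4) as E9.
    transitivity (repr v i); [apply (Entry_fun (natA 0) _ _ _ _ _ E8 E1)|apply (Entry_fun (natA 0) _ _ _ _ _ E2 E9)]. }
  assert (B4 : U (fun i => 0 < repr l i)) by exact (proj1 (tr_lt _ _ _ _ trt_0 Tl) Hl).
  assert (B5 : U (fun i => repr x0 i = hh i 0)).
  { apply (proj1 (tr_Entry _ _ _ _ _ _ _ _ Te Th trt_0 (trt_rp x0))) in Hx0. apply (U_3 _ _ _ _ Hx0 B1 B4). intros i H1 H2 H3.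
    apply (Entry_fun (natA 0) _ _ _ _ _ H1). apply H2; auto. }
  (* The value [z] witnessing the inverse is a true value of [F] and at most [x0], hence at most
     [sR]. At an argument from [i + 4] on this contradicts [s_F]. *)
  assert (B6 : U (fun i => repr ii i < K i)).
  { destruct Hinv as [[(z & Hz & Hzx) _]|[-> _]].
    - apply (Fd_lower _ _ _ _ (trt_code (omega_tower (S m)) _ _ trt_0)) in Hz.
      assert (Hz' : U (fun i => repr z i <= repr x0 i)).
      { apply (U_mono (fun i => @mle natM (repr z i) (repr x0 i))); [intro i; apply leN|]. revert Hzx. unfold mle. apply (fun X : transfers _ _ => proj1 X). trs. }
      apply (U_mono (fun i => ((@Fd natM (scode_from mz (omega_tower (S m))) (repr ii i) (repr z i) /\ repr z i <= repr x0 i) /\ (repr x0 i = hh i 0 /\ 0 < repr l i)) /\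
        ((forall t, t < repr l i -> @Entry natM (repr e i) (repr h i) t (hh i t) /\ aN i <= hh i t <= repr R i) /\ repr R i <= sR m i (st i)))); [|exact (U_and _ _ (U_and _ _ (U_and _ _ Hz Hz') (U_and _ _ B5 B4)) (U_and _ _ B1 HRs))].
      intros i [[[E1 E2] [E3 E4]] [E5 E6]]. destruct (E5 0 E4) as [_ E7].
      change (@mz natM) with (so_code Sz) in E1. rewrite scode_cd in E1. apply decode in E1.
      destruct (le_lt_dec (K i) (repr ii i)) as [Hle|]; auto. exfalso. pose proof (proj1 Fr_lt _ _ _ E1).
      assert (sR m i (st i) < repr z i); [|lia]. apply (s_F m i (st i) (repr ii i)); [|exact E1]. change (sK m i (st i)) with (K i). lia.
    - apply (U_mono (fun i => repr (@mz ultra_model) i = 0)); [unfold K; intros i ->; lia|]. apply trt_0. }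
  assert (B7 : U (fun i => (repr ii i = 0 /\ repr y i = repr lg i) \/ (0 < repr ii i /\ (repr y i ^ repr ii i <= repr lg i /\ repr lg i < (repr y i + 1) ^ repr ii i)))).
  { apply (U_mono (fun i => @sroot natM (repr ii i) (repr lg i) (repr y i))).
    - intros i. unfold sroot. rewrite leN. simpl. auto.
    - revert Hroot. unfold sroot. apply (fun X : transfers _ _ => proj1 X). trs. }
  assert (B8 : U (fun i => repr y i < repr l i)) by exact Hy.
  assert (B9 := ilog_lower _ _ _ Hlog). replace (n - 2) with m in B9 by (unfold n; lia).
  assert (BB := U_and _ _ (U_and _ _ (U_and _ _ B1 B2) (U_and _ _ B3 (U_and _ _ B4 B5))) (U_and _ _ (U_and _ _ B6 B7) (U_and _ _ (U_and _ _ B8 B9) HRs))).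
  apply U_no. revert BB. apply U_mono. intros i [[[E1 E2] [E3 [E4 E5]]] [[E6 E7] [[E8 E9] E10]]].
  assert (repr l i <= repr y i); [|lia].
  apply (colouring m (K i) (K i) (sR m i (st i)) (sal m i (st i))) with (h := hh i) (e := repr ii i) (l := repr lg i); auto; try (unfold K; lia).
  - apply s_ok.
  - intros t Ht. destruct (E1 t Ht) as [_ E11]. fold (aN i). lia.
  - intros t Ht. apply E3; auto. lia.
  - rewrite <- E5. exact E9.
Qed.
Definition ultraA : arithM := {| am := ultra_model; as0 := ultra_sets; aN := S m; aN1 := le_n_S 0 m (Nat.le_0_l m); aB := I_basic; aI := I_ind |}.
End Ultra.

(** * The theorem *)

Section Expand.
Variable A : arithM.
Notation Sg := (Sg A (as0 A)). Notation Pi := (Pi A (as0 A)). Notation D0 := (D0 A (as0 A)).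
Definition delta1_set (P : A -> Prop) := Sg 1 1 (fun g => P (snd g)) /\ Pi 1 1 (fun g => P (snd g)).
Definition delta1_model : model := {| dom := A; sdom := {P : A -> Prop | delta1_set P}; mz := @mz A; m1 := @m1 A; madd := @madd A; mmul := @mmul A;
  mexp := @mexp A; mlt := @mlt A; mmem := fun x P => proj1_sig P x |}.
Lemma ex_eval e t : eval delta1_model e t = eval A e t.
Proof. induction t; simpl; congruence. Qed.
Lemma ex_Tm n e t : Tm A n (fun g => eval A (push A n g e) t).
Proof. exists t, e. reflexivity. Qed.
Lemma ex_push n (g : ctx A n) (e : nat -> A) q : scons q (push A n g e) = push A (S n) (g, q) e.
Proof. extensionality v; destruct v; reflexivity. Qed.
(** Membership atoms are replaced by their definitions, one at level [Sg 1] and one at level [Pi 1].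
    The collection principle [Sg1_ball] carries the existential form through bounded quantifiers. *)
Lemma ex_00 B : sigma00 B -> forall n (e : nat -> A) (s : nat -> sdom delta1_model),
  Sg 1 n (fun g => sat delta1_model (push A n g e) s B) /\ Pi 1 n (fun g => sat delta1_model (push A n g e) s B).
Proof.
  induction 1 as [t u|t u|t X| |B C HB IHB HC IHC|t B HB IHB]; intros n e s.
  - assert (K : D0 n (fun g => sat delta1_model (push A n g e) s (Eq t u))).
    { apply D0_ext with (fun g => eval A (push A n g e) t = eval A (push A n g e) u); [intro g; simpl; rewrite !ex_eval; tauto|].
      apply D0_eq; apply ex_Tm. }
    split; [apply D0_Sg|apply D0_Pi]; auto.
  - assert (K : D0 n (fun g => sat delta1_model (push A n g e) s (Lt t u))).
    { apply D0_ext with (fun g => mlt (eval A (push A n g e) t) (eval A (push A n g e) u)); [intro g; simpl; rewrite !ex_eval; tauto|].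
      apply D0_lt; apply ex_Tm. }
    split; [apply D0_Sg|apply D0_Pi]; auto.
  - destruct (proj2_sig (s X)) as [H1 H2].
    assert (HT : TmC A n 1 (fun g => (tt, eval A (push A n g e) t))) by (split; [exact Logic.I|apply ex_Tm]).
    split.
    + eapply Sg_ext; [|apply (Sg_comp _ _ 1 n 1 _ _ HT H1)]. intro g. simpl. rewrite ex_eval. reflexivity.
    + eapply Pi_ext; [|apply (Pi_comp _ _ 1 n 1 _ _ HT H2)]. intro g. simpl. rewrite ex_eval. reflexivity.
  - split; [apply D0_Sg|apply D0_Pi]; apply (D0_prop A (as0 A) n False).
  - destruct (IHB n e s), (IHC n e s). split; [apply Sg_imp|apply Pi_imp]; auto.
  - destruct (IHB (S n) e s) as [H1 H2].
    assert (E : forall g, sat delta1_model (push A n g e) s (All (Imp (Lt (Var 0) (tlift t)) B)) <->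
      forall y : A, mlt y (eval A (push A n g e) t) -> sat delta1_model (push A (S n) (g, y) e) s B).
    { intro g. apply all_iff. intro y. cbn [sat]. rewrite eval_tlift, ex_eval. cbn [eval]. rewrite <- ex_push. reflexivity. }
    split.
    + eapply Sg_ext; [intro g; symmetry; apply E|]. apply (Sg1_ball A n _ (fun g y => sat delta1_model (push A (S n) (g, y) e) s B) (ex_Tm n e t)).
      eapply Sg_ext; [|apply H1]. intros [g y]; reflexivity.
    + eapply Pi_ext; [intro g; symmetry; apply E|].
      apply (Pi_all A 0 n (fun g y => mlt y (eval A (push A n g e) t) -> sat delta1_model (push A (S n) (g, y) e) s B)).
      apply Pi_imp; [apply D0_Sg, D0_lt; [apply Tm_snd|apply (Tm_fst A n (fun g => eval A (push A n g e) t)), ex_Tm]|].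
      eapply Pi_ext; [|apply H2]. intros [g y]; reflexivity.
Qed.
(** From level 1 on, the innermost quantifier of the prefix absorbs the quantifier that comes from
    the set parameters, so adjoining the sets does not raise the level and induction is
    preserved. *)
Lemma ex_0k k : forall B n (e : nat -> A) (s : nat -> sdom delta1_model),
  (sigma0 (S k) B -> Sg (S k) n (fun g => sat delta1_model (push A n g e) s B)) /\
  (pi0 (S k) B -> Pi (S k) n (fun g => sat delta1_model (push A n g e) s B)).
Proof.
  induction k as [|k IH]; intros B n e s; split; intro H; inversion H as [|? C HC]; subst.
  - inversion HC; subst. eapply Sg_ext; [intro g; symmetry; apply sat_Ex|].
    apply (Sg_ex A 0 n (fun g y => sat delta1_model (scons y (push A n g e)) s C)).
    eapply Sg_ext; [|apply (ex_00 C H0 (S n) e s)]. intros [g y]. rewrite <- ex_push. reflexivity.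
  - inversion HC; subst. apply (Pi_all A 0 n (fun g y => sat delta1_model (scons y (push A n g e)) s C)).
    eapply Pi_ext; [|apply (ex_00 C H0 (S n) e s)]. intros [g y]. rewrite <- ex_push. reflexivity.
  - eexists. split; [apply (IH C (S n) e s); auto|]. intro g. rewrite sat_Ex. split; intros [y Hy]; exists y; revert Hy; rewrite <- ex_push; auto.
  - eexists. split; [apply (IH C (S n) e s); auto|]. intro g. apply all_iff. intro y. rewrite <- ex_push. reflexivity.
Qed.
Lemma ex_ind B k e (s : nat -> sdom delta1_model) : (k < aN A) -> (forall n e, Sg (S k) n (fun g => sat delta1_model (push A n g e) s B)) -> sat delta1_model e s (induction B).
Proof.
  intros Hk HB. unfold induction. cbn [sat]. rewrite sat_inst. cbn [eval]. intros H0 HS x.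
  revert x. apply (iSg A (S k) (fun x => sat delta1_model (scons x e) s B)); auto.
  - eapply Sg_ext; [|apply (HB 1 e)]. intros [[] y]. rewrite <- ex_push. reflexivity.
  - intros x Hx. apply HS in Hx. rewrite sat_fsub in Hx.
    replace (scons (madd x m1 : A) e) with (fun n => eval delta1_model (scons x e) (scons (Add (Var 0) One) shift n)); auto.
    extensionality v; destruct v; reflexivity.
Qed.
Theorem ex_models N : aN A = N -> models delta1_model (RCA0star_ISigma N).
Proof.
  intros HN F HF e s. destruct HF as [[P HP|B HB|B C HB HC]|[B HB]].
  - pose proof (aB A P HP e) as H. simpl in HP. unfold sentence in *.
    repeat destruct HP as [<-|HP]; try destruct HP; exact H.
  - apply (ex_ind B 0); [pose proof (aN1 A); lia|]. intros n e0. apply ex_00; auto.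
  - unfold comprehension. cbn [sat]. intro H. apply sat_Ex2.
    assert (HD : delta1_set (fun x => sat delta1_model (scons x e) s B)).
    { split.
      - eapply Sg_ext; [|apply (proj1 (ex_0k 0 B 1 e s)); auto]. intros [[] y]. rewrite <- ex_push. reflexivity.
      - eapply Pi_ext; [|apply (proj2 (ex_0k 0 C 1 e s)); auto]. intros [[] y]. rewrite <- ex_push. cbn [push snd].
        specialize (H y). rewrite sat_Iff in H. symmetry; apply H. }
    exists (exist _ _ HD). intro x. apply sat_Iff. rewrite sat_lift2. cbn. reflexivity.
  - destruct (aN A) as [|k] eqn:E; [pose proof (aN1 A); lia|]. subst N.
    apply (ex_ind B k); [lia|]. intros n e0. apply ex_0k; auto.
Qed.
(** The statement speaks of numbers only, and both structures have the same number part by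
    definition. *)
Lemma ex_WPH d al : @sWPH delta1_model d (sfgraph d (scode_from mz al)) -> @sWPH A d (sfgraph d (scode_from mz al)).
Proof. exact (fun H => H). Qed.
End Expand.

Theorem WPH_unprovable m :
  ~ proves (RCA0star_ISigma (S m)) (WPH (S (S m)) (f_graph (S (S m)) (omega_tower (S m)))).
Proof.
  intro HP. destruct ultrafilter as (U & H1 & H2 & H3 & H4 & H5).
  set (st := fun i => epsilon (stage_exists m i) (fun _ => True)).
  apply (no_WPH m st U H1 H2 H3 H4 H5).
  set (UA := ultraA m st U H1 H2 H3 H4 H5).
  assert (s : nat -> sdom (delta1_model UA)).
  { intros _. exists (fun _ => False). split; [apply (D0_Sg UA (as0 UA) 1 1), (D0_prop UA (as0 UA) 1 False)|apply (D0_Pi UA (as0 UA) 1 1), (D0_prop UA (as0 UA) 1 False)]. }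
  exact (ex_WPH UA (S (S m)) (omega_tower (S m)) (proj1 (sat_WPH (delta1_model UA) s (S (S m)) (omega_tower (S m)) (fun _ => @mz UA))
    (soundness (delta1_model UA) _ _ _ (ex_models UA (S m) eq_refl) HP (fun _ => @mz UA) s (fun B H => match H with end)))).
Qed.
Theorem theorem25 (d : nat) (hd : 2 <= d) :
  (forall alpha : ord, cnf alpha -> olt alpha (omega_tower (d - 1)) ->
     proves (RCA0star_ISigma (d - 1)) (WPH d (f_graph d alpha))) /\
  ~ proves (RCA0star_ISigma (d - 1)) (WPH d (f_graph d (omega_tower (d - 1)))).
Proof.
  destruct d as [|[|m]]; try lia. replace (S (S m) - 1) with (S m) by lia.
  split; [apply WPH_provable|apply WPH_unprovable].
Qed.
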